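(* Let $\varphi \in L^1(\mathbb{R}^n)$ satisfy the non-degeneracy condition $\inf_{\xi\in\mathbb{R}^n\setminus\{0\}}\sup_{t>0}|\hat\varphi(t\xi)|>c$ for some constant $c>0$, and let $b_0,r_1,r_2,b,\eta$ and the quantities $C_\varphi(\cdot,j,L)$, $D_\varphi(\cdot,J,L)$ be as described in the context. Let $N>0$, $n/N<p,q<\infty$ and $w\in A_{pN/n}$. Suppose that: (i) $\varphi\in C^1(\mathbb{R}^n)$ and $\partial_k\varphi\in L^1(\mathbb{R}^n)$ for $1\le k\le n$; (ii) $|\hat\varphi(\xi)|\le C|\xi|^{\epsilon}$ for all $\xi$, for some $\epsilon>0$ and some constant $C$; (iii) $\sup_{j\ge 0} C_\varphi(\nabla\varphi,j,N)\,b^{-jN-\epsilon j}<\infty$ for some $\epsilon>0$, where $C_\varphi(\nabla\varphi,j,N)=\sum_{k=1}^n C_\varphi(\partial_k\varphi,j,N)$ and $j$ ranges over integers; (iv) $\sum_{k=1}^n D_\varphi(\Xi_k,1,N)<\infty$, where $\Xi_k(\xi)=2\pi i\xi_k$. Let $\psi\in L^1(\mathbb{R}^n)$, and suppose that there exist $\Theta\in C^\infty(\mathbb{R}^n)$ and $A\ge 1$ such that: (v) $\hat\psi(\xi)=\hat\varphi(\xi)\Theta(\xi)$ on $\{|\xi|<r_2A^{-1}\}$; (vi) $\sup_{j\in\mathbb{Z}:\, b^j\le A} C_\varphi(\psi,j,N)\,b^{-\epsilon j}<\infty$ for some $\epsilon>0$; (vii) $D_\varphi(\Theta,A,N)<\infty$.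 Then there is a positive constant $C$ such that for all $f\in\mathscr{S}(\mathbb{R}^n)$ $$\left\|\left(\int_0^\infty|f*\psi_t|^q\,\frac{dt}{t}\right)^{1/q}\right\|_{p,w}\le C\left\|\left(\int_0^\infty|f*\varphi_t|^q\,\frac{dt}{t}\right)^{1/q}\right\|_{p,w}.$$
   Context: $\mathscr{S}(\mathbb{R}^n)$ is the Schwartz class. $\hat f(\xi)=\int_{\mathbb{R}^n}f(x)e^{-2\pi i\langle x,\xi\rangle}\,dx$ and $g_t(x)=t^{-n}g(t^{-1}x)$. For a weight $w$ and $0<p<\infty$, $\|f\|_{p,w}=\left(\int_{\mathbb{R}^n}|f(x)|^pw(x)\,dx\right)^{1/p}$. For $1<s<\infty$, $A_s$ is the Muckenhoupt class on $\mathbb{R}^n$: $w\in A_s$ if $\sup_B\left(|B|^{-1}\int_Bw\right)\left(|B|^{-1}\int_Bw^{-1/(s-1)}\right)^{s-1}<\infty$, the supremum being over all balls $B$. Setup. For $\varphi\in L^1(\mathbb{R}^n)$ satisfying the non-degeneracy condition, there are $b_0\in(0,1)$ and $0<r_1<r_2$ such that for every $b\in[b_0,1)$ there is $\eta\in C^\infty(\mathbb{R}^n)$ with $\hat\eta$ continuous, $\operatorname{supp}\hat\eta\subset\{r_1<|\xi|<r_2\}$, $\sum_{j=-\infty}^\infty\hat\varphi(b^j\xi)\hat\eta(b^j\xi)=1$ for all $\xi\ne0$, and $\hat\eta\in C^k(\mathbb{R}^n)$ whenever $\hat\varphi\in C^k(\mathbb{R}^n\setminus\{0\})$. Such $b_0,r_1,r_2$,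 a number $b\in[b_0,1)$ and a corresponding $\eta$ are fixed. For $J>0$ put $$\hat\zeta_J(\xi)=1-\sum_{j\in\mathbb{Z}:\,b^j\le J}\hat\varphi(b^j\xi)\hat\eta(b^j\xi).$$ For $\psi\in L^1(\mathbb{R}^n)$, $\Theta\in C^\infty(\mathbb{R}^n)$, $j\in\mathbb{Z}$, $J>0$, $L\ge0$ define, with values in $[0,\infty]$, $$C_\varphi(\psi,j,L)=\int_{\mathbb{R}^n}(1+|x|)^L\left|\int_{\mathbb{R}^n}\hat\psi(b^{-j}\xi)\hat\eta(\xi)e^{2\pi i\langle x,\xi\rangle}\,d\xi\right|dx,$$ $$D_\varphi(\Theta,J,L)=\int_{\mathbb{R}^n}(1+|x|)^L\left|\int_{\mathbb{R}^n}\hat\zeta_J(\xi)\Theta(\xi)e^{2\pi i\langle x,\xi\rangle}\,d\xi\right|dx.$$ *)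

(* Defs.v *)
From HB Require Import structures.
From mathcomp Require Import all_boot all_order all_algebra.
From mathcomp Require Import complex.
From mathcomp Require Import all_classical all_reals all_analysis.

Set Implicit Arguments.
Unset Strict Implicit.
Unset Printing Implicit Defensive.

Import Order.TTheory GRing.Theory Num.Theory.
Import numFieldNormedType.Exports.

Local Open Scope classical_set_scope.
Local Open Scope ring_scope.

Definition measure_rV_display : measure_display -> measure_display.
Proof. exact. Qed.

Section measurable_rV.
Context {d} {T : sigmaRingType d}.
Variable n : nat.

Let coors : 'I_n -> 'rV[T]_n -> T := fun i x => x ord0 i.

Let rV_set0 : g_sigma_preimage coors set0.
Proof. exact: sigma_algebra0. Qed.

Let rV_setC A : g_sigma_preimage coors A -> g_sigma_preimage coors (~` A).
Proof. exact: sigma_algebraC. Qed.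

Let rV_bigcup (F : _^nat) : (forall i, g_sigma_preimage coors (F i)) ->
  g_sigma_preimage coors (\bigcup_i (F i)).
Proof. exact: sigma_algebra_bigcup. Qed.

HB.instance Definition _ := @isMeasurable.Build (measure_rV_display d)
  'rV[T]_n (g_sigma_preimage coors) rV_set0 rV_setC rV_bigcup.

End measurable_rV.

Lemma measurable_coord d (T : sigmaRingType d) n (i : 'I_n) :
  measurable_fun [set: 'rV[T]_n] (fun x : 'rV[T]_n => x ord0 i).
Proof.
move=> _ Y mY; rewrite setTI; apply: sub_sigma_algebra => /=.
rewrite -bigcup_seq/=; exists i => /=; first by rewrite mem_index_enum.
by exists Y => //; rewrite setTI.
Qed.

Lemma measurable_fun_rV d1 d2 (T1 : measurableType d1) (T2 : measurableType d2)
    n (f : T1 -> 'rV[T2]_n) :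
  (forall i, measurable_fun [set: T1] (fun x => f x ord0 i)) ->
  measurable_fun [set: T1] f.
Proof.
move=> mf _ A mA; rewrite setTI.
suff: g_sigma_preimage (fun i (x : 'rV[T2]_n) => x ord0 i) `<=`
    [set B | measurable (f @^-1` B)] by apply.
apply: smallest_sub => /=.
  split => /=.
  - by rewrite preimage_set0.
  - by move=> B mB; rewrite setTD preimage_setC; exact: measurableC.
  - by move=> F mF; rewrite preimage_bigcup; exact: bigcup_measurable.
move=> B; rewrite -bigcup_seq => -[i _ [C mC <-]] /=.
by rewrite setTI -[X in measurable X]setTI; exact: (mf i).
Qed.

Section lebesgue_rV.
Context {R : realType}.

Definition rV_cons n (z : 'rV[R]_n * measurableTypeR R) : 'rV[R]_n.+1 :=
  row_mx (z.2)%:M z.1.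

Lemma rV_cons0 n z : @rV_cons n z ord0 ord0 = z.2.
Proof.
rewrite /rV_cons (_ : ord0 = lshift n (ord0 : 'I_1)) ?ord1; last exact/val_inj.
by rewrite (row_mxEl (z.2)%:M z.1) mxE.
Qed.

Lemma rV_consS n z i : @rV_cons n z ord0 (lift ord0 i) = z.1 ord0 i.
Proof.
rewrite /rV_cons (_ : lift ord0 i = rshift 1 i); last exact/val_inj.
by rewrite (row_mxEr (z.2)%:M z.1).
Qed.

Lemma measurable_rV_cons n : measurable_fun [set: _] (@rV_cons n).
Proof.
apply: measurable_fun_rV => i; case: (unliftP ord0 i) => [j|] ->.
  rewrite (_ : (fun _ => _) = (fun x : 'rV[R]_n => x ord0 j) \o fst).
    by apply: measurableT_comp => //; exact: measurable_coord.
  by apply/funext => z; rewrite rV_consS.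
rewrite (_ : (fun _ => _) = snd); first exact: measurable_snd.
by apply/funext => z; rewrite rV_cons0.
Qed.

Definition lebesgue_cons n (mu : {measure set 'rV[R]_n -> \bar R}) :
    set 'rV[R]_n.+1 -> \bar R :=
  pushforward (mu \x lebesgue_measure)%E (@rV_cons n).

HB.instance Definition _ n (mu : {measure set 'rV[R]_n -> \bar R}) :=
  Measure.copy (lebesgue_cons mu)
    (measure_function_pushforward__canonical__measure_function_Measure
       (mu \x lebesgue_measure)%E (@measurable_rV_cons n)).

Fixpoint lebesgue_rV n : {measure set 'rV[R]_n -> \bar R} :=
  match n with
  | 0 => \d_(0 : 'rV[R]_0)
  | m.+1 => lebesgue_cons (lebesgue_rV m)
  end.

Lemma lebesgue_rV_box n (A : 'I_n -> set R) :
  (forall i, measurable (A i)) ->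
  lebesgue_rV n [set x | forall i, A i (x ord0 i)] =
  (\prod_(i < n) lebesgue_measure (A i))%E.
Proof.
elim: n A => [|n IH] A mA.
  by rewrite big_ord0 /= diracE mem_set// => -[].
rewrite big_ord_recl /= /lebesgue_cons /pushforward.
have -> : @rV_cons n @^-1` [set x : 'rV[R]_n.+1 | forall i, A i (x ord0 i)] =
    [set x : 'rV[R]_n | forall i : 'I_n, A (lift ord0 i) (x ord0 i)] `*` A ord0.
  apply/seteqP; split => -[x t] /= h.
    by split=> [i|]; [have := h (lift ord0 i)|have := h ord0];
      rewrite (rV_consS, rV_cons0).
  move=> i; case: (unliftP ord0 i) => [j|] ->; rewrite (rV_consS, rV_cons0).
    by have [+ _] := h; exact.
  by have [_] := h.
rewrite product_measure1E//; first by rewrite [LHS]muleC; congr (_ * _)%E; exact: (IH (fun i => A (lift ord0 i))).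
  rewrite (_ : [set _ | _] =
    \big[setI/setT]_(i < n) (fun x : 'rV[R]_n => x ord0 i) @^-1` A (lift ord0 i)).
    apply: bigsetI_measurable => i _.
    by rewrite -[X in measurable X]setTI; exact: measurable_coord.
  rewrite -bigcap_seq; apply/seteqP; split => x /= h i; first by move=> _; exact: h.
  exact/h/mem_index_enum.
exact: mA.
Qed.

End lebesgue_rV.

Local Notation normc := ComplexField.Normc.normc.
Local Notation Re := complex.Re.
Local Notation Im := complex.Im.

Section euclidean_space.
Context {R : realType} {n : nat}.
Local Notation Rn := 'rV[R]_n.
Local Notation mu := (@lebesgue_rV R n).
Implicit Types (x y xi : Rn) (f g phi psi eta etahat Theta : Rn -> R[i]).

Definition dot x y : R := \sum_(i < n) x ord0 i * y ord0 i.

(* The norm that the library puts on row vectors is the sup norm. *)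
Definition enorm x : R := Num.sqrt (dot x x).

Definition eball x (r : R) : set Rn := [set y | enorm (y - x) < r].

Definition cis (t : R) : R[i] := (cos t +i* sin t)%C.

Definition cintegral f : R[i] :=
  ((\int[mu]_x Re (f x)) +i* (\int[mu]_x Im (f x)))%C.

Definition cL1 f : Prop :=
  mu.-integrable setT (EFin \o (fun x => Re (f x))) /\
  mu.-integrable setT (EFin \o (fun x => Im (f x))).

Definition fourier f : Rn -> R[i] :=
  fun xi => cintegral (fun x => f x * cis (- (2 * pi * dot x xi))).

Definition inv_fourier f : Rn -> R[i] :=
  fun x => cintegral (fun xi => f xi * cis (2 * pi * dot x xi)).

Definition convolution f g : Rn -> R[i] := fun x => cintegral (fun y => f (x - y) * g y).

Definition dilate g (t : R) : Rn -> R[i] := fun x => (t ^- n)%:C%C * g (t^-1 *: x).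

Definition cpartial (k : 'I_n) f : Rn -> R[i] := fun x =>
  ('D_(delta_mx ord0 k) (fun y => Re (f y)) x +i*
   'D_(delta_mx ord0 k) (fun y => Im (f y)) x)%C.

Definition has_cpartial (k : 'I_n) f x : Prop :=
  derivable (fun y => Re (f y)) x (delta_mx ord0 k) /\
  derivable (fun y => Im (f y)) x (delta_mx ord0 k).

Definition ccontinuous_on (U : set Rn) f : Prop := forall x, U x ->
  {for x, continuous (fun y => Re (f y))} /\
  {for x, continuous (fun y => Im (f y))}.

(* Meant for open U only: continuity and derivability are two-sided at each
   point of U. *)
Fixpoint Ck (m : nat) (U : set Rn) f : Prop :=
  match m with
  | 0 => ccontinuous_on U f
  | m'.+1 => ccontinuous_on U f /\ forall k : 'I_n,
      (forall x, U x -> has_cpartial k f x) /\ Ck m' U (cpartial k f)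
  end.

Definition smooth f : Prop := forall m, Ck m setT f.

Definition multi_partial (beta : 'I_n -> nat) f : Rn -> R[i] :=
  foldr (fun k g => iter (beta k) (cpartial k) g) f (enum 'I_n).

Definition schwartz f : Prop := smooth f /\
  forall alpha beta : 'I_n -> nat, exists M : R, forall x,
    `|\prod_(k < n) x ord0 k ^+ alpha k| * normc (multi_partial beta f x) <= M.

(* h is the Fourier transform of the tempered function g in the sense of
   tempered distributions; g need not be integrable. *)
Definition is_tempered_fourier g h : Prop := forall u, schwartz u ->
  [/\ cL1 (fun x => g x * fourier u x), cL1 (fun x => h x * u x) &
      cintegral (fun x => g x * fourier u x) = cintegral (fun x => h x * u x)].

Definition average (B : set Rn) (w : Rn -> R) : \bar R :=
  (((fine (mu B))^-1)%:E * \int[mu]_(x in B) (w x)%:E)%E.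

(* A weight is positive almost everywhere, so the convention that 0 to a
   negative power is 0 never matters. *)
Definition muckenhoupt (s : R) (w : Rn -> R) : Prop :=
  [/\ measurable_fun setT w, (forall x, 0 <= w x), {ae mu, forall x, 0 < w x} &
    (ereal_sup [set (average (eball z.1 z.2) w *
       average (eball z.1 z.2) (fun x => w x `^ (- (s - 1)^-1))%R `^ (s - 1)%R)%E
       | z in [set z : Rn * R | (0 < z.2)%R]] < +oo)%E].

Definition wnorm (p : R) (w : Rn -> R) (F : Rn -> \bar R) : \bar R :=
  ((\int[mu]_x (`|F x| `^ p * (w x)%:E)) `^ p^-1)%E.

Definition square_function (q : R) f psi : Rn -> \bar R := fun x =>
  ((\int[lebesgue_measure]_(t in `]0%R, +oo[)
      ((normc (convolution f (dilate psi t) x) `^ q / t)%R)%:E) `^ q^-1)%E.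

Definition non_degenerate phi : Prop := exists c : R, 0 < c /\
  (c%:E < ereal_inf
    [set ereal_sup [set (normc (fourier phi (t *: xi)))%:E
                    | t in [set t : R | (0 < t)%R]]
    | xi in [set xi : Rn | xi != 0%R]])%E.

(* etahat is the Fourier transform of eta. Being supported in a compact subset
   of an annulus, it leaves finitely many nonzero terms in the sums over
   integers here and in zetahat, as \sum_(j \in _) requires. *)
Record calderon_pair phi (r1 r2 b : R) eta etahat : Prop := CalderonPair {
  calderon_smooth : smooth eta ;
  calderon_fourier : is_tempered_fourier eta etahat ;
  calderon_continuous : ccontinuous_on setT etahat ;
  calderon_supp : closure [set xi | etahat xi != 0] `<=`
    [set xi | r1 < enorm xi < r2] ;
  calderon_sum : forall xi, xi != 0 ->
    \sum_(j \in [set: int]) (fourier phi (b ^ j *: xi) * etahat (b ^ j *: xi)) = 1 ;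
  calderon_Ck : forall m, Ck m [set xi | xi != 0] (fourier phi) ->
    Ck m setT etahat
}.

Definition calderon_setup phi (b0 r1 r2 : R) : Prop :=
  [/\ 0 < b0 < 1, 0 < r1 < r2 & forall b, b0 <= b < 1 ->
    exists eta etahat, calderon_pair phi r1 r2 b eta etahat].

Definition zetahat (b : R) phi etahat (J : R) : Rn -> R[i] := fun xi =>
  1 - \sum_(j \in [set j : int | b ^ j <= J])
        (fourier phi (b ^ j *: xi) * etahat (b ^ j *: xi)).

Definition Xi (k : 'I_n) : Rn -> R[i] := fun xi => (0 +i* (2 * pi * xi ord0 k))%C.

Definition weighted_L1 (L : R) f : \bar R :=
  \int[mu]_x ((1 + enorm x) `^ L * normc (f x))%:E.

Definition Cphi (b : R) etahat psi (j : int) (L : R) : \bar R :=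
  weighted_L1 L (inv_fourier (fun xi => fourier psi (b ^ (- j) *: xi) * etahat xi)).

Definition Dphi (b : R) phi etahat Theta (J L : R) : \bar R :=
  weighted_L1 L (inv_fourier (fun xi => zetahat b phi etahat J xi * Theta xi)).

End euclidean_space.

(* Main.v *)
Require Import Defs.
From mathcomp Require Import all_boot all_order all_algebra.
From mathcomp Require Import complex.
From mathcomp Require Import all_classical all_reals all_analysis.
From HB Require Import structures.
From mathcomp Require Import measurable_realfun.
From mathcomp Require Import ring lra.

Set Implicit Arguments.
Unset Strict Implicit.
Unset Printing Implicit Defensive.

Import Order.TTheory GRing.Theory Num.Theory.
Import numFieldNormedType.Exports.

Local Open Scope classical_set_scope.
Local Open Scope ring_scope.

Local Notation normc := ComplexField.Normc.normc.
Local Notation Re := complex.Re.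
Local Notation Im := complex.Im.

(** Write F(x, t) = f * phi_t (x) and r = n / N. The proof compares both square
functions with the integral over the scales of a power of Peetre's maximal function
F**(x, t) = sup_y |F(x - y, t)| / (1 + |y| / t)^N.

The square function of psi is bounded by Peetre's function. The Calderon identity
writes 1 as the sum of the terms of index j with b^j <= A plus zetahat, on the
frequency side. Inserted into f * psi_t, it gives pieces that are convolutions of
F(., b^j t), or of F(., t), with kernels whose norms in L^1 with the weight
(1 + |x|)^N are the quantities Cphi and Dphi (calderon_decomposition). Hence
|f * psi_t (x)| is at most a constant times a geometrically weighted sum of
F**(x, b^j t), and as dt/t is invariant under dilations, the integral of
|f * psi_t (x)|^q dt/t is at most a constant times that of F**(x, t)^q
(integral_peetre_synthesis).

Peetre's function is bounded by the Hardy-Littlewood maximal function M. Applied to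
the partial derivatives of phi, whose transforms are multiples of that of phi by the
functions Xi_k, the same decomposition bounds the gradient of F by values of F** at
finer scales (scaled_conv_self_improving). Together with the mean value inequality
this yields, for every d in (0, 1],
F**(x, t)^r <= C (d^(-n) M(|F(., t)|^r)(x) + d^r (sum_j b^(eps j) F**(x, b^j t))^r)
(peetre_pointwise). Raised to the power q / r, integrated over the scales and used
with d small enough, it bounds the integral of F**(x, t)^q by that of
M(|F(., t)|^r)(x)^(q/r), once the last term is absorbed (peetre_integral_bound).
The absorption needs the integral of F**(x, t)^q to be finite for Schwartz f; for
small t this holds because the transform of phi is O(|xi|^eps) at the origin, and
for large t because phi has integrable derivatives (peetre_integral_finite).

The maximal function is bounded on the weighted mixed-norm space. Since p / r and
q / r exceed one and w is an A_(p/r) weight, the vector-valued maximal inequality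
(vector_valued_maximal) replaces M(|F(., t)|^r) by |F(., t)|^r, which gives the square
function of phi. That inequality is obtained as follows. The maximal function is taken
over a countable family of cubes with a finite Vitali covering property. Muckenhoupt's
theorem (maxf_Ap_bounded) follows by dominating the maximal function by an iteration
of two weighted ones (maxf_le_iterated), each bounded because A_p weights are doubling.
With equal inner and outer exponents the vector-valued inequality is Muckenhoupt's
theorem integrated over the scales; Rubio de Francia's extrapolation (extrapolation)
gives the other exponents.

On the Fourier side the proof uses inversion for integrable functions with integrable
transform (ft_inversion), the transform of a partial derivative (fourier_partial) and
the decay of transforms of Schwartz functions (schwartz_fourier_decay). *)

(** * Powers and integrals of nonnegative functions *)

Section ereal_powers.
Context {R : realType}.
Local Open Scope ereal_scope.
Implicit Types x y : \bar R.

Lemma lee_poweR x y (r : R) : (0 <= r)%R -> 0 <= x -> x <= y -> x `^ r <= y `^ r.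
Proof.
move=> r0 x0 xy; apply: gt0_ler_poweR => //.
  by rewrite in_itv/= x0 leey.
by rewrite in_itv/= (le_trans x0 xy) leey.
Qed.

Lemma poweRK x (r : R) : r != 0%R -> 0 <= x -> (x `^ r) `^ r^-1 = x.
Proof. by move=> r0 x0; rewrite -poweRrM divff// poweRe1. Qed.

Lemma poweRVK x (r : R) : r != 0%R -> 0 <= x -> (x `^ r^-1) `^ r = x.
Proof. by move=> r0 x0; rewrite -poweRrM mulVf// poweRe1. Qed.

Lemma poweRDp x (r s : R) : (0 < r)%R -> (0 < s)%R -> 0 <= x ->
  x `^ (r + s) = x `^ r * x `^ s.
Proof.
move=> r0 s0 x0; have rs0 : (0 < r + s)%R by rewrite addr_gt0.
by apply: poweRD; rewrite /poweRD_def; apply/implyP => /eqP rs; move: rs0; rewrite rs ltxx.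
Qed.

Lemma poweR_young x y (a : R) : (0 < a < 1)%R -> 0 <= x -> 0 <= y ->
  x `^ a * y `^ (1 - a) <= a%:E * x + (1 - a)%:E * y.
Proof.
move=> /andP[a0 a1] x0 y0; have b0 : (0 < 1 - a)%R by rewrite subr_gt0.
case: x x0 => [x x0|_|//]; last first.
  rewrite gt0_muley ?lte_fin// addye ?leey// -ltNye.
  by rewrite (lt_le_trans _ (mule_ge0 _ y0))// ?ltNyr// lee_fin ltW.
case: y y0 => [y y0|_|//]; last first.
  by rewrite gt0_muley ?lte_fin// addey ?leey// -EFinM ltNye.
rewrite !lee_fin in x0 y0.
rewrite !poweR_EFin -!EFinM -EFinD lee_fin.
have := @conjugate_powR R (x `^ a)%R (y `^ (1 - a))%R a^-1%R (1 - a)^-1%R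
  (powR_ge0 _ _) (powR_ge0 _ _).
rewrite !invr_gt0 => /(_ a0 b0); rewrite !invrK addrC subrK => /(_ erefl).
rewrite -!powRrM !divff ?gt_eqF// !powRr1// => /le_trans; apply.
by rewrite mulrC (mulrC (1 - a)%R).
Qed.

End ereal_powers.

Section nonnegative_measurable.
Context d (T : measurableType d) (R : realType).
Local Open Scope ereal_scope.
Implicit Types f g : T -> \bar R.

(** Both conditions travel together because they are what monotone convergence
and Tonelli's theorem ask for. *)
Definition nnmeas f := measurable_fun [set: T] f /\ forall x, 0 <= f x.

Lemma nnmeas_cst (r : \bar R) : 0 <= r -> nnmeas (fun=> r).
Proof. by move=> r0; split => //; exact: measurable_cst. Qed.

Lemma nnmeasD f g : nnmeas f -> nnmeas g -> nnmeas (fun x => f x + g x).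
Proof.
by move=> [mf f0] [mg g0]; split => [|x]; [exact: emeasurable_funD|exact: adde_ge0].
Qed.

Lemma nnmeasM f g : nnmeas f -> nnmeas g -> nnmeas (fun x => f x * g x).
Proof.
by move=> [mf f0] [mg g0]; split => [|x]; [exact: emeasurable_funM|exact: mule_ge0].
Qed.

Lemma nnmeas_poweR f (r : R) : nnmeas f -> nnmeas (fun x => f x `^ r).
Proof.
move=> [mf f0]; split=> [|x]; last exact: poweR_ge0.
exact: (measurableT_comp (measurable_poweR r)).
Qed.

Lemma nnmeas_indic (A : set T) : measurable A ->
  nnmeas (fun x => (\1_A x : R)%:E).
Proof.
move=> mA; split => [|x]; last by rewrite lee_fin.
exact/measurable_EFinP/measurable_indic.
Qed.

Lemma nnmeas_EFin (h : T -> R) : measurable_fun [set: T] h ->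
  (forall x, 0 <= h x)%R -> nnmeas (fun x => (h x)%:E).
Proof.
by move=> mh h0; split => [|x]; [exact/measurable_EFinP|rewrite lee_fin].
Qed.

Lemma nnmeas_sup (h : nat -> T -> \bar R) : (forall n, nnmeas (h n)) ->
  nnmeas (fun x => ereal_sup (range (h ^~ x))).
Proof.
move=> mh; split => [|x].
  have := @measurable_fun_esups _ _ _ setT h (fun n => (mh n).1) 0%N.
  apply: eq_measurable_fun => x _; rewrite /esups/= /sdrop.
  by congr ereal_sup; apply/seteqP; split => [_ [n _ <-]|_ [n _ <-]]; exists n.
by apply: le_trans ((mh 0%N).2 x) _; apply: ereal_sup_ubound; exists 0%N.
Qed.

Lemma nnmeas_series (h : nat -> T -> \bar R) : (forall n, nnmeas (h n)) ->
  nnmeas (fun x => \sum_(n <oo) h n x).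
Proof.
move=> mh; split => [|x]; last by apply: nneseries_ge0 => n _ _; exact: (mh n).2.
by apply: ge0_emeasurable_sum => [n x _ _|n _]; [exact: (mh n).2|exact: (mh n).1].
Qed.

End nonnegative_measurable.

Lemma nnmeas_comp d1 d2 (T1 : measurableType d1) (T2 : measurableType d2)
  (R : realType) (f : T2 -> \bar R) (h : T1 -> T2) :
  nnmeas f -> measurable_fun [set: T1] h -> nnmeas (fun x => f (h x)).
Proof. by move=> [mf f0] mh; split => // ; exact: measurableT_comp. Qed.

Section integral_lemmas.
Context d (T : measurableType d) (R : realType) (mu : {measure set T -> \bar R}).
Local Open Scope ereal_scope.
Implicit Types (f g : T -> \bar R) (D : set T).

Import HBNNSimple.

(** Monotonicity holds for arbitrary nonnegative functions, because the integral
of a nonnegative function is a supremum over the simple functions below it. *)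
Lemma ge0_le_integralT f g : (forall x, 0 <= f x) -> (forall x, f x <= g x) ->
  \int[mu]_x f x <= \int[mu]_x g x.
Proof.
move=> f0 fg; have g0 x : 0 <= g x by exact: le_trans (fg x).
rewrite !ge0_integralTE//; apply: ereal_sup_le => _ [h hf <-].
by exists h => // x; exact: le_trans (hf x) (fg x).
Qed.

Lemma nnmeas_integral_ge0 D f : nnmeas f -> 0 <= \int[mu]_(x in D) f x.
Proof. by move=> pf; apply: integral_ge0 => x _; exact: pf.2. Qed.

Lemma nnmeas_le_integral D f g : measurable D -> nnmeas f -> nnmeas g ->
  (forall x, D x -> f x <= g x) ->
  \int[mu]_(x in D) f x <= \int[mu]_(x in D) g x.
Proof.
move=> mD [mf f0] [mg g0] fg; apply: ge0_le_integral => //; exact: measurable_funTS.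
Qed.

Lemma nnmeas_integralZl D f (k : \bar R) : measurable D -> nnmeas f -> 0 <= k ->
  \int[mu]_(x in D) (k * f x) = k * \int[mu]_(x in D) f x.
Proof.
by move=> mD [mf f0] k0; rewrite ge0_integralZl//; exact: measurable_funTS.
Qed.

Lemma nnmeas_integralD D f g : measurable D -> nnmeas f -> nnmeas g ->
  \int[mu]_(x in D) (f x + g x) =
  \int[mu]_(x in D) f x + \int[mu]_(x in D) g x.
Proof.
by move=> mD [mf f0] [mg g0]; rewrite ge0_integralD//; exact: measurable_funTS.
Qed.

Lemma nnmeas_integral_eq0 D f : measurable D -> nnmeas f ->
  \int[mu]_(x in D) f x = 0 -> {ae mu, forall x, D x -> f x = 0}.
Proof.
move=> mD [mf f0] fi.
apply/ae_eq_integral_abs => //; first exact: measurable_funTS.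
by rewrite -[RHS]fi; apply: eq_integral => x _; rewrite gee0_abs.
Qed.

Lemma nnmeas_integral_indic D f : measurable D -> nnmeas f ->
  \int[mu]_(x in D) f x = \int[mu]_x ((\1_D x)%:E * f x).
Proof.
move=> mD pf; rewrite integral_mkcond; apply: eq_integral => x _.
by rewrite patchE indicE; case: (x \in D); rewrite ?mul1e ?mul0e.
Qed.

(** Young's inequality, after both integrals have been normalized to one. The
exponents are written a and 1 - a because the applications interpolate between
two weights. If one of the integrals is zero or infinite, the inequality is
clear. *)
Lemma hoelder_poweR D f g (a : R) : measurable D -> nnmeas f -> nnmeas g ->
  (0 < a < 1)%R ->
  \int[mu]_(x in D) (f x `^ a * g x `^ (1 - a)) <=
  (\int[mu]_(x in D) f x) `^ a * (\int[mu]_(x in D) g x) `^ (1 - a).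
Proof.
move=> mD pf pg a01; have /andP[a0 a1] := a01.
have b0 : (0 < 1 - a)%R by rewrite subr_gt0.
set A := \int[mu]_(x in D) f x; set B := \int[mu]_(x in D) g x.
have A0 : 0 <= A by apply: integral_ge0 => x _; exact: pf.2.
have B0 : 0 <= B by apply: integral_ge0 => x _; exact: pg.2.
have ph : nnmeas (fun x => f x `^ a * g x `^ (1 - a)).
  by apply: nnmeasM; exact: nnmeas_poweR.
have zero : {ae mu, forall x, D x -> f x `^ a * g x `^ (1 - a) = 0} ->
    \int[mu]_(x in D) (f x `^ a * g x `^ (1 - a)) = 0.
  move=> ae0; rewrite (@ae_eq_integral _ _ _ _ _ (cst 0))//.
  - by rewrite integral0.
  - exact: measurable_funTS ph.1.
have [A00|An0] := eqVneq A 0.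
  rewrite zero; first by rewrite mule_ge0// poweR_ge0.
  have := nnmeas_integral_eq0 mD pf A00; apply: filterS => x fx /fx ->.
  by rewrite poweR0r ?gt_eqF// mul0e.
have [B00|Bn0] := eqVneq B 0.
  rewrite zero; first by rewrite mule_ge0// poweR_ge0.
  have := nnmeas_integral_eq0 mD pg B00; apply: filterS => x gx /gx ->.
  by rewrite poweR0r ?gt_eqF// mule0.
have Ap : 0 < A by rewrite lt0e An0.
have Bp : 0 < B by rewrite lt0e Bn0.
have [Ay|Ay] := eqVneq A +oo.
  by rewrite Ay poweRyr ?gt_eqF// gt0_mulye ?leey// poweR_gt0.
have [By|By] := eqVneq B +oo.
  by rewrite By poweRyr ?gt_eqF// gt0_muley ?leey// poweR_gt0.
have AE : A = (fine A)%:E by rewrite fineK// ge0_fin_numE// ltey.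
have BE : B = (fine B)%:E by rewrite fineK// ge0_fin_numE// ltey.
have rA : (0 < fine A)%R by rewrite -lte_fin -AE.
have rB : (0 < fine B)%R by rewrite -lte_fin -BE.
pose F x := (fine A)^-1%:E * f x; pose G x := (fine B)^-1%:E * g x.
have pF : nnmeas F by apply: nnmeasM => //; apply: nnmeas_cst; rewrite lee_fin invr_ge0 ltW.
have pG : nnmeas G by apply: nnmeasM => //; apply: nnmeas_cst; rewrite lee_fin invr_ge0 ltW.
have iF : \int[mu]_(x in D) F x = 1.
  rewrite nnmeas_integralZl// ?lee_fin ?invr_ge0 ?(ltW rA)//.
  by rewrite -/A AE -EFinM mulVf// gt_eqF.
have iG : \int[mu]_(x in D) G x = 1.
  rewrite nnmeas_integralZl// ?lee_fin ?invr_ge0 ?(ltW rB)//.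
  by rewrite -/B BE -EFinM mulVf// gt_eqF.
have key x : f x `^ a * g x `^ (1 - a) <=
    (A `^ a * B `^ (1 - a)) * (a%:E * F x + (1 - a)%:E * G x).
  have fE : f x = A * F x.
    by rewrite /F AE muleA -EFinM divff ?mul1e// gt_eqF.
  have gE : g x = B * G x.
    by rewrite /G BE muleA -EFinM divff ?mul1e// gt_eqF.
  have F0 := pF.2 x; have G0 := pG.2 x.
  rewrite {1}fE {1}gE (@poweRM _ A (F x))// (@poweRM _ B (G x))//.
  rewrite muleACA lee_pmul2l//; last 2 first.
  - by rewrite AE BE !poweR_EFin -EFinM.
  - by rewrite mule_gt0// poweR_gt0.
  exact: poweR_young.
have paF : nnmeas (fun x => a%:E * F x).
  by apply: nnmeasM => //; apply: nnmeas_cst; rewrite lee_fin ltW.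
have pbG : nnmeas (fun x => (1 - a)%:E * G x).
  by apply: nnmeasM => //; apply: nnmeas_cst; rewrite lee_fin ltW.
have paFbG := nnmeasD paF pbG.
have pall : nnmeas (fun x => (A `^ a * B `^ (1 - a)) * (a%:E * F x + (1 - a)%:E * G x)).
  by apply: nnmeasM => //; apply: nnmeas_cst; rewrite mule_ge0 ?poweR_ge0.
apply: le_trans (nnmeas_le_integral mD ph pall (fun x _ => key x)) _.
rewrite nnmeas_integralZl// ?mule_ge0 ?poweR_ge0//.
rewrite nnmeas_integralD// (nnmeas_integralZl mD pF) ?lee_fin ?(ltW a0)//.
rewrite (nnmeas_integralZl mD pG) ?lee_fin ?(ltW b0)//.
by rewrite iF iG !mule1 -EFinD (_ : (a + (1 - a))%R = 1%R) ?mule1//; ring.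
Qed.

End integral_lemmas.

Section geometric.
Context {R : realType}.
Local Open Scope ereal_scope.

Lemma geometric_eseries (s : R) : (0 <= s < 1)%R ->
  \sum_(k <oo) (s ^+ k)%:E = (1 - s)^-1%:E.
Proof.
move=> /andP[s0 s1].
have s1' : (`|s| < 1)%R by rewrite ger0_norm.
have /= h := @cvg_geometric_series R 1 s s1'.
apply/cvg_lim => //.
rewrite (_ : (fun n : nat => _) = EFin \o (series (geometric 1 s))).
  by apply: cvg_EFin; [exact: nearW|rewrite mul1r in h].
apply/funext => n /=; rewrite sumEFin; congr (_%:E).
by apply: eq_bigr => i _; rewrite /geometric/= mul1r.
Qed.

(** The q-th power of a geometrically weighted sum is controlled by a
geometrically weighted sum of q-th powers, whether or not q is at least 1:
splitting the weight in two halves, the sum is at most a constant times the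
supremum of its terms taken with half of the weight. *)
Lemma poweR_geometric_sum (th q : R) : (0 < th < 1)%R -> (0 < q)%R ->
  exists2 C : R, (0 < C)%R & forall x : nat -> \bar R, (forall k, 0 <= x k) ->
  (\sum_(k <oo) (th ^+ k)%:E * x k) `^ q <=
  C%:E * \sum_(k <oo) ((th `^ (q / 2)) ^+ k)%:E * x k `^ q.
Proof.
move=> /andP[th0 th1] q0; pose s := Num.sqrt th.
have s0 : (0 < s)%R by rewrite sqrtr_gt0.
have s1 : (s < 1)%R by rewrite -(sqrtr1 R) ltr_sqrt.
exists ((1 - s)^-1 `^ q)%R; first by rewrite powR_gt0// invr_gt0 subr_gt0.
move=> x x0; set Y := (X in _ <= _ * X).
have t0 k : 0 <= ((th `^ (q / 2)) ^+ k)%:E * x k `^ q.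
  by rewrite mule_ge0 ?poweR_ge0// lee_fin exprn_ge0 ?powR_ge0.
have Y0 : 0 <= Y by apply: nneseries_ge0 => k _ _; exact: t0.
have sx0 k : 0 <= (s ^+ k)%:E * x k by rewrite mule_ge0// lee_fin exprn_ge0// ltW.
have [Yy|Yy] := eqVneq Y +oo.
  by rewrite Yy gt0_muley ?leey// lte_fin powR_gt0// invr_gt0 subr_gt0.
have YE : Y `^ q^-1 = (fine (Y `^ q^-1))%:E.
  rewrite fineK// ge0_fin_numE ?poweR_ge0//; apply: poweR_lty; rewrite ltey//.
have sk k : (s ^+ k)%:E * x k <= Y `^ q^-1.
  rewrite -(@poweRK _ ((s ^+ k)%:E * x k) q) ?gt_eqF//.
  apply: lee_poweR; rewrite ?invr_ge0 ?(ltW q0) ?poweR_ge0//.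
  rewrite poweRM// ?lee_fin ?exprn_ge0 ?(ltW s0)//.
  rewrite poweR_EFin.
  have -> : ((s ^+ k) `^ q = (th `^ (q / 2)) ^+ k)%R.
    rewrite -(@powR_mulrn _ s k) ?(ltW s0)// -powRrM /s -powR12_sqrt ?(ltW th0)// -powRrM.
    by rewrite -powR_mulrn ?powR_ge0// -powRrM; congr (_ `^ _)%R; ring.
  rewrite /Y (@nneseries_split _ _ 0 k.+1)// add0n.
  apply: le_trans (leeDl _ _); last by apply: nneseries_ge0 => j _ _; exact: t0.
  by rewrite big_nat_recr//= leeDr// sume_ge0.
have -> : ((1 - s)^-1 `^ q)%:E * Y = ((1 - s)^-1%:E * Y `^ q^-1) `^ q.
  rewrite poweRM ?poweR_ge0 ?lee_fin ?invr_ge0 ?subr_ge0 ?ltW//.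
  by rewrite poweRVK ?gt_eqF// poweR_EFin.
apply: lee_poweR; first exact: ltW.
  by apply: nneseries_ge0 => k _ _; rewrite mule_ge0// lee_fin exprn_ge0// ltW.
rewrite -geometric_eseries ?(ltW s0)//.
rewrite YE muleC -nneseriesZl//; last by move=> k _; rewrite lee_fin exprn_ge0// ltW.
apply: lee_nneseries => k _; first by rewrite mule_ge0// lee_fin exprn_ge0// ltW.
have -> : (th ^+ k = s ^+ k * s ^+ k)%R.
  by rewrite -exprMn -expr2 sqr_sqrtr// ltW.
rewrite EFinM -muleA -YE (muleC (Y `^ _)) lee_wpmul2l ?lee_fin ?exprn_ge0 ?(ltW s0)//.
Qed.

End geometric.

Lemma measurable_natr_bool d (T : measurableType d) (R : realType) (b : T -> bool) :
  measurable_fun [set: T] b -> measurable_fun [set: T] (fun x => (b x)%:R : R).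
Proof.
move=> mb; rewrite (_ : (fun x => _) = (fun x => if b x then 1 else 0 : R)).
  exact: measurable_fun_ifT.
by apply/funext => x; case: (b x).
Qed.

Section integral_powers.
Context {R : realType}.
Local Notation leb := (@lebesgue_measure R).
Local Open Scope ereal_scope.

Lemma integral_powR_cc (q a b : R) : (0 < q)%R -> (0 < a < b)%R ->
  \int[leb]_(t in `[a, b]) (q * t `^ (q - 1))%:E = (b `^ q - a `^ q)%:E.
Proof.
move=> q0 /andP[a0 ab].
have dx x : (0 < x)%R -> derivable (fun t => t `^ q)%R x 1.
  by move=> x0; apply: derivable_powR; rewrite in_itv/= x0.
have cx (p : R) x : (0 < x)%R -> {for x, continuous (fun t => t `^ p)%R}.
  move=> x0; apply/differentiable_continuous/derivable1_diffP.
  by apply: derivable_powR; rewrite in_itv/= x0.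
rewrite (@continuous_FTC2 _ _ (fun t => t `^ q)%R)//.
- apply: continuous_in_subspaceT => x; rewrite inE/= in_itv/= => /andP[ax _].
  have c : {for x, continuous (fun t : R => q * t `^ (q - 1))%R}.
    by apply: continuousM; [exact: cvg_cst|exact/cx/(lt_le_trans a0)].
  exact: c.
- split.
  + by move=> x; rewrite in_itv/= => /andP[ax _]; exact/dx/(lt_trans a0).
  + exact/cvg_at_right_filter/cx.
  + exact/cvg_at_left_filter/cx/(lt_trans a0).
- move=> x; rewrite in_itv/= => /andP[ax _].
  by rewrite powR_derive1// in_itv/= (lt_trans a0).
Qed.

Lemma cvg_powR_harmonic (q A : R) : (0 < q)%R -> (0 < A)%R ->
  ((A / n.+2%:R) `^ q)%R @[n --> \oo] --> 0%R.
Proof.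
move=> q0 A0; have /cvg_at_rightP := powR_cvg0 q0; apply; split.
  by move=> n; rewrite divr_gt0.
rewrite -[X in _ --> X](mulr0 A); apply: cvgM; first exact: cvg_cst.
by have := @cvg_harmonic R; rewrite -(@cvg_shiftS _ (harmonic : R^nat)).
Qed.

Lemma measurable_kernel_powR (q : R) (D : set R) :
  measurable_fun D (fun t : R => (q * t `^ (q - 1))%:E).
Proof.
apply/measurable_EFinP; apply: measurable_funM => //.
exact: measurable_funTS (measurable_powR _).
Qed.

(** The function under the integral sign blows up at 0 when q < 1, so the
integral is computed on an increasing sequence of compact intervals. *)
Lemma integral_powR_oo (q A : R) : (0 < q)%R -> (0 < A)%R ->
  \int[leb]_(t in `]0%R, A[) (q * t `^ (q - 1))%:E = (A `^ q)%:E.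
Proof.
move=> q0 A0.
rewrite integral_itv_bndo_bndc; last exact: measurable_kernel_powR.
have A1 (n : nat) : (A / n.+2%:R < A)%R.
  by rewrite ltr_pdivrMr// ltr_pMr// ltr1n.
pose F (n : nat) : set R := `[(A / n.+2%:R)%R, A]%classic.
have FE : `]0%R, A]%classic = \bigcup_n F n.
  apply/seteqP; split => [t /=|t [n _]]; rewrite /F /= !in_itv/=.
    move=> /andP[t0 tA]; have _ := archi_boundP (ltW (divr_gt0 A0 t0)).
    exists (Num.bound (A / t)) => //=; rewrite in_itv/= tA andbT.
    rewrite ler_pdivrMr// mulrC -ler_pdivrMr//.
    apply/ltW/(lt_le_trans (archi_boundP (ltW (divr_gt0 A0 t0)))).
    by rewrite ler_nat (leq_trans (leqnSn _)).
  by move=> /andP[/lt_le_trans-> //]; rewrite divr_gt0.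
rewrite FE.
have := @ge0_nondecreasing_set_cvg_integral _ (measurableTypeR R) R F
  (fun t => (q * t `^ (q - 1))%:E) leb.
move=> /(_ _ _ (fun i => @measurable_kernel_powR q (F i)) _)/cvg_lim <-//; last 3 first.
- apply/nondecreasing_seqP => n; apply/subsetPset => t; rewrite /F/= !in_itv/=.
  move=> /andP[h ->]; rewrite andbT (le_trans _ h)// ler_wpM2l// ?(ltW A0)//.
  by rewrite lef_pV2 ?posrE// ler_nat.
- by move=> n; exact: measurable_itv.
- by move=> n t _; rewrite lee_fin mulr_ge0 ?powR_ge0// ltW.
apply/cvg_lim => //.
rewrite (_ : (fun n => _) = EFin \o (fun n : nat => A `^ q - (A / n.+2%:R) `^ q)%R).
  apply: cvg_EFin; first exact: nearW.
  rewrite -[X in _ --> X]subr0; apply: cvgB; first exact: cvg_cst.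
  exact: cvg_powR_harmonic.
by apply/funext => n; rewrite integral_powR_cc// divr_gt0//=.
Qed.

(** A q-th power is the integral of its derivative up to that point; this is
what the layer-cake computations use. *)
Lemma poweR_integral (q : R) (A : \bar R) : (0 < q)%R -> 0 <= A ->
  \int[leb]_(t in `]0%R, +oo[)
    ((q * t `^ (q - 1))%:E * ((t : R)%:E < A)%E%:R%:E) = A `^ q.
Proof.
move=> q0; case: A => [A A0|_|//].
  have [->|An0] := eqVneq A 0%R.
    rewrite poweR0r ?gt_eqF// integral0_eq// => t; rewrite /= in_itv/= andbT => t0.
    by rewrite lte_fin ltNge (ltW t0)/= mule0.
  have Ap : (0 < A)%R by rewrite lt0r An0 -lee_fin.
  rewrite poweR_EFin -(integral_powR_oo q0 Ap) [LHS]integral_mkcond [RHS]integral_mkcond.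
  apply: eq_integral => t _; rewrite !patchE.
  rewrite !mem_setE !in_itv/= andbT lte_fin; case: (ltP 0%R t) => //= t0.
  by case: (ltP t A) => tA; rewrite ?mule1 ?mule0.
under eq_integral do rewrite ltry mule1.
rewrite poweRyr ?gt_eqF//; apply/eqyP => r r0.
pose B := (r `^ q^-1)%R; have B0 : (0 < B)%R by exact: powR_gt0.
have <- : \int[leb]_(t in `]0%R, B[) (q * t `^ (q - 1))%:E = r%:E.
  by rewrite integral_powR_oo// /B -powRrM mulVf ?gt_eqF// powRr1// ltW.
apply: ge0_subset_integral => //.
- exact: measurable_kernel_powR.
- by move=> t _; rewrite lee_fin mulr_ge0 ?powR_ge0// ltW.
- by move=> t /=; rewrite !in_itv/= => /andP[->].
Qed.

End integral_powers.

Section layer_cake.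
Context d (T : measurableType d) (R : realType)
  (mu : {sigma_finite_measure set T -> \bar R}).
Local Notation leb := (@lebesgue_measure R).
Local Open Scope ereal_scope.

(** Tonelli's theorem applied to the representation of h^q by poweR_integral. *)
Lemma layer_cake (h v : T -> \bar R) (q : R) : (0 < q)%R -> nnmeas h -> nnmeas v ->
  \int[mu]_x (h x `^ q * v x) =
  \int[leb]_(t in `]0%R, +oo[) ((q * t `^ (q - 1))%:E *
    \int[mu]_x (((t : R)%:E < h x)%E%:R%:E * v x)).
Proof.
move=> q0 ph pv.
pose F (z : T * measurableTypeR R) : \bar R := (\1_(`]0%R, +oo[%classic : set (measurableTypeR R)) z.2)%:E *
  ((q * z.2 `^ (q - 1))%:E * (((z.2 : R)%:E < h z.1)%E%:R%:E * v z.1)).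
have pk : nnmeas (fun t : measurableTypeR R => (\1_(`]0%R, +oo[%classic : set (measurableTypeR R)) t)%:E * (q * t `^ (q - 1))%:E).
  split => [|t]; last first.
    by rewrite mule_ge0// lee_fin// mulr_ge0 ?powR_ge0// ltW.
  apply: emeasurable_funM; last exact: measurable_kernel_powR.
  by apply/measurable_EFinP/measurable_indic; exact: measurable_itv.
have pF : nnmeas F.
  rewrite /F; under [X in nnmeas X]eq_fun do rewrite muleA.
  apply: nnmeasM; first by apply: nnmeas_comp pk _; exact: measurable_snd.
  apply: nnmeasM; last by apply: nnmeas_comp pv _; exact: measurable_fst.
  split => [|z]; last by rewrite lee_fin.
  apply/measurable_EFinP/measurable_natr_bool.
  apply: measurable_fun_lte => //.
    have m2 : measurable_fun [set: T * measurableTypeR R] (fun z => z.2 : R).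
      exact: measurable_snd.
    exact/measurable_EFinP.
  exact: measurableT_comp ph.1 measurable_fst.
have := @fubini_tonelli _ _ _ _ _ mu leb F pF.1 pF.2.
rewrite {1}/F /= => FT.
transitivity (\int[mu]_x \int[leb]_y F (x, y)).
  apply: eq_integral => x _.
  rewrite -(poweR_integral q0 (ph.2 x)) muleC nnmeas_integral_indic//; last first.
    split => [|t]; last by rewrite mule_ge0// lee_fin// mulr_ge0 ?powR_ge0// ltW.
    apply: emeasurable_funM; first exact: measurable_kernel_powR.
    apply/measurable_EFinP/measurable_natr_bool.
    by apply: measurable_fun_lte => //; exact/measurable_EFinP.
  rewrite -nnmeas_integralZl//; last 2 first.
  - under [X in nnmeas X]eq_fun do rewrite muleA.
    apply: nnmeasM => //; split => [|t]; last by rewrite lee_fin.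
    apply/measurable_EFinP/measurable_natr_bool.
    by apply: measurable_fun_lte => //; exact/measurable_EFinP.
  - exact: pv.2.
  by apply: eq_integral => t _; rewrite /F/= muleC -!muleA.
rewrite FT [RHS]integral_mkcond; apply: eq_integral => t _.
rewrite patchE /F/= indicE; case: ifPn => _; last first.
  by rewrite (_ : (fun x => _) = cst 0) ?integral0//; apply/funext => x; rewrite mul0e.
under eq_integral do rewrite mul1e.
rewrite nnmeas_integralZl//.
- apply: nnmeasM => //; split => [|x]; last by rewrite lee_fin.
  apply/measurable_EFinP/measurable_natr_bool.
  by apply: measurable_fun_lte => //; exact: ph.1.
- by rewrite lee_fin mulr_ge0 ?powR_ge0// ltW.
Qed.

End layer_cake.

(** * Maximal functions and Muckenhoupt weights *)

Section maximal_functions.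
Context d (T : measurableType d) (R : realType)
  (mu : {sigma_finite_measure set T -> \bar R}).
Local Open Scope ereal_scope.

Definition weight (w : T -> R) := measurable_fun [set: T] w /\ forall x, (0 < w x)%R.

Lemma weight_nnmeas w : weight w -> nnmeas (fun x => (w x)%:E).
Proof. by move=> [mw w0]; apply: nnmeas_EFin => // x; exact: ltW. Qed.

Variables (Q : nat -> set T).

Definition wmass (w : T -> R) i := \int[mu]_(x in Q i) (w x)%:E.

Definition wavg (w : T -> R) (f : T -> \bar R) i :=
  (fine (wmass w i))^-1%:E * \int[mu]_(x in Q i) (f x * (w x)%:E).

(** The weighted maximal function over the sets Q i. A countable family keeps it
measurable, and the indicator restricts the supremum to the sets that contain x.
*)
Definition maxf (w : T -> R) (f : T -> \bar R) x :=
  ereal_sup (range (fun i => (\1_(Q i) x : R)%:E * wavg w f i)).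

Hypothesis mQ : forall i, measurable (Q i).
Hypothesis Q_gt0 : forall i, 0 < mu (Q i).

Lemma wmass_gt0 w i : weight w -> 0 < wmass w i.
Proof.
move=> ww; rewrite lt0e nnmeas_integral_ge0 ?andbT; last exact: weight_nnmeas.
apply/negP => /eqP /(nnmeas_integral_eq0 (mQ i) (weight_nnmeas ww)) ae0.
have : mu.-negligible (Q i).
  apply: negligibleS ae0 => x Qx /= /(_ Qx) [w0].
  by have := ww.2 x; rewrite w0 ltxx.
by move/measure_negligible => /(_ (mQ i)) Q0; have := Q_gt0 i; rewrite Q0 ltxx.
Qed.

Definition locally_finite (w : T -> R) := forall i, wmass w i < +oo.

Section fixed_weight.
Variables (w : T -> R) (ww : weight w) (lw : locally_finite w).
Implicit Types f g : T -> \bar R.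

Let W i := fine (wmass w i).

Lemma wmassE i : wmass w i = (fine (wmass w i))%:E.
Proof. by rewrite fineK// ge0_fin_numE// ltW// wmass_gt0. Qed.

Lemma fine_wmass_gt0 i : (0 < fine (wmass w i))%R.
Proof. by rewrite -lte_fin -wmassE wmass_gt0. Qed.

Let ww0 := weight_nnmeas ww.

Lemma nnmeas_weightM f : nnmeas f -> nnmeas (fun x => f x * (w x)%:E).
Proof. by move=> pf; exact: nnmeasM. Qed.

Lemma wavg_ge0 f i : nnmeas f -> 0 <= wavg w f i.
Proof.
move=> pf; rewrite mule_ge0 ?nnmeas_integral_ge0//; last exact: nnmeas_weightM.
by rewrite lee_fin invr_ge0 ltW// fine_wmass_gt0.
Qed.

Lemma le_wavg f g i : nnmeas f -> nnmeas g -> (forall x, f x <= g x) ->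
  wavg w f i <= wavg w g i.
Proof.
move=> pf pg fg; apply: lee_wpmul2l; first by rewrite lee_fin invr_ge0 ltW// fine_wmass_gt0.
apply: nnmeas_le_integral => //; try exact: nnmeas_weightM.
by move=> x _; apply: lee_wpmul2r; rewrite ?ww0.2.
Qed.

Lemma wavg_cst (c : \bar R) i : 0 <= c -> wavg w (fun=> c) i = c.
Proof.
move=> c0; rewrite /wavg nnmeas_integralZl// -/(wmass w i) wmassE.
by rewrite muleCA -EFinM mulVf ?mule1// gt_eqF// fine_wmass_gt0.
Qed.

Lemma wavgD f g i : nnmeas f -> nnmeas g ->
  wavg w (fun x => f x + g x) i = wavg w f i + wavg w g i.
Proof.
move=> pf pg; have pfw := nnmeas_weightM pf; have pgw := nnmeas_weightM pg.
rewrite /wavg -ge0_muleDr ?nnmeas_integral_ge0// -nnmeas_integralD//.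
congr (_ * _); apply: eq_integral => x _.
by rewrite ge0_muleDl; [|exact: pf.2|exact: pg.2].
Qed.

Lemma wavgZ f (c : \bar R) i : nnmeas f -> 0 <= c ->
  wavg w (fun x => c * f x) i = c * wavg w f i.
Proof.
move=> pf c0; rewrite /wavg muleCA -(nnmeas_integralZl mu (mQ i) (nnmeas_weightM pf) c0).
by congr (_ * _); apply: eq_integral => x _; rewrite muleA.
Qed.

Lemma wavg_series (f : nat -> T -> \bar R) i : (forall k, nnmeas (f k)) ->
  wavg w (fun x => \sum_(k <oo) f k x) i = \sum_(k <oo) wavg w (f k) i.
Proof.
move=> pf; have pfw k := nnmeas_weightM (pf k).
rewrite /wavg nneseriesZl; last by move=> k _; exact: nnmeas_integral_ge0.
congr (_ * _); rewrite -integral_nneseries//; last 2 first.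
- by move=> k; exact: measurable_funTS (pfw k).1.
- by move=> k x _; exact: (pfw k).2.
apply: eq_integral => x _; rewrite muleC -nneseriesZl; last by move=> k _; exact: (pf k).2.
by apply: eq_eseriesr => k _; rewrite muleC.
Qed.

Lemma nnmeas_maxf f : nnmeas f -> nnmeas (maxf w f).
Proof.
move=> pf; apply: nnmeas_sup => i; apply: nnmeasM; first exact: nnmeas_indic.
by apply: nnmeas_cst; exact: wavg_ge0.
Qed.

Lemma wavg_le_maxf f i x : Q i x -> wavg w f i <= maxf w f x.
Proof.
move=> Qx; apply: ereal_sup_ubound; exists i => //.
by rewrite indicE mem_set// mul1e.
Qed.

Lemma maxf_le f x y : 0 <= y -> (forall i, Q i x -> wavg w f i <= y) ->
  maxf w f x <= y.
Proof.
move=> y0 h; apply: ge_ereal_sup => _ [i _ <-]; rewrite indicE.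
case: (boolP (x \in Q i)) => [|_]; last by rewrite mul0e.
by rewrite inE => /h; rewrite mul1e.
Qed.

Lemma maxfZ f (c : R) x : nnmeas f -> (0 < c)%R ->
  maxf w (fun x => c%:E * f x) x = c%:E * maxf w f x.
Proof.
move=> pf c0; have pM := nnmeas_maxf pf.
have pcf : nnmeas (fun x => c%:E * f x).
  by apply: nnmeasM => //; apply: nnmeas_cst; rewrite lee_fin ltW.
apply/eqP; rewrite eq_le; apply/andP; split.
  apply: maxf_le => [|i Qx]; first by rewrite mule_ge0 ?lee_fin ?(ltW c0)//; exact: pM.2.
  by rewrite wavgZ ?lee_fin ?(ltW c0)// lee_wpmul2l ?lee_fin ?(ltW c0)// wavg_le_maxf.
rewrite muleC -lee_pdivlMr//; apply: maxf_le => [|i Qx].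
  by rewrite mule_ge0 ?lee_fin ?invr_ge0 ?(ltW c0)//; exact: (nnmeas_maxf pcf).2.
rewrite lee_pdivlMr// muleC -wavgZ ?lee_fin ?(ltW c0)//.
exact: wavg_le_maxf.
Qed.

Lemma maxf_series (f : nat -> T -> \bar R) x : (forall k, nnmeas (f k)) ->
  maxf w (fun x => \sum_(k <oo) f k x) x <= \sum_(k <oo) maxf w (f k) x.
Proof.
move=> pf; apply: maxf_le => [|i Qx].
  by apply: nneseries_ge0 => k _ _; exact: (nnmeas_maxf (pf k)).2.
rewrite wavg_series//; apply: lee_nneseries => [k _ _|k _]; first exact: wavg_ge0.
exact: wavg_le_maxf.
Qed.

Variables (D : nat -> nat).
Hypothesis vitali : forall s : seq nat, exists s' : seq nat,
  [/\ uniq s', {subset s' <= s}, trivIset [set` s'] Q &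
   forall i, i \in s -> exists2 j, j \in s' & Q i `<=` Q (D j)].
Variables (K : R).
Hypothesis doubling : forall i, wmass w (D i) <= K%:E * wmass w i.

Let K_ge0 : (0 <= K)%R.
Proof.
have := le_trans (ltW (wmass_gt0 (D 0) ww)) (doubling 0).
by rewrite pmule_lge0 ?lee_fin// wmass_gt0.
Qed.

(** The disjoint sets selected by the covering property have averages above l
and carry, after enlargement, the whole union; the doubling property compares
their masses before and after enlargement. *)
Lemma weak_type_finite f (l : R) n : nnmeas f -> (0 < l)%R ->
  l%:E * \int[mu]_(x in \bigcup_(i in [set i | (i < n)%N /\ l%:E < wavg w f i]) Q i) (w x)%:E
  <= K%:E * \int[mu]_x (f x * (w x)%:E).
Proof.
move=> pf l0; have pfw := nnmeas_weightM pf.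
pose s := [seq i <- iota 0 n | l%:E < wavg w f i].
have [s' [us' s's ts' cov]] := vitali s.
have mE : measurable (\bigcup_(i in [set i | (i < n)%N /\ l%:E < wavg w f i]) Q i).
  by apply: bigcup_measurable.
have le1 : \int[mu]_(x in \bigcup_(i in [set i | (i < n)%N /\ l%:E < wavg w f i]) Q i) (w x)%:E
    <= \sum_(j <- s') wmass w (D j).
  rewrite nnmeas_integral_indic//.
  have -> : \sum_(j <- s') wmass w (D j) =
      \int[mu]_x \sum_(j <- s') ((\1_(Q (D j)) x)%:E * (w x)%:E).
    rewrite ge0_integral_sum//.
    - by apply: eq_bigr => j _; exact: nnmeas_integral_indic.
    - by move=> j; apply: (nnmeasM (nnmeas_indic _ (mQ _)) ww0).1.
    - by move=> j x _; apply: (nnmeasM (nnmeas_indic _ (mQ _)) ww0).2.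
  apply: ge0_le_integralT => x; first exact: (nnmeasM (nnmeas_indic _ mE) ww0).2.
  have s0 : 0 <= \sum_(j <- s') ((\1_(Q (D j)) x)%:E * (w x)%:E).
    by apply: sume_ge0 => j _; apply: (nnmeasM (nnmeas_indic _ (mQ _)) ww0).2.
  rewrite [X in X%:E * _]indicE; case: (boolP (x \in _)) => [|_]; last by rewrite mul0e.
  rewrite inE => -[i [ni li] Qix]; rewrite mul1e.
  have [j js' ij] : exists2 j, j \in s' & Q i `<=` Q (D j).
    by apply: cov; rewrite mem_filter li mem_iota/=.
  rewrite (big_rem j)//= indicE mem_set ?mul1e; last exact: ij.
  apply: leeDl; apply: sume_ge0 => k _.
  by apply: (nnmeasM (nnmeas_indic _ (mQ _)) ww0).2.
apply: (@le_trans _ _ (l%:E * (K%:E * \sum_(j <- s') wmass w j))).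
  apply: lee_wpmul2l; first by rewrite lee_fin ltW.
  apply: (le_trans le1); rewrite ge0_sume_distrr; last by move=> j _; apply/ltW/wmass_gt0.
  by apply: lee_sum => j _; exact: doubling.
rewrite muleCA; apply: lee_wpmul2l; first by rewrite lee_fin.
rewrite ge0_sume_distrr; last by move=> j _; apply/ltW/wmass_gt0.
apply: (@le_trans _ _ (\sum_(j <- s') \int[mu]_(x in Q j) (f x * (w x)%:E))).
  rewrite big_seq [leRHS]big_seq; apply: lee_sum => j /s's.
  rewrite mem_filter => /andP[+ _] => /ltW.
  rewrite /wavg => /(lee_wpmul2r (ltW (wmass_gt0 j ww))) /le_trans; apply.
  by rewrite muleAC {2}wmassE -EFinM mulVf ?mul1e// gt_eqF// fine_wmass_gt0.
rewrite -ge0_integral_bigsetU//=; last 2 first.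
- exact: measurable_funTS pfw.1.
- by move=> x _; exact: pfw.2.
apply: ge0_subset_integral => //.
- by apply: bigsetU_measurable.
- exact: pfw.1.
- by move=> x _; exact: pfw.2.
Qed.

(** The level set of the maximal function is the increasing union of the finite
unions of weak_type_finite. *)
Lemma weak_type f (l : R) : nnmeas f -> (0 < l)%R ->
  l%:E * \int[mu]_x ((l%:E < maxf w f x)%E%:R%:E * (w x)%:E)
  <= K%:E * \int[mu]_x (f x * (w x)%:E).
Proof.
move=> pf l0.
pose E n := \bigcup_(i in [set i | (i < n)%N /\ l%:E < wavg w f i]) Q i.
have mE n : measurable (E n) by apply: bigcup_measurable.
have -> : \int[mu]_x ((l%:E < maxf w f x)%E%:R%:E * (w x)%:E) =
    \int[mu]_(x in \bigcup_n E n) (w x)%:E.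
  rewrite [RHS]nnmeas_integral_indic//; last by apply: bigcup_measurable.
  apply: eq_integral => x _; congr (_%:E * _); rewrite indicE; congr ((_ : bool)%:R).
  apply/idP/idP.
    move=> lM; rewrite inE; apply: contrapT => nE.
    move: lM; rewrite ltNge => /negP; apply; apply: maxf_le; first by rewrite lee_fin ltW.
    move=> i Qix; rewrite leNgt; apply/negP => li; apply: nE.
    by exists i.+1 => //; exists i.
  rewrite inE => -[n _ [i [_ li] Qix]].
  exact: lt_le_trans li (wavg_le_maxf _ Qix).
have ndE : nondecreasing_seq E.
  apply/nondecreasing_seqP => n; apply/subsetPset => x [i [ni li] Qix].
  by exists i => //; split => //; exact: ltnW.
have cv := @ge0_nondecreasing_set_cvg_integral _ _ R E (fun x => (w x)%:E) mu
  ndE mE (fun i => measurable_funTS ww0.1) (fun i x _ => ww0.2 x).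
rewrite -lee_pdivlMl//.
apply: (cvge_to_le cv); apply: nearW => n; rewrite lee_pdivlMl//.
exact: weak_type_finite.
Qed.

(** Only the part of f above t/2 matters at level t, because the average of the
rest is at most t/2. *)
Lemma weak_type_truncated f (t : R) : nnmeas f -> (0 < t)%R ->
  t%:E * \int[mu]_x ((t%:E < maxf w f x)%E%:R%:E * (w x)%:E)
  <= (2 * K)%:E * \int[mu]_x ((t%:E < 2%:E * f x)%E%:R%:E * (f x * (w x)%:E)).
Proof.
move=> pf t0; have t20 : (0 < t / 2)%R by rewrite divr_gt0.
pose g x := (t%:E < 2%:E * f x)%E%:R%:E * f x.
have pb h : nnmeas h -> nnmeas (fun x => (t%:E < h x)%E%:R%:E : \bar R).
  move=> ph; split => [|x]; last by rewrite lee_fin.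
  by apply/measurable_EFinP/measurable_natr_bool/measurable_fun_lte => //; exact: ph.1.
have p2f : nnmeas (fun x => 2%:E * f x) by apply: nnmeasM => //; apply: nnmeas_cst.
have pg : nnmeas g by apply: nnmeasM => //; exact: pb.
have fg x : f x <= g x + (t / 2)%:E.
  rewrite /g; case: ltP => [_|]; first by rewrite mul1e leeDl// lee_fin ltW.
  by rewrite mul0e add0e EFinM (muleC t%:E) lee_pdivlMl.
have Mfg x : maxf w f x <= maxf w g x + (t / 2)%:E.
  apply: maxf_le => [|i Qx].
    by rewrite adde_ge0 ?(nnmeas_maxf pg).2// lee_fin ltW.
  have ph : nnmeas (fun x => g x + (t / 2)%:E).
    by apply: nnmeasD => //; apply: nnmeas_cst; rewrite lee_fin ltW.
  apply: (le_trans (le_wavg i pf ph fg)).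
  rewrite wavgD//; last by apply: nnmeas_cst; rewrite lee_fin ltW.
  by rewrite wavg_cst ?lee_fin ?(ltW t20)// leeD2r// wavg_le_maxf.
have tz z : t%:E * z = 2%:E * ((t / 2)%:E * z).
  by rewrite muleA -EFinM; congr (_%:E * _); field.
have gw : \int[mu]_x (g x * (w x)%:E) =
    \int[mu]_x ((t%:E < 2%:E * f x)%E%:R%:E * (f x * (w x)%:E)).
  by apply: eq_integral => x _; rewrite /g muleA.
rewrite tz (EFinM 2 K) -(muleA 2%:E K%:E) lee_pmul2l// -gw.
apply: (le_trans _ (weak_type pg t20)).
apply: lee_wpmul2l; first by rewrite lee_fin (ltW t20).
apply: nnmeas_le_integral => //.
- by apply: nnmeasM => //; apply: pb; exact: nnmeas_maxf.
- apply: nnmeasM => //; split => [|x]; last by rewrite lee_fin.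
  apply/measurable_EFinP/measurable_natr_bool/measurable_fun_lte => //.
  exact: (nnmeas_maxf pg).1.
move=> x _; apply: lee_wpmul2r; first exact: ww0.2.
rewrite lee_fin; case: (ltP t%:E) => // tM.
have -> // : ((t / 2)%:E < maxf w g x) = true.
have := lt_le_trans tM (Mfg x); rewrite -lteBlDr//.
by rewrite -EFinB (_ : t - t / 2 = t / 2)%R; [|lra].
Qed.

(** Integrate weak_type_truncated against p t^(p - 2): by layer_cake, the
left-hand side is the integral of the p-th power of the maximal function, and
the right-hand side involves the power p - 1 of 2 f times f. *)
Lemma strong_type (p : R) : (1 < p)%R -> forall f, nnmeas f ->
  \int[mu]_x (maxf w f x `^ p * (w x)%:E) <=
  (2 * K * (p / (p - 1)) * 2 `^ (p - 1))%:E * \int[mu]_x (f x `^ p * (w x)%:E).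
Proof.
move=> p1 f pf; have p0 : (0 < p)%R by apply: lt_trans p1.
have p10 : (0 < p - 1)%R by rewrite subr_gt0.
have p2f : nnmeas (fun x => 2%:E * f x) by apply: nnmeasM => //; apply: nnmeas_cst.
have pfw := nnmeas_weightM pf.
rewrite (layer_cake mu p0 (nnmeas_maxf pf) ww0).
have -> : (2 * K * (p / (p - 1)) * 2 `^ (p - 1))%:E * \int[mu]_x (f x `^ p * (w x)%:E) =
  (2 * K * (p / (p - 1)))%:E * \int[mu]_x ((2%:E * f x) `^ (p - 1) * (f x * (w x)%:E)).
  rewrite EFinM -muleA; congr (_ * _).
  have pfp : nnmeas (fun x => f x `^ p * (w x)%:E).
    by apply: nnmeasM => //; exact: nnmeas_poweR.
  rewrite -nnmeas_integralZl ?lee_fin ?powR_ge0//; apply: eq_integral => x _.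
  rewrite poweRM//; last exact: pf.2.
  rewrite poweR_EFin -muleA; congr (_ * _); rewrite muleA; congr (_ * _).
  rewrite -{3}(poweRe1 (pf.2 x)) -poweRDp//; last exact: pf.2.
  by rewrite subrK.
set c := (2 * K * (p / (p - 1)))%R.
have c0 : (0 <= c)%R.
  by apply: mulr_ge0; [exact: mulr_ge0|rewrite divr_ge0 ?(ltW p0) ?(ltW p10)].
have pcfw : nnmeas (fun x => c%:E * (f x * (w x)%:E)).
  by apply: nnmeasM => //; apply: nnmeas_cst; rewrite lee_fin.
rewrite -nnmeas_integralZl//; last by apply: nnmeasM => //; exact: nnmeas_poweR.
under [leRHS]eq_integral do rewrite muleCA.
rewrite (layer_cake mu p10 p2f pcfw) integral_mkcond [leRHS]integral_mkcond.
have pb h : nnmeas h -> forall t : R, nnmeas (fun x : T => (t%:E < h x)%E%:R%:E : \bar R).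
  move=> ph t; split => [|x]; last by rewrite lee_fin.
  by apply/measurable_EFinP/measurable_natr_bool/measurable_fun_lte => //; exact: ph.1.
apply: ge0_le_integralT => t; rewrite !patchE mem_setE in_itv/= andbT;
  case: ltP => // t0.
  rewrite mule_ge0 ?nnmeas_integral_ge0//.
    by rewrite lee_fin mulr_ge0 ?powR_ge0// ltW.
  by apply: nnmeasM => //; apply: pb; exact: nnmeas_maxf.
under [in leRHS]eq_integral do rewrite muleCA.
rewrite (nnmeas_integralZl mu measurableT _ _) ?lee_fin//; last first.
  by apply: nnmeasM => //; exact: pb.
have -> : (p * t `^ (p - 1) = (p * t `^ (p - 1 - 1)) * t)%R.
  by rewrite -mulrA -[X in (_ * (_ * X))%R]powRr1 ?ltW// -powRD ?subrK// gt_eqF// implybT.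
have -> : ((p - 1) * t `^ (p - 1 - 1))%:E * (c%:E *
    \int[mu]_x ((t%:E < 2%:E * f x)%E%:R%:E * (f x * (w x)%:E))) =
  (p * t `^ (p - 1 - 1))%:E * ((2 * K)%:E *
    \int[mu]_x ((t%:E < 2%:E * f x)%E%:R%:E * (f x * (w x)%:E))).
  rewrite !muleA -!EFinM; congr (_%:E * _); rewrite /c; field; exact: lt0r_neq0.
rewrite EFinM -muleA lee_wpmul2l//; last exact: weak_type_truncated.
by rewrite lee_fin mulr_ge0 ?powR_ge0// ltW.
Qed.

End fixed_weight.

End maximal_functions.

Lemma powRDp (R : realType) (x a b : R) : (0 < x)%R -> (x `^ (a + b) = x `^ a * x `^ b)%R.
Proof. by move=> x0; apply: powRD; apply/implyP => _; rewrite gt_eqF. Qed.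

(** A countable family of sets for which the finite Vitali covering lemma holds:
out of finitely many members one can extract disjoint ones whose enlargements
D i cover the union, and enlarging costs at most the factor K0 in measure.  The
members E k increase to the whole space. *)
Record vitali_family d (T : measurableType d) (R : realType)
  (mu : {sigma_finite_measure set T -> \bar R}) (Q : nat -> set T)
  (D E : nat -> nat) (K0 : R) : Prop := VitaliFamily {
  vf_measurable : forall i, measurable (Q i) ;
  vf_gt0 : forall i, (0 < mu (Q i))%E ;
  vf_fin : forall i, (mu (Q i) < +oo)%E ;
  vf_vitali : forall s : seq nat, exists s' : seq nat,
    [/\ uniq s', {subset s' <= s}, trivIset [set` s'] Q &
     forall i, i \in s -> exists2 j, j \in s' & Q i `<=` Q (D j)] ;
  vf_sub : forall i, Q i `<=` Q (D i) ;
  vf_enlarge : forall i, (mu (Q (D i)) <= K0%:E * mu (Q i))%E ;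
  vf_const_gt0 : 0 < K0 ;
  vf_nondecreasing : nondecreasing_seq (Q \o E) ;
  vf_cover : \bigcup_k Q (E k) = setT
}.

Section Ap_weights.
Context d (T : measurableType d) (R : realType)
  (mu : {sigma_finite_measure set T -> \bar R}).
Local Open Scope ereal_scope.
Variables (Q : nat -> set T) (D E : nat -> nat) (K0 : R).
Hypothesis VF : vitali_family mu Q D E K0.

Let mQ := vf_measurable VF.
Let Q_gt0 := vf_gt0 VF.
Let Q_fin := vf_fin VF.
Let vitali := vf_vitali VF.
Let QD := vf_sub VF.
Let muD := vf_enlarge VF.
Let K0_gt0 := vf_const_gt0 VF.
Local Notation wmass := (wmass mu Q).
Local Notation wavg := (wavg mu Q).
Local Notation maxf := (maxf mu Q).
Local Notation locally_finite := (locally_finite mu Q).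

(** The weight of the dual space: if w is the weight of an L^p space, the dual
of that space carries the weight w^(1 - p') with 1/p + 1/p' = 1. *)
Definition dual_weight (p : R) (w : T -> R) x := (w x `^ (- (p - 1)^-1))%R.

Lemma weight_dual p w : weight w -> weight (dual_weight p w).
Proof.
move=> [mw w0]; split => [|x]; last exact: powR_gt0.
exact: measurableT_comp (measurable_powR _) mw.
Qed.

Lemma dual_weightK p w : (1 < p)%R -> weight w ->
  dual_weight (p / (p - 1)) (dual_weight p w) = w.
Proof.
move=> p1 [_ w0]; apply/funext => x; rewrite /dual_weight -powRrM.
have p10 : (p - 1 != 0)%R by rewrite gt_eqF// subr_gt0.
rewrite (_ : p / (p - 1) - 1 = (p - 1)^-1)%R; last by field.
by rewrite invrK mulrNN mulVf// powRr1// ltW.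
Qed.

(** The A_p condition for averages over the sets Q i, cleared of denominators:
in this form, raising to the power 1/(p - 1) exchanges w and its dual. *)
Definition Ap_weight (p K : R) (w : T -> R) :=
  [/\ weight w, locally_finite w, locally_finite (dual_weight p w) &
    forall i, wmass w i * wmass (dual_weight p w) i `^ (p - 1) <= K%:E * mu (Q i) `^ p].

(** Raise the A_p condition to the power 1/(p - 1). *)
Lemma Ap_weight_dual p K w : (1 < p)%R -> (0 < K)%R -> Ap_weight p K w ->
  Ap_weight (p / (p - 1)) (K `^ (p - 1)^-1) (dual_weight p w).
Proof.
move=> p1 K1 [ww lw ls h]; have p10 : (0 < p - 1)%R by rewrite subr_gt0.
split; rewrite ?dual_weightK//; first exact: weight_dual.
move=> i; have W0 := ltW (wmass_gt0 mQ Q_gt0 i ww).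
have S0 := ltW (wmass_gt0 mQ Q_gt0 i (weight_dual p ww)).
have -> : (p / (p - 1) - 1 = (p - 1)^-1)%R by field; exact: lt0r_neq0.
have pV0 : (0 <= (p - 1)^-1)%R by rewrite invr_ge0 ltW.
have := lee_poweR pV0 (mule_ge0 W0 (poweR_ge0 _ _)) (h i).
rewrite (@poweRM _ (wmass w i))// ?poweR_ge0//.
rewrite (@poweRM _ K%:E) ?poweR_ge0 ?lee_fin ?(ltW K1)//.
by rewrite (poweRK (lt0r_neq0 p10) S0) muleC -poweRrM poweR_EFin.
Qed.

(** Hoelder's inequality for the factorization of 1 into powers of w and of its
dual weight. *)
Lemma measure_le_wmass p w i : (1 < p)%R -> weight w ->
  mu (Q i) `^ p <= wmass w i * wmass (dual_weight p w) i `^ (p - 1).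
Proof.
move=> p1 ww; have p0 : (0 < p)%R by apply: lt_trans p1.
have ws := weight_dual p ww.
have W0 := ltW (wmass_gt0 mQ Q_gt0 i ww); have S0 := ltW (wmass_gt0 mQ Q_gt0 i ws).
have a01 : (0 < p^-1 < 1)%R by rewrite invr_gt0 p0 invf_lt1.
have := hoelder_poweR mu (mQ i) (weight_nnmeas ww) (weight_nnmeas ws) a01.
have -> : \int[mu]_(x in Q i) ((w x)%:E `^ p^-1 * (dual_weight p w x)%:E `^ (1 - p^-1)) = mu (Q i).
  rewrite -[RHS]mul1e -integral_cst//; apply: eq_integral => x _.
  rewrite !poweR_EFin -EFinM /dual_weight -powRrM -powRDp ?ww.2//.
  rewrite (_ : _ + _ = 0)%R ?powRr0//; field.
  by rewrite !gt_eqF// subr_gt0.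
move=> /(lee_poweR (ltW p0) (measure_ge0 _ _)) /le_trans; apply.
rewrite poweRM ?poweR_ge0// poweRVK ?gt_eqF// -poweRrM.
by rewrite (_ : (1 - p^-1) * p = p - 1)%R//; field; exact: lt0r_neq0.
Qed.

(** The A_p condition on the enlarged set bounds the mass of that set by means
of its dual mass, which is at least the dual mass of Q i; measure_le_wmass then
brings back the mass of Q i. *)
Lemma Ap_weight_doubling p K w i : (1 < p)%R -> (0 < K)%R -> Ap_weight p K w ->
  wmass w (D i) <= (K * K0 `^ p)%:E * wmass w i.
Proof.
move=> p1 K1 [ww lw ls h]; have p10 : (0 < p - 1)%R by rewrite subr_gt0.
have p0 : (0 < p)%R by apply: lt_trans p1.
have ws := weight_dual p ww.
have S0 := wmass_gt0 mQ Q_gt0 i ws.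
have le1 : wmass w (D i) * wmass (dual_weight p w) i `^ (p - 1) <=
    ((K * K0 `^ p)%:E * wmass w i) * wmass (dual_weight p w) i `^ (p - 1).
  apply: (@le_trans _ _ (wmass w (D i) * wmass (dual_weight p w) (D i) `^ (p - 1))).
    apply: lee_wpmul2l; first exact/ltW/(wmass_gt0 mQ Q_gt0).
    apply: lee_poweR; [exact: ltW|exact: ltW|].
    apply: ge0_subset_integral => //; first exact: measurable_funTS (weight_nnmeas ws).1.
    by move=> x _; exact: (weight_nnmeas ws).2.
  apply: (le_trans (h (D i))).
  rewrite EFinM -!muleA lee_wpmul2l ?lee_fin ?(ltW K1)//.
  apply: (@le_trans _ _ ((K0 `^ p)%:E * mu (Q i) `^ p)).
    rewrite -poweR_EFin -poweRM ?lee_fin ?(ltW K0_gt0)//.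
    by apply: lee_poweR => //; exact: ltW.
  rewrite lee_wpmul2l ?lee_fin ?powR_ge0//.
  exact: measure_le_wmass.
move: le1; rewrite lee_pmul2r//; last exact: poweR_gt0.
by rewrite (wmassE mQ Q_gt0 ws ls) poweR_EFin.
Qed.

Local Notation one := ((fun=> 1%R) : T -> R).

Lemma weight1 : weight one. Proof. by split. Qed.

Lemma wmass1 i : wmass one i = mu (Q i).
Proof. by rewrite /wmass (integral_cst mu (mQ i) 1) mul1e. Qed.

Lemma locally_finite1 : locally_finite one.
Proof. by move=> i; rewrite wmass1. Qed.

(** The averages of f are compared with those of two successive maximal
functions, the inner one with respect to the dual weight and the outer one with
respect to the weight itself.  Each of them is bounded because A_p weights are
doubling. *)
Lemma maxf_le_iterated p K w f x : (1 < p)%R -> (0 < K)%R -> Ap_weight p K w ->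
  nnmeas f ->
  maxf one f x `^ (p - 1) <= K%:E * maxf w (fun y => maxf (dual_weight p w)
    (fun z => f z * ((dual_weight p w z)^-1)%:E) y `^ (p - 1) * ((w y)^-1)%:E) x.
Proof.
move=> p1 K1 [ww lw ls h] pf; have p10 : (0 < p - 1)%R by rewrite subr_gt0.
have ws := weight_dual p ww.
have pV (v : T -> R) : weight v -> nnmeas (fun x => (v x)^-1%:E).
  move=> [mv v0]; apply: nnmeas_EFin => [|y]; last by rewrite invr_ge0 ltW.
  rewrite (_ : (fun _ => _) = (fun y => v y `^ (-1)))%R.
    exact: measurableT_comp (measurable_powR _) mv.
  by apply/funext => y; rewrite powR_inv1 ?ltW.
set s := dual_weight p w in ws ls h *.
set hh := fun z => f z * _; set g := fun y => maxf s hh y `^ (p - 1) * _.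
have phh : nnmeas hh by apply: nnmeasM => //; exact: pV.
have pMh := nnmeas_maxf mQ Q_gt0 ws ls phh.
have pg : nnmeas g by apply: nnmeasM; [exact: nnmeas_poweR|exact: pV].
have Mg0 := (nnmeas_maxf mQ Q_gt0 ww lw pg).2 x.
rewrite -[leRHS](@poweRVK _ _ (p - 1)) ?gt_eqF// ?mule_ge0 ?lee_fin ?(ltW K1)//.
apply: lee_poweR; [exact: ltW|exact: (nnmeas_maxf mQ Q_gt0 weight1 locally_finite1 pf).2|].
apply: maxf_le; first exact: poweR_ge0.
move=> i Qix.
have a10 := wavg_ge0 mQ Q_gt0 weight1 locally_finite1 i pf.
rewrite -[leLHS](@poweRK _ _ (p - 1)) ?gt_eqF//.
apply: lee_poweR; [by rewrite invr_ge0 ltW|exact: poweR_ge0|].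
apply: (@le_trans _ _ (K%:E * wavg w g i)); last first.
  by rewrite lee_wpmul2l ?lee_fin ?(ltW K1)//; exact: wavg_le_maxf.
set a := wavg s hh i; have a0 : 0 <= a by exact: (wavg_ge0 mQ Q_gt0).
set m := fine (wmass one i); set A := fine (wmass w i); set S := fine (wmass s i).
have m0 := fine_wmass_gt0 mQ Q_gt0 weight1 locally_finite1 i; rewrite -/m in m0.
have A0 := fine_wmass_gt0 mQ Q_gt0 ww lw i; rewrite -/A in A0.
have S0 := fine_wmass_gt0 mQ Q_gt0 ws ls i; rewrite -/S in S0.
have mE : mu (Q i) = m%:E by rewrite -wmass1 (wmassE mQ Q_gt0 weight1 locally_finite1).
have -> : wavg one f i = (m^-1 * S)%:E * a.
  rewrite /wavg -/m EFinM -muleA; congr (_ * _); rewrite /a /wavg -/S muleA -EFinM.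
  rewrite divff ?mul1e ?gt_eqF//; apply: eq_integral => y _; rewrite mule1 /hh.
  by rewrite -muleA -EFinM mulVf ?mule1// gt_eqF// ws.2.
(* On Q i the inner maximal function is at least a everywhere, so that the
average of g with respect to w is bounded below. *)
have le1 : (A^-1)%:E * (a `^ (p - 1) * m%:E) <= wavg w g i.
  rewrite /wavg -/A lee_wpmul2l ?lee_fin ?invr_ge0 ?(ltW A0)//.
  rewrite -mE -(integral_cst mu (mQ i)); apply: nnmeas_le_integral => //.
  - by apply: nnmeas_cst; exact: poweR_ge0.
  - by apply: nnmeasM => //; exact: weight_nnmeas.
  move=> y Qy; rewrite /g -muleA -EFinM mulVf ?mule1 ?gt_eqF ?ww.2//.
  by apply: lee_poweR; [exact: ltW| |exact: wavg_le_maxf].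
apply: (le_trans _ (lee_wpmul2l (_ : 0 <= K%:E) le1)); last by rewrite lee_fin ltW.
rewrite poweRM//; last by rewrite lee_fin mulr_ge0 ?invr_ge0 ?(ltW m0) ?(ltW S0).
rewrite (muleC (a `^ _)) !muleA -!EFinM poweR_EFin lee_wpmul2r ?poweR_ge0//.
have := h i; rewrite mE (wmassE mQ Q_gt0 ww lw) (wmassE mQ Q_gt0 ws ls) -/A -/S !poweR_EFin -!EFinM.
rewrite !lee_fin => h'.
rewrite powRM ?invr_ge0 ?(ltW m0) ?(ltW S0)//.
rewrite -(powR_inv1 (ltW m0)) -powRrM mulN1r mulrC.
have mp : (m `^ p * m `^ (- (p - 1)) = m)%R.
  by rewrite -powRDp// (_ : _ + _ = 1)%R ?powRr1 ?(ltW m0)//; ring.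
rewrite -{2}mp mulrA ler_wpM2r ?powR_ge0//.
by rewrite mulrAC ler_pdivlMr// mulrC.
Qed.

End Ap_weights.

Section muckenhoupt.
Context d (T : measurableType d) (R : realType)
  (mu : {sigma_finite_measure set T -> \bar R}).
Local Open Scope ereal_scope.
Variables (Q : nat -> set T) (D E : nat -> nat) (K0 : R).
Hypothesis VF : vitali_family mu Q D E K0.

Let mQ := vf_measurable VF.
Let Q_gt0 := vf_gt0 VF.
Let Q_fin := vf_fin VF.
Let vitali := vf_vitali VF.
Let QD := vf_sub VF.
Let muD := vf_enlarge VF.
Let K0_gt0 := vf_const_gt0 VF.
Local Notation wmass := (wmass mu Q).
Local Notation wavg := (wavg mu Q).
Local Notation maxf := (maxf mu Q).
Local Notation Ap_weight := (Ap_weight mu Q).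
Local Notation one := ((fun=> 1%R) : T -> R).

Lemma nnmeas_weightV (v : T -> R) : weight v -> nnmeas (fun x => (v x)^-1%:E).
Proof.
move=> [mv v0]; apply: nnmeas_EFin => [|y]; last by rewrite invr_ge0 ltW.
rewrite (_ : (fun _ => _) = (fun y => v y `^ (-1)))%R.
  exact: measurableT_comp (measurable_powR _) mv.
by apply/funext => y; rewrite powR_inv1 ?ltW.
Qed.

Lemma nnmeas_maxf1 f : nnmeas f -> nnmeas (maxf one f).
Proof.
exact: (nnmeas_maxf mQ Q_gt0 (@weight1 _ _ _) (locally_finite1 VF)).
Qed.

(** Muckenhoupt's theorem: raise maxf_le_iterated to the power p' = p / (p - 1)
and apply strong_type twice, for w with the exponent p' and for its dual weight
with the exponent p. The bound depends on the weight only through its A_p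
constant, so that it can be used for the unspecified weights of extrapolation.
*)
Lemma maxf_Ap_bounded (p K : R) : (1 < p)%R -> (0 < K)%R ->
  exists2 B : R, (0 < B)%R & forall w, Ap_weight p K w -> forall f, nnmeas f ->
  \int[mu]_x (maxf one f x `^ p * (w x)%:E) <=
  B%:E * \int[mu]_x (f x `^ p * (w x)%:E).
Proof.
move=> p1 K1; have p0 : (0 < p)%R by apply: lt_trans p1.
have p10 : (0 < p - 1)%R by rewrite subr_gt0.
pose p' := (p / (p - 1))%R.
have p'1 : (1 < p')%R by rewrite /p' ltr_pdivlMr// mul1r ltrBlDr ltrDl.
pose c (k r : R) := (2 * k * (r / (r - 1)) * 2 `^ (r - 1))%R.
have c_gt0 k r : (0 < k)%R -> (1 < r)%R -> (0 < c k r)%R.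
  move=> k0 r1; rewrite /c; apply: mulr_gt0; last exact: powR_gt0.
  by rewrite !mulr_gt0// ?invr_gt0 ?subr_gt0//; apply: lt_trans r1.
pose K' := (K `^ (p - 1)^-1)%R.
have K'0 : (0 < K')%R by exact: powR_gt0.
pose c1 := c (K * K0 `^ p)%R p'; pose c2 := c (K' * K0 `^ p')%R p.
have c10 : (0 < c1)%R by apply: c_gt0 => //; rewrite mulr_gt0 ?powR_gt0.
have c20 : (0 < c2)%R by apply: c_gt0 => //; rewrite mulr_gt0 ?powR_gt0.
exists (K `^ p' * c1 * c2)%R; first by do 2![apply: mulr_gt0 => //]; exact: powR_gt0.
move=> w Aw f pf; have [ww lw ls h] := Aw.
have ws := weight_dual p ww.
set s := dual_weight p w in ws ls h *.
pose hh z := f z * (s z)^-1%:E; pose g y := maxf s hh y `^ (p - 1) * (w y)^-1%:E.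
have phh : nnmeas hh by apply: nnmeasM => //; exact: nnmeas_weightV.
have pMh := nnmeas_maxf mQ Q_gt0 ws ls phh.
have pg : nnmeas g by apply: nnmeasM; [exact: nnmeas_poweR|exact: nnmeas_weightV].
have pMg := nnmeas_maxf mQ Q_gt0 ww lw pg.
have pM1 := nnmeas_maxf1 pf.
have pww := weight_nnmeas ww.
have As := Ap_weight_dual VF p1 K1 Aw.
have st1 := strong_type mQ Q_gt0 ww lw vitali
  (fun i => Ap_weight_doubling VF i p1 K1 Aw) p'1 pg.
have st2 := strong_type mQ Q_gt0 ws ls vitali
  (fun i => Ap_weight_doubling VF i p'1 K'0 As) p1 phh.
apply: (@le_trans _ _ ((K `^ p')%:E * \int[mu]_x (maxf w g x `^ p' * (w x)%:E))).
  rewrite -nnmeas_integralZl ?lee_fin ?powR_ge0//; last first.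
    by apply: nnmeasM => //; exact: nnmeas_poweR.
  apply: nnmeas_le_integral => //.
  - by apply: nnmeasM => //; exact: nnmeas_poweR.
  - apply: nnmeasM; first by apply: nnmeas_cst; rewrite lee_fin powR_ge0.
    by apply: nnmeasM => //; exact: nnmeas_poweR.
  move=> x _; rewrite muleA; apply: lee_wpmul2r; first exact: pww.2.
  rewrite -poweR_EFin -poweRM ?lee_fin ?(ltW K1)//; last exact: pMg.2.
  have -> : maxf one f x `^ p = (maxf one f x `^ (p - 1)) `^ p'.
    by rewrite -poweRrM /p'; congr (_ `^ _); field; exact: lt0r_neq0.
  apply: lee_poweR; rewrite ?poweR_ge0//; first by rewrite ltW// (lt_trans _ p'1).
  exact: (maxf_le_iterated VF).
rewrite -!(mulrA (K `^ p'))%R EFinM -!muleA lee_wpmul2l ?lee_fin ?powR_ge0//.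
apply: (le_trans st1); rewrite -/(c _ _) -/c1 (EFinM c1 c2) -muleA lee_wpmul2l ?lee_fin ?(ltW c10)//.
have -> : \int[mu]_x (g x `^ p' * (w x)%:E) = \int[mu]_x (maxf s hh x `^ p * (s x)%:E).
  apply: eq_integral => x _; have wx := ww.2 x.
  rewrite /g poweRM ?poweR_ge0// ?lee_fin ?invr_ge0 ?(ltW wx)// -poweRrM -muleA.
  rewrite (_ : (p - 1) * p' = p)%R; last by rewrite /p'; field; exact: lt0r_neq0.
  congr (_ * _); rewrite poweR_EFin -EFinM /s /dual_weight; congr (_%:E).
  rewrite -(powR_inv1 (ltW wx)) -powRrM -{2}(powRr1 (ltW wx)) -powRDp//.
  by congr (_ `^ _)%R; rewrite /p'; field; exact: lt0r_neq0.
apply: (le_trans st2); rewrite -/(c _ _) -/c2 lee_wpmul2l ?lee_fin ?(ltW c20)//.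
rewrite le_eqVlt; apply/orP; left; apply/eqP; apply: eq_integral => x _.
have sx := ws.2 x; have wx := ww.2 x.
rewrite /hh poweRM ?lee_fin ?invr_ge0 ?(ltW sx)//; last exact: pf.2.
rewrite -muleA; congr (_ * _); rewrite poweR_EFin -EFinM; congr (_%:E).
rewrite -(powR_inv1 (ltW sx)) -powRrM -{2}(powRr1 (ltW sx)) -powRDp//.
rewrite /s /dual_weight -powRrM -[RHS]powRr1 ?(ltW wx)//.
by congr (_ `^ _)%R; field; exact: lt0r_neq0.
Qed.

Definition A1_const (C : R) (u : T -> R) := forall i,
  {ae mu, forall x, Q i x -> wavg one (fun y => (u y)%:E) i <= (C * u x)%:E}.

Lemma le_wavg1_ae f g i : nnmeas f -> nnmeas g ->
  {ae mu, forall x, f x <= g x} -> wavg one f i <= wavg one g i.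
Proof.
move=> pf pg fg; apply: lee_wpmul2l.
  rewrite lee_fin invr_ge0 ltW//.
  exact: (fine_wmass_gt0 mQ Q_gt0 (@weight1 _ _ _) (locally_finite1 VF)).
apply: ae_ge0_le_integral => //.
- by move=> x _; rewrite mule1; exact: pf.2.
- by under eq_fun do rewrite mule1; exact: measurable_funTS pf.1.
- by move=> x _; rewrite mule1; exact: pg.2.
- by under eq_fun do rewrite mule1; exact: measurable_funTS pg.1.
- by apply: filterS fg => x fgx _; rewrite !mule1.
Qed.

(** If f is not almost everywhere zero, some set E k carries mass of f, and
every point belongs to all the later ones. *)
Lemma maxf_gt0 f x : nnmeas f -> 0 < \int[mu]_y f y -> 0 < maxf one f x.
Proof.
move=> pf f_gt0.
have [k0 fk0] : exists k, 0 < \int[mu]_(y in Q (E k)) f y.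
  apply: contrapT => /forallNP h.
  have h0 k : {ae mu, forall y, Q (E k) y -> f y = 0}.
    apply: nnmeas_integral_eq0 => //; apply/eqP; rewrite eq_le.
    by rewrite nnmeas_integral_ge0// andbT leNgt; apply/negP/h.
  have : {ae mu, forall y, f y = 0}.
    have := ae_foralln h0; apply: filterS => y hy.
    have : [set: T] y by [].
    by rewrite -(vf_cover VF) => -[k _]; exact: hy.
  move=> f0; suff : \int[mu]_y f y = 0 by move=> z; rewrite z ltxx in f_gt0.
  rewrite (@ae_eq_integral _ _ _ _ _ (cst 0))//; [exact: integral0|exact: pf.1|].
  by apply: filterS f0 => y fy _.
have [k1 _ k1x] : (\bigcup_k Q (E k)) x by rewrite (vf_cover VF).
pose k := maxn k0 k1.
have sub j : (j <= k)%N -> Q (E j) `<=` Q (E k).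
  by move=> jk; apply/subsetPset/(vf_nondecreasing VF).
have kx : Q (E k) x by apply: sub k1x; exact: leq_maxr.
apply: lt_le_trans (wavg_le_maxf mu one f kx).
rewrite /wavg; apply: mule_gt0.
  rewrite lte_fin invr_gt0.
  exact: (fine_wmass_gt0 mQ Q_gt0 (@weight1 _ _ _) (locally_finite1 VF)).
under eq_integral do rewrite mule1.
apply: (lt_le_trans fk0); apply: ge0_subset_integral => //.
- exact: measurable_funTS pf.1.
- by move=> y _; exact: pf.2.
- by apply: sub; exact: leq_maxl.
Qed.

(** The iteration of Rubio de Francia: the series of the iterates of the maximal
function, with geometric weights small enough for convergence in the weighted
space, dominates h and is multiplied by at most a constant by the maximal
function. *)
Lemma rubio_de_francia (r K : R) : (1 < r)%R -> (0 < K)%R ->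
  exists2 C : R, (0 < C)%R & forall om, Ap_weight r K om -> forall h, nnmeas h ->
  0 < \int[mu]_x (h x `^ r * (om x)%:E) ->
  \int[mu]_x (h x `^ r * (om x)%:E) < +oo ->
  exists u : T -> R, [/\ weight u, {ae mu, forall x, h x <= (u x)%:E},
    A1_const C u &
    \int[mu]_x ((u x)%:E `^ r * (om x)%:E) <=
    C%:E * \int[mu]_x (h x `^ r * (om x)%:E)].
Proof.
move=> r1 K1; have r0 : (0 < r)%R by apply: lt_trans r1.
have [B B0 MB] := maxf_Ap_bounded r1 K1.
have half01 : (0 < (2^-1 : R) < 1)%R by rewrite invr_gt0 ltr0n invf_lt1// ltr1n.
have [C0 C00 geo] := poweR_geometric_sum half01 r0.
(* The factor be compensates the norm of the maximal function on the weighted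
space; the additional factor 1/2 makes the series converge. *)
pose be := (B `^ (- r^-1))%R; have be0 : (0 < be)%R by exact: powR_gt0.
have beB : (be `^ r * B = 1)%R.
  rewrite /be -powRrM mulNr mulVf ?gt_eqF// powRN powRr1 ?(ltW B0)//.
  by rewrite mulVf// gt_eqF.
pose la := (2^-1 * be)%R; have la0 : (0 < la)%R by rewrite mulr_gt0.
pose th := (2^-1 `^ (r / 2) : R)%R.
have th01 : (0 <= th < 1)%R.
  rewrite powR_ge0/=; have := @gt0_ltr_powR R (r / 2)%R.
  rewrite divr_gt0// => /(_ isT 2^-1%R 1%R); rewrite !nnegrE powR1; apply => //.
  by case/andP: half01.
pose C2 := (C0 * (1 - th)^-1)%R.
have C20 : (0 < C2)%R by rewrite mulr_gt0// invr_gt0 subr_gt0; case/andP: th01.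
exists (la^-1 + C2)%R; first by rewrite addr_gt0// invr_gt0.
move=> om Aom h ph I0 Iy; have [wom _ _ _] := Aom.
set I := \int[mu]_x _ in I0 Iy *.
have pom := weight_nnmeas wom.
pose H k := iter k (maxf one) h.
have pH k : nnmeas (H k) by elim: k => //= k; exact: nnmeas_maxf1.
have pHr k : nnmeas (fun x => H k x `^ r * (om x)%:E).
  by apply: nnmeasM => //; exact: nnmeas_poweR.
have IH k : \int[mu]_x (H k x `^ r * (om x)%:E) <= (B ^+ k)%:E * I.
  elim: k => [|k IHk]; first by rewrite expr0 mul1e.
  apply: (le_trans (MB _ Aom _ (pH k))).
  by rewrite exprS EFinM -muleA lee_wpmul2l ?lee_fin ?(ltW B0).
pose X k x := (be ^+ k)%:E * H k x.
have lak k : (0 <= la ^+ k)%R by rewrite exprn_ge0// ltW.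
have bek k : (0 <= be ^+ k)%R by rewrite exprn_ge0// ltW.
have pX k : nnmeas (X k) by apply: nnmeasM => //; apply: nnmeas_cst; rewrite lee_fin.
pose U x := \sum_(k <oo) ((2^-1 ^+ k)%R%:E * X k x).
have UE x : U x = \sum_(k <oo) ((la ^+ k)%:E * H k x).
  by apply: eq_eseriesr => k _; rewrite /X muleA -EFinM -exprMn.
have pUk k : nnmeas (fun x => (la ^+ k)%:E * H k x).
  by apply: nnmeasM => //; apply: nnmeas_cst; rewrite lee_fin.
have pU : nnmeas U.
  by rewrite (_ : U = fun x => \sum_(k <oo) ((la ^+ k)%:E * H k x)); [exact: nnmeas_series|exact/funext].
have termU k x : (la ^+ k)%:E * H k x <= U x.
  rewrite UE (@nneseries_split _ _ 0 k.+1); last by move=> j _; exact: (pUk j).2.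
  rewrite add0n; apply: le_trans (leeDl _ _).
    by rewrite big_nat_recr//= leeDr// sume_ge0// => j _; exact: (pUk j).2.
  by apply: nneseries_ge0 => j _ _; exact: (pUk j).2.
have hU x : h x <= U x by have := termU 0%N x; rewrite expr0 mul1e.
have MU x : maxf one U x <= la^-1%:E * U x.
  rewrite (_ : U = fun x => \sum_(k <oo) ((la ^+ k)%:E * H k x)); last exact/funext.
  apply: (le_trans (maxf_series mQ Q_gt0 (@weight1 _ _ _) (locally_finite1 VF) _ _)) => //.
  rewrite -nneseriesZl; last by move=> k _; exact: (pUk k).2.
  rewrite [leRHS](@nneseries_split _ _ 0 1); last first.
    by move=> k _; rewrite mule_ge0 ?(pUk k).2// lee_fin invr_ge0 ltW.
  rewrite add0n; apply: le_trans (leeDr _ _); last first.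
    by apply: sume_ge0 => k _; rewrite mule_ge0 ?(pUk k).2// lee_fin invr_ge0 ltW.
  rewrite -nneseries_addn; last first.
    by move=> k; rewrite mule_ge0 ?(pUk _).2// lee_fin invr_ge0 ltW.
  apply: lee_nneseries => [k _ _|k _].
    exact: (nnmeas_maxf1 (pUk k)).2.
  rewrite (maxfZ mQ Q_gt0 (@weight1 _ _ _) (locally_finite1 VF)) ?exprn_gt0//.
  by rewrite addn1 muleA -EFinM exprS mulKf ?gt_eqF.
have Ur : \int[mu]_x (U x `^ r * (om x)%:E) <= C2%:E * I.
  have IE : I = (fine I)%:E by rewrite fineK// ge0_fin_numE// ltW.
  have thk k : (0 <= th ^+ k)%R by rewrite exprn_ge0// powR_ge0.
  have pXr k : nnmeas (fun x => X k x `^ r * (om x)%:E).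
    by apply: nnmeasM => //; exact: nnmeas_poweR.
  have pthXr k : nnmeas (fun x => (th ^+ k)%:E * (X k x `^ r * (om x)%:E)).
    by apply: nnmeasM => //; apply: nnmeas_cst; rewrite lee_fin.
  apply: (@le_trans _ _ (\int[mu]_x (C0%:E * \sum_(k <oo)
      ((th ^+ k)%:E * (X k x `^ r * (om x)%:E))))).
    apply: nnmeas_le_integral => //.
    - by apply: nnmeasM => //; exact: nnmeas_poweR.
    - apply: nnmeasM; first by apply: nnmeas_cst; rewrite lee_fin ltW.
      exact: nnmeas_series.
    move=> x _; have := geo (X ^~ x) (fun k => (pX k).2 x).
    move=> /(lee_wpmul2r (pom.2 x)) /le_trans; apply.
    rewrite -muleA lee_wpmul2l ?lee_fin ?(ltW C00)// muleC -nneseriesZl; last first.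
      by move=> k _; rewrite mule_ge0 ?poweR_ge0 ?lee_fin.
    apply: lee_nneseries => [k _ _|k _].
      by rewrite mule_ge0 ?(pom.2 x)// mule_ge0 ?poweR_ge0 ?lee_fin.
    by rewrite muleC muleA.
  rewrite nnmeas_integralZl ?lee_fin ?(ltW C00)//; last exact: nnmeas_series.
  rewrite integral_nneseries//; [|by move=> k; exact: (pthXr k).1|by move=> k x _; exact: (pthXr k).2].
  rewrite EFinM -muleA lee_wpmul2l ?lee_fin ?(ltW C00)//.
  rewrite -geometric_eseries// {1}IE muleC -nneseriesZl; last by move=> k _; rewrite lee_fin.
  apply: lee_nneseries => [k _ _|k _]; first exact: nnmeas_integral_ge0.
  rewrite nnmeas_integralZl ?lee_fin// muleC -IE; apply: lee_wpmul2r; first by rewrite lee_fin.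
  have -> : \int[mu]_x (X k x `^ r * (om x)%:E) =
      ((be ^+ k) `^ r)%:E * \int[mu]_x (H k x `^ r * (om x)%:E).
    rewrite -nnmeas_integralZl ?lee_fin ?powR_ge0//; apply: eq_integral => x _.
    by rewrite /X poweRM ?lee_fin//; [rewrite muleA poweR_EFin|exact: (pH k).2].
  apply: (@le_trans _ _ (((be ^+ k) `^ r)%:E * ((B ^+ k)%:E * I))).
    by rewrite lee_wpmul2l ?lee_fin ?powR_ge0.
  rewrite muleA -EFinM -powR_mulrn ?(ltW be0)// -powRrM mulrC.
  rewrite (mulrC k%:R) powRrM powR_mulrn ?powR_ge0// -exprMn mulrC beB expr1n.
  by rewrite mul1e.
(* U is positive because its term of index one already is. *)
have UM : forall x, 0 < U x.
  move=> x; apply: lt_le_trans (termU 1%N x).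
  rewrite expr1 mule_gt0//=; apply: maxf_gt0 => //.
  rewrite lt0e nnmeas_integral_ge0// andbT; apply/negP => /eqP h0.
  have := nnmeas_integral_eq0 measurableT ph h0 => ae0.
  move: I0; rewrite /I (@ae_eq_integral _ _ _ _ _ (cst 0))//; last 2 first.
  - exact: (pHr 0%N).1.
  - by apply: filterS ae0 => x' /= h0' _; rewrite h0'// poweR0r ?gt_eqF// mul0e.
  by rewrite integral0 ltxx.
have Ufin : {ae mu, forall x, U x < +oo}.
  have pUr : nnmeas (fun x => U x `^ r * (om x)%:E).
    by apply: nnmeasM => //; exact: nnmeas_poweR.
  have : mu.-integrable setT (fun x => U x `^ r * (om x)%:E).
    apply/integrableP; split; first exact: pUr.1.
    under eq_integral do rewrite gee0_abs ?pUr.2//.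
    by apply: (le_lt_trans Ur); rewrite lte_mul_pinfty ?lee_fin ?(ltW C20).
  move=> /(integrable_ae measurableT); apply: filterS => x /(_ Logic.I).
  case: (U x) (UM x) => [z _ _||//]; first by rewrite ltry.
  by move=> _; rewrite poweRyr ?gt_eqF// gt0_mulye// lte_fin wom.2.
(* U is finite almost everywhere; the value 1 on the exceptional set makes u a
finite positive function. *)
pose u x := if U x == +oo then 1%R else fine (U x).
have uU : {ae mu, forall x, (u x)%:E = U x}.
  apply: filterS Ufin => x Ux; rewrite /u lt_eqF// fineK// ge0_fin_numE//.
  exact: pU.2.
have wu : weight u.
  split => [|x].
    apply: measurable_fun_ifT => //.
    - exact: measurable_fun_eqe pU.1 _.
    - exact: measurableT_comp pU.1.
  rewrite /u; case: eqP => // /eqP Ux; rewrite fine_gt0// UM ltey//.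
exists u; split => //.
- by apply: filterS (uU) => x ->.
- move=> i; apply: filterS (uU) => x ux Qix.
  apply: (@le_trans _ _ (wavg one U i)).
    apply: le_wavg1_ae => //; first exact: weight_nnmeas.
    by apply: filterS (uU) => y ->.
  apply: (@le_trans _ _ (la^-1%:E * U x)).
    by apply: le_trans (MU x); exact: wavg_le_maxf.
  rewrite EFinM ux lee_wpmul2r ?pU.2// lee_fin lerDl ltW//.
- apply: (@le_trans _ _ (\int[mu]_x (U x `^ r * (om x)%:E))).
    rewrite le_eqVlt; apply/orP; left; apply/eqP; apply: ae_eq_integral => //.
    + by apply: (nnmeasM _ pom).1; apply: nnmeas_poweR; exact: weight_nnmeas.
    + by apply: (nnmeasM _ pom).1; exact: nnmeas_poweR.
    + by apply: filterS (uU) => x -> _.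
  apply: (le_trans Ur); rewrite lee_wpmul2r ?(ltW I0)// lee_fin lerDr.
  by rewrite invr_ge0 ltW.
Qed.

End muckenhoupt.

(** * Extrapolation and the vector-valued maximal inequality *)

Section extrapolation.
Context d (T : measurableType d) (R : realType)
  (mu : {sigma_finite_measure set T -> \bar R}).
Local Open Scope ereal_scope.
Variables (Q : nat -> set T) (D E : nat -> nat) (K0 : R).
Hypothesis VF : vitali_family mu Q D E K0.

Let mQ := vf_measurable VF.
Let Q_gt0 := vf_gt0 VF.
Let Q_fin := vf_fin VF.
Local Notation wmass := (wmass mu Q).
Local Notation wavg := (wavg mu Q).
Local Notation maxf := (maxf mu Q).
Local Notation Ap_weight := (Ap_weight mu Q).
Local Notation A1_const := (A1_const mu Q).
Local Notation one := ((fun=> 1%R) : T -> R).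

(** Q i has positive measure, hence contains a point where the A_1 bound holds;
its right-hand side is finite. *)
Lemma A1_locally_finite C u : weight u -> A1_const C u -> locally_finite mu Q u.
Proof.
move=> wu A1 i.
have [x Qx ux] : exists2 x, Q i x & wavg one (fun y => (u y)%:E) i <= (C * u x)%:E.
  apply: contrapT => h.
  have : mu.-negligible (Q i).
    apply: negligibleS (A1 i) => x Qx /= h'; apply: h; exists x => //.
    exact: h'.
  by move/measure_negligible => /(_ (mQ i)) Q0; have := Q_gt0 i; rewrite Q0 ltxx.
rewrite ltey; apply/negP => /eqP Wy.
move: ux; rewrite /wavg; under eq_integral do rewrite mule1.
rewrite -/(wmass u i) Wy gt0_muley ?leye_eq// lte_fin invr_gt0.
exact: (fine_wmass_gt0 mQ Q_gt0 (@weight1 _ _ _) (locally_finite1 VF)).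
Qed.

(** On Q i an A_1 weight is bounded below by its average divided by C; its
negative powers are bounded above accordingly. *)
Lemma A1_integral_le C u w e i : (0 < e)%R -> (0 < C)%R -> weight u -> A1_const C u ->
  weight w -> \int[mu]_(x in Q i) (w x * u x `^ (- e))%:E <=
  (C `^ e * (fine (wmass u i) / fine (mu (Q i))) `^ (- e))%:E * wmass w i.
Proof.
move=> e0 C0 wu A1 ww; have lu := A1_locally_finite wu A1.
set U := fine (wmass u i); set m := fine (mu (Q i)).
have U0 : (0 < U)%R by have := fine_wmass_gt0 mQ Q_gt0 wu lu i.
have m0 : (0 < m)%R.
  by have := fine_wmass_gt0 mQ Q_gt0 (@weight1 _ _ _) (locally_finite1 VF) i; rewrite (wmass1 VF).
have pw := weight_nnmeas ww.
have pv : nnmeas (fun x => (w x * u x `^ (- e))%:E).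
  apply: nnmeas_EFin => [|x]; last by rewrite mulr_ge0 ?powR_ge0// ltW// ww.2.
  apply: measurable_funM; first exact: ww.1.
  exact: measurableT_comp (measurable_powR _) wu.1.
rewrite -nnmeas_integralZl ?lee_fin ?mulr_ge0 ?powR_ge0//.
apply: ae_ge0_le_integral => //.
- by move=> x _; exact: pv.2.
- exact: measurable_funTS pv.1.
- by move=> x _; rewrite mule_ge0 ?pw.2// lee_fin mulr_ge0 ?powR_ge0.
- by apply: measurable_funTS; apply: emeasurable_funM => //; exact: pw.1.
have := A1 i; apply: filterS => x /= h Qx; have {h} := h Qx.
rewrite /wavg; under eq_integral do rewrite mule1.
rewrite -/(wmass u i) (wmass1 VF) -/m (wmassE mQ Q_gt0 wu lu) -/U -EFinM lee_fin mulrC => h.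
rewrite -EFinM lee_fin mulrC ler_wpM2r//; first exact/ltW/ww.2.
have ux := wu.2 x; have Um0 : (0 < U / m)%R by rewrite divr_gt0.
rewrite -[leLHS]mul1r.
have -> : (1 = C `^ e * C `^ (- e))%R by rewrite -powRDp// subrr powRr0.
rewrite -mulrA ler_wpM2l ?powR_ge0// -powRM ?(ltW C0) ?(ltW ux)//.
have Cu0 : (0 < C * u x)%R by rewrite mulr_gt0.
have le_e : ((U / m) `^ e <= (C * u x) `^ e)%R.
  by apply: (ge0_ler_powR (ltW e0)); rewrite ?nnegrE ?(ltW Um0) ?(ltW Cu0).
by rewrite !powRN lef_pV2 ?posrE ?powR_gt0.
Qed.

Lemma Ap_weight_intro s K v : weight v -> (1 < s)%R ->
  (forall i, exists X Y : R, [/\ wmass v i <= X%:E, wmass (dual_weight s v) i <= Y%:E,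
     (0 <= X)%R, (0 <= Y)%R & (X * Y `^ (s - 1) <= K * fine (mu (Q i)) `^ s)%R]) ->
  Ap_weight s K v.
Proof.
move=> wv s1 h; split => //.
- by move=> i; have [X [Y [vX _ _ _ _]]] := h i; rewrite (le_lt_trans vX)// ltry.
- by move=> i; have [X [Y [_ vY _ _ _]]] := h i; rewrite (le_lt_trans vY)// ltry.
move=> i; have [X [Y [vX vY X0 Y0 XY]]] := h i.
have mE : mu (Q i) = (fine (mu (Q i)))%:E by rewrite fineK// ge0_fin_numE.
rewrite mE poweR_EFin -EFinM.
apply: (@le_trans _ _ (X%:E * Y%:E `^ (s - 1))); last by rewrite poweR_EFin -EFinM lee_fin.
apply: lee_pmul => //.
- exact/ltW/(wmass_gt0 mQ Q_gt0).
- exact: poweR_ge0.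
- apply: lee_poweR => //; first by rewrite subr_ge0 ltW.
  exact/ltW/(wmass_gt0 mQ Q_gt0)/weight_dual.
Qed.

Lemma fine_Ap_weight p K w i : Ap_weight p K w ->
  (fine (wmass w i) * fine (wmass (dual_weight p w) i) `^ (p - 1) <=
   K * fine (mu (Q i)) `^ p)%R.
Proof.
move=> [ww lw ls h]; have := h i; have ws := weight_dual p ww.
rewrite (wmassE mQ Q_gt0 ww lw) (wmassE mQ Q_gt0 ws ls).
have -> : mu (Q i) = (fine (mu (Q i)))%:E by rewrite fineK// ge0_fin_numE.
by rewrite !poweR_EFin -!EFinM lee_fin.
Qed.

Lemma fine_mu_gt0 i : (0 < fine (mu (Q i)))%R.
Proof.
by have := fine_wmass_gt0 mQ Q_gt0 (@weight1 _ _ _) (locally_finite1 VF) i; rewrite (wmass1 VF).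
Qed.

Lemma weight_powM a b (w u : T -> R) : weight w -> weight u ->
  weight (fun x => w x `^ a * u x `^ b)%R.
Proof.
move=> [mw w0] [my u0]; split => [|x]; last by rewrite mulr_gt0// powR_gt0.
by apply: measurable_funM; exact: measurableT_comp (measurable_powR _) _.
Qed.

Lemma wmass_powM a w u i : (0 < a < 1)%R -> weight w -> weight u ->
  locally_finite mu Q w -> locally_finite mu Q u ->
  wmass (fun x => w x `^ a * u x `^ (1 - a))%R i <=
  (fine (wmass w i) `^ a * fine (wmass u i) `^ (1 - a))%:E.
Proof.
move=> a01 ww wu lw lu.
rewrite EFinM -!poweR_EFin -(wmassE mQ Q_gt0 ww lw) -(wmassE mQ Q_gt0 wu lu).
exact: (hoelder_poweR mu (mQ i) (weight_nnmeas ww) (weight_nnmeas wu) a01).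
Qed.

(** The negative power of u is bounded on Q i by A1_integral_le. The dual of the
new weight for the exponent s is a geometric mean of u and of the dual of w for
the exponent p, which Hoelder's inequality handles. The powers of the average of
u cancel in the product. *)
Lemma Ap_A1_lower p s K C w u : (1 < p)%R -> (p < s)%R -> (0 < C)%R ->
  Ap_weight p K w -> weight u -> A1_const C u ->
  Ap_weight s (K * C `^ (s - p)) (fun x => w x * u x `^ (p - s))%R.
Proof.
move=> p1 ps C0 Aw wu A1; have [ww lw ls _] := Aw.
have lu := A1_locally_finite wu A1.
have s1 : (1 < s)%R by apply: lt_trans ps.
have s10 : (0 < s - 1)%R by rewrite subr_gt0.
have p10 : (0 < p - 1)%R by rewrite subr_gt0.
have sp0 : (0 < s - p)%R by rewrite subr_gt0.
have ws := weight_dual p ww.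
pose a := ((p - 1) / (s - 1))%R.
have a01 : (0 < a < 1)%R by rewrite divr_gt0// ltr_pdivrMr// mul1r ltrD2r.
have wv : weight (fun x => w x * u x `^ (p - s))%R.
  split => [|x]; last by rewrite mulr_gt0 ?powR_gt0 ?ww.2 ?wu.2.
  apply: measurable_funM; first exact: ww.1.
  exact: measurableT_comp (measurable_powR _) wu.1.
apply: Ap_weight_intro => // i.
set A := fine (wmass w i); set S := fine (wmass (dual_weight p w) i).
set U := fine (wmass u i); set m := fine (mu (Q i)).
have A0 : (0 < A)%R by have := fine_wmass_gt0 mQ Q_gt0 ww lw i.
have S0 : (0 < S)%R by have := fine_wmass_gt0 mQ Q_gt0 ws ls i.
have U0 : (0 < U)%R by have := fine_wmass_gt0 mQ Q_gt0 wu lu i.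
have m0 : (0 < m)%R by have := fine_mu_gt0 i.
have Um0 : (0 < U / m)%R by rewrite divr_gt0.
exists (C `^ (s - p) * (U / m) `^ (- (s - p)) * A)%R, (S `^ a * U `^ (1 - a))%R.
split; rewrite ?mulr_ge0 ?powR_ge0 ?(ltW A0)//.
- have := A1_integral_le i sp0 C0 wu A1 ww.
  by rewrite opprB (wmassE mQ Q_gt0 ww lw) -EFinM.
- apply: le_trans (wmass_powM i a01 ws wu ls lu).
  rewrite le_eqVlt; apply/orP; left; apply/eqP; apply: eq_integral => x _.
  rewrite /dual_weight; congr (_%:E); have wx := ww.2 x; have ux := wu.2 x.
  rewrite powRM ?powR_ge0 ?(ltW wx)// -!powRrM; congr (_ `^ _ * _ `^ _)%R.
    by rewrite /a; field; rewrite !lt0r_neq0.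
  by rewrite /a; field; rewrite lt0r_neq0.
rewrite powRM ?powR_ge0// -!powRrM.
rewrite (_ : a * (s - 1) = p - 1)%R; last by rewrite /a; field; exact: lt0r_neq0.
rewrite (_ : (1 - a) * (s - 1) = s - p)%R; last by rewrite /a; field; exact: lt0r_neq0.
have -> : ((U / m) `^ (- (s - p)) = U `^ (- (s - p)) * m `^ (s - p))%R.
  rewrite powRM ?invr_ge0 ?(ltW U0) ?(ltW m0)//; congr (_ * _)%R.
  by rewrite -(powR_inv1 (ltW m0)) -powRrM mulN1r opprK.
have UU : (U `^ (- (s - p)) * U `^ (s - p) = 1)%R by rewrite -powRDp// addNr powRr0.
have := fine_Ap_weight i Aw; rewrite -/A -/S -/m => h.
have ac (c v x y z t : R) : (c * (v * x) * y * (z * t) = (v * t) * (c * x) * (y * z))%R.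
  by ring.
have ac' (c x y z : R) : (c * x * (y * z) = (x * z) * (c * y))%R by ring.
rewrite ac.
rewrite UU mul1r.
have -> : (m `^ s = m `^ p * m `^ (s - p))%R by rewrite -powRDp//; congr (_ `^ _)%R; ring.
rewrite (ac' K).
by rewrite ler_wpM2l// mulr_ge0 ?powR_ge0.
Qed.

(** The argument of Ap_A1_lower with the roles of the weights and of their duals
exchanged: now the weight is a geometric mean of w and u, and its dual is the
dual of w times a negative power of u. *)
Lemma Ap_A1_upper p s K C w u : (1 < s)%R -> (s < p)%R -> (0 < C)%R -> (0 < K)%R ->
  Ap_weight p K w -> weight u -> A1_const C u ->
  Ap_weight s (K `^ ((s - 1) / (p - 1)) * C `^ (1 - (s - 1) / (p - 1)))
    (fun x => w x `^ ((s - 1) / (p - 1)) * u x `^ (1 - (s - 1) / (p - 1)))%R.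
Proof.
move=> s1 sp C0 K1 Aw wu A1; have [ww lw ls _] := Aw.
have lu := A1_locally_finite wu A1.
have p1 : (1 < p)%R by apply: lt_trans sp.
have s10 : (0 < s - 1)%R by rewrite subr_gt0.
have p10 : (0 < p - 1)%R by rewrite subr_gt0.
have ws := weight_dual p ww.
set a := ((s - 1) / (p - 1))%R.
have a01 : (0 < a < 1)%R by rewrite divr_gt0// ltr_pdivrMr// mul1r ltrD2r.
have a0 : (0 < a)%R by case/andP: a01.
have a10 : (0 < 1 - a)%R by rewrite subr_gt0; case/andP: a01.
have wv := weight_powM a (1 - a) ww wu.
apply: Ap_weight_intro => // i.
set A := fine (wmass w i); set S := fine (wmass (dual_weight p w) i).
set U := fine (wmass u i); set m := fine (mu (Q i)).
have A0 : (0 < A)%R by have := fine_wmass_gt0 mQ Q_gt0 ww lw i.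
have S0 : (0 < S)%R by have := fine_wmass_gt0 mQ Q_gt0 ws ls i.
have U0 : (0 < U)%R by have := fine_wmass_gt0 mQ Q_gt0 wu lu i.
have m0 : (0 < m)%R by have := fine_mu_gt0 i.
have Um0 : (0 < U / m)%R by rewrite divr_gt0.
pose e := ((1 - a) / (s - 1))%R; have e0 : (0 < e)%R by rewrite divr_gt0.
exists (A `^ a * U `^ (1 - a))%R, (C `^ e * (U / m) `^ (- e) * S)%R.
split; rewrite ?mulr_ge0 ?powR_ge0 ?(ltW S0)//.
- exact: wmass_powM.
- have := A1_integral_le i e0 C0 wu A1 ws.
  rewrite (wmassE mQ Q_gt0 ws ls) -EFinM; apply: le_trans.
  rewrite le_eqVlt; apply/orP; left; apply/eqP; apply: eq_integral => x _.
  rewrite /dual_weight; congr (_%:E); have wx := ww.2 x; have ux := wu.2 x.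
  rewrite powRM ?powR_ge0// -!powRrM; congr (_ `^ _ * _ `^ _)%R.
    by rewrite /a; field; rewrite !lt0r_neq0.
  by rewrite /e; ring.
rewrite (powRM _ _ (ltW S0)) ?mulr_ge0 ?powR_ge0//.
rewrite (@powRM _ (C `^ e)) ?powR_ge0// -!powRrM.
rewrite (_ : - e * (s - 1) = - (1 - a))%R; last by rewrite /e; field; exact: lt0r_neq0.
rewrite (_ : e * (s - 1) = 1 - a)%R; last by rewrite /e; field; exact: lt0r_neq0.
have -> : ((U / m) `^ (- (1 - a)) = U `^ (- (1 - a)) * m `^ (1 - a))%R.
  rewrite powRM ?invr_ge0 ?(ltW U0) ?(ltW m0)//; congr (_ * _)%R.
  by rewrite -(powR_inv1 (ltW m0)) -powRrM mulN1r opprK.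
have UU : (U `^ (- (1 - a)) * U `^ (1 - a) = 1)%R by rewrite -powRDp// addNr powRr0.
have := fine_Ap_weight i Aw; rewrite -/A -/S -/m => h.
have AS0 : (0 <= A * S `^ (p - 1))%R by rewrite mulr_ge0 ?powR_ge0 ?(ltW A0).
have h' : (A `^ a * S `^ (s - 1) <= K `^ a * m `^ (p * a))%R.
  have := ge0_ler_powR (ltW a0) AS0 (le_trans AS0 h) h.
  rewrite !powRM ?powR_ge0 ?(ltW A0) ?(ltW K1)// -!powRrM.
  by rewrite (_ : (p - 1) * a = s - 1)%R//; rewrite /a; field; exact: lt0r_neq0.
have ac (c v x y z t : R) : (y * t * (c * (v * x) * z) = (v * t) * (c * x) * (y * z))%R.
  by ring.
have ac' (c x y z : R) : (c * x * (y * z) = (x * z) * (c * y))%R by ring.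
rewrite ac.
rewrite UU mul1r.
have -> : (m `^ s = m `^ (p * a) * m `^ (1 - a))%R.
  rewrite -powRDp//; congr (_ `^ _)%R; rewrite /a; field; exact: lt0r_neq0.
rewrite (ac' (K `^ a)%R).
by rewrite ler_wpM2l// mulr_ge0 ?powR_ge0.
Qed.

(** Let u be the A_1 weight obtained by iterating the maximal function on
G^(1/s), and v = w u^(p - s), an A_s weight. As G^(1/s) <= u, the integral of G
v is at most that of G^(p/s) w; Hoelder's inequality passes from the integral of
F v to that of F^(p/s) w. *)
Lemma extrapolation_lower p s K : (1 < p)%R -> (p < s)%R -> (0 < K)%R ->
  exists2 K' : R, (0 < K')%R & forall B, (0 < B)%R -> exists2 C : R, (0 < C)%R &
  forall F G, nnmeas F -> nnmeas G ->
  (forall v, Ap_weight s K' v ->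
    \int[mu]_x (F x * (v x)%:E) <= B%:E * \int[mu]_x (G x * (v x)%:E)) ->
  forall w, Ap_weight p K w ->
  \int[mu]_x (F x `^ (p / s) * (w x)%:E) <=
  C%:E * \int[mu]_x (G x `^ (p / s) * (w x)%:E).
Proof.
move=> p1 ps K1; have p0 : (0 < p)%R by apply: lt_trans p1.
have s0 : (0 < s)%R by apply: lt_trans ps.
have [C1 C10 rdf] := rubio_de_francia VF p1 K1.
exists (K * C1 `^ (s - p))%R; first by rewrite mulr_gt0 ?powR_gt0.
move=> B B0; pose a := (p / s)%R.
have a01 : (0 < a < 1)%R by rewrite divr_gt0// ltr_pdivrMr// mul1r.
have a0 : (0 < a)%R by case/andP: a01.
have a10 : (0 < 1 - a)%R by rewrite subr_gt0; case/andP: a01.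
exists (B `^ a * C1 `^ (1 - a))%R; first by rewrite mulr_gt0 ?powR_gt0.
move=> F G pF pG FG w Aw; have [ww lw _ _] := Aw; have pw := weight_nnmeas ww.
rewrite -/a; set I := \int[mu]_x (G x `^ a * (w x)%:E).
have pGa : nnmeas (fun x => G x `^ a * (w x)%:E).
  by apply: nnmeasM => //; exact: nnmeas_poweR.
have pFa : nnmeas (fun x => F x `^ a * (w x)%:E).
  by apply: nnmeasM => //; exact: nnmeas_poweR.
have I_ge0 : 0 <= I by exact: nnmeas_integral_ge0.
have [->|Iy] := eqVneq I +oo.
  by rewrite gt0_muley ?leey// lte_fin mulr_gt0 ?powR_gt0.
have {}Iy : I < +oo by rewrite ltey.
(* If G vanishes almost everywhere, so does F; an A_1 weight that shows it is
obtained from the indicator function of a set of the family. *)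
have [I0|I0] := eqVneq I 0.
  have G0 : {ae mu, forall x, G x = 0}.
    have := nnmeas_integral_eq0 measurableT pGa I0; apply: filterS => x /(_ Logic.I).
    move=> /eqP; rewrite mule_eq0 eqe (gt_eqF (ww.2 x)) orbF => /eqP.
    by apply: poweR_eq0_eq0; exact: pG.2.
  pose h x := (\1_(Q (E 0%N)) x : R)%:E.
  have ph : nnmeas h by exact: nnmeas_indic.
  have hp : \int[mu]_x (h x `^ p * (w x)%:E) = wmass w (E 0%N).
    rewrite /wmass (nnmeas_integral_indic mu (mQ (E 0%N)) pw).
    apply: eq_integral => x _; congr (_ * _); rewrite /h poweR_EFin indicE.
    by case: (x \in _); rewrite ?powR1 ?powR0 ?gt_eqF.
  have [] := rdf _ Aw h ph; rewrite ?hp//; first exact: wmass_gt0.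
  move=> u [wu _ A1 _].
  have Av := Ap_A1_lower p1 ps C10 Aw wu A1.
  have [wv _ _ _] := Av; have pv := weight_nnmeas wv.
  have := FG _ Av; rewrite [X in _ * X](_ : _ = 0) ?mule0; last first.
    rewrite (@ae_eq_integral _ _ _ _ _ (cst 0))//; first exact: integral0.
    - exact: (nnmeasM pG pv).1.
    - by apply: filterS (G0) => x -> _; rewrite mul0e.
  move=> Fv0; rewrite (_ : \int[mu]_x _ = 0) ?mule_ge0 ?lee_fin ?mulr_ge0 ?powR_ge0//.
  rewrite (@ae_eq_integral _ _ _ _ _ (cst 0))//; first exact: integral0.
    exact: pFa.1.
  have Fv : \int[mu]_x (F x * (w x * u x `^ (p - s))%:E) = 0.
    apply/eqP; rewrite eq_le Fv0/=; exact: nnmeas_integral_ge0 (nnmeasM pF pv).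
  have := nnmeas_integral_eq0 measurableT (nnmeasM pF pv) Fv.
  apply: filterS => x /(_ Logic.I) /eqP.
  rewrite mule_eq0 eqe (gt_eqF (wv.2 x)) orbF => /eqP -> _.
  by rewrite poweR0r ?mul0e// gt_eqF.
have {}I0 : 0 < I by rewrite lt0e I0.
pose h x := G x `^ s^-1.
have ph : nnmeas h by exact: nnmeas_poweR.
have hp : \int[mu]_x (h x `^ p * (w x)%:E) = I.
  by apply: eq_integral => x _; rewrite /h -poweRrM mulrC.
have [] := rdf _ Aw h ph; rewrite ?hp//.
move=> u [wu hu A1 uI].
have Av := Ap_A1_lower p1 ps C10 Aw wu A1.
have [wv _ _ _] := Av; have pv := weight_nnmeas wv.
have pu := weight_nnmeas wu.
have GvI : \int[mu]_x (G x * (w x * u x `^ (p - s))%:E) <= I.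
  apply: ae_ge0_le_integral => //.
  - by move=> x _; exact: (nnmeasM pG pv).2.
  - exact: (nnmeasM pG pv).1.
  - by move=> x _; exact: pGa.2.
  - exact: pGa.1.
  apply: filterS (hu) => x; rewrite /h => hx _; have := pG.2 x.
  case: (G x) hx => [g|hx _|//]; last first.
    by move: hx; rewrite poweRyr ?leye_eq// gt_eqF// invr_gt0.
  rewrite !poweR_EFin -!EFinM !lee_fin => gu g0; have ux := wu.2 x.
  have [->|gn0] := eqVneq g 0%R; first by rewrite mul0r mulr_ge0 ?powR_ge0// ltW ?ww.2.
  have {}g0 : (0 < g)%R by rewrite lt0r gn0.
  rewrite mulrCA mulrC ler_wpM2r//; first exact/ltW/ww.2.
  have -> : (g `^ a = g * (g `^ s^-1) `^ (- (s - p)))%R.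
    rewrite -[X in (X * _)%R]powRr1 ?(ltW g0)// -powRrM -powRDp//; congr (_ `^ _)%R.
    by rewrite /a; field; exact: lt0r_neq0.
  rewrite ler_wpM2l ?(ltW g0)// -opprB !powRN lef_pV2 ?posrE ?powR_gt0//.
  by apply: ge0_ler_powR; rewrite ?nnegrE ?powR_ge0 ?(ltW ux)// subr_ge0 ltW.
have -> : \int[mu]_x (F x `^ a * (w x)%:E) = \int[mu]_x
    ((F x * (w x * u x `^ (p - s))%:E) `^ a * ((u x)%:E `^ p * (w x)%:E) `^ (1 - a)).
  apply: eq_integral => x _; have wx := ww.2 x; have ux := wu.2 x.
  rewrite poweRM ?pF.2 ?pv.2// -muleA; congr (_ * _).
  rewrite (poweR_EFin (u x)) -(EFinM (u x `^ p)) !poweR_EFin -EFinM; congr (_%:E).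
  rewrite !powRM ?powR_ge0 ?(ltW wx)// -!powRrM.
  have ac (x1 x2 x3 x4 : R) : (x1 * x2 * (x3 * x4) = x1 * x4 * (x2 * x3))%R by ring.
  rewrite ac -!powRDp// (addrC a) subrK powRr1 ?(ltW wx)//.
  rewrite (_ : (p - s) * a + p * (1 - a) = 0)%R ?powRr0 ?mulr1//.
  by rewrite /a; field; exact: lt0r_neq0.
have pup : nnmeas (fun x => (u x)%:E `^ p * (w x)%:E).
  by apply: nnmeasM => //; exact: nnmeas_poweR.
apply: (le_trans (hoelder_poweR mu measurableT (nnmeasM pF pv) pup a01)).
have -> : (B `^ a * C1 `^ (1 - a))%:E * I = (B%:E * I) `^ a * (C1%:E * I) `^ (1 - a).
  rewrite !poweRM ?lee_fin ?(ltW B0) ?(ltW C10)// muleACA -poweRDp//.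
  by rewrite (addrC a) subrK poweRe1// !poweR_EFin -EFinM.
apply: lee_pmul; rewrite ?poweR_ge0//; apply: lee_poweR; rewrite ?(ltW a0) ?(ltW a10)//.
- exact: nnmeas_integral_ge0 (nnmeasM pF pv).
- by apply: (le_trans (FG _ Av)); rewrite lee_wpmul2l ?lee_fin ?(ltW B0).
- exact: nnmeas_integral_ge0 pup.
Qed.

(** Monotone convergence for truncations in size and in space; for a locally
finite weight the truncated integrals are finite, so that one may divide by
them. *)
Lemma nnmeas_integral_lim_min (H : T -> \bar R) (p : R) (w : T -> R) (c : \bar R) :
  (0 < p)%R -> nnmeas H -> weight w ->
  (forall k : nat, \int[mu]_x ((Order.min (H x) k%:R%:E * (\1_(Q (E k)) x)%:E) `^ p * (w x)%:E) <= c) ->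
  \int[mu]_x (H x `^ p * (w x)%:E) <= c.
Proof.
move=> p0 pH ww hc; have pw := weight_nnmeas ww.
pose g k x := (Order.min (H x) k%:R%:E * (\1_(Q (E k)) x : R)%:E) `^ p * (w x)%:E.
have min0 k x : 0 <= Order.min (H x) (k%:R%:E : \bar R) by rewrite le_min pH.2 lee_fin/=.
have pg k : nnmeas (g k).
  apply: nnmeasM => //; apply: nnmeas_poweR; apply: nnmeasM; last exact: nnmeas_indic.
  by split => // ; apply: measurable_mine => //; exact: pH.1.
have ndg x : nondecreasing_seq (g ^~ x).
  move=> j k jk; apply: lee_wpmul2r; first exact: pw.2.
  apply: lee_poweR; [exact: ltW|by rewrite mule_ge0// lee_fin|].
  apply: lee_pmul => //; rewrite ?lee_fin//.
    by rewrite le_min ge_min lexx/= ge_min lee_fin ler_nat jk orbT.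
  rewrite !indicE ler_nat; case: (boolP (x \in Q (E j))) => // /set_mem Qjx.
  by rewrite mem_set//; have /subsetPset := vf_nondecreasing VF jk; exact.
have limg x : g ^~ x @ \oo --> H x `^ p * (w x)%:E.
  have [k0 _ Qk0] : (\bigcup_k Q (E k)) x by rewrite (vf_cover VF).
  have Qk k : (k0 <= k)%N -> (\1_(Q (E k)) x = 1 :> R)%R.
    by move=> kk; rewrite indicE mem_set//; have /subsetPset := vf_nondecreasing VF kk; exact.
  have gE k : (k0 <= k)%N -> g k x = Order.min (H x) k%:R%:E `^ p * (w x)%:E.
    by move=> /Qk Qkx; rewrite /g Qkx mule1.
  case HE : (H x) (pH.2 x) => [y||//] y0; rewrite HE in gE.
    apply: cvg_near_cst; exists (maxn k0 (Num.bound y)) => // k /=.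
    rewrite geq_max => /andP[kk0 ky]; rewrite gE// min_l// lee_fin.
    by rewrite (le_trans (ltW (archi_boundP _)))// ?ler_nat// -lee_fin.
  rewrite poweRyr ?gt_eqF// gt0_mulye ?lte_fin ?ww.2//.
  apply/cvgeyPge => A; pose b := ((`|A| / w x) `^ p^-1)%R.
  have b0 : (0 <= b)%R by exact: powR_ge0.
  exists (maxn k0 (Num.bound b)) => // k /=.
  rewrite geq_max => /andP[kk0 kb]; rewrite gE// min_r ?leey//.
  rewrite poweR_EFin -EFinM lee_fin (le_trans (ler_norm A))// -ler_pdivrMr ?ww.2//.
  have -> : (`|A| / w x = b `^ p)%R.
    by rewrite /b -powRrM mulVf ?gt_eqF// powRr1// divr_ge0// ltW// ww.2.
  apply: (ge0_ler_powR (ltW p0)); rewrite ?nnegrE//.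
  by rewrite (le_trans (ltW (archi_boundP b0)))// ler_nat.
rewrite (_ : \int[mu]_x _ = \int[mu]_x limn (g ^~ x)); last first.
  by apply: eq_integral => x _; apply/esym/cvg_lim.
have cv : (fun k => \int[mu]_x g k x) @ \oo --> \int[mu]_x limn (g ^~ x).
  apply: cvg_monotone_convergence => //.
  - by move=> k; exact: (pg k).1.
  - by move=> k x _; exact: (pg k).2.
by apply: (cvge_to_le cv); exact: nearW.
Qed.

(** Duality: the left-hand side, truncated so as to be finite, is the integral of
F against a multiple of the weight; the latter is enlarged to an A_s weight by
iterating the maximal function in the dual space. *)
Lemma extrapolation_upper p s K : (1 < s)%R -> (s < p)%R -> (0 < K)%R ->
  exists2 K' : R, (0 < K')%R & forall B, (0 < B)%R -> exists2 C : R, (0 < C)%R &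
  forall F G, nnmeas F -> nnmeas G ->
  (forall v, Ap_weight s K' v ->
    \int[mu]_x (F x * (v x)%:E) <= B%:E * \int[mu]_x (G x * (v x)%:E)) ->
  forall w, Ap_weight p K w ->
  \int[mu]_x (F x `^ (p / s) * (w x)%:E) <=
  C%:E * \int[mu]_x (G x `^ (p / s) * (w x)%:E).
Proof.
move=> s1 sp K1; have p1 : (1 < p)%R by apply: lt_trans sp.
have p0 : (0 < p)%R by apply: lt_trans p1.
have s0 : (0 < s)%R by apply: lt_trans s1.
have p10 : (0 < p - 1)%R by rewrite subr_gt0.
have s10 : (0 < s - 1)%R by rewrite subr_gt0.
pose p' := (p / (p - 1))%R.
have p'1 : (1 < p')%R by rewrite /p' ltr_pdivlMr// mul1r ltrBlDr ltrDl.
pose a := ((s - 1) / (p - 1))%R.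
have [C1 C10 rdf] := rubio_de_francia VF p'1 (powR_gt0 (p - 1)^-1 K1).
exists (K `^ a * C1 `^ (1 - a))%R; first by rewrite mulr_gt0 ?powR_gt0.
move=> B B0; pose th := (s / p)%R.
have th01 : (0 < th < 1)%R by rewrite divr_gt0// ltr_pdivrMr// mul1r.
have th0 : (0 < th)%R by case/andP: th01.
have th10 : (0 < 1 - th)%R by rewrite subr_gt0; case/andP: th01.
pose C := ((B * C1 `^ (1 - th)) `^ th^-1)%R.
exists C; first by rewrite powR_gt0// mulr_gt0 ?powR_gt0.
have C0 : (0 < C)%R by rewrite powR_gt0// mulr_gt0 ?powR_gt0.
move=> F G pF pG FG w Aw; have [ww lw ls _] := Aw; have pw := weight_nnmeas ww.
have thV : (p / s = th^-1)%R by rewrite /th invf_div.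
rewrite thV; set I := \int[mu]_x (G x `^ th^-1 * (w x)%:E).
have pGa : nnmeas (fun x => G x `^ th^-1 * (w x)%:E).
  by apply: nnmeasM => //; exact: nnmeas_poweR.
have I_ge0 : 0 <= I by exact: nnmeas_integral_ge0.
pose H x := F x `^ s^-1; have pH : nnmeas H by exact: nnmeas_poweR.
have -> : \int[mu]_x (F x `^ th^-1 * (w x)%:E) = \int[mu]_x (H x `^ p * (w x)%:E).
  apply: eq_integral => x _; rewrite /H -poweRrM; congr (_ `^ _ * _).
  by rewrite /th invf_div mulrC.
apply: nnmeas_integral_lim_min => // k.
set Phi := fun x => Order.min (H x) k%:R%:E * (\1_(Q (E k)) x : R)%:E.
have min0 x : 0 <= Order.min (H x) (k%:R%:E : \bar R) by rewrite le_min pH.2 lee_fin/=.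
have pPhi : nnmeas Phi.
  apply: nnmeasM; last exact: nnmeas_indic.
  by split => //; apply: measurable_mine => //; exact: pH.1.
have PhiH x : Phi x <= H x.
  rewrite /Phi indicE; case: (x \in _); last by rewrite mule0 pH.2.
  by rewrite mule1 ge_min lexx.
have Phifin x : Phi x = (fine (Phi x))%:E.
  rewrite fineK// ge0_fin_numE ?pPhi.2// /Phi.
  rewrite (@le_lt_trans _ _ k%:R%:E) ?ltry// indicE.
  by case: (x \in _); rewrite ?mule1 ?mule0 ?lee_fin// ge_min lexx orbT.
pose phi x := fine (Phi x).
have phi0 x : (0 <= phi x)%R by rewrite -lee_fin -Phifin; exact: pPhi.2.
set J := \int[mu]_x (Phi x `^ p * (w x)%:E).
have pJ : nnmeas (fun x => Phi x `^ p * (w x)%:E).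
  by apply: nnmeasM => //; exact: nnmeas_poweR.
have Jy : J < +oo.
  apply: (@le_lt_trans _ _ ((k%:R `^ p)%:E * wmass w (E k))); last first.
    by rewrite (wmassE mQ Q_gt0 ww lw) -EFinM ltry.
  rewrite /wmass (nnmeas_integral_indic mu (mQ (E k)) pw).
  rewrite -nnmeas_integralZl ?lee_fin ?powR_ge0//; last first.
    by apply: nnmeasM => //; exact: nnmeas_indic.
  apply: nnmeas_le_integral => //.
    apply: nnmeasM; first by apply: nnmeas_cst; rewrite lee_fin powR_ge0.
    by apply: nnmeasM => //; exact: nnmeas_indic.
  move=> x _; rewrite muleA; apply: lee_wpmul2r; first exact: pw.2.
  rewrite /Phi indicE; case: (x \in _); rewrite ?mule1 ?mule0 ?poweR0r ?gt_eqF//.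
  rewrite -poweR_EFin; apply: lee_poweR => //; first exact: ltW.
  by rewrite ge_min lexx orbT.
have [->|Jn0] := eqVneq J 0; first by rewrite mule_ge0// lee_fin ltW.
have J0 : 0 < J by rewrite lt0e Jn0 nnmeas_integral_ge0.
have [->|Iy] := eqVneq I +oo; first by rewrite gt0_muley ?leey.
have As := Ap_weight_dual VF p1 K1 Aw.
have ws := weight_dual p ww; have ps := weight_nnmeas ws.
pose h x := Phi x `^ (p - 1) * (w x)%:E.
have ph : nnmeas h by apply: nnmeasM => //; exact: nnmeas_poweR.
have hp : \int[mu]_x (h x `^ p' * (dual_weight p w x)%:E) = J.
  apply: eq_integral => x _; have wx := ww.2 x.
  rewrite /h poweRM ?poweR_ge0 ?lee_fin ?(ltW wx)// -poweRrM -muleA.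
  rewrite (_ : (p - 1) * p' = p)%R; last by rewrite /p'; field; exact: lt0r_neq0.
  congr (_ * _); rewrite poweR_EFin -EFinM /dual_weight -powRDp//; congr (_%:E).
  rewrite (_ : p' + _ = 1)%R ?powRr1 ?(ltW wx)// /p'; field; exact: lt0r_neq0.
have [] := rdf _ As h ph; rewrite ?hp//.
move=> u [wu hu A1 uJ].
have Av := Ap_A1_upper s1 sp C10 K1 Aw wu A1; rewrite -/a in Av.
have [wv _ _ _] := Av; have pv := weight_nnmeas wv; have pu := weight_nnmeas wu.
have JFv : J <= \int[mu]_x (F x * (w x `^ a * u x `^ (1 - a))%:E).
  apply: ae_ge0_le_integral => //.
  - by move=> x _; exact: pJ.2.
  - exact: pJ.1.
  - by move=> x _; exact: (nnmeasM pF pv).2.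
  - exact: (nnmeasM pF pv).1.
  apply: filterS (hu) => x + _; rewrite /h => hx.
  have wx := ww.2 x; have ux := wu.2 x.
  have FE : F x = H x `^ s by rewrite /H poweRVK ?gt_eqF//; exact: pF.2.
  apply: (@le_trans _ _ (Phi x `^ s * (w x `^ a * u x `^ (1 - a))%:E)); last first.
    by rewrite FE lee_wpmul2r ?pv.2// lee_poweR ?pPhi.2// ltW.
  have -> : Phi x `^ p = Phi x `^ s * Phi x `^ (p - s).
    rewrite -poweRDp ?subr_gt0//; last exact: pPhi.2.
    by congr (_ `^ _); ring.
  rewrite -muleA lee_wpmul2l ?poweR_ge0//.
  move: hx; rewrite (Phifin x) -/(phi x) !poweR_EFin -!EFinM !lee_fin => hx.
  have a10 : (0 < 1 - a)%R by rewrite subr_gt0 ltr_pdivrMr// mul1r ltrD2r.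
  have -> : (phi x `^ (p - s) * w x = w x `^ a * (phi x `^ (p - 1) * w x) `^ (1 - a))%R.
    rewrite powRM ?powR_ge0 ?(ltW wx)// -powRrM mulrCA -powRDp//.
    rewrite (addrC a) subrK powRr1 ?(ltW wx)//; congr (_ `^ _ * _)%R.
    by rewrite /a; field; exact: lt0r_neq0.
  rewrite ler_wpM2l ?powR_ge0//; apply: (ge0_ler_powR (ltW a10)) => //; rewrite nnegrE.
    by rewrite mulr_ge0 ?powR_ge0// ltW.
  exact: ltW.
have pus : nnmeas (fun x => (u x)%:E `^ p' * (dual_weight p w x)%:E).
  by apply: nnmeasM => //; exact: nnmeas_poweR.
have GvE : \int[mu]_x (G x * (w x `^ a * u x `^ (1 - a))%:E) = \int[mu]_x
    ((G x `^ th^-1 * (w x)%:E) `^ th * ((u x)%:E `^ p' * (dual_weight p w x)%:E) `^ (1 - th)).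
  apply: eq_integral => x _; have wx := ww.2 x; have ux := wu.2 x.
  rewrite poweRM ?poweR_ge0 ?pw.2// poweRVK ?gt_eqF ?pG.2// -muleA; congr (_ * _).
  rewrite (poweR_EFin (u x)) -(EFinM (u x `^ p')) !poweR_EFin -EFinM; congr (_%:E).
  rewrite powRM ?powR_ge0// /dual_weight -!powRrM mulrCA mulrC -powRDp//.
  congr (_ `^ _ * _ `^ _)%R; rewrite /a /th /p'; field; rewrite !lt0r_neq0//.
(* J is bounded by a power of itself with an exponent less than one; being
positive and finite, it can be divided out. *)
have key : J <= (B%:E * (C1%:E * J) `^ (1 - th)) * I `^ th.
  apply: (le_trans JFv); apply: (le_trans (FG _ Av)).
  rewrite -muleA lee_wpmul2l ?lee_fin ?(ltW B0)// GvE muleC.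
  apply: le_trans (hoelder_poweR mu measurableT pGa pus th01) _.
  rewrite lee_wpmul2l ?poweR_ge0//; apply: lee_poweR => //; first exact: ltW.
  exact: nnmeas_integral_ge0.
have JE : J = (fine J)%:E by rewrite fineK// ge0_fin_numE// ltW.
have IE : I = (fine I)%:E by rewrite fineK// ge0_fin_numE// ltey.
have j0 : (0 < fine J)%R by rewrite -lte_fin -JE.
have i0 : (0 <= fine I)%R by rewrite -lee_fin -IE.
have {}key : (fine J)%:E <= (B%:E * (C1%:E * (fine J)%:E) `^ (1 - th)) * (fine I)%:E `^ th.
  by rewrite -JE -IE.
rewrite JE IE -(EFinM C) lee_fin.
move: key j0 i0; move: (fine J) (fine I) => j i key j0 i0.
have {}key : (j <= B * (C1 * j) `^ (1 - th) * i `^ th)%R.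
  by move: key; rewrite -(EFinM C1 j) !poweR_EFin -!EFinM lee_fin.
rewrite powRM ?(ltW C10) ?(ltW j0)// in key.
have jth : (j `^ th <= (B * C1 `^ (1 - th)) * i `^ th)%R.
  rewrite -(@ler_pM2r _ (j `^ (1 - th))) ?powR_gt0// -powRDp//.
  rewrite (addrC th) subrK powRr1 ?(ltW j0)//; apply: le_trans key _.
  by rewrite le_eqVlt; apply/orP; left; apply/eqP; ring.
have thV0 : (0 <= th^-1)%R by rewrite invr_ge0 ltW.
have rhs0 : (0 <= B * C1 `^ (1 - th) * i `^ th)%R.
  by rewrite !mulr_ge0 ?powR_ge0// ltW.
have := ge0_ler_powR thV0 _ _ jth; rewrite !nnegrE powR_ge0 => /(_ isT rhs0).
rewrite -powRrM divff ?gt_eqF// powRr1 ?(ltW j0)// => /le_trans; apply.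
rewrite powRM ?powR_ge0//; last by rewrite mulr_ge0 ?powR_ge0// ltW.
by rewrite -powRrM divff ?gt_eqF// powRr1.
Qed.

Lemma extrapolation p s K : (1 < p)%R -> (1 < s)%R -> (0 < K)%R ->
  exists2 K' : R, (0 < K')%R & forall B, (0 < B)%R -> exists2 C : R, (0 < C)%R &
  forall F G, nnmeas F -> nnmeas G ->
  (forall v, Ap_weight s K' v ->
    \int[mu]_x (F x * (v x)%:E) <= B%:E * \int[mu]_x (G x * (v x)%:E)) ->
  forall w, Ap_weight p K w ->
  \int[mu]_x (F x `^ (p / s) * (w x)%:E) <=
  C%:E * \int[mu]_x (G x `^ (p / s) * (w x)%:E).
Proof.
move=> p1 s1 K1; case: (ltgtP p s) => [ps|sp|ps].
- exact: extrapolation_lower.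
- exact: extrapolation_upper.
exists K => // B B0; exists B => // F G pF pG FG w; rewrite ps => Aw.
rewrite divff ?gt_eqF ?(lt_trans _ s1)//.
under eq_integral do rewrite poweRe1 ?pF.2//.
under [in leRHS]eq_integral do rewrite poweRe1 ?pG.2//.
exact: FG.
Qed.

Section vector_valued.
Context d' (S : measurableType d') (tau : {sigma_finite_measure set S -> \bar R}).

(** The maximal function in the first variable is a supremum of countably many
averages, each of which is measurable in the second variable by Tonelli's
theorem. *)
Lemma nnmeas_maxf_pair (g : T * S -> \bar R) : nnmeas g ->
  nnmeas (fun z => maxf one (fun y => g (y, z.2)) z.1).
Proof.
move=> pg; apply: (@nnmeas_sup _ _ _ (fun i z => (\1_(Q i) z.1 : R)%:E *
  wavg one (fun y => g (y, z.2)) i)) => i.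
have p1 : nnmeas (fun y : T => (\1_(Q i) y : R)%:E) by exact: nnmeas_indic.
apply: nnmeasM; first by apply: nnmeas_comp p1 _; exact: measurable_fst.
apply: nnmeasM.
  apply: nnmeas_cst; rewrite lee_fin invr_ge0 ltW//.
  exact: (fine_wmass_gt0 mQ Q_gt0 (@weight1 _ _ _) (locally_finite1 VF)).
have ph : nnmeas (fun z : T * S => (\1_(Q i) z.1 : R)%:E * g z).
  by apply: nnmeasM => //; apply: nnmeas_comp p1 _; exact: measurable_fst.
suff : nnmeas (fun t : S => \int[mu]_(x in Q i) (g (x, t) * 1)).
  by move=> h; apply: nnmeas_comp h _; exact: measurable_snd.
split => [|t]; last by apply: integral_ge0 => x _; rewrite mule1 pg.2.
have := @measurable_fun_fubini_tonelli_G _ _ _ _ _ mu _ ph.1 ph.2.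
apply: eq_measurable_fun => t _; rewrite /fubini_G.
under [RHS]eq_integral do rewrite mule1.
rewrite (nnmeas_integral_indic mu (mQ i))//.
by apply: nnmeas_comp pg _; exact: pair2_measurable.
Qed.

(** The weighted vector-valued maximal inequality.  When the inner and the outer
exponents agree it is Muckenhoupt's theorem integrated over S; extrapolation
gives the other exponents. *)
Theorem vector_valued_maximal (p s K : R) : (1 < p)%R -> (1 < s)%R -> (0 < K)%R ->
  exists2 C : R, (0 < C)%R & forall (g : T * S -> \bar R) (k : S -> \bar R),
  nnmeas g -> nnmeas k -> forall w, Ap_weight p K w ->
  \int[mu]_x ((\int[tau]_t (maxf one (fun y => g (y, t)) x `^ s * k t)) `^ (p / s) * (w x)%:E)
  <= C%:E * \int[mu]_x ((\int[tau]_t (g (x, t) `^ s * k t)) `^ (p / s) * (w x)%:E).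
Proof.
move=> p1 s1 K1; have [K' K'0 ext] := extrapolation p1 s1 K1.
have [B B0 mB] := maxf_Ap_bounded VF s1 K'0.
have [C C0 extC] := ext B B0; exists C => // g k pg pk.
have pM := nnmeas_maxf_pair pg.
have slice (h : T * S -> \bar R) t : nnmeas h -> nnmeas (fun x => h (x, t)).
  by move=> ph; apply: nnmeas_comp ph _; exact: pair2_measurable.
have slice2 (h : T * S -> \bar R) x : nnmeas h -> nnmeas (fun t => h (x, t)).
  by move=> ph; apply: nnmeas_comp ph _; exact: pair1_measurable.
have pk2 : nnmeas (fun z : T * S => k z.2) by apply: nnmeas_comp pk _; exact: measurable_snd.
have pH (h : T * S -> \bar R) : nnmeas h -> nnmeas (fun z => h z `^ s * k z.2).
  by move=> ph; apply: nnmeasM => //; exact: nnmeas_poweR.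
have pF (h : T * S -> \bar R) : nnmeas h ->
    nnmeas (fun x => \int[tau]_t (h (x, t) `^ s * k t)).
  move=> ph; split => [|x].
    exact: (@measurable_fun_fubini_tonelli_F _ _ _ _ _ tau _ (pH _ ph).1 (pH _ ph).2).
  exact: nnmeas_integral_ge0 (slice2 _ x (pH _ ph)).
apply: (extC _ _ (pF _ pM) (pF _ pg)) => v Av.
have [wv _ _ _] := Av; have pv := weight_nnmeas wv.
have pv1 : nnmeas (fun z : T * S => (v z.1)%:E) by apply: nnmeas_comp pv _; exact: measurable_fst.
have swap (h : T * S -> \bar R) : nnmeas h ->
    \int[mu]_x (\int[tau]_t (h (x, t) `^ s * k t) * (v x)%:E) =
    \int[tau]_t (\int[mu]_x (h (x, t) `^ s * (v x)%:E) * k t).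
  move=> ph.
  have pp : nnmeas (fun z => h z `^ s * k z.2 * (v z.1)%:E).
    by apply: nnmeasM => //; exact: pH.
  have := @fubini_tonelli _ _ _ _ _ mu tau _ pp.1 pp.2 => FT.
  transitivity (\int[mu]_x \int[tau]_t (h (x, t) `^ s * k t * (v x)%:E)).
    apply: eq_integral => x _; rewrite muleC -nnmeas_integralZl//.
    - by apply: eq_integral => t _; rewrite muleC.
    - exact: slice2 _ x (pH _ ph).
    - exact: pv.2.
  rewrite FT; apply: eq_integral => t _.
  rewrite [RHS]muleC -nnmeas_integralZl//.
  - by apply: eq_integral => x _; rewrite muleCA muleA.
  - by apply: nnmeasM => //; apply: nnmeas_poweR; exact: slice.
  - exact: pk.2.
rewrite (swap _ pM) (swap _ pg).
have pI (h : T * S -> \bar R) : nnmeas h ->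
    nnmeas (fun t => \int[mu]_x (h (x, t) `^ s * (v x)%:E) * k t).
  move=> ph; apply: nnmeasM => //.
  have pp : nnmeas (fun z => h z `^ s * (v z.1)%:E).
    by apply: nnmeasM => //; exact: nnmeas_poweR.
  split => [|t]; last exact: nnmeas_integral_ge0 (slice _ t pp).
  exact: (@measurable_fun_fubini_tonelli_G _ _ _ _ _ mu _ pp.1 pp.2).
rewrite -nnmeas_integralZl ?lee_fin ?(ltW B0)//; last exact: pI.
apply: nnmeas_le_integral => //; first exact: (pI _ pM).
  by apply: nnmeasM; [apply: nnmeas_cst; rewrite lee_fin ltW|exact: (pI _ pg)].
move=> t _; rewrite muleA; apply: lee_wpmul2r; first exact: pk.2.
exact: (mB _ Av _ (slice _ t pg)).
Qed.

End vector_valued.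

End extrapolation.

(** * Lebesgue measure on row vectors and rational cubes *)

Section lebesgue_rV_basics.
Context {R : realType}.
Local Open Scope ereal_scope.
Local Notation leb1 := (@lebesgue_measure R).

Lemma measurable_box n (A : 'I_n -> set R) : (forall i, measurable (A i)) ->
  measurable [set x : 'rV[R]_n | forall i, A i (x ord0 i)].
Proof.
move=> mA; rewrite (_ : [set _ | _] =
    \big[setI/setT]_(i < n) (fun x : 'rV[R]_n => x ord0 i) @^-1` A i).
  apply: bigsetI_measurable => i _.
  by rewrite -[X in measurable X]setTI; exact: measurable_coord.
rewrite -bigcap_seq; apply/seteqP; split => x /= h i; first by move=> _; exact: h.
exact/h/mem_index_enum.
Qed.

(** The measure lebesgue_rV under a name that carries the structure of a
sigma-finite measure. *)
Definition leb n : set 'rV[R]_n -> \bar R := lebesgue_rV n.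
Arguments leb : clear implicits.

HB.instance Definition _ n := Measure.copy (leb n) (lebesgue_rV n).

Lemma leb_sigma_finite n : sigma_finite setT (leb n).
Proof.
pose F (k : nat) := [set x : 'rV[R]_n | forall i, `](- k%:R)%R, k%:R[%classic (x ord0 i)].
exists F.
  apply/seteqP; split => // x _.
  have := @archi_boundP R (\sum_(i < n) `|x ord0 i|)%R (sumr_ge0 _ (fun i _ => normr_ge0 _)).
  move=> h; exists (Num.bound (\sum_(i < n) `|x ord0 i|)%R) => // i /=.
  rewrite in_itv/= -ltr_norml; apply: le_lt_trans h.
  by rewrite (bigD1 i)//= lerDl sumr_ge0.
move=> k; split; first exact: (@measurable_box n (fun=> `](- k%:R)%R, k%:R[%classic) (fun=> measurable_itv _)).
rewrite /leb /= (@lebesgue_rV_box R n (fun=> `](- k%:R)%R, k%:R[%classic)); last first.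
  by move=> i; exact: measurable_itv.
suff : (\prod_(i < n) leb1 `](- k%:R)%R, k%:R[%classic)%E \is a fin_num.
  by rewrite fin_numElt => /andP[].
apply: (big_ind (fun x => x \is a fin_num)) => // [x y|i _]; first exact: fin_numM.
by rewrite lebesgue_measure_itv/=; case: ifP.
Qed.

HB.instance Definition _ n := Measure_isSigmaFinite.Build _ _ _ (leb n) (leb_sigma_finite n).

Lemma integral_cons n (f : 'rV[R]_n.+1 -> \bar R) : nnmeas f ->
  \int[leb n.+1]_x f x = \int[leb n]_x \int[leb1]_t f (rV_cons (x, t)).
Proof.
move=> pf.
have pfc : nnmeas (fun z => f (@rV_cons R n z)).
  by apply: nnmeas_comp pf _; exact: measurable_rV_cons.
have := @ge0_integral_pushforward _ _ _ _ R (@rV_cons R n) (@measurable_rV_cons R n)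
  (leb n \x leb1) setT f measurableT pf.1 (fun x _ => pf.2 x).
rewrite preimage_setT => h.
rewrite -(@fubini_tonelli1 _ _ _ _ _ (leb n) leb1 _ pfc.1 pfc.2).
exact: h.
Qed.

Lemma measurable_affine1 (c a : R) :
  measurable_fun [set: measurableTypeR R] (fun t => c * t + a : measurableTypeR R)%R.
Proof. by apply: measurable_funD => //; exact: measurable_funM. Qed.

(** The left-hand side is a measure in A, and it agrees with Lebesgue measure on
half-open intervals. *)
Lemma lebesgue_measure_affine (c a : R) (A : set (measurableTypeR R)) :
  (c != 0)%R -> measurable A ->
  `|c|%:E * leb1 ((fun t => c * t + a)%R @^-1` A) = leb1 A.
Proof.
move=> c0 mA; pose r : {nonneg R} := NngNum (normr_ge0 c).
pose m := mscale r (measure_function_pushforward__canonical__measure_function_Measure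
   leb1 (measurable_affine1 c a)).
apply/esym/(@lebesgue_measure_unique R m) => // _ [[u v]] _ <-.
change (leb1 `]u, v]%classic = `|c|%:E * leb1 ((fun t : R => c * t + a)%R @^-1` `]u, v]%classic)).
have [c_gt0|] := ltP 0%R c.
  have -> : (fun t : R => c * t + a)%R @^-1` `]u, v] = `]((u - a) / c)%R, ((v - a) / c)%R]%classic.
    apply/seteqP; split => t /=; rewrite !in_itv/= ltr_pdivrMr// ler_pdivlMr// (mulrC t);
    by rewrite ltrBlDr lerBrDr.
  rewrite !lebesgue_measure_itv/= !lte_fin ltr_pM2r ?invr_gt0// ltrD2r.
  case: ifP => _; last by rewrite mule0.
  rewrite -!EFinB -EFinM gtr0_norm//; congr (_%:E); field; exact: lt0r_neq0.
rewrite le_eqVlt (negPf c0)/= => c_lt0.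
have -> : (fun t : R => c * t + a)%R @^-1` `]u, v] = `[((v - a) / c)%R, ((u - a) / c)%R[%classic.
  apply/seteqP; split => t /=; rewrite !in_itv/= ltr_ndivlMr// ler_ndivrMr// (mulrC t);
  by rewrite ltrBlDr lerBrDr andbC.
rewrite !lebesgue_measure_itv/= !lte_fin ltr_nM2r ?invr_lt0// ltrD2r.
case: ifP => _; last by rewrite mule0.
rewrite -!EFinB -EFinM ltr0_norm//; congr (_%:E); field; exact: ltr0_neq0.
Qed.

Lemma integral_affine1 (c a : R) (g : R -> \bar R) : (c != 0)%R ->
  nnmeas (g : measurableTypeR R -> \bar R) ->
  \int[leb1]_t g (c * t + a)%R = `|c|^-1%:E * \int[leb1]_t g t.
Proof.
move=> c0 pg; pose r : {nonneg R} := NngNum (normr_ge0 c).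
pose ph := measure_function_pushforward__canonical__measure_function_Measure
   leb1 (measurable_affine1 c a).
have -> : \int[leb1]_t g t = \int[mscale r ph]_t g t.
  apply: eq_measure_integral => A mA _.
  exact/esym/lebesgue_measure_affine.
rewrite (@ge0_integral_mscale _ _ _ ph setT measurableT r g pg.1 (fun x _ => pg.2 x)).
rewrite muleA -EFinM mulVf ?normr_eq0// mul1e.
have := @ge0_integral_pushforward _ _ _ _ R _ (measurable_affine1 c a) leb1 setT g
  measurableT pg.1 (fun x _ => pg.2 x).
by rewrite preimage_setT => ->.
Qed.

Lemma measurable_affine n (c : R) (a : 'rV[R]_n) :
  measurable_fun [set: 'rV[R]_n] (fun x => c *: x + a)%R.
Proof.
apply: measurable_fun_rV => i.
rewrite (_ : (fun _ => _) = (fun x : 'rV[R]_n => c * x ord0 i + a ord0 i)%R); last first.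
  by apply/funext => x; rewrite !mxE.
by apply: measurable_funD => //; apply: measurable_funM => //; exact: measurable_coord.
Qed.

(** Induction on the dimension: integral_cons splits off the first coordinate,
which integral_affine1 handles. *)
Lemma integral_affine n (c : R) (a : 'rV[R]_n) (f : 'rV[R]_n -> \bar R) : (c != 0)%R ->
  nnmeas f -> \int[leb n]_x f (c *: x + a)%R = (`|c| ^- n)%:E * \int[leb n]_x f x.
Proof.
move=> c0; elim: n => [|n IH] in a f *; move=> pf.
  rewrite expr0 invr1 mul1e; apply: eq_integral => x _.
  by congr f; rewrite [LHS]thinmx0 [RHS]thinmx0.
pose a' : 'rV[R]_n := (\row_i a ord0 (lift ord0 i))%R.
have pfa : nnmeas (fun x : 'rV[R]_n.+1 => f (c *: x + a)%R) by apply: nnmeas_comp pf _; exact: measurable_affine.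
rewrite !integral_cons//.
have consE x t : (c *: rV_cons (x, t) + a = rV_cons (c *: x + a', c * t + a ord0 ord0))%R.
  have affE m (b z : 'rV[R]_m) i : ((c *: z + b) ord0 i = c * z ord0 i + b ord0 i)%R.
    by rewrite !mxE.
  apply/rowP => i; rewrite affE; case: (unliftP ord0 i) => [j|] ->.
    by rewrite !rV_consS/= affE mxE.
  by rewrite !rV_cons0.
pose h x := \int[leb1]_t f (rV_cons (x, t)).
have pfc : nnmeas (fun z => f (@rV_cons R n z)).
  by apply: nnmeas_comp pf _; exact: measurable_rV_cons.
have ph : nnmeas h.
  split => [|x]; last by apply: integral_ge0 => t _; exact: pf.2.
  exact: (@measurable_fun_fubini_tonelli_F _ _ _ _ _ leb1 _ pfc.1 pfc.2).
transitivity (\int[leb n]_x (`|c|^-1%:E * h (c *: x + a')%R)).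
  apply: eq_integral => x _; under eq_integral do rewrite consE.
  rewrite (@integral_affine1 c (a ord0 ord0) (fun t => f (rV_cons ((c *: x + a')%R, t))))//.
  by apply: nnmeas_comp pfc _; exact: pair1_measurable.
rewrite nnmeas_integralZl ?lee_fin ?invr_ge0//; last first.
  by apply: nnmeas_comp ph _; exact: measurable_affine.
by rewrite (IH a' h ph) muleA -EFinM exprS invfM.
Qed.

Lemma integral_prod n (u : 'I_n -> R -> \bar R) :
  (forall i, nnmeas (u i : measurableTypeR R -> \bar R)) ->
  \int[leb n]_x \prod_(i < n) u i (x ord0 i) = \prod_(i < n) \int[leb1]_t u i t.
Proof.
elim: n u => [|n IH] u pu.
  rewrite big_ord0; under eq_integral do rewrite big_ord0.
  by rewrite integral_dirac// diracE mem_set// mul1e.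
have prod0 m (F : 'I_m -> \bar R) : (forall i, 0 <= F i) -> 0 <= \prod_(i < m) F i.
  by move=> F0; apply: (big_ind (fun x => 0 <= x)) => //; exact: mule_ge0.
have pprod m (v : 'I_m -> R -> \bar R) : (forall i, nnmeas (v i : measurableTypeR R -> \bar R)) ->
    nnmeas (fun x : 'rV[R]_m => \prod_(i < m) v i (x ord0 i)).
  move=> pv; split => [|x]; last by apply: prod0 => i; exact: (pv i).2.
  have : forall s : seq 'I_m, measurable_fun [set: 'rV[R]_m] (fun x => \prod_(i <- s) v i (x ord0 i)).
    elim => [|i s IHs].
      by under eq_fun do rewrite big_nil; exact: measurable_cst.
    under eq_fun do rewrite big_cons; apply: emeasurable_funM => //.
    by apply: (measurableT_comp (pv i).1); exact: measurable_coord.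
  exact.
rewrite integral_cons; last exact: pprod.
rewrite big_ord_recl.
pose P (x : 'rV[R]_n) := \prod_(i < n) u (lift ord0 i) (x ord0 i).
have pP : nnmeas P by apply: (pprod n (fun i => u (lift ord0 i))) => i.
transitivity (\int[leb n]_x (\int[leb1]_t u ord0 t * P x)).
  apply: eq_integral => x _.
  rewrite muleC -nnmeas_integralZl//; last exact: pP.2.
  apply: eq_integral => t _; rewrite big_ord_recl rV_cons0/= muleC; congr (_ * _).
  by apply: eq_bigr => i _; rewrite rV_consS.
rewrite nnmeas_integralZl//; last exact: nnmeas_integral_ge0.
by congr (_ * _); exact: (IH (fun i => u (lift ord0 i))).
Qed.

(** The norm of row vectors is the sup norm, whose balls are open cubes. *)
Lemma rV_ballE n (x : 'rV[R]_n) (r : R) : (0 < r)%R ->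
  ball x r = [set y | forall i, `](x ord0 i - r)%R, (x ord0 i + r)%R[%classic (y ord0 i)].
Proof.
move=> r0; apply/seteqP; split => y /=.
  move=> [_ h] i; have := h ord0 i; rewrite /ball/= in_itv/= => h'.
  by rewrite -ltr_distl distrC.
move=> h; split => // i j; rewrite (ord1 i) /ball/=; have := h j.
by rewrite in_itv/= -ltr_distl distrC.
Qed.

Lemma measurable_rV_ball n (x : 'rV[R]_n) (r : R) : measurable (ball x r).
Proof.
have [r0|r0] := ltP 0%R r; last first.
  rewrite (_ : ball x r = set0)//; apply/seteqP; split => // y [] /=.
  by rewrite ltNge r0.
rewrite rV_ballE//.
exact: (@measurable_box n (fun i => `](x ord0 i - r)%R, (x ord0 i + r)%R[%classic)
  (fun=> measurable_itv _)).
Qed.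

Lemma leb_rV_ball n (x : 'rV[R]_n) (r : R) : (0 < r)%R ->
  leb n (ball x r) = ((2 * r) ^+ n)%:E.
Proof.
move=> r0; rewrite rV_ballE// /leb /=.
rewrite (@lebesgue_rV_box R n (fun i => `](x ord0 i - r)%R, (x ord0 i + r)%R[%classic)); last first.
  by move=> i; exact: measurable_itv.
under eq_bigr => i _.
  rewrite lebesgue_measure_itv/= lte_fin ifT; last by rewrite ltrBlDr -addrA ltrDl addr_gt0.
  rewrite -EFinB (_ : x ord0 i + r - (x ord0 i - r) = 2 * r)%R; last by ring.
  over.
elim: {x} n => [|n IH]; first by rewrite big_ord0.
by rewrite big_ord_recl IH exprS EFinM.
Qed.

End lebesgue_rV_basics.
Arguments leb {R} n _.

Section rational_cubes.
Context {R : realType} (n : nat).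
Local Notation Rn := 'rV[R]_n.

Definition rat_point (c : 'rV[rat]_n) : Rn := map_mx ratr c.

(** Every number has to denote a cube of positive radius; those that do not
encode one stand for the cube of radius one around the origin. *)
Definition rat_cube_code (k : nat) : 'rV[rat]_n * rat :=
  if (unpickle k : option ('rV[rat]_n * rat)) is Some (c, q) then (if 0 < q then (c, q) else (0, 1)) else (0, 1).

Definition rat_cube (k : nat) : set Rn :=
  ball (rat_point (rat_cube_code k).1) (ratr (rat_cube_code k).2).

Definition rat_cube_index (c : 'rV[rat]_n) (q : rat) : nat := pickle (c, q).

Lemma rat_cube_code_gt0 k : 0 < (rat_cube_code k).2.
Proof. by rewrite /rat_cube_code; case: unpickle => // -[c q]; case: ifP. Qed.

Lemma rat_radius_gt0 k : 0 < ratr (rat_cube_code k).2 :> R.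
Proof. by rewrite ltr0q rat_cube_code_gt0. Qed.

Lemma rat_cube_indexE c q : 0 < q -> rat_cube (rat_cube_index c q) = ball (rat_point c) (ratr q : R).
Proof. by move=> q0; rewrite /rat_cube /rat_cube_code pickleK q0. Qed.

Lemma rat_cube_code_index c q : 0 < q -> rat_cube_code (rat_cube_index c q) = (c, q).
Proof. by move=> q0; rewrite /rat_cube_code pickleK q0. Qed.

Lemma rat_point_near (x : Rn) (e : R) : 0 < e -> exists c, ball x e (rat_point c).
Proof.
move=> e0.
have h i : exists q : rat, `|x ord0 i - ratr q| < e.
  have [|q] := @rat_in_itvoo R (x ord0 i - e) (x ord0 i + e).
    by rewrite ltrBlDr -addrA ltrDl addr_gt0.
  by rewrite in_itv/= -ltr_distl distrC => qe; exists q.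
have [c hc] := choice h; exists (\row_i c i); split => // i j.
by rewrite (ord1 i) !mxE; exact: hc.
Qed.

Lemma rat_between (a b : R) : a < b -> exists q : rat, a < ratr q < b.
Proof. by move=> /rat_in_itvoo [q]; rewrite in_itv/=; exists q. Qed.

(** Up to a constant factor, rational cubes are as good as arbitrary ones; this
is how averages over arbitrary balls are bounded by the maximal function over
the countable family. *)
Lemma ball_in_rat_cube (x : Rn) (r : R) : 0 < r -> exists k,
  [/\ ball x r `<=` rat_cube k, ratr (rat_cube_code k).2 < 2 * r & rat_cube k `<=` ball x (3 * r)].
Proof.
move=> r0; have r20 : 0 < r / 2 by rewrite divr_gt0.
have [c xc] := rat_point_near x r20.
have [q /andP[q1 q2]] : exists q : rat, r + r / 2 < ratr q < 2 * r by apply: rat_between; lra.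
have q0 : 0 < q by rewrite -(@ltr0q R); apply: lt_trans q1; rewrite addr_gt0.
exists (rat_cube_index c q); rewrite rat_cube_indexE// rat_cube_code_index//=.
split => //= y.
  move=> xy; apply: (le_ball (ltW q1)); rewrite addrC.
  exact: ball_triangle (ball_sym xc) xy.
move=> cy; have := ball_triangle xc cy; apply: le_ball; lra.
Qed.

Lemma open_rV_measurable (U : set Rn) : open U -> measurable U.
Proof.
move=> oU; rewrite (_ : U = \bigcup_(k in [set k | rat_cube k `<=` U]) rat_cube k).
  by apply: bigcup_measurable => k _; exact: measurable_rV_ball.
apply/seteqP; split => [x Ux|x [k /= kU /kU//]].
move: oU; rewrite openE => /(_ x Ux); rewrite /interior -nbhs_ballE => -[e /= e0 eU].
have e30 : 0 < e / 3 by rewrite divr_gt0.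
have [k [xk _ kx]] := ball_in_rat_cube x e30.
exists k; last by apply: xk; exact: ballxx.
move=> y /= /kx; rewrite mulrCA divff// mulr1; exact: eU.
Qed.

Lemma continuous_rV_measurable (f : Rn -> R) : continuous f -> measurable_fun [set: Rn] f.
Proof.
move=> cf; apply: (measurability _ (RGenOpens.measurableE R)) => _ [_ [a [b ->] <-]].
by rewrite setTI; apply: open_rV_measurable; move/continuousP : cf; apply; exact: interval_open.
Qed.

Definition cube_enlarge (k : nat) : nat :=
  rat_cube_index (rat_cube_code k).1 (3 * (rat_cube_code k).2).

Definition cube_exhaust (k : nat) : nat := rat_cube_index 0 k.+1%:R.

Lemma cube_enlargeE k : rat_cube (cube_enlarge k) =
  ball (rat_point (rat_cube_code k).1) (3 * ratr (rat_cube_code k).2 : R).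
Proof.
rewrite rat_cube_indexE ?mulr_gt0 ?rat_cube_code_gt0//.
by rewrite rmorphM/= ratr_nat.
Qed.

Lemma rat_cube_sub_enlarge i j : rat_cube i `&` rat_cube j !=set0 ->
  ratr (rat_cube_code i).2 <= ratr (rat_cube_code j).2 :> R ->
  rat_cube i `<=` rat_cube (cube_enlarge j).
Proof.
move=> [z [iz jz]] ij y iy; rewrite cube_enlargeE.
have := ball_triangle jz (ball_triangle (ball_sym iz) iy).
by apply: le_ball; lra.
Qed.

(** The greedy selection, as an induction over the cubes sorted by increasing
radius: the smallest cube is added to those selected among the others if it is
disjoint from them; otherwise it meets one of them, which is at least as large
and whose threefold enlargement contains it. *)
Lemma rat_cube_vitali (s : seq nat) : exists s' : seq nat,
  [/\ uniq s', {subset s' <= s}, trivIset [set` s'] rat_cube &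
   forall i, i \in s -> exists2 j, j \in s' & rat_cube i `<=` rat_cube (cube_enlarge j)].
Proof.
pose rad k : R := ratr (rat_cube_code k).2.
pose LE := [rel x y | rad x <= rad y].
have LE_trans : transitive LE by move=> x y z; exact: le_trans.
wlog : s / sorted LE s => [wl|].
  have [|s' [us' ss' ts' cov]] := wl (sort LE s).
    by apply: sort_sorted => x y; exact: le_total.
  exists s'; split => //; first by move=> x /ss'; rewrite mem_sort.
  by move=> i si; apply: cov; rewrite mem_sort.
elim: s => [_|i s IH]; first by exists [::]; split => // i j.
rewrite /= => pis; have ss := path_sorted pis.
have [s' [us' ss' ts' cov]] := IH ss.
have le_i j : j \in s' -> rad i <= rad j.
  by move=> /ss' js; have /allP := order_path_min LE_trans pis; exact.
have [h|/existsNP[j /not_implyP[js' /eqP/set0P ji]]] :=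
    pselect (forall j, j \in s' -> rat_cube i `&` rat_cube j = set0).
  have is' : i \notin s'.
    apply/negP => /h; rewrite setIid => /seteqP[] /(_ _ (ballxx _ (rat_radius_gt0 i))).
    exact.
  exists (i :: s'); split => //=; first by rewrite is'.
  - by move=> k; rewrite !inE => /orP[->//|/ss' ->]; rewrite orbT.
  - move=> k l /=; rewrite !inE => /predU1P[->|ks'] /predU1P[->|ls']//.
    + by rewrite h// => -[].
    + by rewrite setIC h// => -[].
    + exact: ts'.
  - move=> k; rewrite inE => /predU1P[->|ks].
      exists i; rewrite ?mem_head//; apply: rat_cube_sub_enlarge => //.
      exists (rat_point (rat_cube_code i).1); split; exact: ballxx _ (rat_radius_gt0 i).
    by have [j js' kj] := cov _ ks; exists j; rewrite // inE js' orbT.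
exists s'; split => //; first by move=> k /ss' ks; rewrite inE ks orbT.
move=> k; rewrite inE => /predU1P[->|]; last exact: cov.
by exists j => //; apply: rat_cube_sub_enlarge => //; exact: le_i.
Qed.

Lemma leb_rat_cube i : leb n (rat_cube i) = ((2 * ratr (rat_cube_code i).2) ^+ n)%:E.
Proof. exact: leb_rV_ball (rat_radius_gt0 i). Qed.

Lemma rat_cube_vitali_family : vitali_family (leb n : {sigma_finite_measure set Rn -> \bar R}) rat_cube cube_enlarge cube_exhaust (3 ^+ n).
Proof.
split.
- by move=> i; exact: measurable_rV_ball.
- by move=> i; rewrite [ltRHS]leb_rat_cube lte_fin exprn_gt0// mulr_gt0// rat_radius_gt0.
- by move=> i; rewrite [ltLHS]leb_rat_cube ltry.
- exact: rat_cube_vitali.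
- move=> i; apply: rat_cube_sub_enlarge => //.
  exists (rat_point (rat_cube_code i).1); split; exact: ballxx _ (rat_radius_gt0 i).
- move=> i; rewrite [X in (_ <= _ * X)%E]leb_rat_cube cube_enlargeE.
  rewrite [leLHS](@leb_rV_ball R n) ?(mulr_gt0 (ltr0n _ 3)) ?rat_radius_gt0//.
  by rewrite mulrCA exprMn EFinM.
- by rewrite exprn_gt0.
- move=> j k jk; apply/subsetPset; rewrite /= !rat_cube_indexE//.
  by apply: le_ball; rewrite ler_rat ler_nat.
- apply/seteqP; split => // x _.
  have s0 : 0 <= \sum_(i < n) `|x ord0 i| by apply: sumr_ge0.
  exists (Num.bound (\sum_(i < n) `|x ord0 i|)) => //; rewrite rat_cube_indexE//.
  split => [|i j]; first by rewrite ltr0q.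
  rewrite (ord1 i) mxE mxE (rmorph0 (@ratr R)) /ball/= sub0r normrN ratr_nat.
  apply: (@lt_trans _ _ (Num.bound (\sum_(i < n) `|x ord0 i|))%:R); last by rewrite ltr_nat.
  by apply: le_lt_trans (archi_boundP s0); rewrite (bigD1 j)//= lerDl sumr_ge0.
Qed.

Lemma measurable_dot (x : Rn) : measurable_fun [set: Rn] (dot x).
Proof.
rewrite /dot; apply: measurable_sum => i.
by apply: measurable_funM => //; exact: measurable_coord.
Qed.

Lemma dot_ge0 (x : Rn) : 0 <= dot x x.
Proof. by apply: sumr_ge0 => i _; rewrite -expr2 sqr_ge0. Qed.

Lemma measurable_enorm (x : Rn) : measurable_fun [set: Rn] (fun y => enorm (y - x)).
Proof.
under eq_fun do rewrite /enorm -powR12_sqrt ?dot_ge0//.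
apply: (measurableT_comp (measurable_powR _)).
apply: measurable_sum => i.
rewrite (_ : (fun _ => _) = (fun y : Rn => (y ord0 i - x ord0 i) * (y ord0 i - x ord0 i))); last first.
  by apply/funext => y; rewrite !mxE.
by apply: measurable_funM => //; apply: measurable_funB => //; exact: measurable_coord.
Qed.

Lemma measurable_eball (x : Rn) r : measurable (eball x r).
Proof.
rewrite (_ : eball x r = (fun y => enorm (y - x)) @^-1` `]-oo, r[); last first.
  by apply/seteqP; split => y /=; rewrite in_itv.
by rewrite -[X in measurable X]setTI; apply: measurable_enorm => //; exact: measurable_itv.
Qed.

Lemma coord_le_enorm (x : Rn) i : `|x ord0 i| <= enorm x.
Proof.
rewrite -sqrtr_sqr; apply: ler_wsqrtr; rewrite /dot (bigD1 i)//= -expr2 lerDl.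
by apply: sumr_ge0 => j _; rewrite -expr2 sqr_ge0.
Qed.

Lemma enorm_le_coord (x : Rn) (r : R) : 0 <= r -> (forall i, `|x ord0 i| <= r) ->
  enorm x <= n%:R * r.
Proof.
move=> r0 xr; rewrite /enorm -(@ger0_norm _ (n%:R * r)) ?mulr_ge0// -sqrtr_sqr.
apply: ler_wsqrtr; apply: (@le_trans _ _ (\sum_(i < n) r ^+ 2)).
  apply: ler_sum => i _; rewrite -expr2 -[leLHS]real_normK ?num_real//.
  by rewrite lerXn2r ?nnegrE.
rewrite sumr_const card_ord -(mulr_natl (r ^+ 2) n) exprMn -natrX.
apply: ler_wpM2r; [exact: sqr_ge0|rewrite ler_nat].
by case: (n) => // k; rewrite leq_pmulr.
Qed.

Lemma eball_sub_ball (x : Rn) r : eball x r `<=` ball x r.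
Proof.
move=> y /= xy; split; first by apply: le_lt_trans xy; exact: sqrtr_ge0.
move=> i j; rewrite (ord1 i) /ball/= distrC.
by apply: le_lt_trans xy; have := coord_le_enorm (y - x) j; rewrite !mxE.
Qed.

Lemma ball_sub_eball (x : Rn) r : 0 < r -> ball x r `<=` eball x (n.+1%:R * r).
Proof.
move=> r0 y [_ xy]; rewrite /eball/=.
apply: (@le_lt_trans _ _ (n%:R * r)); last by rewrite ltr_pM2r// ltr_nat.
apply: enorm_le_coord; first exact: ltW.
move=> i; rewrite !mxE distrC; exact: ltW (xy ord0 i).
Qed.

(** A cube of radius r is contained in the Euclidean ball of radius (n + 1) r
with the same centre, whose measure is comparable, so that the Muckenhoupt
condition over balls gives the condition over cubes. The weight is set to one on
the null set where it vanishes. *)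
Lemma muckenhoupt_Ap_weight (s : R) (w : Rn -> R) : 1 < s -> muckenhoupt s w ->
  exists2 K : R, 0 < K & exists w', [/\ Ap_weight (leb n) rat_cube s K w' &
    {ae lebesgue_rV n, forall x, w' x = w x}].
Proof.
move=> s1 [mw w0 wpos wsup].
have s10 : 0 < s - 1 by rewrite subr_gt0.
pose w' x := if w x == 0 then 1 else w x.
have w'w : {ae leb n, forall x, w' x = w x}.
  by apply: filterS wpos => x wx; rewrite /w' gt_eqF.
have ww' : weight w'.
  split => [|x]; last by rewrite /w'; case: eqP => // /eqP wx; rewrite lt0r wx w0.
  apply: measurable_fun_ifT => //.
  exact: measurable_fun_eqr.
have VF := rat_cube_vitali_family.
have mQ := vf_measurable VF; have Q0 := vf_gt0 VF.
set S := ereal_sup _ in wsup.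
have S0 : (0 <= S)%E.
  apply: (@le_trans _ _ (average (eball 0 1) w * average (eball 0 1) (fun x => w x `^ (- (s - 1)^-1))%R `^ (s - 1)%R)%E).
    apply: mule_ge0; last exact: poweR_ge0.
    apply: mule_ge0; first by rewrite lee_fin invr_ge0 fine_ge0.
    by apply: integral_ge0 => x _; rewrite lee_fin.
  by apply: ereal_sup_ubound; exists (0, 1) => //=.
have SE : S = (fine S)%:E by rewrite fineK// ge0_fin_numE.
pose M := fine S.
have M0 : 0 <= M by rewrite -lee_fin -SE.
pose K := (M + 1) * (n.+1%:R ^+ n) `^ s.
have K0 : 0 < K by rewrite mulr_gt0 ?powR_gt0 ?exprn_gt0// ltr_wpDl.
exists K => //; exists w'; split => //.
pose sg := dual_weight s w'.
have wsg : weight sg by exact: weight_dual.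
have pw := weight_nnmeas ww'; have psg := weight_nnmeas wsg.
have key i : (wmass (leb n) rat_cube w' i * wmass (leb n) rat_cube sg i `^ (s - 1) <= K%:E * leb n (rat_cube i) `^ s)%E.
  set c := rat_point (rat_cube_code i).1; set r : R := ratr (rat_cube_code i).2.
  have r0 : 0 < r by exact: rat_radius_gt0.
  pose rho := n.+1%:R * r; have rho0 : 0 < rho by rewrite mulr_gt0.
  pose B := eball c rho.
  have mB : measurable B by exact: measurable_eball.
  have QB : rat_cube i `<=` B by exact: ball_sub_eball.
  have BQ : B `<=` ball c rho by exact: eball_sub_ball.
  have Blt : (leb n B <= ((2 * rho) ^+ n)%:E)%E.
    rewrite -(leb_rV_ball c rho0); apply: le_measure => //; rewrite inE//.
    exact: measurable_rV_ball.
  have Bgt : (0 < leb n B)%E.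
    by apply: (lt_le_trans (Q0 i)); apply: le_measure; rewrite ?inE//; exact: mQ.
  set m := fine (leb n B).
  have mE : leb n B = m%:E.
    by rewrite fineK// ge0_fin_numE//; apply: (le_lt_trans Blt); rewrite ltry.
  have m0 : 0 < m by rewrite -lte_fin -mE.
  have avgE (v v' : Rn -> R) : weight v' -> measurable_fun setT v ->
      {ae leb n, forall x, v' x = v x} ->
      average B v = (m^-1%:E * \int[leb n]_(x in B) (v' x)%:E)%E.
    move=> [mv' _] mv vv'; rewrite /average; congr (_ * _)%E.
    apply: ae_eq_integral => //.
    - by apply/measurable_EFinP; exact: measurable_funTS.
    - by apply/measurable_EFinP; exact: measurable_funTS.
    - by apply: filterS vv' => x -> _.
  have msg : measurable_fun setT (fun x => w x `^ (- (s - 1)^-1)).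
    exact: measurableT_comp (measurable_powR _) mw.
  have sgw : {ae leb n, forall x, sg x = w x `^ (- (s - 1)^-1)}.
    by apply: filterS w'w => x; rewrite /sg /dual_weight => ->.
  have := @ereal_sup_ubound R _ _ (ex_intro2 _ _ (c, rho) rho0 erefl) : (_ <= S)%E.
  rewrite /= -/B (avgE w w')// (avgE _ sg)// SE -/M.
  set a := (\int[leb n]_(x in B) (w' x)%:E)%E; set b := (\int[leb n]_(x in B) (sg x)%:E)%E.
  move=> h.
  have a0 : (0 <= a)%E by exact: nnmeas_integral_ge0.
  have b0 : (0 <= b)%E by exact: nnmeas_integral_ge0.
  have Wa : (wmass (leb n) rat_cube w' i <= a)%E.
    apply: ge0_subset_integral => //; first exact: measurable_funTS pw.1.
    by move=> x _; exact: pw.2.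
  have Wb : (wmass (leb n) rat_cube sg i <= b)%E.
    apply: ge0_subset_integral => //; first exact: measurable_funTS psg.1.
    by move=> x _; exact: psg.2.
  apply: (@le_trans _ _ (a * b `^ (s - 1))%E).
    apply: lee_pmul => //; rewrite ?poweR_ge0//.
      exact/ltW/(wmass_gt0 mQ Q0).
    apply: lee_poweR => //; [exact: ltW|exact/ltW/(wmass_gt0 mQ Q0)].
  have mz (z : \bar R) : (z = m%:E * (m^-1%:E * z))%E.
    by rewrite muleA -EFinM divff ?mul1e// gt_eqF.
  rewrite (mz a) (mz b) (@poweRM _ m%:E) ?mule_ge0 ?lee_fin ?invr_ge0 ?(ltW m0)//.
  rewrite muleACA poweR_EFin -(EFinM m).
  apply: (@le_trans _ _ ((m * m `^ (s - 1))%:E * M%:E)%E).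
    by apply: lee_wpmul2l; rewrite // lee_fin mulr_ge0 ?powR_ge0// ltW.
  rewrite leb_rV_ball// poweR_EFin -!EFinM lee_fin.
  have -> : m * m `^ (s - 1) = m `^ s.
    by rewrite mulr_powRB1 ?(ltW m0)// (lt_trans _ s1).
  have mle : m <= n.+1%:R ^+ n * (2 * r) ^+ n.
    by rewrite -exprMn mulrCA -/rho -lee_fin -mE.
  have r2n : 0 <= (2 * r) ^+ n by rewrite exprn_ge0// mulr_ge0// ltW.
  have s0 : 0 <= s by rewrite ltW// (lt_trans _ s1).
  rewrite mulrC /K -mulrA -powRM ?exprn_ge0 ?(mulr_ge0 _ (ltW r0))//.
  apply: ler_pM; rewrite ?powR_ge0 ?lerDl//.
  apply: (ge0_ler_powR s0) => //; rewrite nnegrE; first exact: ltW.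
  exact: le_trans (ltW m0) mle.
have fin i : (K%:E * leb n (rat_cube i) `^ s < +oo)%E.
  by rewrite /rat_cube leb_rV_ball ?rat_radius_gt0// poweR_EFin -EFinM ltry.
split => // i.
- rewrite ltey; apply/eqP => Wy; have := le_lt_trans (key i) (fin i).
  by rewrite Wy gt0_mulye// poweR_gt0// (wmass_gt0 mQ Q0).
- rewrite ltey; apply/eqP => Wy; have := le_lt_trans (key i) (fin i).
  by rewrite Wy poweRyr ?gt_eqF// gt0_muley// (wmass_gt0 mQ Q0).
Qed.

End rational_cubes.

(** * Integration of complex-valued functions *)

Section complex_numbers.
Context {R : realType}.
Implicit Types z w : R[i].

Lemma Re_mul z w : Re (z * w) = Re z * Re w - Im z * Im w.
Proof. by case: z w => [a b] [c e]. Qed.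

Lemma Im_mul z w : Im (z * w) = Re z * Im w + Im z * Re w.
Proof. by case: z w => [a b] [c e]. Qed.

Lemma Re_add z w : Re (z + w) = Re z + Re w.
Proof. by case: z w => [a b] [c e]. Qed.

Lemma Im_add z w : Im (z + w) = Im z + Im w.
Proof. by case: z w => [a b] [c e]. Qed.

Lemma complex_ext z w : Re z = Re w -> Im z = Im w -> z = w.
Proof. by case: z w => [a b] [c e] /= -> ->. Qed.

Lemma normc_ge0 z : 0 <= normc z.
Proof. by case: z => a b; exact: sqrtr_ge0. Qed.

Lemma normcE z : normc z = Num.sqrt (Re z ^+ 2 + Im z ^+ 2).
Proof. by case: z. Qed.

Lemma sqr_normcE z : normc z ^+ 2 = Re z ^+ 2 + Im z ^+ 2.
Proof. by rewrite normcE sqr_sqrtr// addr_ge0 ?sqr_ge0. Qed.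

Lemma Re_le_normc z : `|Re z| <= normc z.
Proof. by rewrite normcE -sqrtr_sqr ler_wsqrtr// lerDl sqr_ge0. Qed.

Lemma Im_le_normc z : `|Im z| <= normc z.
Proof. by rewrite normcE -sqrtr_sqr ler_wsqrtr// lerDr sqr_ge0. Qed.

Lemma normc_real (x : R) : normc x%:C%C = `|x|.
Proof. by rewrite normcE /= expr0n addr0 sqrtr_sqr. Qed.

Lemma normc_le_ReIm z : normc z <= `|Re z| + `|Im z|.
Proof.
rewrite normcE -[leRHS]ger0_norm ?addr_ge0// -sqrtr_sqr ler_wsqrtr//.
rewrite sqrrD !real_normK ?num_real// -addrA lerD2l lerDr.
by rewrite mulrn_wge0// mulr_ge0.
Qed.

Lemma normc_sum (I : Type) (r : seq I) (F : I -> R[i]) :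
  normc (\sum_(i <- r) F i) <= \sum_(i <- r) normc (F i).
Proof.
elim: r => [|i r IH]; first by rewrite !big_nil ComplexField.Normc.normc0.
by rewrite !big_cons (le_trans (le_normcD _ _))// lerD2l.
Qed.

Lemma normc_prod (I : Type) (r : seq I) (F : I -> R[i]) :
  normc (\prod_(i <- r) F i) = \prod_(i <- r) normc (F i).
Proof.
elim: r => [|i r IH]; first by rewrite !big_nil ComplexField.Normc.normc1.
by rewrite !big_cons ComplexField.Normc.normcM IH.
Qed.

Lemma normcX z k : normc (z ^+ k) = normc z ^+ k.
Proof.
elim: k => [|k IH]; first by rewrite !expr0 ComplexField.Normc.normc1.
by rewrite !exprS ComplexField.Normc.normcM IH.
Qed.

End complex_numbers.

Lemma Re_sum (R : realType) (I : Type) (r : seq I) (F : I -> R[i]) :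
  Re (\sum_(i <- r) F i) = \sum_(i <- r) Re (F i).
Proof. by elim: r => [|i r IH]; rewrite ?big_nil// !big_cons Re_add IH. Qed.

Lemma Im_sum (R : realType) (I : Type) (r : seq I) (F : I -> R[i]) :
  Im (\sum_(i <- r) F i) = \sum_(i <- r) Im (F i).
Proof. by elim: r => [|i r IH]; rewrite ?big_nil// !big_cons Im_add IH. Qed.

Section complex_integral.
Context d (T : measurableType d) {R : realType}.
Variable mu : {measure set T -> \bar R}.
Implicit Types (f g : T -> R[i]) (h : T -> R).

Definition cmeas f := measurable_fun [set: T] (fun x => Re (f x)) /\
  measurable_fun [set: T] (fun x => Im (f x)).

Definition cintegrable f :=
  mu.-integrable setT (EFin \o (fun x => Re (f x))) /\
  mu.-integrable setT (EFin \o (fun x => Im (f x))).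

Definition cint f : R[i] := ((\int[mu]_x Re (f x)) +i* (\int[mu]_x Im (f x)))%C.

Lemma cmeas_cst (z : R[i]) : cmeas (fun=> z).
Proof. by split; exact: measurable_cst. Qed.

Lemma cmeas_real h : measurable_fun setT h -> cmeas (fun x => (h x)%:C%C).
Proof. by move=> mh; split=> //; exact: measurable_cst. Qed.

Lemma cmeasM f g : cmeas f -> cmeas g -> cmeas (fun x => f x * g x).
Proof.
move=> [mf1 mf2] [mg1 mg2]; split.
  by under eq_fun do rewrite Re_mul; apply: measurable_funB; exact: measurable_funM.
by under eq_fun do rewrite Im_mul; apply: measurable_funD; exact: measurable_funM.
Qed.

Lemma cmeasD f g : cmeas f -> cmeas g -> cmeas (fun x => f x + g x).
Proof.
move=> [mf1 mf2] [mg1 mg2]; split.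
  by under eq_fun do rewrite Re_add; exact: measurable_funD.
by under eq_fun do rewrite Im_add; exact: measurable_funD.
Qed.

Lemma cmeasB f g : cmeas f -> cmeas g -> cmeas (fun x => f x - g x).
Proof.
move=> mf mg; rewrite (_ : (fun _ => _) = fun x => f x + (-1) * g x).
  by apply: cmeasD => //; apply: cmeasM => //; exact: cmeas_cst.
by apply/funext => x; rewrite mulN1r.
Qed.

Lemma cmeas_sum (I : Type) (r : seq I) (F : I -> T -> R[i]) :
  (forall i, cmeas (F i)) -> cmeas (fun x => \sum_(i <- r) F i x).
Proof.
move=> mF; elim: r => [|i r IH].
  by under eq_fun do rewrite big_nil; exact: cmeas_cst.
by under eq_fun do rewrite big_cons; exact: cmeasD.
Qed.

Lemma cmeas_prod (I : Type) (r : seq I) (F : I -> T -> R[i]) :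
  (forall i, cmeas (F i)) -> cmeas (fun x => \prod_(i <- r) F i x).
Proof.
move=> mF; elim: r => [|i r IH].
  by under eq_fun do rewrite big_nil; exact: cmeas_cst.
by under eq_fun do rewrite big_cons; exact: cmeasM.
Qed.

Lemma measurable_normc f : cmeas f -> measurable_fun setT (fun x => normc (f x)).
Proof.
move=> [mf1 mf2].
under eq_fun do rewrite normcE -powR12_sqrt ?addr_ge0 ?sqr_ge0//.
apply: (measurableT_comp (measurable_powR _)).
by apply: measurable_funD; under eq_fun do rewrite expr2; exact: measurable_funM.
Qed.

Lemma nnmeas_normc f : cmeas f -> nnmeas (fun x => (normc (f x))%:E).
Proof.
move=> mf; split=> [|x]; last by rewrite lee_fin normc_ge0.
by apply/measurable_EFinP; exact: measurable_normc.
Qed.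

Lemma cintegrable_cmeas f : cintegrable f -> cmeas f.
Proof.
by move=> [/measurable_int/measurable_EFinP m1 /measurable_int/measurable_EFinP m2].
Qed.

Lemma cintegrable_le f (u : T -> \bar R) : cmeas f ->
  (forall x, ((normc (f x))%:E <= u x)%E) -> (\int[mu]_x u x < +oo)%E ->
  cintegrable f.
Proof.
move=> [m1 m2] fu uoo; split; apply/integrableP; split;
  (try by apply/measurable_EFinP); apply: le_lt_trans uoo;
  apply: ge0_le_integralT => x; rewrite ?lee_fin ?abse_ge0//.
- by apply: le_trans (fu x); rewrite lee_fin Re_le_normc.
- by apply: le_trans (fu x); rewrite lee_fin Im_le_normc.
Qed.

Lemma cintegrableP f : cintegrable f <->
  cmeas f /\ (\int[mu]_x (normc (f x))%:E < +oo)%E.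
Proof.
split=> [if_|[mf foo]]; last exact: (cintegrable_le mf (fun=> lexx _) foo).
split; first exact: cintegrable_cmeas.
have [m1 m2] := cintegrable_cmeas if_.
case: if_ => /integrableP[_ i1] /integrableP[_ i2].
apply: (@le_lt_trans _ _ (\int[mu]_x (`|Re (f x)|%:E + `|Im (f x)|%:E))%E).
  by apply: ge0_le_integralT => x; rewrite -?EFinD lee_fin ?normc_ge0// normc_le_ReIm.
rewrite ge0_integralD//; first exact: lte_add_pinfty.
- by apply/measurable_EFinP; exact: measurableT_comp.
- by apply/measurable_EFinP; exact: measurableT_comp.
Qed.

Lemma cintegrable_lty f : cintegrable f -> (\int[mu]_x (normc (f x))%:E < +oo)%E.
Proof. by move=> /cintegrableP[]. Qed.

Lemma cintegrable_eq f g : f =1 g -> cintegrable f -> cintegrable g.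
Proof. by move=> /funext ->. Qed.

Lemma cintegrableM_bounded f g (c : R) : cmeas f -> (forall x, normc (f x) <= c) ->
  cintegrable g -> cintegrable (fun x => f x * g x).
Proof.
move=> mf fc ig; have mg := cintegrable_cmeas ig.
apply: (cintegrable_le (u := fun x => (c%:E * (normc (g x))%:E)%E)).
- exact: cmeasM.
- by move=> x; rewrite ComplexField.Normc.normcM -EFinM lee_fin ler_wpM2r ?normc_ge0.
- case: (pselect (exists x : T, True)) => [[x0 _]|noT].
    have c0 : 0 <= c by apply: le_trans (fc x0); exact: normc_ge0.
    rewrite nnmeas_integralZl//; last exact: nnmeas_normc.
    by rewrite lte_mul_pinfty//; exact: cintegrable_lty.
  rewrite (_ : setT = set0) ?integral_set0//.
  by apply/seteqP; split => // x _; apply: noT; exists x.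
Qed.

Lemma cintegrableZ f (z : R[i]) : cintegrable f -> cintegrable (fun x => z * f x).
Proof. by move=> if_; apply: (cintegrableM_bounded (c := normc z)) => //; exact: cmeas_cst. Qed.

Lemma cintegrableD f g : cintegrable f -> cintegrable g -> cintegrable (fun x => f x + g x).
Proof.
move=> [f1 f2] [g1 g2]; split.
  rewrite (_ : _ \o _ = (EFin \o (fun x => Re (f x))) \+ (EFin \o (fun x => Re (g x))))%E.
    exact: integrableD.
  by apply/funext => x /=; rewrite Re_add EFinD.
rewrite (_ : _ \o _ = (EFin \o (fun x => Im (f x))) \+ (EFin \o (fun x => Im (g x))))%E.
  exact: integrableD.
by apply/funext => x /=; rewrite Im_add EFinD.
Qed.

Lemma cintegrableB f g : cintegrable f -> cintegrable g -> cintegrable (fun x => f x - g x).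
Proof.
move=> if_ ig; apply: (@cintegrable_eq (fun x => f x + (-1) * g x)).
  by move=> x; rewrite mulN1r.
by apply: cintegrableD => //; exact: cintegrableZ.
Qed.

Lemma eq_cint f g : f =1 g -> cint f = cint g.
Proof. by move=> /funext ->. Qed.

Lemma cintD f g : cintegrable f -> cintegrable g ->
  cint (fun x => f x + g x) = cint f + cint g.
Proof.
move=> [f1 f2] [g1 g2]; rewrite /cint; apply: complex_ext => /=.
  by under eq_Rintegral do rewrite Re_add; exact: RintegralD.
by under eq_Rintegral do rewrite Im_add; exact: RintegralD.
Qed.

Lemma cintZ f (z : R[i]) : cintegrable f -> cint (fun x => z * f x) = z * cint f.
Proof.
move=> [f1 f2].
have iZ (c : R) (g0 : T -> R) : mu.-integrable setT (EFin \o g0) ->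
    mu.-integrable setT (EFin \o (fun x => c * g0 x)).
  by move=> ig0; apply: (@eq_integrable _ _ _ _ _ _ (fun x => c%:E * (EFin \o g0) x)%E) => //;
    exact: integrableZl.
rewrite /cint; apply: complex_ext; rewrite ?Re_mul ?Im_mul /=.
  under eq_Rintegral do rewrite Re_mul.
  rewrite RintegralB//; [|exact: iZ|exact: iZ].
  by rewrite !RintegralZl.
under eq_Rintegral do rewrite Im_mul.
rewrite RintegralD//; [|exact: iZ|exact: iZ].
by rewrite !RintegralZl.
Qed.

Lemma cintB f g : cintegrable f -> cintegrable g ->
  cint (fun x => f x - g x) = cint f - cint g.
Proof.
move=> if_ ig; rewrite (@eq_cint _ (fun x => f x + (-1) * g x)).
  by rewrite cintD// ?cintZ// ?mulN1r//; exact: cintegrableZ.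
by move=> x; rewrite mulN1r.
Qed.

Lemma cint0 : cint (fun=> 0) = 0.
Proof. by rewrite /cint /Rintegral /= !integral0. Qed.

Lemma cint_sum (I : eqType) (r : seq I) (F : I -> T -> R[i]) :
  (forall i, i \in r -> cintegrable (F i)) ->
  cint (fun x => \sum_(i <- r) F i x) = \sum_(i <- r) cint (F i).
Proof.
elim: r => [_|i r IH iF].
  by rewrite big_nil -[RHS]cint0; apply: eq_cint => x; rewrite big_nil.
have irF : forall j, j \in r -> cintegrable (F j).
  by move=> j jr; apply: iF; rewrite inE jr orbT.
rewrite big_cons -IH// -cintD; [|exact: iF (mem_head _ _)|].
  by apply: eq_cint => x; rewrite big_cons.
elim: r irF {IH iF} => [_|j r IH irF].
  by apply: (@cintegrable_eq (fun=> 0)) => [x|]; rewrite ?big_nil//; split; exact: integrable0.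
apply: (@cintegrable_eq (fun x => F j x + \sum_(i0 <- r) F i0 x)).
  by move=> x; rewrite big_cons.
apply: cintegrableD; first exact: irF (mem_head _ _).
by apply: IH => k kr; apply: irF; rewrite inE kr orbT.
Qed.

(** Multiplying f by the conjugate of its integral z makes the integral equal to
the real number |z|^2, so that only the real part of the integrand counts, and
the real part is at most the modulus. *)
Lemma normc_cint_EFin f : cintegrable f ->
  ((normc (cint f))%:E <= \int[mu]_x (normc (f x))%:E)%E.
Proof.
move=> if_; set z := cint f.
have [z0|z0] := eqVneq (normc z) 0.
  by rewrite z0; apply: integral_ge0 => x _; rewrite lee_fin normc_ge0.
have zp : 0 < normc z by rewrite lt_neqAle eq_sym z0 normc_ge0.
have conjzE : (z^*)%C * z = (normc z ^+ 2)%:C%C.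
  rewrite sqr_normcE; apply: complex_ext; rewrite ?Re_mul ?Im_mul; case: (z) => a b /=.
    by rewrite mulNr opprK -!expr2.
  by rewrite mulNr mulrC subrr.
have nconj : normc (z^*)%C = normc z.
  by rewrite !normcE; case: (z) => a b /=; rewrite sqrrN.
have iz := cintegrableZ (z^*)%C if_.
have E : normc z ^+ 2 = \int[mu]_x Re ((z^*)%C * f x).
  by have := congr1 (fun z : R[i] => Re z) (cintZ (z^*)%C if_); rewrite -/z conjzE /= => ->.
have : ((normc z ^+ 2)%:E <= (normc z)%:E * \int[mu]_x (normc (f x))%:E)%E.
  rewrite E /Rintegral fineK; last first.
    by apply: integrable_fin_num => //; case: iz.
  have pnf := nnmeas_normc (cintegrable_cmeas if_).
  rewrite -nnmeas_integralZl//; last by rewrite lee_fin ltW.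
  apply: le_trans (lee_abs _) _; apply: (le_trans (le_abse_integral _ _ _)) => //.
    by case: iz => /measurable_int.
  apply: ge0_le_integralT => x; rewrite ?abse_ge0// -EFinM lee_fin.
  by apply: (le_trans (Re_le_normc _)); rewrite ComplexField.Normc.normcM nconj.
rewrite expr2 EFinM lee_pmul2l//.
Qed.

Lemma normc_cint_le f (c : \bar R) : cintegrable f ->
  (\int[mu]_x (normc (f x))%:E <= c)%E -> ((normc (cint f))%:E <= c)%E.
Proof. by move=> if_; exact: le_trans (normc_cint_EFin if_). Qed.

(** Apply dominated convergence to the modulus of F k - f, which is at most 2 u.
*)
Lemma cint_dominated (F : nat -> T -> R[i]) f (u : T -> \bar R) :
  (forall k, cmeas (F k)) -> cmeas f ->
  (forall x, (fun k => normc (F k x - f x)) @ \oo --> 0) ->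
  (forall k x, ((normc (F k x))%:E <= u x)%E) -> measurable_fun setT u ->
  (\int[mu]_x u x < +oo)%E ->
  cintegrable f /\ (fun k => normc (cint (F k) - cint f)) @ \oo --> 0.
Proof.
move=> mF mf cvF Fu mu_ uoo.
have u0 x : (0 <= u x)%E by apply: le_trans (Fu 0%N x); rewrite lee_fin normc_ge0.
have fu x : ((normc (f x))%:E <= u x)%E.
  case: (u x) (u0 x) (Fu ^~ x) => [c| |] // _ Fc; last by rewrite leey.
  rewrite lee_fin; apply/ler_addgt0Pl => e e0.
  have [k _ hk] : \forall k \near \oo, normc (F k x - f x) < e.
    by move/cvgrPdist_lt : (cvF x) => /(_ e e0); apply: filterS => k;
      rewrite sub0r normrN ger0_norm ?normc_ge0.
  have := hk k (leqnn k) => /ltW hk'.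
  rewrite -[f x](subKr (F k x)) (le_trans (le_normcD _ _))// addrC lerD//; last first.
    by have := Fc k; rewrite lee_fin.
  by rewrite normcN.
have if_ : cintegrable f by exact: cintegrable_le fu uoo.
have iF k : cintegrable (F k) by apply: cintegrable_le uoo.
split=> //.
have iu : mu.-integrable setT (fun x => u x + u x)%E.
  apply: integrableD => //; apply/integrableP; split => //;
  by under eq_integral do rewrite gee0_abs//.
have [] := @dominated_convergence _ _ _ mu setT measurableT
  (fun k x => (normc (F k x - f x))%:E) (cst 0%E) (fun x => u x + u x)%E.
- by move=> k; apply/measurable_EFinP/measurable_normc; exact: cmeasB.
- exact: measurable_cst.
- by apply: aeW => x _; apply: cvg_EFin; [exact: nearW|exact: cvF].
- exact: iu.
- apply: aeW => x k _; rewrite abse_EFin ger0_norm ?normc_ge0//.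
  apply: (@le_trans _ _ ((normc (F k x))%:E + (normc (f x))%:E)%E); last exact: leeD.
  by rewrite -EFinD lee_fin -(normcN (f x)) le_normcD.
move=> _; under eq_fun do under eq_integral do rewrite sube0 abse_EFin ger0_norm ?normc_ge0//.
move=> cv _.
apply/cvgrPdist_lt => e e0; near=> k.
rewrite sub0r normrN ger0_norm ?normc_ge0// -lte_fin -cintB//.
apply: le_lt_trans (normc_cint_EFin _) _; first exact: cintegrableB.
near: k.
have e0' : (0 < e%:E)%E by rewrite lte_fin.
exact: (cv (fun y => (y < e%:E)%E) (@open_ereal_lt' R _ _ e0')).
Unshelve. all: by end_near.
Qed.

End complex_integral.

Lemma cmeas_comp d d' (T : measurableType d) (T' : measurableType d') (R : realType)
    (f : T -> R[i]) (g : T' -> T) :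
  cmeas f -> measurable_fun setT g -> cmeas (fun x => f (g x)).
Proof. by move=> [m1 m2] mg; split; [exact: measurableT_comp m1 mg|exact: measurableT_comp m2 mg]. Qed.

Section complex_fubini.
Context d1 d2 (T1 : measurableType d1) (T2 : measurableType d2) (R : realType).
Variable m1 : {sigma_finite_measure set T1 -> \bar R}.
Variable m2 : {sigma_finite_measure set T2 -> \bar R}.
Variable f : T1 * T2 -> R[i].
Hypothesis mf : cmeas f.
Hypothesis if1 : forall x, cintegrable m2 (fun y => f (x, y)).
Hypothesis foo : (\int[m1]_x \int[m2]_y (normc (f (x, y)))%:E < +oo)%E.

Let iprod : cintegrable (m1 \x m2)%E f.
Proof.
apply/cintegrableP; split=> //.
by have [m0 p0] := nnmeas_normc mf; rewrite fubini_tonelli1.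
Qed.

Lemma cintegrable_fubini : cintegrable m1 (fun x => cint m2 (fun y => f (x, y))).
Proof.
have [ir ii] := iprod.
have fE (h : T1 * T2 -> R) : (forall x, m2.-integrable setT (EFin \o (fun y => h (x, y)))) ->
    (m1 \x m2)%E.-integrable setT (EFin \o h) ->
    m1.-integrable setT (EFin \o (fun x => \int[m2]_y h (x, y))).
  move=> h1 ih; have := integrable_fubini_F ih; rewrite /fubini_F.
  apply: eq_integrable => // x _ /=; rewrite /Rintegral fineK//.
  exact: integrable_fin_num (h1 x).
split; [apply: (fE (fun z => Re (f z))) => // x|apply: (fE (fun z => Im (f z))) => // x];
  by case: (if1 x).
Qed.

Hypothesis if2 : forall y, cintegrable m1 (fun x => f (x, y)).

Lemma cint_fubini :
  cint m1 (fun x => cint m2 (fun y => f (x, y))) =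
  cint m2 (fun y => cint m1 (fun x => f (x, y))).
Proof.
have [ir ii] := iprod.
have fE (h : T1 * T2 -> R) : (forall x, m2.-integrable setT (EFin \o (fun y => h (x, y)))) ->
    (forall y, m1.-integrable setT (EFin \o (fun x => h (x, y)))) ->
    (m1 \x m2)%E.-integrable setT (EFin \o h) ->
    \int[m1]_x \int[m2]_y h (x, y) = \int[m2]_y \int[m1]_x h (x, y).
  move=> h1 h2 ih; have /(congr1 fine) := Fubini ih.
  rewrite /Rintegral => E; transitivity (fine (\int[m1]_x \int[m2]_y (EFin \o h) (x, y))).
    by congr fine; apply: eq_integral => x _; rewrite fineK//; exact: integrable_fin_num (h1 x).
  rewrite E; congr fine; apply: eq_integral => y _; rewrite fineK//.
  exact: integrable_fin_num (h2 y).
congr (_ +i* _)%C; [apply: (fE (fun z => Re (f z))) => // x|apply: (fE (fun z => Im (f z))) => // x];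
  by [case: (if1 x)|case: (if2 x)].
Qed.

End complex_fubini.

Lemma prode_ge0_lty (R : realType) (I : Type) (s : seq I) (P : pred I) (u : I -> \bar R) :
  (forall i, P i -> (0 <= u i < +oo)%E) -> (0 <= \prod_(i <- s | P i) u i < +oo)%E.
Proof.
apply: (big_ind (fun z : \bar R => (0 <= z < +oo)%E)) => [|x y /andP[x0 xoo] /andP[y0 yoo]].
  by rewrite lee01 ltry.
by rewrite mule_ge0//= lte_mul_pinfty// ge0_fin_numE.
Qed.

Section cint_rV.
Context {R : realType}.
Local Notation leb1 := (@lebesgue_measure R).

Lemma cintegrable_affine n (c : R) (a : 'rV[R]_n) (f : 'rV[R]_n -> R[i]) : c != 0 ->
  cintegrable (leb n) f -> cintegrable (leb n) (fun x => f (c *: x + a)).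
Proof.
move=> c0 /cintegrableP[mf foo]; apply/cintegrableP.
split; first by apply: cmeas_comp mf _; exact: measurable_affine.
rewrite (@integral_affine R n c a (fun x => (normc (f x))%:E))//; last exact: nnmeas_normc.
by rewrite lte_mul_pinfty// lee_fin invr_ge0 exprn_ge0.
Qed.

Lemma cint_affine n (c : R) (a : 'rV[R]_n) (f : 'rV[R]_n -> R[i]) : c != 0 ->
  cintegrable (leb n) f ->
  cint (leb n) (fun x => f (c *: x + a)) = (`|c| ^- n)%:C%C * cint (leb n) f.
Proof.
move=> c0 [f1 f2].
have E (h : 'rV[R]_n -> R) : (leb n).-integrable setT (EFin \o h) ->
    \int[leb n]_x h (c *: x + a) = (`|c| ^- n) * \int[leb n]_x h x.
  move=> ih; have mh := measurable_int _ ih.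
  rewrite /Rintegral !(integralE _ _ (fun x => (h _)%:E)).
  have -> : (\int[leb n]_x ((fun x => (h (c *: x + a))%:E)^\+ x) =
     (`|c| ^- n)%:E * \int[leb n]_x ((EFin \o h)^\+ x))%E.
    rewrite -(@integral_affine R n c a ((EFin \o h)^\+)%E)//.
      by apply: eq_integral => x _; rewrite !funeposE.
    by split; [exact: measurable_funepos|move=> x; exact: funepos_ge0].
  have -> : (\int[leb n]_x ((fun x => (h (c *: x + a))%:E)^\- x) =
     (`|c| ^- n)%:E * \int[leb n]_x ((EFin \o h)^\- x))%E.
    rewrite -(@integral_affine R n c a ((EFin \o h)^\-)%E)//.
      by apply: eq_integral => x _; rewrite !funenegE.
    by split; [exact: measurable_funeneg|move=> x; exact: funeneg_ge0].
  have p1 : (\int[leb n]_x ((EFin \o h)^\+ x))%E \is a fin_num.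
    by apply: integrable_pos_fin_num.
  have p2 : (\int[leb n]_x ((EFin \o h)^\- x))%E \is a fin_num.
    by apply: integrable_neg_fin_num.
  rewrite -(fineK p1) -(fineK p2) -!EFinM -!EFinB /=.
  by rewrite mulrBr.
rewrite /cint (E _ f1) (E _ f2); apply: complex_ext; rewrite ?Re_mul ?Im_mul /=.
  by rewrite mul0r subr0.
by rewrite mul0r addr0.
Qed.

Lemma cint_cons n (f : 'rV[R]_n.+1 -> R[i]) : cintegrable (leb n.+1) f ->
  (forall x, cintegrable leb1 (fun t => f (rV_cons (x, t)))) ->
  cint (leb n.+1) f = cint (leb n) (fun x => cint leb1 (fun t => f (rV_cons (x, t)))).
Proof.
move=> if_ ifs.
have [f1 f2] := if_.
have mr : measurable_fun [set: 'rV[R]_n * measurableTypeR R] (@rV_cons R n) := @measurable_rV_cons R n.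
have mf := cintegrable_cmeas if_.
have E (h : 'rV[R]_n.+1 -> R) : (leb n.+1).-integrable setT (EFin \o h) ->
   (forall x, leb1.-integrable setT (EFin \o (fun t => h (rV_cons (x, t))))) ->
   \int[leb n.+1]_x h x = \int[leb n]_x \int[leb1]_t h (rV_cons (x, t)).
  move=> ih ihs.
  have ih' : (leb n \x leb1)%E.-integrable setT (EFin \o (fun z => h (rV_cons z))).
    have /integrableP[mh hoo] := ih; apply/integrableP; split.
      exact: measurableT_comp mh mr.
    apply: le_lt_trans hoo; rewrite (@integral_cons _ _ (fun x => `|(h x)%:E|%E)); last first.
      by split; [exact: measurableT_comp|move=> x; exact: abse_ge0].
    rewrite (@fubini_tonelli1 _ _ _ _ R (leb n) leb1 (fun z => `|(h (rV_cons z))%:E|%E))//.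
    by apply: measurableT_comp => //; exact: measurableT_comp mh mr.
  rewrite /Rintegral.
  transitivity (fine (\int[(leb n \x leb1)%E]_z (h (rV_cons z))%:E)).
    congr fine.
    exact: (@integral_pushforward _ _ _ _ R _ mr (leb n \x leb1)%E setT _ (measurable_int _ ih) ih').
  rewrite -(integral12_prod_meas1 ih') /fubini_F; congr fine.
  apply: eq_integral => x _; rewrite fineK//; exact: integrable_fin_num (ihs x).
congr (_ +i* _)%C; [apply: (E (fun z => Re (f z))) => // x|apply: (E (fun z => Im (f z))) => // x];
  by case: (ifs x).
Qed.

Lemma cintegrable_prod n (u : 'I_n -> R -> R[i]) :
  (forall i, cintegrable leb1 (u i)) ->
  cintegrable (leb n) (fun x => \prod_(i < n) u i (x ord0 i)).
Proof.
move=> iu; apply/cintegrableP; split.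
  apply: (@cmeas_prod _ _ _ _ _ (fun i (x : 'rV[R]_n) => u i (x ord0 i))) => i.
  by apply: cmeas_comp (cintegrable_cmeas (iu i)) _; exact: measurable_coord.
have -> : (\int[leb n]_x (normc (\prod_(i < n) u i (x ord0 i)))%:E =
    \int[leb n]_x \prod_(i < n) (normc (u i (x ord0 i)))%:E)%E.
  by apply: eq_integral => x _; rewrite normc_prod prodEFin.
rewrite (@integral_prod _ _ (fun i t => (normc (u i t))%:E)); last first.
  by move=> i; exact: nnmeas_normc (cintegrable_cmeas (iu i)).
have : (0 <= \prod_(i < n) \int[leb1]_t (normc (u i t))%:E < +oo)%E.
  apply: prode_ge0_lty => i _; rewrite (cintegrable_lty (iu i)) andbT.
  by apply: integral_ge0 => t _; rewrite lee_fin normc_ge0.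
by case/andP.
Qed.

Lemma cint_prod n (u : 'I_n -> R -> R[i]) :
  (forall i, cintegrable leb1 (u i)) ->
  cint (leb n) (fun x => \prod_(i < n) u i (x ord0 i)) = \prod_(i < n) cint leb1 (u i).
Proof.
elim: n u => [|n IH] u iu.
  rewrite big_ord0; under eq_cint do rewrite big_ord0.
  rewrite /cint /Rintegral /= !integral_dirac// diracE mem_set// mule0.
  by rewrite -EFinM /= mulr1.
have E x t : \prod_(i < n.+1) u i (rV_cons (x, t) ord0 i) =
    (\prod_(i < n) u (lift ord0 i) (x ord0 i)) * u ord0 t.
  rewrite big_ord_recl rV_cons0/= mulrC; congr (_ * _).
  by apply: eq_bigr => i _; rewrite rV_consS.
rewrite cint_cons; [|exact: cintegrable_prod|]; last first.
  by move=> x; apply: (cintegrable_eq (fun t => esym (E x t))); exact: cintegrableZ.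
rewrite big_ord_recl -(IH (fun i => u (lift ord0 i)))// -cintZ; last first.
  by apply: (cintegrable_prod (u := fun i => u (lift ord0 i))).
apply: eq_cint => x; rewrite (eq_cint _ (E x)) cintZ// mulrC//.
Qed.

End cint_rV.

(** * The Fourier transform and its inversion *)

Section complex_limits.
Context {R : realType}.
Implicit Types (u v : nat -> R[i]) (l m : R[i]).

Definition ccvg u l := (fun k => normc (u k - l)) @ \oo --> 0.

Lemma normc_cvg0 u (v : nat -> R) : (forall k, normc (u k) <= v k) ->
  v @ \oo --> 0 -> (fun k => normc (u k)) @ \oo --> 0.
Proof.
move=> uv v0; apply: squeeze_cvgr v0; last exact: (@cvg_cst _ 0).
by apply: nearW => k; rewrite normc_ge0 uv.
Qed.

Lemma ccvg_cst l : ccvg (fun=> l) l.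
Proof. by rewrite /ccvg subrr ComplexField.Normc.normc0; exact: cvg_cst. Qed.

Lemma ccvgP u l : ((fun k => Re (u k)) @ \oo --> Re l) ->
  ((fun k => Im (u k)) @ \oo --> Im l) -> ccvg u l.
Proof.
move=> c1 c2.
apply: (@normc_cvg0 _ (fun k => `|Re (u k) - Re l| + `|Im (u k) - Im l|)).
  by move=> k; apply: (le_trans (normc_le_ReIm _)); case: (u k) l {c1 c2} => a b [c e].
rewrite -(addr0 0); apply: cvgD.
  by apply/norm_cvg0P/subr_cvg0.
by apply/norm_cvg0P/subr_cvg0.
Qed.

Lemma ccvgD u v l m : ccvg u l -> ccvg v m -> ccvg (fun k => u k + v k) (l + m).
Proof.
move=> cu cv; apply: (@normc_cvg0 _ (fun k => normc (u k - l) + normc (v k - m))).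
  move=> k; rewrite (_ : u k + v k - (l + m) = (u k - l) + (v k - m)); last by ring.
  exact: le_normcD.
by rewrite -(addr0 0); exact: cvgD cu cv.
Qed.

Lemma ccvgM u v l m : ccvg u l -> ccvg v m -> ccvg (fun k => u k * v k) (l * m).
Proof.
move=> cu cv; apply: (@normc_cvg0 _ (fun k => normc (u k - l) * normc (v k - m) +
    (normc l * normc (v k - m) + normc (u k - l) * normc m))).
  move=> k; rewrite (_ : u k * v k - l * m = (u k - l) * (v k - m) +
    (l * (v k - m) + (u k - l) * m)); last by ring.
  rewrite (le_trans (le_normcD _ _))// ComplexField.Normc.normcM lerD2l.
  by rewrite (le_trans (le_normcD _ _))// !ComplexField.Normc.normcM.
have -> : 0 = 0 * 0 + (normc l * 0 + 0 * normc m) by rewrite !(mulr0, mul0r, addr0).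
by apply: cvgD; [exact: cvgM|apply: cvgD; [exact: cvgMr|exact: cvgMl]].
Qed.

Lemma ccvg_sum (I : Type) (r : seq I) (u : I -> nat -> R[i]) (l : I -> R[i]) :
  (forall i, ccvg (u i) (l i)) ->
  ccvg (fun k => \sum_(i <- r) u i k) (\sum_(i <- r) l i).
Proof.
move=> cu; elim: r => [|i r IH].
  by under eq_fun do rewrite big_nil; rewrite big_nil; exact: ccvg_cst.
by under eq_fun do rewrite big_cons; rewrite big_cons; exact: ccvgD.
Qed.

Lemma ccvg_unique u l m : ccvg u l -> ccvg u m -> l = m.
Proof.
move=> cl cm; apply/eqP; rewrite -subr_eq0; apply/eqP/ComplexField.Normc.eq0_normc.
have c0 : (fun k => normc (u k - l) + normc (u k - m)) @ \oo --> 0.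
  by rewrite -(addr0 0); exact: cvgD.
have le k : normc (l - m) <= normc (u k - l) + normc (u k - m).
  rewrite (_ : l - m = - (u k - l) + (u k - m)); last by ring.
  by rewrite (le_trans (le_normcD _ _))// normcN.
apply/eqP; rewrite eq_le normc_ge0 andbT.
by rewrite -(cvg_lim _ c0)//; apply: limr_ge; [exact: cvgP c0|exact: nearW].
Qed.

Lemma eq_ccvg u v l : (\forall k \near \oo, u k = v k) -> ccvg u l -> ccvg v l.
Proof.
move=> uv; apply: cvg_trans; apply: near_eq_cvg.
by apply: filterS (uv) => k ->.
Qed.

End complex_limits.

Section exponentials.
Context {R : realType}.

Lemma cisD (a b : R) : cis (a + b) = cis a * cis b.
Proof. by apply: complex_ext; rewrite ?Re_mul ?Im_mul /= ?cosD ?sinD// addrC mulrC [in X in _ + X]mulrC addrC; ring. Qed.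

Lemma cis0 : cis 0 = 1 :> R[i].
Proof. by apply: complex_ext; rewrite /= ?cos0 ?sin0. Qed.

Lemma normc_cis (a : R) : normc (cis a) = 1.
Proof. by rewrite normcE /= cos2Dsin2 sqrtr1. Qed.

Lemma ccvg_cis (u : nat -> R) (a : R) : u @ \oo --> a -> ccvg (fun k => cis (u k)) (cis a).
Proof.
by move=> ua; apply: ccvgP => /=; apply: continuous_cvg ua;
  [exact: continuous_cos|exact: continuous_sin].
Qed.

Lemma cmeas_cis d (T : measurableType d) (h : T -> R) : measurable_fun setT h ->
  cmeas (fun x => cis (h x)).
Proof.
move=> mh; split; apply: measurableT_comp mh.
  by apply: continuous_measurable_fun; exact: continuous_cos.
by apply: continuous_measurable_fun; exact: continuous_sin.
Qed.

Context {n : nat}.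
Local Notation Rn := 'rV[R]_n.
Implicit Types (x y xi : Rn).

(** The character e^(2 pi i <x, xi>) of R^n. *)
Definition chi x xi : R[i] := cis (2 * pi * dot x xi).

Lemma dotDl x y xi : dot (x + y) xi = dot x xi + dot y xi.
Proof. by rewrite /dot -big_split; apply: eq_bigr => i _; rewrite mxE mulrDl. Qed.

Lemma dotC x y : dot x y = dot y x.
Proof. by apply: eq_bigr => i _; rewrite mulrC. Qed.

Lemma dotZl c x xi : dot (c *: x) xi = c * dot x xi.
Proof. by rewrite /dot mulr_sumr; apply: eq_bigr => i _; rewrite mxE mulrA. Qed.

Lemma dotNl x xi : dot (- x) xi = - dot x xi.
Proof. by rewrite -scaleN1r dotZl mulN1r. Qed.

Lemma chiC x xi : chi x xi = chi xi x.
Proof. by rewrite /chi dotC. Qed.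

Lemma chiD x y xi : chi (x + y) xi = chi x xi * chi y xi.
Proof. by rewrite /chi dotDl mulrDr cisD. Qed.

Lemma chi0 xi : chi 0 xi = 1.
Proof. by rewrite /chi -(scale0r 0) dotZl mul0r mulr0 cis0. Qed.

Lemma chiZ c x xi : chi (c *: x) xi = chi x (c *: xi).
Proof. by rewrite /chi (dotC x) !dotZl dotC. Qed.

Lemma chiNE x xi : chi (- x) xi = cis (- (2 * pi * dot x xi)).
Proof. by rewrite /chi dotNl mulrN. Qed.

Lemma normc_chi x xi : normc (chi x xi) = 1.
Proof. exact: normc_cis. Qed.

Lemma measurable_dot2 d (T : measurableType d) (g h : T -> Rn) :
  measurable_fun setT g -> measurable_fun setT h ->
  measurable_fun setT (fun z => dot (g z) (h z)).
Proof.
move=> mg mh; rewrite /dot; apply: measurable_sum => i; apply: measurable_funM.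
  exact: measurableT_comp (measurable_coord i) mg.
exact: measurableT_comp (measurable_coord i) mh.
Qed.

Lemma cmeas_chi d (T : measurableType d) (g h : T -> Rn) :
  measurable_fun setT g -> measurable_fun setT h -> cmeas (fun z => chi (g z) (h z)).
Proof. by move=> mg mh; apply: cmeas_cis; apply: measurable_funM => //; exact: measurable_dot2. Qed.

Lemma cvg_dot (u : nat -> Rn) x xi : u @ \oo --> x -> (fun k => dot (u k) xi) @ \oo --> dot x xi.
Proof.
move=> ux; apply: cvg_big => // [|i _]; first exact: add_continuous.
apply: cvgMl.
exact: (@cvg_comp _ _ _ u (fun y : Rn => y ord0 i) _ _ _ ux (@coord_continuous R _ _ ord0 i x)).
Qed.

Lemma ccvg_chi (u : nat -> Rn) x xi : u @ \oo --> x -> ccvg (fun k => chi (u k) xi) (chi x xi).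
Proof. by move=> ux; apply: ccvg_cis; apply: cvgMr; exact: cvg_dot. Qed.

(** Continuity along sequences is what dominated convergence gives for integrals
that depend on a parameter. *)
Definition seq_continuous (g : Rn -> R[i]) :=
  forall (u : nat -> Rn) x, u @ \oo --> x -> ccvg (fun k => g (u k)) (g x).

Lemma ccontinuous_seq g : ccontinuous_on setT g -> seq_continuous g.
Proof.
move=> cg u x ux; have [c1 c2] := cg x I.
apply: ccvgP; [exact: continuous_cvg c1 ux|exact: continuous_cvg c2 ux].
Qed.

End exponentials.

Lemma cmeas_cint d1 d2 (T1 : measurableType d1) (T2 : measurableType d2) (R : realType)
    (m2 : {sigma_finite_measure set T2 -> \bar R}) (f : T1 * T2 -> R[i]) :
  cmeas f -> cmeas (fun x => cint m2 (fun y => f (x, y))).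
Proof.
have E (h : T1 * T2 -> R) : measurable_fun setT h ->
    measurable_fun setT (fun x => \int[m2]_y h (x, y)).
  move=> mh; rewrite /Rintegral; apply: measurableT_comp; first exact: fine_measurable.
  have mhE : measurable_fun setT (EFin \o h) by apply/measurable_EFinP.
  rewrite (_ : (fun _ => _) = (fun x => \int[m2]_y (EFin \o h)^\+ (x, y))
     \- (fun x => \int[m2]_y (EFin \o h)^\- (x, y)))%E.
    apply: emeasurable_funB.
      by apply: measurable_fun_fubini_tonelli_F => //; exact: measurable_funepos.
    by apply: measurable_fun_fubini_tonelli_F => //; exact: measurable_funeneg.
  apply/funext => x; rewrite integralE; congr (_ - _)%E; apply: eq_integral => y _.
    by rewrite !funeposE.
  by rewrite !funenegE.
by move=> [m1' m2']; split; [exact: (E (fun z => Re (f z)))|exact: (E (fun z => Im (f z)))].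
Qed.

Section fubini_product.
Context d1 d2 (T1 : measurableType d1) (T2 : measurableType d2) (R : realType).
Variable m1 : {sigma_finite_measure set T1 -> \bar R}.
Variable m2 : {sigma_finite_measure set T2 -> \bar R}.

(** The form of Fubini's theorem for Fourier integrals: as characters have
modulus one, the integrand is dominated by a product of integrable functions. *)
Lemma cint_fubini_prod (G : T1 * T2 -> R[i]) (g : T1 -> R[i]) (h : T2 -> R[i]) : cmeas G ->
  (forall x y, normc (G (x, y)) <= normc (g x) * normc (h y)) ->
  cintegrable m1 g -> cintegrable m2 h ->
  cintegrable m1 (fun x => cint m2 (fun y => G (x, y))) /\
  cint m1 (fun x => cint m2 (fun y => G (x, y))) =
  cint m2 (fun y => cint m1 (fun x => G (x, y))).
Proof.
move=> mG Ggh ig ih.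
have [mg goo] := (cintegrableP m1 g).1 ig; have [mh hoo] := (cintegrableP m2 h).1 ih.
have pg := nnmeas_normc mg; have ph := nnmeas_normc mh.
have g0 : (0 <= \int[m1]_x (normc (g x))%:E)%E by exact: nnmeas_integral_ge0.
have h0 : (0 <= \int[m2]_x (normc (h x))%:E)%E by exact: nnmeas_integral_ge0.
have i1 x : cintegrable m2 (fun y => G (x, y)).
  apply: (cintegrable_le (u := fun y => ((normc (g x))%:E * (normc (h y))%:E)%E)).
  - by apply: cmeas_comp mG _; exact: pair1_measurable.
  - by move=> y; rewrite -EFinM lee_fin.
  - by rewrite nnmeas_integralZl ?lee_fin ?normc_ge0// lte_mul_pinfty// lee_fin normc_ge0.
have i2 y : cintegrable m1 (fun x => G (x, y)).
  apply: (cintegrable_le (u := fun x => ((normc (h y))%:E * (normc (g x))%:E)%E)).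
  - by apply: cmeas_comp mG _; exact: pair2_measurable.
  - by move=> x; rewrite -EFinM lee_fin mulrC.
  - by rewrite nnmeas_integralZl ?lee_fin ?normc_ge0// lte_mul_pinfty// lee_fin normc_ge0.
have Goo : (\int[m1]_x \int[m2]_y (normc (G (x, y)))%:E < +oo)%E.
  apply: (@le_lt_trans _ _ (\int[m1]_x ((\int[m2]_y (normc (h y))%:E) * (normc (g x))%:E))%E).
    apply: ge0_le_integralT => x.
      by apply: integral_ge0 => y _; rewrite lee_fin normc_ge0.
    rewrite muleC -nnmeas_integralZl ?lee_fin ?normc_ge0//.
    by apply: ge0_le_integralT => y; rewrite ?lee_fin ?normc_ge0// -EFinM lee_fin.
  by rewrite nnmeas_integralZl// lte_mul_pinfty// ge0_fin_numE.
by split; [exact: cintegrable_fubini|exact: cint_fubini].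
Qed.

End fubini_product.

Section fourier_transform.
Context {R : realType} {n : nat}.
Local Notation Rn := 'rV[R]_n.
Local Notation mu := (@leb R n).
Implicit Types (x y xi : Rn) (g h : Rn -> R[i]).

(** The transform for s = -1 and its inverse for s = 1, whose theories coincide.
*)
Definition ft (s : R) g : Rn -> R[i] := fun xi => cint mu (fun x => g x * chi (s *: x) xi).

Lemma fourierE g : fourier g = ft (-1) g.
Proof. by apply/funext => xi; apply: eq_cint => x; rewrite scaleN1r chiNE. Qed.

Lemma inv_fourierE g : inv_fourier g = ft 1 g.
Proof. by apply/funext => x; apply: eq_cint => xi; rewrite scale1r chiC. Qed.

Lemma cintegrable_chi g (z : Rn -> Rn) xi : measurable_fun setT z ->
  cintegrable mu g -> cintegrable mu (fun x => g x * chi (z x) xi).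
Proof.
move=> mz ig; apply: (@cintegrable_eq _ _ _ _ (fun x => chi (z x) xi * g x)).
  by move=> x; rewrite mulrC.
apply: (cintegrableM_bounded (c := 1)) => //.
  by apply: cmeas_chi => //; exact: measurable_cst.
by move=> x; rewrite normc_chi.
Qed.

Lemma measurable_scale (s : R) : measurable_fun setT (fun x : Rn => s *: x).
Proof. rewrite (_ : (fun _ => _) = (fun x : Rn => s *: x + 0)); first exact: measurable_affine.
by apply/funext => x; rewrite addr0. Qed.

Lemma cintegrable_ft s g xi : cintegrable mu g -> cintegrable mu (fun x => g x * chi (s *: x) xi).
Proof. by move=> ig; apply: cintegrable_chi => //; exact: measurable_scale. Qed.

Lemma cmeas_ft s g : cmeas g -> cmeas (ft s g).
Proof.
move=> mg; apply: (@cmeas_cint _ _ _ _ _ mu (fun z : Rn * Rn => g z.2 * chi (s *: z.2) z.1)).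
apply: cmeasM; first by apply: cmeas_comp mg _; exact: measurable_snd.
apply: cmeas_chi; last exact: measurable_fst.
exact: measurableT_comp (measurable_scale s) measurable_snd.
Qed.

Lemma ft_bounded g : cintegrable mu g -> exists c : R, 0 <= c /\
  forall s xi, normc (ft s g xi) <= c.
Proof.
move=> ig; have [mg goo] := (cintegrableP mu g).1 ig.
have g0 : (0 <= \int[mu]_x (normc (g x))%:E)%E.
  by apply: integral_ge0 => x _; rewrite lee_fin normc_ge0.
exists (fine (\int[mu]_x (normc (g x))%:E)); split; first exact: fine_ge0.
move=> s xi; rewrite -lee_fin fineK ?ge0_fin_numE//.
apply: normc_cint_le; first exact: cintegrable_ft.
by apply: ge0_le_integralT => x; rewrite lee_fin ?normc_ge0// ComplexField.Normc.normcM normc_chi mulr1.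
Qed.

Lemma ft_seq_continuous s g : cintegrable mu g -> seq_continuous (ft s g).
Proof.
move=> ig u x ux; have [mg goo] := (cintegrableP mu g).1 ig.
suff [] : cintegrable mu (fun y => g y * chi (s *: y) x) /\
    ccvg (fun k => ft s g (u k)) (ft s g x) by [].
apply: (@cint_dominated _ _ _ mu (fun k y => g y * chi (s *: y) (u k)) _ (fun y => (normc (g y))%:E)).
- by move=> k; apply: cintegrable_cmeas; exact: cintegrable_ft.
- by apply: cintegrable_cmeas; exact: cintegrable_ft.
- move=> y; apply: (ccvgM (ccvg_cst _)); under eq_fun do rewrite chiC; rewrite chiC.
  exact: ccvg_chi.
- by move=> k y; rewrite ComplexField.Normc.normcM normc_chi mulr1.
- exact: (nnmeas_normc mg).1.
- exact: goo.
Qed.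

Lemma ft_multiplication s g h : cintegrable mu g -> cintegrable mu h ->
  cint mu (fun xi => ft s g xi * h xi) = cint mu (fun x => g x * ft s h x).
Proof.
move=> ig ih.
have [mg mh] := (cintegrable_cmeas ig, cintegrable_cmeas ih).
have mG : cmeas (fun z : Rn * Rn => (h z.1 * g z.2) * chi (s *: z.2) z.1).
  apply: cmeasM.
    by apply: cmeasM; [apply: cmeas_comp mh _|apply: cmeas_comp mg _];
      [exact: measurable_fst|exact: measurable_snd].
  apply: cmeas_chi; last exact: measurable_fst.
  exact: measurableT_comp (measurable_scale s) measurable_snd.
have [|_ E] := cint_fubini_prod mG _ ih ig.
  by move=> x y; rewrite /= !ComplexField.Normc.normcM normc_chi mulr1.
transitivity (cint mu (fun xi => cint mu (fun x => (h xi * g x) * chi (s *: x) xi))).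
  apply: eq_cint => xi; rewrite mulrC -cintZ; last exact: cintegrable_ft.
  by apply: eq_cint => x; rewrite mulrA.
rewrite E.
apply: eq_cint => x; rewrite -cintZ; last exact: cintegrable_ft.
by apply: eq_cint => xi; rewrite /= mulrA (mulrC (h xi)) chiZ chiC.
Qed.

(** Fubini's theorem: the character at x - y is the product of the characters at
x and at -y. *)
Lemma ft_convolution s g h x : cintegrable mu g -> cintegrable mu h ->
  cintegrable mu (fun y => ft s g (x - y) * h y) /\
  cint mu (fun y => ft s g (x - y) * h y) =
  cint mu (fun xi => g xi * ft (- s) h xi * chi (s *: x) xi).
Proof.
move=> ig ih.
have [mg mh] := (cintegrable_cmeas ig, cintegrable_cmeas ih).
have mG : cmeas (fun z : Rn * Rn => (h z.1 * g z.2) * chi (s *: z.2) (x - z.1)).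
  apply: cmeasM.
    by apply: cmeasM; [apply: cmeas_comp mh _|apply: cmeas_comp mg _];
      [exact: measurable_fst|exact: measurable_snd].
  apply: cmeas_chi.
    exact: measurableT_comp (measurable_scale s) measurable_snd.
  under eq_fun do rewrite addrC -scaleN1r.
  exact: measurableT_comp (measurable_affine _ _) measurable_fst.
have [] := cint_fubini_prod mG _ ih ig.
  by move=> y xi; rewrite /= !ComplexField.Normc.normcM normc_chi mulr1.
have E1 y : cint mu (fun xi => (h y * g xi) * chi (s *: xi) (x - y)) = ft s g (x - y) * h y.
  rewrite mulrC -cintZ; last exact: cintegrable_ft.
  by apply: eq_cint => xi; rewrite mulrA.
have E2 xi : cint mu (fun y => (h y * g xi) * chi (s *: xi) (x - y)) =
    g xi * ft (- s) h xi * chi (s *: x) xi.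
  rewrite mulrAC -cintZ; last exact: cintegrable_ft.
  apply: eq_cint => y; rewrite [chi (s *: xi) _]chiC chiD -(scaleN1r y).
  rewrite -!chiZ scalerA mulrN1 (mulrC (h y)) -!mulrA; congr (_ * _).
  by rewrite mulrCA.
move=> i1 e; split; first by apply: cintegrable_eq i1 => y; exact: E1.
by rewrite -(eq_cint _ E1) e; apply: eq_cint => xi; exact: E2.
Qed.

Lemma ft_dilate s g (t : R) : 0 < t -> cintegrable mu g ->
  cintegrable mu (dilate g t) /\ forall xi, ft s (dilate g t) xi = ft s g (t *: xi).
Proof.
move=> t0 ig.
have t1 : t^-1 != 0 by rewrite invr_eq0 gt_eqF.
have tn : `|t^-1| ^- n = t ^+ n by rewrite ger0_norm ?invr_ge0 ?ltW// exprVn invrK.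
split.
  apply: cintegrableZ; apply: cintegrable_eq (cintegrable_affine 0 t1 ig) => x.
  by rewrite addr0.
move=> xi; rewrite /ft.
have := cint_affine 0 t1 (cintegrable_ft s (t *: xi) ig).
rewrite tn => E; rewrite (_ : cint mu (fun x => g x * chi (s *: x) (t *: xi)) =
   (t ^- n)%:C%C * ((t ^+ n)%:C%C * cint mu (fun x => g x * chi (s *: x) (t *: xi)))); last first.
  by rewrite mulrA -rmorphM mulVf ?expf_neq0 ?gt_eqF// rmorph1 mul1r.
rewrite -E -cintZ; last first.
  exact: (cintegrable_affine 0 t1 (cintegrable_ft s (t *: xi) ig)).
apply: eq_cint => x; rewrite addr0 /dilate mulrA -chiZ !scalerA.
by rewrite (mulrC t s) mulfK ?gt_eqF.
Qed.

End fourier_transform.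

Section poisson_kernel.
Context {R : realType}.
Local Notation leb1 := (@lebesgue_measure R).

(** The integral of e^(-|t|) e^(i v t) over the real line. *)
Definition poisson1 (v : R) : R := 2 / (1 + v ^+ 2).

(** With one added to the cosine the integrand is nonnegative, and the
fundamental theorem of calculus on a half-line applies to nonnegative functions.
*)
Lemma integral_half_exp_cos (v : R) :
  (\int[leb1]_(t in `[0%R, +oo[) (expR (- t) * (1 + cos (v * t)))%:E =
  (1 + (1 + v ^+ 2)^-1)%:E)%E.
Proof.
have v1 : 0 < 1 + v ^+ 2 by rewrite ltr_pwDl// sqr_ge0.
pose S t := sin (v * t); pose C t := cos (v * t).
pose h := (1 + v ^+ 2)^-1 *: (v *: S - C) - cst 1.
pose E t : R := expR (- t).
pose F : R -> R := E * h.
have dl (t : R) : is_derive t (1 : R) (fun t : R => v * t) v.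
  have := @is_deriveZ R R R^o id v t 1 1 (is_derive_id t 1).
  by rewrite /GRing.scale/= mulr1.
have dS (t : R) : is_derive t (1 : R) S (v * cos (v * t)).
  rewrite mulrC; exact: (@is_derive1_comp R sin (fun t => v * t) t _ _ (is_derive_sin _) (dl t)).
have dC (t : R) : is_derive t (1 : R) C (v * (- sin (v * t))).
  rewrite mulrC; exact: (@is_derive1_comp R cos (fun t => v * t) t _ _ (is_derive_cos _) (dl t)).
have dE (t : R) : is_derive t (1 : R) E (-1 * expR (- t)).
  rewrite mulrC; exact: (@is_derive1_comp R expR -%R t _ _ (is_derive_expR _) (is_deriveNid t 1)).
have dF (t : R) : is_derive t (1 : R) F (expR (- t) * (1 + cos (v * t))).
  have dh : is_derive t 1 h ((1 + v ^+ 2)^-1 *: (v *: (v * cos (v * t)) - (v * (- sin (v * t)))) - 0).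
    exact: is_deriveB.
  apply: is_derive_eq (is_deriveM (dE t) dh) _.
  change (expR (- t) * ((1 + v ^+ 2)^-1 * (v * (v * cos (v * t)) - v * (- sin (v * t))) - 0) +
    ((1 + v ^+ 2)^-1 * (v * sin (v * t) - cos (v * t)) - 1) * (-1 * expR (- t)) =
    expR (- t) * (1 + cos (v * t))).
  by field; rewrite gt_eqF.
have F0 : F 0 = - (1 + (1 + v ^+ 2)^-1).
  rewrite /F /h /E /S /C !fctE /GRing.scale/= mulr0 oppr0 expR0 sin0 cos0.
  by field; rewrite gt_eqF.
have hb t : `|h t| <= `|v| + 1 + 1.
  rewrite /h !fctE /GRing.scale/= (le_trans (ler_normB _ _))// normr1 lerD2r.
  rewrite normrM ger0_norm ?invr_ge0 ?(ltW v1)//.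
  apply: (@le_trans _ _ (`|v * S t - C t|)).
    by rewrite ler_piMl// invf_le1// lerDl sqr_ge0.
  rewrite (le_trans (ler_normB _ _))// lerD//; last first.
    by rewrite /C ler_norml cos_geN1 cos_le1.
  by rewrite normrM ler_piMr// ler_norml sin_geN1 sin_le1.
have Foo : F x @[x --> +oo] --> 0.
  have c0 : expR (- x) * (`|v| + 1 + 1) @[x --> +oo] --> 0.
    by rewrite -(mul0r (`|v| + 1 + 1)); apply: cvgMl; exact: cvgr_expR.
  apply: (@squeeze_cvgr _ _ _ _ (fun x => - (expR (- x) * (`|v| + 1 + 1))) (fun x => expR (- x) * (`|v| + 1 + 1))) => //.
    apply: nearW => x; rewrite -ler_norml /F !fctE normrM ger0_norm ?expR_ge0//.
    by rewrite ler_wpM2l ?expR_ge0.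
  by rewrite -oppr0; exact: cvgN.
rewrite (@ge0_continuous_FTC2y _ _ F 0 0).
- by rewrite F0 -EFinB sub0r opprK.
- by move=> x _; rewrite mulr_ge0 ?expR_ge0// -lerBlDl sub0r cos_geN1.
- apply: continuous_subspaceT => x; apply: cvgM.
    by apply: continuous_cvg; [exact: continuous_expR|apply: cvgN; exact: cvg_id].
  apply: cvgD; first exact: cvg_cst.
  by apply: continuous_cvg; [exact: continuous_cos|apply: cvgMr; exact: cvg_id].
- exact: Foo.
- by move=> x _; exact: (@ex_derive _ _ _ _ _ _ _ (dF x)).
- apply: cvg_at_right_filter; apply: differentiable_continuous.
  by apply/derivable1_diffP; exact: (@ex_derive _ _ _ _ _ _ _ (dF 0)).
- by move=> x _; rewrite derive1E; exact: (@derive_val _ _ _ _ _ _ _ (dF x)).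
Qed.

Let continuous_expabs : continuous (fun t : R => expR (- `|t|)).
Proof.
move=> x; apply: continuous_cvg; first exact: continuous_expR.
by apply: cvgN; exact: norm_continuous.
Qed.

Let integral_exp_cos (v : R) :
  (\int[leb1]_t (expR (- `|t|) * (1 + cos (v * t)))%:E = (2 + poisson1 v)%:E)%E.
Proof.
have f0 x : 0 <= expR (- `|x|) * (1 + cos (v * x)).
  by rewrite mulr_ge0 ?expR_ge0// -lerBlDl sub0r cos_geN1.
have cf : continuous (fun x => expR (- `|x|) * (1 + cos (v * x))).
  move=> x; apply: cvgM; first exact: continuous_expabs.
  apply: cvgD; first exact: cvg_cst.
  by apply: continuous_cvg; [exact: continuous_cos|apply: cvgMr; exact: cvg_id].
have ef : (fun x => expR (- `|x|) * (1 + cos (v * x))) =1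
    (fun x => expR (- `|x|) * (1 + cos (v * x))) \o -%R.
  by move=> x /=; rewrite normrN mulrN cosN.
rewrite (ge0_symfun_integralT f0 cf ef) -set_itvcy.
rewrite (_ : (\int[leb1]_(x in _) _)%E =
    (\int[leb1]_(t in `[0%R, +oo[) (expR (- t) * (1 + cos (v * t)))%:E)%E).
  by rewrite integral_half_exp_cos -EFinM mulrDr mulr1.
by apply: eq_integral => x; rewrite inE/= in_itv/= andbT => x0; rewrite ger0_norm.
Qed.

Let mexp : measurable_fun setT (fun t : R => expR (- `|t|)).
Proof. exact: continuous_measurable_fun. Qed.

Let mexpE : nnmeas (fun t : R => (expR (- `|t|))%:E).
Proof. by split=> [|x]; [exact/measurable_EFinP|rewrite lee_fin expR_ge0]. Qed.

Let integral_expabs : (\int[leb1]_t (expR (- `|t|))%:E = 2%:E)%E.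
Proof.
have := integral_exp_cos 0; rewrite (_ : 2 + poisson1 0 = 2 * 2); last first.
  by rewrite /poisson1 expr0n/=; field.
under eq_integral do rewrite mul0r cos0 mulrC EFinM.
have two : (0 < (1 + 1 : R)%:E)%E by rewrite lte_fin; lra.
rewrite nnmeas_integralZl ?(ltW two)//.
case: (\int[leb1]_t _)%E => [r| |]; last 2 first.
- by rewrite gt0_muley.
- by rewrite gt0_muleNy.
by rewrite -EFinM => -[] h; congr EFin; lra.
Qed.

Lemma cintegrable_expabs (v : R) :
  cintegrable leb1 (fun t => (expR (- `|t|))%:C%C * cis (v * t)).
Proof.
apply: (@cintegrable_le _ _ _ leb1 _ (fun t => (expR (- `|t|))%:E)).
- by apply: cmeasM; [exact: cmeas_real|apply: cmeas_cis; exact: measurable_funM].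
- by move=> t; rewrite ComplexField.Normc.normcM normc_cis mulr1 normc_real ger0_norm ?expR_ge0.
- by rewrite integral_expabs ltry.
Qed.

Lemma cint_expabs (v : R) :
  cint leb1 (fun t => (expR (- `|t|))%:C%C * cis (v * t)) = (poisson1 v)%:C%C.
Proof.
have [i1 i2] := cintegrable_expabs v.
have i0 : leb1.-integrable setT (EFin \o (fun t => expR (- `|t|))).
  apply/integrableP; split; first by apply/measurable_EFinP.
  by under eq_integral do rewrite /= ger0_norm ?expR_ge0//; rewrite integral_expabs ltry.
have I0 : \int[leb1]_t expR (- `|t|) = 2 by rewrite /Rintegral integral_expabs.
apply: complex_ext => /=.
  have : \int[leb1]_t (expR (- `|t|) + Re ((expR (- `|t|))%:C%C * cis (v * t))) = 2 + poisson1 v.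
    rewrite /Rintegral -[RHS]/(fine (2 + poisson1 v)%:E) -integral_exp_cos; congr fine.
    by apply: eq_integral => t _; rewrite Re_mul /= mul0r subr0 mulrDr mulr1.
  by rewrite RintegralD// I0 => /addrI.
have msin : measurable_fun setT (fun t : R => expR (- `|t|) * (1 + sin (v * t))).
  apply: measurable_funM => //; apply: measurable_funD => //.
  apply: measurableT_comp; first by apply: continuous_measurable_fun; exact: continuous_sin.
  exact: measurable_funM.
have ps : nnmeas (fun t : measurableTypeR R => (expR (- `|t|) * (1 + sin (v * t)))%:E).
  split; first by apply/measurable_EFinP.
  by move=> t; rewrite lee_fin mulr_ge0 ?expR_ge0// -lerBlDl sub0r sin_geN1.
have N1 : (-1 : R) != 0 by rewrite oppr_eq0 oner_eq0.
have := integral_affine1 0 N1 ps.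
rewrite normrN1 invr1 mul1e => /(congr1 fine).
set I := \int[leb1]_x _.
have E1 : fine (\int[leb1]_t (expR (- `|t|) * (1 + sin (v * t)))%:E) = 2 + I.
  rewrite -I0 -RintegralD//; congr fine; apply: eq_integral => t _.
  by rewrite mul0r addr0 mulrDr mulr1.
have E2 : fine (\int[leb1]_t (expR (- `|-1 * t + 0|) * (1 + sin (v * (-1 * t + 0))))%:E) = 2 - I.
  rewrite -I0 -RintegralB//; congr fine; apply: eq_integral => t _.
  by rewrite mul0r !addr0 mulN1r normrN mulrN sinN mulrDr mulr1 mulrN.
rewrite E1 E2; lra.
Qed.

Lemma cintegrable_poisson1 :
  cintegrable leb1 (fun t => (poisson1 (2 * pi * t))%:C%C) /\
  cint leb1 (fun t => (poisson1 (2 * pi * t))%:C%C) = 1.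
Proof.
have p0 v : 0 <= poisson1 v by rewrite divr_ge0// addr_ge0// sqr_ge0.
have cp : continuous poisson1.
  move=> x; apply: cvgMr; apply: cvgV; first by rewrite gt_eqF// ltr_pwDl// sqr_ge0.
  by apply: cvgD; [exact: cvg_cst|exact: exprn_continuous].
have mp : measurable_fun setT poisson1 by exact: continuous_measurable_fun.
have pi2 : 2 * pi != 0 :> R by rewrite mulf_neq0 ?gt_eqF// pi_gt0.
have pp : nnmeas (fun t : measurableTypeR R => (poisson1 t)%:E).
  by split=> [|t]; [exact/measurable_EFinP|rewrite lee_fin].
have I2 : (\int[leb1]_t (poisson1 t)%:E = (2 * pi)%:E)%E.
  have ep : poisson1 =1 poisson1 \o -%R by move=> t /=; rewrite /poisson1 sqrrN.
  rewrite (ge0_symfun_integralT p0 cp ep) -set_itvcy.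
  have mo : measurable_fun setT (fun t : R => (oneDsqr t)^-1).
    apply: continuous_measurable_fun => x.
    by apply: cvgV; [rewrite gt_eqF// ltr_pwDl// sqr_ge0|apply: cvgD; [exact: cvg_cst|exact: exprn_continuous]].
  have po : nnmeas (fun t : measurableTypeR R => ((oneDsqr t)^-1)%:E).
    split; first by apply/measurable_EFinP.
    by move=> x; rewrite lee_fin invr_ge0 addr_ge0// sqr_ge0.
  rewrite (_ : (\int[leb1]_(x in _) _)%E = (\int[leb1]_(t in `[0%R, +oo[) (2%:E * (oneDsqr t)^-1%:E))%E) //.
  rewrite (@nnmeas_integralZl _ _ _ leb1 `[0%R, +oo[%classic _ 2%:E _ po)//.
  by rewrite integral0y_oneDsqr -!EFinM; congr EFin; field.
have I1 : (\int[leb1]_t (poisson1 (2 * pi * t))%:E = 1)%E.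
  have := integral_affine1 0 pi2 pp; rewrite I2 => E.
  rewrite -[LHS](_ : (\int[leb1]_t (poisson1 (2 * pi * t + 0))%:E)%E = _); last first.
    by apply: eq_integral => t _; rewrite addr0.
  by rewrite E -EFinM ger0_norm ?mulr_ge0 ?pi_ge0// mulVf.
have m1 : measurable_fun setT (fun t : R => poisson1 (2 * pi * t)).
  by apply: measurableT_comp mp _; exact: measurable_funM.
split.
  apply: (@cintegrable_le _ _ _ leb1 _ (fun t => (poisson1 (2 * pi * t))%:E)).
  - exact: cmeas_real.
  - by move=> t; rewrite normc_real ger0_norm.
  - by rewrite I1 ltry.
apply: complex_ext; rewrite /= /Rintegral ?I1//.
by rewrite integral0.
Qed.

Context {n : nat}.
Local Notation Rn := 'rV[R]_n.
Local Notation mu := (@leb R n).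

Definition abel (x : Rn) : R[i] := \prod_(i < n) (expR (- `|x ord0 i|))%:C%C.
(** The Fourier transform of abel, which is an approximate identity when
dilated: its integral is one (cint_poisson). *)
Definition poisson (x : Rn) : R[i] := \prod_(i < n) (poisson1 (2 * pi * x ord0 i))%:C%C.

Lemma cis_sum (I : Type) (r : seq I) (F : I -> R) :
  cis (\sum_(i <- r) F i) = \prod_(i <- r) cis (F i).
Proof.
elim: r => [|i r IH]; first by rewrite !big_nil cis0.
by rewrite !big_cons cisD IH.
Qed.

Lemma abel_chi s x xi : abel x * chi (s *: x) xi =
  \prod_(i < n) ((expR (- `|x ord0 i|))%:C%C * cis ((s * (2 * pi * xi ord0 i)) * x ord0 i)).
Proof.
rewrite big_split /=; congr (_ * _).
rewrite /chi /dot mulr_sumr cis_sum; apply: eq_bigr => i _.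
by congr cis; rewrite mxE; ring.
Qed.

Lemma ft_abel s xi : s ^+ 2 = 1 -> ft s abel xi = poisson xi.
Proof.
move=> s1; rewrite /ft (eq_cint _ (fun x => abel_chi s x xi)).
rewrite (@cint_prod _ _ (fun i t => (expR (- `|t|))%:C%C * cis ((s * (2 * pi * xi ord0 i)) * t))).
  by apply: eq_bigr => i _; rewrite cint_expabs /poisson1 exprMn s1 mul1r.
by move=> i; exact: cintegrable_expabs.
Qed.

Lemma cintegrable_abel : cintegrable mu abel.
Proof.
apply: cintegrable_eq (@cintegrable_prod _ n (fun _ t => (expR (- `|t|))%:C%C * cis (0 * t)) _).
  by move=> x; apply: eq_bigr => i _; rewrite mul0r cis0 mulr1.
by move=> i; exact: cintegrable_expabs.
Qed.

Lemma cintegrable_poisson : cintegrable mu poisson.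
Proof. apply: (@cintegrable_prod _ n (fun _ t => (poisson1 (2 * pi * t))%:C%C)) => i.
exact: cintegrable_poisson1.1. Qed.

Lemma cint_poisson : cint mu poisson = 1.
Proof.
rewrite (@cint_prod _ n (fun _ t => (poisson1 (2 * pi * t))%:C%C)) => [|i]; last exact: cintegrable_poisson1.1.
by rewrite big1// => i _; exact: cintegrable_poisson1.2.
Qed.

Lemma abelE x : abel x = (expR (- \sum_(i < n) `|x ord0 i|))%:C%C.
Proof. by rewrite /abel -sumrN expR_sum rmorph_prod. Qed.

Lemma normc_abel_le1 x : normc (abel x) <= 1.
Proof.
rewrite abelE normc_real ger0_norm ?expR_ge0// -expR0 ler_expR oppr_le0.
exact: sumr_ge0.
Qed.

Lemma ccvg_abel (e : nat -> R) x : (forall k, 0 <= e k) -> e @ \oo --> 0 ->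
  ccvg (fun k => abel (e k *: x)) 1.
Proof.
move=> e0 ce.
set S := \sum_(i < n) `|x ord0 i|.
have E k : abel (e k *: x) = (expR (- (e k * S)))%:C%C.
  rewrite abelE mulr_sumr; congr ((expR (- _))%:C%C); apply: eq_bigr => i _.
  by rewrite mxE normrM ger0_norm.
under eq_fun do rewrite E; apply: ccvgP => /=; last exact: cvg_cst.
rewrite -[X in _ --> X]expR0; apply: continuous_cvg; first exact: continuous_expR.
rewrite -oppr0; apply: cvgN.
by rewrite -(mul0r S); exact: cvgMl.
Qed.

Lemma chiN (x xi : Rn) : chi (- x) xi = chi x (- xi).
Proof. by rewrite /chi dotNl dotC -dotNl dotC. Qed.

Lemma chiDr (x y z : Rn) : chi x (y + z) = chi x y * chi x z.
Proof. by rewrite ![chi x _]chiC chiD. Qed.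

(** Abel summation. The integrals of ft s g times the characters damped by abel
(e k xi) converge to the left-hand side, by dominated convergence. By
ft_multiplication they are also the integrals of g against Poisson kernels of
width e k centred at x, which converge to g x. *)
Lemma ft_inversion (s : R) (g : Rn -> R[i]) (c : R) : s ^+ 2 = 1 ->
  cintegrable mu g -> (forall x, normc (g x) <= c) -> seq_continuous g ->
  cintegrable mu (ft s g) -> forall x, ft (- s) (ft s g) x = g x.
Proof.
move=> s1 ig gc cg ig' x.
pose e (k : nat) : R := k.+1%:R^-1.
have e_gt0 k : 0 < e k by rewrite invr_gt0.
have ce : e @ \oo --> 0 by exact: cvg_harmonic.
have mg := cintegrable_cmeas ig.
have [mP Poo] := (cintegrableP mu poisson).1 cintegrable_poisson.
pose h k xi := abel (e k *: xi) * chi (- s *: xi) x.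
have iak k : cintegrable mu (fun xi => abel (e k *: xi)).
  apply: cintegrable_eq (cintegrable_affine 0 (lt0r_neq0 (e_gt0 k)) cintegrable_abel) => y.
  by rewrite addr0.
have ih k : cintegrable mu (h k) by exact: cintegrable_ft.
have hE k y : ft s (h k) y = ((e k) ^- n)%:C%C * poisson ((e k)^-1 *: (y - x)).
  have := cint_affine 0 (lt0r_neq0 (e_gt0 k)) (cintegrable_ft s ((e k)^-1 *: (y - x)) cintegrable_abel).
  rewrite -/(ft s abel _) ft_abel// ger0_norm ?(ltW (e_gt0 k))// => <-.
  have ek : e k != 0 by rewrite lt0r_neq0.
  apply: eq_cint => xi; rewrite addr0 /h -mulrA; congr (_ * _).
  by rewrite scaleNr chiN -chiDr addrC /chi !dotZl [dot xi (_ *: _)]dotC dotZl [dot (y - x) xi]dotC mulVKf.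
have EL k : cint mu (fun xi => ft s g xi * h k xi) = cint mu (fun u => g (e k *: u + x) * poisson u).
  rewrite ft_multiplication//.
  have ek0 : (e k)^-1 != 0 by rewrite invr_eq0 lt0r_neq0.
  have ig2 : cintegrable mu (fun u => g (e k *: u + x) * poisson u).
    apply: (cintegrableM_bounded (c := c)) => //; last exact: cintegrable_poisson.
    by apply: cmeas_comp mg _; exact: measurable_affine.
  have := cint_affine (- ((e k)^-1 *: x)) ek0 ig2.
  rewrite ger0_norm ?invr_ge0 ?(ltW (e_gt0 k))// exprVn invrK => E.
  rewrite -[RHS]mul1r -(rmorph1 (real_complex R)).
  rewrite -(@mulVf _ (e k ^+ n)) ?expf_neq0 ?lt0r_neq0// rmorphM -mulrA -E.
  rewrite -cintZ; last exact: (cintegrable_affine (- ((e k)^-1 *: x)) ek0 ig2).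
  apply: eq_cint => y; rewrite hE mulrCA.
  by rewrite -!scalerBr scalerA divff ?lt0r_neq0// scale1r subrK.
have cL : ccvg (fun k => cint mu (fun xi => ft s g xi * h k xi)) (ft (- s) (ft s g) x).
  suff [] : cintegrable mu (fun xi => ft s g xi * chi (- s *: xi) x) /\
      ccvg (fun k => cint mu (fun xi => ft s g xi * h k xi)) (ft (- s) (ft s g) x) by [].
  apply: (@cint_dominated _ _ _ mu (fun k xi => ft s g xi * h k xi) _ (fun xi => (normc (ft s g xi))%:E)).
  - by move=> k; apply: cmeasM; [exact: cintegrable_cmeas ig'|exact: cintegrable_cmeas (ih k)].
  - by apply: cintegrable_cmeas; exact: cintegrable_ft.
  - move=> xi; apply: (ccvgM (ccvg_cst _)); rewrite -[X in ccvg _ X]mul1r; apply: ccvgM.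
      by apply: ccvg_abel => // k; exact: ltW.
    exact: ccvg_cst.
  - move=> k xi; rewrite !ComplexField.Normc.normcM normc_chi mulr1 lee_fin.
    by rewrite ler_piMr ?normc_ge0// normc_abel_le1.
  - exact: (nnmeas_normc (cintegrable_cmeas ig')).1.
  - exact: cintegrable_lty.
have cR : ccvg (fun k => cint mu (fun xi => ft s g xi * h k xi)) (g x).
  under eq_fun do rewrite EL.
  rewrite (_ : g x = cint mu (fun u => g x * poisson u)); last first.
    by rewrite cintZ ?cint_poisson ?mulr1//; exact: cintegrable_poisson.
  have c0 : 0 <= c by apply: le_trans (gc 0); exact: normc_ge0.
  suff [] : cintegrable mu (fun u => g x * poisson u) /\
      ccvg (fun k => cint mu (fun u => g (e k *: u + x) * poisson u)) (cint mu (fun u => g x * poisson u)) by [].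
  apply: (@cint_dominated _ _ _ mu (fun k u => g (e k *: u + x) * poisson u) _ (fun u => (c%:E * (normc (poisson u))%:E)%E)).
  - by move=> k; apply: cmeasM => //; apply: cmeas_comp mg _; exact: measurable_affine.
  - by apply: cmeasM => //; exact: cmeas_cst.
  - move=> u; apply: ccvgM (ccvg_cst _); apply: cg.
    rewrite -[X in _ --> X]add0r -(scale0r u); apply: cvgD; last exact: cvg_cst.
    by apply: cvgZl.
  - by move=> k u; rewrite ComplexField.Normc.normcM -EFinM lee_fin ler_wpM2r ?normc_ge0.
  - by apply: emeasurable_funM => //; exact: (nnmeas_normc mP).1.
  - rewrite nnmeas_integralZl ?lee_fin//; last exact: nnmeas_normc.
    by rewrite lte_mul_pinfty// lee_fin.
exact: ccvg_unique cL cR.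
Qed.

End poisson_kernel.

(** * Partial derivatives and Schwartz functions *)

Section derivatives.
Context {R : realType}.
Local Notation leb1 := (@lebesgue_measure R).

Definition on_segment (s : R) (D : R -> R[i]) : R -> R[i] :=
  fun u => (\1_(`[0, s] : set R) u)%:C%C * D u.

Lemma cint_FTC (Phi D : R -> R[i]) (s : R) : 0 < s ->
  (forall u : R, is_derive u (1 : R) (fun u => Re (Phi u)) (Re (D u))) ->
  (forall u : R, is_derive u (1 : R) (fun u => Im (Phi u)) (Im (D u))) ->
  continuous (fun u => Re (D u)) -> continuous (fun u => Im (D u)) ->
  cintegrable leb1 (on_segment s D) /\ cint leb1 (on_segment s D) = Phi s - Phi 0.
Proof.
move=> s0 d1 d2 c1 c2.
have E (h h' : R -> R) : (forall u : R, is_derive u (1 : R) h (h' u)) -> continuous h' ->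
    leb1.-integrable setT (EFin \o (fun u => \1_(`[0, s] : set R) u * h' u)) /\
    \int[leb1]_u (\1_(`[0, s] : set R) u * h' u) = h s - h 0.
  move=> dh ch.
  have ih : leb1.-integrable `[0, s] (EFin \o h').
    by apply: continuous_compact_integrable; [exact: segment_compact|exact: continuous_subspaceT].
  have eqh : (fun u => (\1_(`[0, s] : set R) u * h' u)%:E) = (EFin \o h') \_ (`[0, s] : set R).
    apply/funext => u; rewrite /patch indicE; case: ifP => _; first by rewrite mul1r.
    by rewrite mul0r.
  split.
    have [+ _] := @integrable_mkcond _ _ _ leb1 (`[0, s] : set R) (EFin \o h') (measurable_itv _).
    by rewrite -eqh => /(_ ih).
  have ch0 x : {for x, continuous h}.
    by apply: differentiable_continuous; apply/derivable1_diffP; exact: (@ex_derive _ _ _ _ _ _ _ (dh x)).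
  rewrite /Rintegral eqh -integral_mkcond (@continuous_FTC2 _ h' h 0 s)//.
  - exact: continuous_subspaceT.
  - split=> [x _||]; first exact: (@ex_derive _ _ _ _ _ _ _ (dh x)).
      by apply: cvg_at_right_filter; exact: ch0.
    by apply: cvg_at_left_filter; exact: ch0.
  - by move=> x _; rewrite derive1E; exact: (@derive_val _ _ _ _ _ _ _ (dh x)).
have [i1 e1] := E _ _ d1 c1; have [i2 e2] := E _ _ d2 c2.
have eR u : Re (on_segment s D u) = \1_(`[0, s] : set R) u * Re (D u).
  by rewrite Re_mul /= mul0r subr0.
have eI u : Im (on_segment s D u) = \1_(`[0, s] : set R) u * Im (D u).
  by rewrite Im_mul /= mul0r addr0.
split; first by split; [move: i1|move: i2]; congr (_.-integrable _ _); apply/funext => u /=; rewrite ?eR ?eI.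
rewrite /cint; under eq_Rintegral do rewrite eR; under [in X in (_ +i* X)%C]eq_Rintegral do rewrite eI.
by rewrite e1 e2; case: (Phi s) (Phi 0) => [a b] [a' b'].
Qed.

Lemma integral_indic_segment (s : R) : 0 < s ->
  (\int[leb1]_u (\1_(`[0%R, s] : set R) u)%:E = s%:E)%E.
Proof.
move=> s0; rewrite integral_indic// setIT; transitivity (leb1 [set` `[0, s]%R]); first by [].
by rewrite lebesgue_measure_itv /= lte_fin s0 -EFinB subr0.
Qed.

Lemma cint_cis (a s : R) : 0 < s ->
  cintegrable leb1 (on_segment s (fun u => cis (a * u))) /\
  (0 +i* a)%C * cint leb1 (on_segment s (fun u => cis (a * u))) = cis (a * s) - 1.
Proof.
move=> s0.
have dl (t : R) : is_derive t (1 : R) (fun t : R => a * t) a.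
  have := @is_deriveZ R R R^o id a t 1 1 (is_derive_id t 1).
  by rewrite /GRing.scale/= mulr1.
have cl : continuous (fun t : R => a * t) by move=> x; apply: cvgMr; exact: cvg_id.
pose D u : R[i] := (0 +i* a)%C * cis (a * u).
have [] := @cint_FTC (fun u => cis (a * u)) D s s0.
- move=> u; rewrite /D Re_mul /= mul0r sub0r -mulrN mulrC.
  exact: (@is_derive1_comp R cos (fun t => a * t) u _ _ (is_derive_cos _) (dl u)).
- move=> u; rewrite /D Im_mul /= mul0r add0r mulrC.
  exact: (@is_derive1_comp R sin (fun t => a * t) u _ _ (is_derive_sin _) (dl u)).
- rewrite (_ : (fun _ => _) = fun u => - (a * sin (a * u))); last first.
    by apply/funext => u; rewrite /D Re_mul /= mul0r sub0r.
  move=> x; apply: cvgN; apply: cvgMr; apply: (continuous_cvg _ _ (cl x)); exact: continuous_sin.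
- rewrite (_ : (fun _ => _) = fun u => a * cos (a * u)); last first.
    by apply/funext => u; rewrite /D Im_mul /= mul0r add0r.
  move=> x; apply: cvgMr; apply: (continuous_cvg _ _ (cl x)); exact: continuous_cos.
rewrite mulr0 cis0 => iD eD.
have is_ : cintegrable leb1 (on_segment s (fun u => cis (a * u))).
  apply: (@cintegrable_le _ _ _ leb1 _ (fun u => (\1_(`[0, s] : set R) u)%:E)).
  - apply: cmeasM; first by apply: cmeas_real; exact: measurable_indic.
    by apply: cmeas_cis; exact: measurable_funM.
  - by move=> u; rewrite ComplexField.Normc.normcM normc_cis mulr1 normc_real ger0_norm// indicE.
  - by rewrite integral_indic_segment// ltry.
split => //; rewrite -cintZ// -eD; apply: eq_cint => u.
by rewrite /on_segment /D mulrCA.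
Qed.

Context {n : nat}.
Local Notation Rn := 'rV[R]_n.
Local Notation mu := (@leb R n).
Implicit Types (phi f g : Rn -> R[i]).

Local Notation e_ k := (delta_mx ord0 k : Rn).

Lemma line_derive (h : Rn -> R) (k : 'I_n) (x : Rn) (u : R) :
  derivable h (x + u *: e_ k) (e_ k) ->
  is_derive u (1 : R) (fun u => h (x + u *: e_ k)) ('D_(e_ k) h (x + u *: e_ k)).
Proof.
have E : (fun d : R => d^-1 *: (((fun u => h (x + u *: e_ k)) \o shift u) (d *: 1) - h (x + u *: e_ k))) =
   (fun d : R => d^-1 *: ((h \o shift (x + u *: e_ k)) (d *: e_ k) - h (x + u *: e_ k))).
  apply/funext => d; congr (_ *: (_ - _)) => /=; congr h.
  by rewrite [d *: 1]mulr1 scalerDl addrCA.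
by move=> dh; apply: DeriveDef; rewrite /derivable/derive E.
Qed.

Lemma continuous_line (k : 'I_n) (x : Rn) : continuous (fun u : R => x + u *: e_ k).
Proof.
move=> u; apply: cvgD; first exact: cvg_cst.
by apply: cvgZl; exact: cvg_id.
Qed.

Lemma Ck1_continuous phi : Ck 1 setT phi -> ccontinuous_on setT phi.
Proof. by case. Qed.

Lemma Ck1_partial_continuous phi k : Ck 1 setT phi -> ccontinuous_on setT (cpartial k phi).
Proof. by case=> _ /(_ k) []. Qed.

Lemma ccontinuous_cmeas g : ccontinuous_on setT g -> cmeas g.
Proof.
by move=> cg; split; apply: continuous_rV_measurable => x; case: (cg x I).
Qed.

(** Since phi is only integrable, boundary terms at infinity are not known to
vanish and one cannot integrate by parts over a whole line. Instead, the
increment phi (x + s e_k) - phi x is the integral of the partial derivative over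
a segment. Its transform is cis (a s) - 1 times that of phi, and by Fubini's
theorem it is E times that of the partial derivative, where E is the integral of
e^(i a u) over [0, s]. As cis (a s) - 1 = i a E, it remains to choose s such
that E is not zero. *)
Lemma fourier_partial phi (k : 'I_n) xi : Ck 1 setT phi -> cintegrable mu phi ->
  cintegrable mu (cpartial k phi) ->
  fourier (cpartial k phi) xi = Xi k xi * fourier phi xi.
Proof.
move=> phi1 iphi iD; rewrite !fourierE.
(* With this choice a s is pi or -pi, hence cis (a s) = -1 and E is not zero; if
the frequency vanishes in the direction k, then a = 0 and E = s. *)
pose s : R := if xi ord0 k == 0 then 1 else (2 * `|xi ord0 k|)^-1.
have s0 : 0 < s.
  by rewrite /s; case: ifPn => // x0; rewrite invr_gt0 mulr_gt0// normr_gt0.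
have cphi := Ck1_continuous phi1.
have cD := Ck1_partial_continuous k phi1.
have mphi := ccontinuous_cmeas cphi; have mD := ccontinuous_cmeas cD.
have line x := @cint_FTC (fun u => phi (x + u *: e_ k)) (fun u => cpartial k phi (x + u *: e_ k)) s s0.
have {line} line x : cintegrable leb1 (on_segment s (fun u => cpartial k phi (x + u *: e_ k))) /\
   cint leb1 (on_segment s (fun u => cpartial k phi (x + u *: e_ k))) = phi (x + s *: e_ k) - phi x.
  have [_ /(_ k)[dphi _]] := phi1.
  have := line x; rewrite scale0r addr0; apply.
  - move=> u; have [dr di] := dphi (x + u *: e_ k) I.
    exact: (@line_derive (fun y => Re (phi y)) k x u dr).
  - move=> u; have [dr di] := dphi (x + u *: e_ k) I.
    exact: (@line_derive (fun y => Im (phi y)) k x u di).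
  - move=> u; have [c1 c2] := cD (x + u *: e_ k) I.
    exact: (@continuous_comp _ _ _ (fun u : R => x + u *: e_ k) (fun y => Re (cpartial k phi y)) u (@continuous_line k x u) c1).
  - move=> u; have [c1 c2] := cD (x + u *: e_ k) I.
    exact: (@continuous_comp _ _ _ (fun u : R => x + u *: e_ k) (fun y => Im (cpartial k phi y)) u (@continuous_line k x u) c2).
pose a := 2 * pi * xi ord0 k.
have dote : dot (e_ k) xi = xi ord0 k.
  rewrite /dot (bigD1 k)//= mxE !eqxx mul1r big1 ?addr0// => i ik.
  by rewrite mxE (negbTE ik) andbF mul0r.
have chie u : chi (u *: e_ k) xi = cis (a * u).
  by rewrite /chi dotZl dote /a; congr cis; ring.
have [iE eE] := cint_cis a s0.
set E := cint leb1 _ in eE.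
have E0 : E != 0.
  apply/negP => /eqP E0; have := eE; rewrite E0 mulr0 => /esym/eqP.
  rewrite subr_eq0 /s; have [xi0|xi0] := eqVneq (xi ord0 k) 0.
    move=> _; move: E0; rewrite /E /a xi0 mulr0.
    have -> : cint leb1 (on_segment s (fun u => cis (0 * u))) =
        cint leb1 (fun u => (\1_(`[0, 1] : set R) u)%:C%C).
      apply: eq_cint; by move=> u; rewrite /on_segment /s xi0 eqxx mul0r cis0 mulr1.
    move/(congr1 (fun z : R[i] => Re z)) => /=; rewrite /Rintegral integral_indic_segment//.
    by move/eqP; rewrite oner_eq0.
  have -> : a * (2 * `|xi ord0 k|)^-1 = Num.sg (xi ord0 k) * pi.
    rewrite /a {1}(numEsg (xi ord0 k)); field.
    by rewrite normr_eq0.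
  move/eqP/(congr1 (fun z : R[i] => Re z)) => /=.
  have -> : cos (Num.sg (xi ord0 k) * pi) = -1.
    have [x0|x0] := ltP 0 (xi ord0 k); first by rewrite gtr0_sg// mul1r cospi.
    by rewrite ltr0_sg ?mulN1r ?cosN ?cospi// lt_neqAle xi0.
  by move/eqP; rewrite -subr_eq0 -opprD oppr_eq0 -mulr2n pnatr_eq0.
pose G (z : R * Rn) := on_segment s (fun u => cpartial k phi (z.2 + u *: e_ k)) z.1 * chi (-1 *: z.2) xi.
have mG : cmeas (G : measurableTypeR R * Rn -> R[i]).
  apply: cmeasM; last first.
    apply: cmeas_chi; last exact: measurable_cst.
    exact: measurableT_comp (measurable_scale _) measurable_snd.
  apply: cmeasM.
    apply: cmeas_real.
    have mI : measurable_fun [set: measurableTypeR R] (fun u => \1_(`[0, s] : set R) u : R).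
      by apply: measurable_indic; exact: measurable_itv.
    exact: (measurableT_comp mI measurable_fst).
  apply: cmeas_comp mD _.
  apply: measurable_fun_rV => i.
  rewrite (_ : (fun _ => _) = (fun z : measurableTypeR R * Rn => z.2 ord0 i + z.1 * e_ k ord0 i)); last first.
    by apply/funext => z; rewrite !mxE.
  apply: measurable_funD; first exact: measurableT_comp (measurable_coord i) measurable_snd.
  by apply: measurable_funM => //; exact: measurable_fst.
have iDx u : cintegrable mu (fun x => cpartial k phi (x + u *: e_ k)).
  apply: cintegrable_eq (cintegrable_affine (u *: e_ k) (oner_neq0 R) iD) => x.
  by rewrite scale1r.
have nD u : (\int[mu]_x (normc (cpartial k phi (x + u *: e_ k)))%:E =
    \int[mu]_x (normc (cpartial k phi x))%:E)%E.
  have := @integral_affine R n 1 (u *: e_ k) (fun x => (normc (cpartial k phi x))%:E) (oner_neq0 R) (nnmeas_normc mD).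
  rewrite normr1 expr1n invr1 mul1e => <-.
  by apply: eq_integral => x _; rewrite scale1r.
have G1 u : cintegrable mu (fun x => G (u, x)).
  apply: cintegrable_chi; first exact: measurable_scale.
  exact: (cintegrableZ (\1_(`[0, s] : set R) u)%:C%C (iDx u)).
have Goo : (\int[leb1]_u \int[mu]_x (normc (G (u, x)))%:E < +oo)%E.
  apply: (@le_lt_trans _ _ (\int[leb1]_u ((\int[mu]_x (normc (cpartial k phi x))%:E) * (\1_(`[0, s] : set R) u)%:E))%E).
    apply: ge0_le_integralT => u; first by apply: integral_ge0 => x _; rewrite lee_fin normc_ge0.
    have pD := nnmeas_normc (cintegrable_cmeas (iDx u)).
    have I0 : (0 <= (\1_(`[0, s] : set R) u)%:E :> \bar R)%E by rewrite lee_fin indicE.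
    rewrite -(nD u) muleC -(nnmeas_integralZl _ measurableT pD I0).
    apply: ge0_le_integralT => x; first by rewrite lee_fin normc_ge0.
    rewrite -EFinM lee_fin !ComplexField.Normc.normcM normc_chi mulr1 normc_real.
    by rewrite ger0_norm// indicE.
  have pI : nnmeas (fun u : measurableTypeR R => (\1_(`[0, s] : set R) u : R)%:E).
    by apply: nnmeas_indic; exact: measurable_itv.
  have D0 : (0 <= \int[mu]_x (normc (cpartial k phi x))%:E)%E.
    by apply: integral_ge0 => x _; rewrite lee_fin normc_ge0.
  rewrite (nnmeas_integralZl _ measurableT pI D0).
  rewrite integral_indic_segment// lte_mul_pinfty// ?ltry//.
  by rewrite ge0_fin_numE// (cintegrable_lty iD).
have G2 x : cintegrable leb1 (fun u => G (u, x)).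
  apply: cintegrable_eq (cintegrableZ (chi (-1 *: x) xi) (line x).1) => u.
  by rewrite mulrC.
have := cint_fubini mG G1 Goo G2.
have -> : cint leb1 (fun u => cint mu (fun x => G (u, x))) = ft (-1) (cpartial k phi) xi * E.
  rewrite /E -cintZ//; apply: eq_cint => u.
  rewrite /G /on_segment mulrCA.
  transitivity ((\1_(`[0, s] : set R) u)%:C%C * cint mu (fun x => cpartial k phi (x + u *: e_ k) * chi (-1 *: x) xi)).
    rewrite -cintZ; last exact: cintegrable_ft.
    by apply: eq_cint => x; rewrite mulrA.
  congr (_ * _); rewrite mulrC -cintZ; last exact: cintegrable_ft.
  have ic : cintegrable mu (fun x => cis (a * u) * (cpartial k phi x * chi (-1 *: x) xi)).
    by apply: cintegrableZ; exact: cintegrable_ft.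
  have := cint_affine (u *: e_ k) (oner_neq0 R) ic.
  rewrite normr1 expr1n invr1 rmorph1 mul1r => <-.
  apply: eq_cint => x; rewrite scale1r mulrCA; congr (_ * _).
  rewrite scalerDr chiD -chie !scaleN1r mulrCA -chiD subrr chi0 mulr1//.
have -> : cint mu (fun x => cint leb1 (fun u => G (u, x))) = (cis (a * s) - 1) * ft (-1) phi xi.
  transitivity (cint mu (fun x => phi (x + s *: e_ k) * chi (-1 *: x) xi - phi x * chi (-1 *: x) xi)).
    apply: eq_cint => x; rewrite -mulrBl -(line x).2 mulrC -cintZ; last exact: (line x).1.
    by apply: eq_cint => u; rewrite mulrC.
  have i1 : cintegrable mu (fun x => phi (x + s *: e_ k) * chi (-1 *: x) xi).
    apply: cintegrable_ft; apply: cintegrable_eq (cintegrable_affine (s *: e_ k) (oner_neq0 R) iphi) => x.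
    by rewrite scale1r.
  rewrite cintB//; last exact: cintegrable_ft.
  rewrite mulrBl mul1r; congr (_ - _).
  rewrite -cintZ; last exact: cintegrable_ft.
  have ic : cintegrable mu (fun x => cis (a * s) * (phi x * chi (-1 *: x) xi)).
    by apply: cintegrableZ; exact: cintegrable_ft.
  have := cint_affine (s *: e_ k) (oner_neq0 R) ic.
  rewrite normr1 expr1n invr1 rmorph1 mul1r => <-.
  apply: eq_cint => x; rewrite scale1r mulrCA; congr (_ * _).
  rewrite scalerDr chiD -chie !scaleN1r mulrCA -chiD subrr chi0 mulr1//.
rewrite -eE mulrAC => /(mulIf E0) ->; congr (_ * _).
Qed.

End derivatives.

Section schwartz_functions.
Context {R : realType} {n : nat}.
Local Notation Rn := 'rV[R]_n.
Local Notation mu := (@leb R n).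
Local Notation leb1 := (@lebesgue_measure R).
Implicit Types (f g : Rn -> R[i]) (A : {set 'I_n}).

Definition twice_on A (k : 'I_n) : nat := if k \in A then 2 else 0.

(** An integrable product of functions of one variable that dominates the
functions of rapid decrease. *)
Definition decay (x : Rn) : R := \prod_(k < n) (1 + x ord0 k ^+ 2)^-1.

Lemma decay_gt0 x : 0 < decay x.
Proof. by apply: prodr_gt0 => k _; rewrite invr_gt0 ltr_pwDl// sqr_ge0. Qed.

(** Take for A the set of coordinates of absolute value greater than one: the
factor 1 + x_k^2 is at most twice x_k^2 for k in A, and at most 2 otherwise. *)
Lemma decay_bound (x : Rn) (z : R) (M : {set 'I_n} -> R) : 0 <= z ->
  (forall A, `|\prod_(k < n) x ord0 k ^+ twice_on A k| * z <= M A) ->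
  z <= (2 ^+ n * \sum_A `|M A|) * decay x.
Proof.
move=> z0 zM; pose A : {set 'I_n} := finset (fun k => 1 < `|x ord0 k|).
have P0 : 0 < \prod_(k < n) (1 + x ord0 k ^+ 2).
  by apply: prodr_gt0 => k _; rewrite ltr_pwDl// sqr_ge0.
rewrite /decay prodfV ler_pdivlMr//.
apply: (@le_trans _ _ (2 ^+ n * (`|\prod_(k < n) x ord0 k ^+ twice_on A k| * z))).
  rewrite mulrA mulrC ler_wpM2r// normr_prod -[X in X ^+ n](mulr1 2).
  rewrite (_ : (2 * 1) ^+ n = \prod_(k < n) 2); last by rewrite prodr_const card_ord mulr1.
  rewrite -big_split /=; apply: ler_prod => k _.
  rewrite addr_ge0 ?sqr_ge0//= /twice_on inE.
  have x2 : x ord0 k ^+ 2 = `|x ord0 k| ^+ 2 by rewrite real_normK ?num_real.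
  case: ifPn => [x1|]; last first.
    rewrite -leNgt => x1; rewrite expr0 normr1 x2.
    have : `|x ord0 k| ^+ 2 <= 1 by rewrite expr_le1.
    by lra.
  rewrite normrX x2.
  have : 1 <= `|x ord0 k| ^+ 2 by rewrite expr_ge1// ltW.
  by lra.
rewrite ler_wpM2l ?exprn_ge0//; apply: (le_trans (zM A)); apply: (le_trans (ler_norm _)).
by rewrite (bigD1 A)//= lerDl sumr_ge0.
Qed.

Lemma continuous_inv1sqr : continuous (fun t : R => (1 + t ^+ 2)^-1).
Proof.
move=> x; apply: cvgV; first by rewrite gt_eqF// ltr_pwDl// sqr_ge0.
by apply: cvgD; [exact: cvg_cst|exact: exprn_continuous].
Qed.

Lemma nnmeas_inv1sqr : nnmeas (fun t : measurableTypeR R => ((1 + t ^+ 2)^-1)%:E).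
Proof.
split; first by apply/measurable_EFinP; exact: continuous_measurable_fun continuous_inv1sqr.
by move=> t; rewrite lee_fin invr_ge0 addr_ge0// sqr_ge0.
Qed.

Lemma integral_inv1sqr_lty : (\int[leb1]_t ((1 + t ^+ 2)^-1)%:E < +oo)%E.
Proof.
rewrite ge0_symfun_integralT//; last 3 first.
- by move=> x; rewrite invr_ge0 addr_ge0// sqr_ge0.
- exact: continuous_inv1sqr.
- by move=> t /=; rewrite sqrrN.
by rewrite -set_itvcy [X in (2%:E * X)%E]integral0y_oneDsqr -EFinM ltry.
Qed.

Lemma nnmeas_decay : nnmeas (fun x => (decay x)%:E).
Proof.
split=> [|x]; last by rewrite lee_fin ltW// decay_gt0.
apply/measurable_EFinP; apply: measurable_prod => i _.
have mu1 : measurable_fun [set: measurableTypeR R] (fun t : R => (1 + t ^+ 2)^-1).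
  exact: continuous_measurable_fun continuous_inv1sqr.
exact: (measurableT_comp mu1 (measurable_coord i)).
Qed.

Lemma integral_decay_lty : (\int[mu]_x (decay x)%:E < +oo)%E.
Proof.
under eq_integral do rewrite /decay -prodEFin.
rewrite (@integral_prod _ _ (fun _ t => ((1 + t ^+ 2)^-1)%:E)); last by move=> i; exact: nnmeas_inv1sqr.
have /andP[//] : (0 <= \prod_(i < n) \int[leb1]_t ((1 + t ^+ 2)^-1)%:E < +oo)%E.
apply: prode_ge0_lty => i _; rewrite integral_inv1sqr_lty andbT.
exact: nnmeas_integral_ge0 nnmeas_inv1sqr.
Qed.

Lemma cintegrable_decay (c : R) g : cmeas g ->
  (forall x, normc (g x) <= c * decay x) -> cintegrable mu g.
Proof.
move=> mg gc.
apply: (@cintegrable_le _ _ _ mu _ (fun x => (`|c|%:E * (decay x)%:E)%E)) => //.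
  move=> x; rewrite -EFinM lee_fin (le_trans (gc x))// ler_wpM2r ?ler_norm//.
  exact/ltW/decay_gt0.
rewrite nnmeas_integralZl//; last exact: nnmeas_decay.
by rewrite lte_mul_pinfty ?integral_decay_lty// lee_fin.
Qed.

Lemma smooth_cpartial k f : smooth f -> smooth (cpartial k f).
Proof. by move=> sf m; have [_ /(_ k) []] := sf m.+1. Qed.

Lemma smooth_continuous f : smooth f -> ccontinuous_on setT f.
Proof. by move=> sf; exact: (sf 0%N). Qed.

(** The iterated derivative multi_partial restricted to the directions in s,
which allows an induction over the directions. *)
Definition partials (s : seq 'I_n) (beta : 'I_n -> nat) f : Rn -> R[i] :=
  foldr (fun k g => iter (beta k) (cpartial k) g) f s.

Lemma smooth_iter k m f : smooth f -> smooth (iter m (cpartial k) f).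
Proof. by move=> sf; elim: m => //= m IH; exact: smooth_cpartial. Qed.

Lemma smooth_partials s beta f : smooth f -> smooth (partials s beta f).
Proof. by move=> sf; elim: s => //= k s IH; exact: smooth_iter. Qed.

Lemma eq_partials s beta beta' f : {in s, beta =1 beta'} ->
  partials s beta f = partials s beta' f.
Proof.
elim: s => //= k s IH e; rewrite (e k) ?mem_head// IH// => j js.
by apply: e; rewrite inE js orbT.
Qed.

(** Extending beta by zero turns derivatives in the directions of a final
segment into derivatives in all directions, to which the definition of Schwartz
functions applies. *)
Lemma partials_suffix p s beta f : uniq (p ++ s) ->
  partials s beta f = partials (p ++ s) (fun k => if k \in s then beta k else 0%N) f.
Proof.
elim: p => [_|k p IH /= /andP[kps ups]].
  by apply: eq_partials => k /= ->.
rewrite {}IH// ifF//; apply/negbTE; apply: contra kps.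
by rewrite mem_cat => ->; rewrite orbT.
Qed.

Lemma schwartz_multi_partial_integrable f beta : schwartz f -> cintegrable mu (multi_partial beta f).
Proof.
move=> [sf df].
have cf : ccontinuous_on setT (multi_partial beta f).
  by apply: smooth_continuous; exact: (@smooth_partials (enum 'I_n)).
have [M hM] : exists M : {set 'I_n} -> R, forall A (x : Rn),
    `|\prod_(k < n) x ord0 k ^+ twice_on A k| * normc (multi_partial beta f x) <= M A.
  by have /choice[M hM] := fun A => df (twice_on A) beta; exists M.
apply: (@cintegrable_decay (2 ^+ n * \sum_A `|M A|)).
  exact: ccontinuous_cmeas.
by move=> x; apply: decay_bound; [exact: normc_ge0|].
Qed.

(** Apply fourier_partial one derivative at a time; each intermediate derivative
is integrable because partials_suffix makes it a multi_partial of f. *)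
Lemma schwartz_partials_fourier f (p s : seq 'I_n) beta xi : schwartz f -> p ++ s = enum 'I_n ->
  fourier (partials s beta f) xi = \prod_(k <- s) Xi k xi ^+ beta k * fourier f xi.
Proof.
move=> sf; have [smf _] := sf.
have ups : uniq (enum 'I_n) by exact: enum_uniq.
elim: s p => [p _|k s IH p ps]; first by rewrite big_nil mul1r.
have ks : k \notin s.
  by move: ups; rewrite -ps cat_uniq /= => /and3P[_ _ /andP[]].
have key m : cintegrable mu (iter m (cpartial k) (partials s beta f)).
  pose beta' j := if j == k then m else beta j.
  have -> : iter m (cpartial k) (partials s beta f) = partials (k :: s) beta' f.
    rewrite /= {1}/beta' eqxx; congr (iter _ _ _); apply: eq_partials => j js.
    by rewrite /beta'; case: eqVneq => // jk; rewrite -jk js in ks.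
  rewrite (@partials_suffix p) ?ps//.
  exact: (schwartz_multi_partial_integrable _ sf).
have -> : fourier (partials (k :: s) beta f) xi = Xi k xi ^+ beta k * fourier (partials s beta f) xi.
  rewrite [partials _ _ _]/=; elim: (beta k) => [|m IHm]; first by rewrite mul1r.
  rewrite iterS fourier_partial; [|exact: (smooth_iter k m (smooth_partials s beta smf) 1)|exact: key m|exact: key m.+1].
  by rewrite IHm exprS mulrA.
by rewrite (IH (rcons p k)) ?cat_rcons// big_cons mulrA.
Qed.

Lemma schwartz_integrable f : schwartz f -> cintegrable mu f.
Proof.
move=> sf; have := schwartz_multi_partial_integrable (fun=> 0%N) sf.
by rewrite /multi_partial; elim: (enum 'I_n).
Qed.

Lemma schwartz_bounded f : schwartz f -> exists c, forall x, normc (f x) <= c.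
Proof.
move=> [_ /(_ (fun=> 0%N) (fun=> 0%N)) [M hM]]; exists M => x.
have := hM x; rewrite big1 ?normr1 ?mul1r; last by move=> i _; rewrite expr0.
by rewrite /multi_partial; elim: (enum 'I_n).
Qed.

Lemma normc_Xi k (xi : Rn) : normc (Xi k xi) = 2 * pi * `|xi ord0 k|.
Proof.
rewrite normcE /= expr0n add0r sqrtr_sqr normrM ger0_norm//.
by rewrite mulr_ge0// pi_ge0.
Qed.

(** Monomials times the transform of f are bounded, as they are transforms of
derivatives of f up to powers of 2 pi i; decay_bound converts bounds into decay.
*)
Lemma schwartz_fourier_decay f (gam : 'I_n -> nat) : schwartz f ->
  exists2 C : R, 0 <= C &
    forall xi : Rn, `|\prod_(k < n) xi ord0 k ^+ gam k| * normc (fourier f xi) <= C * decay xi.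
Proof.
move=> sf.
have M (A : {set 'I_n}) : exists c : R, forall xi : Rn,
    `|\prod_(k < n) xi ord0 k ^+ (twice_on A k + gam k)| * normc (fourier f xi) <= c.
  have iA := schwartz_multi_partial_integrable (fun k => twice_on A k + gam k)%N sf.
  have [c [_ hc]] := ft_bounded iA; exists c => xi.
  apply: le_trans (hc (-1) xi); rewrite -fourierE.
  rewrite (@schwartz_partials_fourier f [::] (enum 'I_n))//.
  rewrite ComplexField.Normc.normcM ler_wpM2r ?normc_ge0//.
  rewrite normc_prod -(big_enum _ _ xpredT) /= normr_prod; apply: ler_prod => k _.
  rewrite normr_ge0/= normcX normc_Xi normrX.
  have pi1 : 1 <= 2 * pi :> R by have := pi_ge2 R; lra.
  by rewrite lerXn2r ?nnegrE ?mulr_ge0 ?pi_ge0// ler_peMl.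
have [c hc] := choice M.
exists (2 ^+ n * \sum_A `|c A|); first by rewrite mulr_ge0 ?exprn_ge0// sumr_ge0.
move=> xi; apply: decay_bound => [|A]; first by rewrite mulr_ge0 ?normc_ge0.
apply: le_trans (hc A xi); rewrite mulrA -normrM -big_split /=.
by under eq_bigr do rewrite -exprD.
Qed.

Lemma schwartz_fourier_integrable f : schwartz f -> cintegrable mu (fourier f).
Proof.
move=> sf; have [C _ hC] := schwartz_fourier_decay (fun=> 0%N) sf.
apply: (@cintegrable_decay C).
  by rewrite fourierE; apply: cmeas_ft; exact: cintegrable_cmeas (schwartz_integrable sf).
by move=> xi; have := hC xi; rewrite big1 ?normr1 ?mul1r.
Qed.

Lemma schwartz_inversion f x : schwartz f -> ft 1 (fourier f) x = f x.
Proof.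
move=> sf; have [c hc] := schwartz_bounded sf.
have s1 : (-1 : R) ^+ 2 = 1 by rewrite sqrrN expr1n.
have cf : seq_continuous f by apply: ccontinuous_seq; exact: smooth_continuous sf.1.
have if_ := schwartz_fourier_integrable sf; rewrite fourierE in if_.
by have := ft_inversion s1 (schwartz_integrable sf) hc cf if_ x; rewrite opprK -fourierE.
Qed.

(** Write f as the inverse transform of its transform and apply ft_convolution.
*)
Lemma schwartz_convolution f g (t : R) x : schwartz f -> cintegrable mu g -> 0 < t ->
  convolution f (dilate g t) x =
  cint mu (fun xi => fourier f xi * fourier g (t *: xi) * chi x xi).
Proof.
move=> sf ig t0; have [ig' E] := ft_dilate (-1) t0 ig.
have [_] := ft_convolution 1 x (schwartz_fourier_integrable sf) ig'.
under eq_cint do rewrite schwartz_inversion//.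
move=> e; transitivity (cint mu (fun y => f (x - y) * dilate g t y)); first by [].
by rewrite e; apply: eq_cint => xi; rewrite E [fourier g]fourierE scale1r.
Qed.

End schwartz_functions.

(** * The Calderon identity *)

Section euclidean_norm.
Context {R : realType} {n : nat}.
Local Notation Rn := 'rV[R]_n.
Local Notation mu := (@leb R n).
Implicit Types (x y xi : Rn) (g : Rn -> R[i]).

Lemma enorm_ge0 x : 0 <= enorm x.
Proof. exact: sqrtr_ge0. Qed.

Lemma enormZ (c : R) x : 0 <= c -> enorm (c *: x) = c * enorm x.
Proof.
move=> c0; rewrite /enorm dotZl dotC dotZl mulrA -expr2 sqrtrM ?sqr_ge0//.
by rewrite sqrtr_sqr ger0_norm.
Qed.

Lemma enorm0 : enorm (0 : Rn) = 0.
Proof. by rewrite -(scale0r 0) enormZ// mul0r. Qed.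

Lemma measurable_enorm0 : measurable_fun [set: Rn] (@enorm R n).
Proof. by have := measurable_enorm (0 : Rn); under eq_fun do rewrite subr0. Qed.

Lemma enorm_ball_compact (rho : R) : compact [set x : Rn | forall i, (`[- rho, rho]%classic : set R) (x ord0 i)].
Proof. by apply: (@rV_compact _ n (fun _ => `[- rho, rho]%classic : set R)) => i; exact: segment_compact. Qed.

Lemma ccontinuous_bounded g (rho : R) : ccontinuous_on setT g ->
  exists2 c : R, 0 <= c & forall xi, enorm xi <= rho -> normc (g xi) <= c.
Proof.
move=> cg; pose K := [set x : Rn | forall i, (`[- rho, rho]%classic : set R) (x ord0 i)].
have bnd (h : Rn -> R) : continuous h -> exists2 c : R, 0 <= c & forall x, K x -> `|h x| <= c.
  move=> ch; have : compact (h @` K).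
    by apply: continuous_compact; [exact: continuous_subspaceT|exact: enorm_ball_compact].
  move=> /compact_bounded [M [_ hM]]; exists (`|M| + 1); first by rewrite addr_ge0.
  move=> x Kx; apply: (hM (`|M| + 1)); last by exists x.
  by rewrite (le_lt_trans (ler_norm _))// ltrDl.
have [c1 c10 h1] := bnd (fun x => Re (g x)) (fun x => (cg x I).1).
have [c2 c20 h2] := bnd (fun x => Im (g x)) (fun x => (cg x I).2).
exists (c1 + c2) => [|xi xir]; first exact: addr_ge0.
have Kxi : K xi.
  move=> i /=; rewrite in_itv/= -ler_norml; apply: le_trans xir; exact: coord_le_enorm.
by apply: (le_trans (normc_le_ReIm _)); rewrite lerD ?h1 ?h2.
Qed.

Lemma cintegrable_bounded_support g (rho c : R) : cmeas g ->
  (forall xi, normc (g xi) <= c) -> (forall xi, g xi != 0 -> enorm xi < rho) ->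
  cintegrable mu g.
Proof.
move=> mg gc gs; pose B := ball (0 : Rn) (`|rho| + 1).
have c0 : 0 <= c by apply: le_trans (gc 0); exact: normc_ge0.
apply: (@cintegrable_le _ _ _ mu _ (fun x => (c%:E * (\1_B x : R)%:E)%E)) => // [x|].
  rewrite -EFinM lee_fin indicE; have [-> |gx] := eqVneq (g x) 0.
    by rewrite ComplexField.Normc.normc0 mulr_ge0.
  rewrite mem_set ?mulr1//; apply: eball_sub_ball; rewrite /eball /= subr0.
  by apply: lt_le_trans (gs _ gx) _; rewrite (le_trans (ler_norm _))// lerDl.
have pB : nnmeas (fun x : Rn => (\1_B x : R)%:E).
  by apply: nnmeas_indic; exact: measurable_rV_ball.
rewrite nnmeas_integralZl ?lee_fin// integral_indic//; last exact: measurable_rV_ball.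
rewrite setIT [X in (_ * X)%E](@leb_rV_ball R n) ?ltr_wpDl//.
by rewrite -EFinM ltry.
Qed.

Lemma weighted_L1_integrable (L : R) g : 0 <= L -> cmeas g -> (weighted_L1 L g < +oo)%E ->
  cintegrable mu g.
Proof.
move=> L0 mg; apply: cintegrable_le => // x; rewrite lee_fin ler_peMl ?normc_ge0//.
apply: (@le_trans _ _ ((1 + enorm x) `^ 0)); first by rewrite powRr0.
by apply: ler_powR => //; rewrite lerDl enorm_ge0.
Qed.

Lemma seq_continuousM g h : seq_continuous g -> seq_continuous h ->
  seq_continuous (fun x => g x * h x).
Proof. by move=> cg ch u x ux; apply: ccvgM; [exact: cg|exact: ch]. Qed.

Lemma seq_continuousZ g (c : R) : seq_continuous g -> seq_continuous (fun x => g (c *: x)).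
Proof. by move=> cg u x ux; apply: cg; apply: cvgZr. Qed.

End euclidean_norm.

Section scales.
Context {R : realType}.
Variable b : R.
Hypothesis b01 : 0 < b < 1.

Lemma scale_gt0 (j : int) : 0 < b ^ j.
Proof. by case/andP: b01 => b0 _; exact: exprz_gt0. Qed.

Lemma scale_threshold (A : R) : 0 < A -> exists j0 : int, forall j : int, (b ^ j <= A) = (j0 <= j).
Proof.
case/andP: (b01) => b0 b1 A0; exists (Num.ceil (ln A / ln b)) => j.
have lb : ln b < 0 by rewrite ln_lt0.
rewrite ceil_le_int -powR_intmul ?(ltW b0)// -[LHS]ler_ln ?posrE ?powR_gt0//.
by rewrite ln_powR ler_ndivrMr.
Qed.

Lemma scale_le (i j : int) : i <= j -> b ^ j <= b ^ i.
Proof.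
case/andP: (b01) => b0 b1 ij.
rewrite (_ : j = i + (j - i)); last by rewrite addrC subrK.
rewrite expfzDr ?gt_eqF// ler_piMr ?(ltW (scale_gt0 _))//.
have : 0 <= j - i by rewrite subr_ge0.
case: (j - i) => // k _.
by rewrite -exprnP exprn_ile1// ltW.
Qed.

Lemma scale_natD (j : int) (k : nat) : b ^ (j + k%:Z) = b ^ j * b ^+ k.
Proof. by case/andP: (b01) => b0 b1; rewrite expfzDr ?gt_eqF. Qed.

Lemma scale_small (c : R) : 0 < c -> exists k : nat, b ^+ k <= c.
Proof.
move=> c0; have [j0 h] := scale_threshold c0; exists `|j0|%N.
by have := h `|j0|%N%:Z; rewrite -exprnP => ->; rewrite abszE ler_norm.
Qed.

End scales.

Section calderon.
Context {R : realType} {n : nat}.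
Local Notation Rn := 'rV[R]_n.
Local Notation mu := (@leb R n).
Implicit Types (x y xi : Rn).
Variables (b r1 r2 : R) (phi etahat : Rn -> R[i]).
Hypothesis b01 : 0 < b < 1.
Hypothesis r12 : 0 < r1 < r2.
Hypothesis iphi : cintegrable mu phi.
Hypothesis ceta : ccontinuous_on setT etahat.
Hypothesis seta : forall xi, etahat xi != 0 -> r1 < enorm xi < r2.
Hypothesis sum1 : forall xi, xi != 0 ->
    \sum_(j \in [set: int]) (fourier phi (b ^ j *: xi) * etahat (b ^ j *: xi)) = 1.

Let term (j : int) xi : R[i] := fourier phi (b ^ j *: xi) * etahat (b ^ j *: xi).

Let b0 : 0 < b. Proof. by case/andP: b01. Qed.
Let r10 : 0 < r1. Proof. by case/andP: r12. Qed.
Let r20 : 0 < r2. Proof. by case/andP: r12 => r10' /(lt_trans r10'). Qed.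

Lemma term_support j xi : term j xi != 0 -> r1 < b ^ j * enorm xi < r2.
Proof.
rewrite /term mulf_eq0 negb_or => /andP[_ /seta].
by rewrite enormZ// ltW// scale_gt0.
Qed.

(** On a bounded set, b^j |xi| <= r1 for all large j, so that only finitely many
scales contribute. *)
Lemma zetahat_partial (A : R) (j0 : int) (rho : R) : (forall j : int, (b ^ j <= A) = (j0 <= j)) ->
  exists K : nat, forall m, (K <= m)%N -> forall xi, enorm xi <= rho ->
  zetahat b phi etahat A xi = 1 - \sum_(k < m) term (j0 + k%:Z) xi.
Proof.
move=> hj0; have c0 : 0 < r1 / (b ^ j0 * (`|rho| + 1)).
  by rewrite divr_gt0// mulr_gt0// ?scale_gt0// ltr_wpDl.
have [K hK] := scale_small b01 c0; exists K => m Km xi xir.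
rewrite /zetahat; congr (1 - _).
rewrite -(big_mkord xpredT (fun k => term (j0 + k%:Z) xi)) /index_iota subn0.
rewrite -(big_map (fun k : nat => j0 + k%:Z) xpredT (fun j => term j xi)).
rewrite (@fsbigE _ _ _ _ _ [seq j0 + k%:Z | k <- iota 0 m])//.
- rewrite big_seq_cond [RHS]big_seq; apply: eq_bigl => j.
  case: (boolP (j \in _)) => //= /mapP[k _ ->]; apply/mem_set.
  by rewrite /= hj0 lerDl.
- rewrite map_inj_uniq ?iota_uniq// => i j /addrI; by case.
- by move=> j /= /mapP[k _ ->]; rewrite hj0 lerDl.
- move=> j; rewrite /= hj0 => j0j jm; apply/eqP; apply: contraT => /term_support /andP[jx _].
  have [k jk] : exists k : nat, j = j0 + k%:Z.
    by exists `|j - j0|%N; rewrite gez0_abs ?subr_ge0// [RHS]addrC subrK.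
  have mk : (m <= k)%N.
    rewrite leqNgt; apply: contra jm => km; apply/mapP; exists k => //.
    by rewrite mem_iota add0n.
  move: jx; rewrite jk scale_natD// ltNge => /negP[].
  have bk : b ^+ k <= r1 / (b ^ j0 * (`|rho| + 1)).
    by apply: le_trans hK; rewrite ler_wiXn2l ?ltW//; [case/andP: b01|exact: leq_trans mk].
  apply: (@le_trans _ _ (b ^ j0 * (r1 / (b ^ j0 * (`|rho| + 1))) * (`|rho| + 1))); last first.
    have E (u v w : R) : u != 0 -> w != 0 -> u * (v / (u * w)) * w = v.
      by move=> u0 w0; field; rewrite u0 w0.
    by rewrite E ?gt_eqF ?ltr_wpDl ?scale_gt0.
  apply: ler_pM; rewrite ?enorm_ge0//.
  - by rewrite mulr_ge0 ?exprn_ge0 ?ltW// ?scale_gt0.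
  - by rewrite ler_wpM2l// ltW// scale_gt0.
  - by rewrite (le_trans xir)// (le_trans (ler_norm _))// lerDl.
Qed.

(** If |xi| >= r2 / A, the terms with b^j > A, which are left out of the sum in
the definition, vanish; hence that sum is the full one, which equals one. *)
Lemma zetahat_support (A : R) xi : 0 < A -> zetahat b phi etahat A xi != 0 -> enorm xi < r2 / A.
Proof.
move=> A0; apply: contraNT; rewrite -leNgt => xiA; apply/eqP.
have xi0 : xi != 0.
  by apply: contraTneq xiA => ->; rewrite enorm0 -ltNge divr_gt0.
rewrite /zetahat; apply/eqP; rewrite subr_eq0 -(sum1 xi0); apply/eqP/esym.
apply: fsbig_widen => // j [_ /=] /negP; rewrite -ltNge => Aj.
apply/eqP; apply: contraT => /term_support /andP[_].
rewrite ltNge => /negP[]; apply: (@le_trans _ _ (A * enorm xi)).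
  by move: xiA; rewrite ler_pdivrMr// mulrC.
by rewrite ler_wpM2r ?enorm_ge0// ltW.
Qed.

Lemma eta_bounded : exists2 c : R, 0 <= c & forall xi, normc (etahat xi) <= c.
Proof.
have [c c0 hc] := ccontinuous_bounded r2 ceta; exists c => // xi.
have [->|/seta /andP[_ x2]] := eqVneq (etahat xi) 0; first by rewrite ComplexField.Normc.normc0.
exact/hc/ltW.
Qed.

Lemma fourier_bounded (chi : Rn -> R[i]) : cintegrable mu chi ->
  exists2 c : R, 0 <= c & forall xi, normc (fourier chi xi) <= c.
Proof.
by move=> /ft_bounded[c [c0 hc]]; exists c => // xi; rewrite fourierE.
Qed.

(** A nonzero term requires r1 < b^j |xi| < r2; for fixed xi there are at most M
such scales when b^M <= r1 / r2. *)
Lemma term_sum_bounded : exists2 B : R, 0 <= B & forall (j0 : int) (m : nat) xi,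
  normc (\sum_(k < m) term (j0 + k%:Z) xi) <= B.
Proof.
have [ce ce0 hce] := eta_bounded.
have [cp cp0 hcp] := fourier_bounded iphi.
have [M hM] := scale_small b01 (divr_gt0 r10 r20).
exists (M%:R * (cp * ce)) => [|j0 m xi]; first by rewrite !mulr_ge0.
apply: (le_trans (normc_sum _ _)).
pose a (k : nat) := normc (term (j0 + k%:Z) xi).
have ab k : a k <= cp * ce.
  by rewrite /a /term ComplexField.Normc.normcM ler_pM ?normc_ge0.
have a0 k : 0 <= a k by exact: normc_ge0.
have anear k l : (k + M <= l)%N -> a k != 0 -> a l = 0.
  move=> kl ak; apply/eqP; apply: contraT => al.
  have nz i : a i != 0 -> term (j0 + i%:Z) xi != 0.
    by apply: contra => /eqP ti; rewrite /a ti ComplexField.Normc.normc0.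
  have /andP[_ k2] := term_support (nz _ ak).
  have /andP[l1 _] := term_support (nz _ al).
  move: l1; rewrite ltNge => /negP[].
  rewrite -(subnKC kl) !PoszD addrA scale_natD// addrA scale_natD// -!mulrA.
  rewrite mulrCA; apply: (@le_trans _ _ (r1 / r2 * r2)); last by rewrite divfK ?gt_eqF.
  have bj0 := ltW (scale_gt0 b01 j0).
  have bl : b ^+ (l - (k + M)) <= 1.
    by rewrite exprn_ile1 ?(ltW b0)//; case/andP: b01 => _ /ltW.
  apply: ler_pM; rewrite ?(exprn_ge0 _ (ltW b0)) ?mulr_ge0 ?(exprn_ge0 _ (ltW b0)) ?enorm_ge0 ?(ltW (scale_gt0 b01 _))//.
  apply: le_trans (ltW k2); rewrite ler_wpM2l ?(ltW (scale_gt0 b01 _))//.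
  by rewrite ler_piMl ?enorm_ge0.
rewrite -(big_mkord xpredT a).
have [/forallP all0|] := boolP [forall k : 'I_m, a k == 0].
  rewrite big_mkord big1 ?mulr_ge0// => k _; exact/eqP/all0.
rewrite negb_forall => /existsP[k0 ak0].
have ex : exists k, a k != 0 by exists k0.
case: (ex_minnP ex) => k1 ak1 k1min.
apply: (@le_trans _ _ (\sum_(0 <= k < k1 + M + m) a k)).
  rewrite [leRHS](@big_cat_nat _ _ _ m)//=; last by rewrite leq_addl.
  by rewrite lerDl sumr_ge0.
rewrite (@big_cat_nat _ _ _ k1)//=; last by rewrite -addnA leq_addr.
rewrite big_nat big1 ?add0r => [|k /andP[_ kk1]]; last first.
  by apply/eqP; apply: contraT => /k1min; rewrite leqNgt kk1.
rewrite (@big_cat_nat _ _ _ (k1 + M)) ?leq_addr//=.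
rewrite [X in _ + X]big_nat [X in _ + X]big1 ?addr0 => [|k /andP[kk1 _]]; last first.
  exact: anear ak1.
apply: (@le_trans _ _ (\sum_(k1 <= k < k1 + M) cp * ce)).
  by apply: ler_sum => k _.
by rewrite sumr_const_nat addKn mulr_natl.
Qed.

Lemma zetahat_bounded (A : R) : 0 < A ->
  exists2 c : R, 0 <= c & forall xi, normc (zetahat b phi etahat A xi) <= c.
Proof.
move=> A0; have [B B0 hB] := term_sum_bounded; have [j0 hj0] := scale_threshold b01 A0.
exists (1 + B) => [|xi]; first by rewrite addr_ge0.
have [K hK] := zetahat_partial (enorm xi) hj0.
rewrite (hK K)// (le_trans (le_normcD _ _))// normcN lerD//.
by rewrite ComplexField.Normc.normc1.
Qed.

Lemma term_seq_continuous j : seq_continuous (term j).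
Proof.
apply: seq_continuousM; apply: seq_continuousZ; last exact: ccontinuous_seq.
by rewrite fourierE; exact: ft_seq_continuous.
Qed.

Lemma term_cmeas j : cmeas (term j).
Proof.
have ms := measurable_scale (b ^ j) : measurable_fun setT (fun x : Rn => _).
apply: cmeasM; apply: cmeas_comp ms; last exact: ccontinuous_cmeas.
by rewrite fourierE; apply: cmeas_ft; exact: cintegrable_cmeas iphi.
Qed.

Lemma zetahat_seq_continuous (A : R) : 0 < A -> seq_continuous (zetahat b phi etahat A).
Proof.
move=> A0 u x ux; have [j0 hj0] := scale_threshold b01 A0.
have [K hK] := zetahat_partial (n%:R * (`|x| + 1)) hj0.
have bx (y : Rn) : `|y| <= `|x| + 1 -> enorm y <= n%:R * (`|x| + 1).
  move=> yx; apply: enorm_le_coord; first by rewrite addr_ge0.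
  by move=> i; apply: le_trans yx; rewrite -[leRHS]/(mx_norm y) mx_normrE; exact: (le_bigmax _ (fun ij => `|y ij.1 ij.2|) (ord0, i)).
rewrite (hK K)//; last by apply: bx; rewrite lerDl.
apply: (@eq_ccvg _ (fun k => 1 + (-1) * \sum_(i < K) term (j0 + i%:Z) (u k))).
  have : \forall k \near \oo, `|u k| <= `|x| + 1.
    have /cvgrPdist_le/(_ 1 ltr01) := ux; apply: filterS => k.
    by rewrite distrC => h; rewrite -(subrK x (u k)) (le_trans (ler_normD _ _))// addrC lerD2l.
  by apply: filterS => k ukx; rewrite mulN1r (hK K)//; exact: bx.
rewrite -[X in ccvg _ (1 + X)]mulN1r; apply: (ccvgD (ccvg_cst _)); apply: (ccvgM (ccvg_cst _)).
by apply: ccvg_sum => i; exact: term_seq_continuous.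
Qed.

Lemma zetahat_cmeas (A : R) : 0 < A -> cmeas (zetahat b phi etahat A).
Proof.
move=> A0; have [j0 hj0] := scale_threshold b01 A0.
have [K hK] := zetahat_partial (r2 / A) hj0.
pose D := [set x : Rn | enorm x < r2 / A].
have mD : measurable D.
  rewrite (_ : D = (@enorm R n) @^-1` `]-oo, (r2 / A)[%classic); last first.
    by apply/seteqP; split => y /=; rewrite in_itv.
  by rewrite -[X in measurable X]setTI; apply: measurable_enorm0 => //; exact: measurable_itv.
rewrite (_ : zetahat b phi etahat A = fun x => (\1_D x)%:C%C * (1 - \sum_(i < K) term (j0 + i%:Z) x)).
  apply: cmeasM; first by apply: cmeas_real; exact: measurable_indic.
  apply: cmeasB; first exact: cmeas_cst.
  by apply: cmeas_sum => i; exact: term_cmeas.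
apply/funext => x; rewrite indicE; have [xD|xD] := boolP (x \in D).
  by rewrite mul1r (hK K)// ltW//; move: xD; rewrite inE.
rewrite mul0r; apply/eqP; apply: contraNT xD => /(zetahat_support A0) xA.
by rewrite inE.
Qed.

End calderon.

(** * Peetre's maximal function and the decomposition of convolutions *)

Lemma ccvg_normc_le (R : realType) (u : nat -> R[i]) (l : R[i]) (C : \bar R) :
  ccvg u l -> (forall k, ((normc (u k))%:E <= C)%E) -> ((normc l)%:E <= C)%E.
Proof.
move=> ul uC; have C0 : (0 <= C)%E by apply: le_trans (uC 0%N); rewrite lee_fin normc_ge0.
case: C C0 uC => [c| |] // _ uC; last by rewrite leey.
rewrite lee_fin; apply/ler_addgt0Pl => e e0.
have [k _ hk] : \forall k \near \oo, normc (u k - l) < e.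
  by move/cvgrPdist_lt : ul => /(_ e e0); apply: filterS => k;
    rewrite sub0r normrN ger0_norm ?normc_ge0.
have := hk k (leqnn k) => /ltW hk'.
rewrite -[l](subKr (u k)) (le_trans (le_normcD _ _))// addrC lerD//; last first.
  by have := uC k; rewrite lee_fin.
by rewrite normcN.
Qed.

Section peetre.
Context {R : realType} {n : nat}.
Local Notation Rn := 'rV[R]_n.
Local Notation mu := (@leb R n).
Implicit Types (x y z xi : Rn) (F : Rn -> R -> R[i]).

Definition rat_vec (i : nat) : Rn := @rat_point R n (rat_cube_code n i).1.

Definition peetre_weight (N : R) (y : Rn) (t : R) : R := (1 + enorm y / t) `^ N.

Lemma peetre_weight_ge1 N y t : 0 <= N -> 0 < t -> 1 <= peetre_weight N y t.
Proof.
move=> N0 t0; apply: (@le_trans _ _ ((1 + enorm y / t) `^ 0)); first by rewrite powRr0.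
by apply: ler_powR => //; rewrite lerDl divr_ge0 ?enorm_ge0// ltW.
Qed.

Lemma peetre_weight_gt0 N y t : 0 <= N -> 0 < t -> 0 < peetre_weight N y t.
Proof. by move=> N0 t0; apply: lt_le_trans (peetre_weight_ge1 y N0 t0). Qed.

(** Peetre's maximal function of F at scale t. The supremum is over rational
vectors, which keeps it measurable; peetre_le recovers arbitrary vectors. *)
Definition peetre F (N : R) (x : Rn) (t : R) : \bar R :=
  ereal_sup (range (fun i => (normc (F (x - rat_vec i) t) / peetre_weight N (rat_vec i) t)%:E)).

Lemma peetre_ge0 F N x t : 0 <= N -> 0 < t -> (0 <= peetre F N x t)%E.
Proof.
move=> N0 t0; apply: le_ereal_sup_tmp; exists (normc (F (x - rat_vec 0) t) / peetre_weight N (rat_vec 0) t)%:E.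
  by exists 0%N.
by rewrite lee_fin divr_ge0 ?normc_ge0// ltW// peetre_weight_gt0.
Qed.

(** Minkowski's inequality; the Cauchy-Schwarz inequality CS expresses that the
square of <y, y> x - <x, y> y is nonnegative. *)
Lemma enormD x y : enorm (x + y) <= enorm x + enorm y.
Proof.
have CS : dot x y ^+ 2 <= dot x x * dot y y.
  have [y0|y0] := eqVneq (dot y y) 0.
    have yi i : y ord0 i = 0.
      apply/normr0_eq0/eqP; rewrite eq_le normr_ge0 andbT.
      by have := coord_le_enorm y i; rewrite /enorm y0 sqrtr0.
    by rewrite y0 mulr0 /dot big1 ?expr0n// => i _; rewrite yi mulr0.
  have yp : 0 < dot y y by rewrite lt_neqAle eq_sym y0 dot_ge0.
  have := dot_ge0 (dot y y *: x + (- dot x y) *: y).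
  set c := dot x y; set d := dot y y; set V := (_ + _ : Rn).
  have -> : dot V V = d * (d * dot x x + (- c) * c) + (- c) * (d * c + (- c) * d).
    rewrite {1}/V dotDl !dotZl (dotC x V) (dotC y V) /V !dotDl !dotZl.
    by rewrite (dotC y x).
  move=> h.
  have : 0 <= d * (d * dot x x - c ^+ 2) by move: h; rewrite expr2; lra.
  by rewrite pmulr_rge0// subr_ge0 mulrC.
rewrite -[leRHS]ger0_norm ?addr_ge0 ?enorm_ge0// -sqrtr_sqr; apply: ler_wsqrtr.
rewrite sqrrD !sqr_sqrtr ?dot_ge0// !dotDl (dotC x (x + y)) (dotC y (x + y)) !dotDl (dotC y x).
have : dot x y <= enorm x * enorm y.
  rewrite -sqrtrM ?dot_ge0//; apply: (le_trans (ler_norm _)).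
  by rewrite -sqrtr_sqr ler_wsqrtr.
by rewrite /enorm mulr2n; lra.
Qed.

Lemma peetre_weightD N y z t : 0 <= N -> 0 < t ->
  peetre_weight N (y + z) t <= peetre_weight N y t * peetre_weight N z t.
Proof.
move=> N0 t0; rewrite -powRM ?addr_ge0 ?divr_ge0 ?enorm_ge0 ?(ltW t0)//.
have e0 u : 0 <= enorm (u : Rn) / t by rewrite divr_ge0 ?enorm_ge0// ltW.
apply: ge0_ler_powR => //; rewrite ?nnegrE ?mulr_ge0 ?addr_ge0 ?e0//.
apply: (@le_trans _ _ (1 + (enorm y / t + enorm z / t))).
  by rewrite lerD2l -mulrDl ler_wpM2r ?invr_ge0 ?(ltW t0)// enormD.
by rewrite mulrDl mul1r mulrDr mulr1; have := mulr_ge0 (e0 y) (e0 z); lra.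
Qed.

Lemma rat_vec_near (y : Rn) : exists v : nat -> nat, (fun k => rat_vec (v k)) @ \oo --> y.
Proof.
have h (k : nat) : exists i, ball y k.+1%:R^-1 (rat_vec i).
  have [|c hc] := @rat_point_near R n y k.+1%:R^-1; first by rewrite invr_gt0.
  by exists (rat_cube_index c 1); rewrite /rat_vec rat_cube_code_index.
have [v hv] := choice h; exists v; apply/cvg_ballP => e e0.
have := @cvg_harmonic R; move/cvgrPdist_lt => /(_ e e0); apply: filterS => k.
rewrite sub0r normrN ger0_norm ?invr_ge0// => ke.
by apply: le_ball (hv k); rewrite ltW.
Qed.

(** The inequality passes from rational vectors to their limits because F is
continuous in space and the weight is continuous. *)
Lemma peetre_le F N x y t : 0 <= N -> 0 < t -> seq_continuous (F ^~ t) ->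
  ((normc (F (x - y) t))%:E <= peetre F N x t * (peetre_weight N y t)%:E)%E.
Proof.
move=> N0 t0 cF; have [v hv] := rat_vec_near y.
have P0 := peetre_ge0 F x N0 t0.
have W0 := peetre_weight_gt0 y N0 t0.
have [Poo|] := eqVneq (peetre F N x t) +oo%E; first by rewrite Poo gt0_mulye ?lte_fin ?leey.
move=> Poo; have Pf : peetre F N x t \is a fin_num by rewrite ge0_fin_numE// ltey.
rewrite -(fineK Pf) -EFinM; set c := fine _.
have c0 : 0 <= c by exact: fine_ge0.
have kc k : normc (F (x - rat_vec (v k)) t) <= c * peetre_weight N (rat_vec (v k)) t.
  rewrite -ler_pdivrMr ?peetre_weight_gt0// -lee_fin /c fineK//.
  by apply: ereal_sup_ubound; exists (v k).
(* Submultiplicativity reduces the continuity of the weight to the origin. *)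
have kc' k : normc (F (x - rat_vec (v k)) t) <= (c * peetre_weight N y t) * peetre_weight N (rat_vec (v k) - y) t.
  apply: (le_trans (kc k)); rewrite -mulrA ler_wpM2l// mulrC.
  by have := peetre_weightD (rat_vec (v k) - y) y N0 t0; rewrite subrK.
have ct1 : (fun k => 1 + enorm (rat_vec (v k) - y) / t) @ \oo --> (1 : R).
  rewrite -[X in _ --> X]addr0 -(mul0r t^-1); apply: cvgD; first exact: cvg_cst.
  apply: cvgMl; rewrite -[X in _ --> X](mulr0 n%:R).
  apply: (@squeeze_cvgr _ _ _ _ (fun=> 0) (fun k => n%:R * `|rat_vec (v k) - y|)).
  - apply: nearW => k; rewrite enorm_ge0/=; apply: enorm_le_coord => // i.
    by rewrite -[leRHS]/(mx_norm _) mx_normrE; exact: (le_bigmax _ (fun ij => `|(rat_vec (v k) - y) ij.1 ij.2|) (ord0, i)).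
  - by rewrite mulr0; exact: cvg_cst.
  - apply: cvgMr; apply/norm_cvg0P; exact/subr_cvg0.
have ctN : (fun k => peetre_weight N (rat_vec (v k) - y) t) @ \oo --> (1 : R).
  have one : (1 : R) `^ N = 1 by rewrite powR1.
  have contN : {for 1, continuous (fun z : R => z `^ N)}.
    apply: differentiable_continuous; apply/derivable1_diffP.
    by have [] := @is_derive1_powR R N 1 ltr01.
  rewrite -[X in _ --> X]one.
  exact: (@cvg_comp _ _ _ (fun k => 1 + enorm (rat_vec (v k) - y) / t) (fun z : R => z `^ N) _ _ _ ct1 contN).
have cFk : ccvg (fun k => F (x - rat_vec (v k)) t) (F (x - y) t).
  by apply: cF; apply: cvgB; [exact: cvg_cst|].
rewrite lee_fin; apply/ler_addgt0Pl => e e0.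
have cl : (fun k => (c * peetre_weight N y t) * peetre_weight N (rat_vec (v k) - y) t + normc (F (x - rat_vec (v k)) t - F (x - y) t))
    @ \oo --> c * peetre_weight N y t.
  rewrite -[X in _ --> X]addr0; apply: cvgD => //.
  by rewrite -[X in _ --> X]mulr1; apply: cvgMr.
have le : normc (F (x - y) t) <= c * peetre_weight N y t.
  apply: (cvgr_to_ge cl); apply: nearW => k.
  have T (u w : R[i]) : normc w <= normc u + normc (u - w).
    by rewrite -{1}(subKr u w) (le_trans (le_normcD _ _))// normcN.
  exact: le_trans (T (F (x - rat_vec (v k)) t) _) (lerD (kc' k) (lexx _)).
by rewrite (le_trans le)// lerDr ltW.
Qed.

(** The weight is submultiplicative (peetre_weightD). *)
Lemma peetre_shift F N x y t : 0 <= N -> 0 < t -> seq_continuous (F ^~ t) ->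
  (peetre F N (x - y) t <= peetre F N x t * (peetre_weight N y t)%:E)%E.
Proof.
move=> N0 t0 cF; apply: ge_ereal_sup => _ [i _ <-].
have := peetre_le x (y + rat_vec i) N0 t0 cF; rewrite opprD addrA => h.
have Wi := peetre_weight_gt0 (rat_vec i) N0 t0.
rewrite mulrC EFinM lee_pdivrMl//; apply: (le_trans h).
rewrite [leRHS]muleCA; apply: lee_wpmul2l; first exact: peetre_ge0.
by rewrite -EFinM lee_fin mulrC peetre_weightD.
Qed.

(** Only positive scales have a meaning; the factor 0 < t makes the function
measurable on the whole product space. *)
Lemma nnmeas_peetre F N : 0 <= N -> cmeas (fun z : Rn * measurableTypeR R => F z.1 z.2) ->
  nnmeas (fun z : Rn * measurableTypeR R => ((0 < z.2)%R%:R)%:E * peetre F N z.1 z.2)%E.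
Proof.
move=> N0 mF.
pose h i (z : Rn * measurableTypeR R) := (((0 < z.2)%R%:R) * (normc (F (z.1 - rat_vec i) z.2) * (1 + enorm (rat_vec i) * z.2 `^ (-1)) `^ (- N)))%:E.
have ph i : nnmeas (h i).
  split; last first.
    by move=> z; rewrite lee_fin !mulr_ge0 ?normc_ge0 ?powR_ge0.
  apply/measurable_EFinP; apply: measurable_funM.
    by apply: measurable_natr_bool; apply: measurable_fun_ltr; [exact: measurable_cst|exact: measurable_snd].
  apply: measurable_funM.
    apply: (measurable_normc (f := fun z : Rn * measurableTypeR R => F (z.1 - rat_vec i) z.2)).
    apply: (cmeas_comp (f := fun z : Rn * measurableTypeR R => F z.1 z.2) (g := fun z : Rn * measurableTypeR R => (z.1 - rat_vec i, z.2))) => //.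
    apply: measurable_fun_pair; last exact: measurable_snd.
    have := measurable_affine 1 (- rat_vec i); under eq_fun do rewrite scale1r.
    by move=> m; exact: measurableT_comp m measurable_fst.
  apply: (measurableT_comp (measurable_powR _)); apply: measurable_funD => //.
  by apply: measurable_funM => //; exact: (measurableT_comp (measurable_powR _) measurable_snd).
rewrite (_ : (fun _ => _) = fun z : Rn * measurableTypeR R => ereal_sup (range (h ^~ z))); first exact: nnmeas_sup.
apply/funext => z; have [z0|z0] := ltP 0 z.2.
  rewrite mul1e; congr ereal_sup; congr (_ @` _); apply/funext => i.
  by rewrite /h z0 mul1r powRN powR_inv1// ltW.
rewrite mul0e; apply/eqP; rewrite eq_le; apply/andP; split.
  by apply: le_ereal_sup_tmp; exists (h 0%N z); [exists 0%N|exact: (ph 0%N).2].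
by apply: ge_ereal_sup => _ [i _ <-]; rewrite /h ltNge z0 mul0r.
Qed.

End peetre.

Section decomposition.
Context {R : realType} {n : nat}.
Local Notation Rn := 'rV[R]_n.
Local Notation mu := (@leb R n).
Implicit Types (x y z xi : Rn) (f g m : Rn -> R[i]).

(** The convolution of f with g_t on the frequency side (scaled_convE); the
integrand is dominated uniformly in z. *)
Definition scaled_conv f g z (t : R) : R[i] :=
  cint mu (fun xi => fourier f xi * fourier g (t *: xi) * chi z xi).

Lemma fourier_scaled_bounded g (t : R) : cintegrable mu g ->
  exists2 c : R, 0 <= c & forall xi, normc (fourier g (t *: xi)) <= c.
Proof. by move=> /ft_bounded[c [c0 hc]]; exists c => // xi; rewrite fourierE. Qed.

Lemma cmeas_fourier_scale g (t : R) : cintegrable mu g -> cmeas (fun xi => fourier g (t *: xi)).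
Proof.
move=> ig; rewrite fourierE.
have ms := measurable_scale t : measurable_fun setT (fun x : Rn => _).
exact: cmeas_comp (cmeas_ft _ (cintegrable_cmeas ig)) ms.
Qed.

Variable f : Rn -> R[i].
Hypothesis sf : schwartz f.

Lemma cintegrable_scaled g (t : R) : cintegrable mu g ->
  cintegrable mu (fun xi => fourier f xi * fourier g (t *: xi)).
Proof.
move=> ig; have [c c0 hc] := fourier_scaled_bounded t ig.
apply: cintegrable_eq (cintegrableM_bounded (cmeas_fourier_scale t ig) hc (schwartz_fourier_integrable sf)).
by move=> xi; rewrite mulrC.
Qed.

Lemma scaled_convE g (t : R) z : cintegrable mu g -> 0 < t ->
  convolution f (dilate g t) z = scaled_conv f g z t.
Proof. by move=> ig t0; rewrite schwartz_convolution. Qed.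

Lemma scaled_conv_ft g (t : R) :
  (fun z => scaled_conv f g z t) = ft 1 (fun xi => fourier f xi * fourier g (t *: xi)).
Proof.
by apply/funext => z; apply: eq_cint => xi; rewrite scale1r chiC.
Qed.

Lemma scaled_conv_seq_continuous g (t : R) : cintegrable mu g ->
  seq_continuous (fun z => scaled_conv f g z t).
Proof.
by move=> ig; rewrite scaled_conv_ft; apply: ft_seq_continuous; exact: cintegrable_scaled.
Qed.

Lemma cmeas_scaled_conv g : cintegrable mu g ->
  cmeas (fun z : Rn * measurableTypeR R => scaled_conv f g z.1 z.2).
Proof.
move=> ig; rewrite /scaled_conv.
apply: (@cmeas_cint _ _ _ _ _ mu (fun z : (Rn * measurableTypeR R) * Rn =>
  fourier f z.2 * fourier g (z.1.2 *: z.2) * chi z.1.1 z.2)).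
have m11 : measurable_fun setT (fun z : (Rn * measurableTypeR R) * Rn => z.1.1).
  exact: measurableT_comp measurable_fst measurable_fst.
have m12 : measurable_fun setT (fun z : (Rn * measurableTypeR R) * Rn => z.1.2).
  exact: measurableT_comp measurable_snd measurable_fst.
apply: cmeasM; last by apply: cmeas_chi => //; exact: measurable_snd.
apply: cmeasM.
  exact: cmeas_comp (cintegrable_cmeas (schwartz_fourier_integrable sf)) measurable_snd.
rewrite fourierE; apply: cmeas_comp (cmeas_ft (-1) (cintegrable_cmeas ig)) _.
apply: measurable_fun_rV => i.
rewrite (_ : (fun _ => _) = fun z : (Rn * measurableTypeR R) * Rn => z.1.2 * z.2 ord0 i); last first.
  by apply/funext => z; rewrite mxE.
apply: measurable_funM => //; exact: measurableT_comp (measurable_coord i) measurable_snd.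
Qed.

Lemma integral_dilate_weight (K : Rn -> R[i]) (N t : R) : 0 < t -> cmeas K ->
  (\int[mu]_y ((peetre_weight N y t)%:E * (normc (dilate K t y))%:E) = weighted_L1 N K)%E.
Proof.
move=> t0 mK; have t1 : t^-1 != 0 by rewrite invr_eq0 gt_eqF.
pose h (y : Rn) := ((1 + enorm y) `^ N * normc (K y))%:E.
have ph : nnmeas h.
  split=> [|y]; last by rewrite lee_fin mulr_ge0 ?powR_ge0 ?normc_ge0.
  apply/measurable_EFinP; apply: measurable_funM; last exact: measurable_normc.
  apply: (measurableT_comp (measurable_powR _)); apply: measurable_funD => //.
  exact: measurable_enorm0.
have := integral_affine 0 t1 ph.
rewrite ger0_norm ?invr_ge0 ?(ltW t0)// exprVn invrK => E.
have tn : 0 < t ^+ n by exact: exprn_gt0.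
transitivity (\int[mu]_y ((t ^- n)%:E * h (t^-1 *: y + 0)%R)%E)%E.
  apply: eq_integral => y _; rewrite addr0 /h -!EFinM; congr EFin.
  rewrite /peetre_weight enormZ ?invr_ge0 ?(ltW t0)// (mulrC t^-1).
  rewrite /dilate ComplexField.Normc.normcM normc_real ger0_norm ?invr_ge0 ?(ltW tn)//.
  by rewrite mulrCA.
rewrite nnmeas_integralZl//; last 2 first.
- by apply: nnmeas_comp ph _; exact: measurable_affine.
- by rewrite lee_fin invr_ge0 ltW.
by rewrite E muleA -EFinM mulVf ?gt_eqF// mul1e.
Qed.

(** By Fourier inversion the multiplier m (tau xi) acts as convolution with the
dilate of the inverse transform of m. Under that convolution integral, peetre_le
bounds the translates of f * phi_tau, and what remains is the weighted L^1 norm.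
*)
Lemma peetre_kernel_bound phi m (c N tau : R) x : cintegrable mu phi -> 0 <= N -> 0 < tau ->
  cintegrable mu m -> (forall xi, normc (m xi) <= c) -> seq_continuous m ->
  (weighted_L1 N (inv_fourier m) < +oo)%E ->
  ((normc (cint mu (fun xi => fourier f xi * fourier phi (tau *: xi) * m (tau *: xi) * chi x xi)))%:E
    <= weighted_L1 N (inv_fourier m) * peetre (scaled_conv f phi) N x tau)%E.
Proof.
move=> iphi N0 tau0 im mc cm; rewrite inv_fourierE => Koo.
have mK : cmeas (ft 1 m) by apply: cmeas_ft; exact: cintegrable_cmeas im.
have iK := weighted_L1_integrable N0 mK Koo.
have inv xi : ft (-1) (ft 1 m) xi = m xi.
  by apply: (ft_inversion _ im mc cm iK); rewrite expr1n.
have [iKt Kt] := ft_dilate (-1) tau0 iK.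
have [iF E] := ft_convolution 1 x (cintegrable_scaled tau iphi) iKt.
rewrite -(scaled_conv_ft phi tau) in iF E.
have -> : cint mu (fun xi => fourier f xi * fourier phi (tau *: xi) * m (tau *: xi) * chi x xi) =
    cint mu (fun y => scaled_conv f phi (x - y) tau * dilate (ft 1 m) tau y).
  by rewrite E; apply: eq_cint => xi; rewrite Kt inv scale1r.
apply: normc_cint_le => //.
have cF := scaled_conv_seq_continuous tau iphi.
have P0 := peetre_ge0 (scaled_conv f phi) x N0 tau0.
rewrite -(integral_dilate_weight N tau0 mK) muleC -nnmeas_integralZl//; last first.
  apply: nnmeasM; last exact: nnmeas_normc (cintegrable_cmeas iKt).
  apply: nnmeas_EFin => [|y]; last exact: powR_ge0.
  apply: (measurableT_comp (measurable_powR _)); apply: measurable_funD => //.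
  by apply: measurable_funM => //; exact: measurable_enorm0.
apply: ge0_le_integralT => y; first by rewrite lee_fin normc_ge0.
rewrite ComplexField.Normc.normcM EFinM muleA; apply: lee_wpmul2r.
  by rewrite lee_fin normc_ge0.
exact: peetre_le.
Qed.

Variables (b r1 r2 : R) (phi etahat : Rn -> R[i]).
Hypothesis b01 : 0 < b < 1.
Hypothesis r12 : 0 < r1 < r2.
Hypothesis iphi : cintegrable mu phi.
Hypothesis ceta : ccontinuous_on setT etahat.
Hypothesis seta : forall xi, etahat xi != 0 -> r1 < enorm xi < r2.
Hypothesis sum1 : forall xi, xi != 0 ->
    \sum_(j \in [set: int]) (fourier phi (b ^ j *: xi) * etahat (b ^ j *: xi)) = 1.

(** Insert 1 as the sum of the terms and of zetahat. The term of index j is the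
convolution of f * phi_(b^j t) with a kernel whose weighted norm is Cphi. In the
last one the transform of g may be replaced by that of phi times Theta, on
account of the support of zetahat, which gives a kernel of norm Dphi and f *
phi_t. The partial sums S converge by dominated convergence, since for each xi
they are eventually constant in m. *)
Lemma calderon_decomposition g Theta (A N t : R) (j0 : int) x :
  cintegrable mu g -> ccontinuous_on setT Theta -> 0 < A -> 0 <= N -> 0 < t ->
  (forall j : int, (b ^ j <= A) = (j0 <= j)) ->
  (forall xi, enorm xi < r2 / A -> fourier g xi = fourier phi xi * Theta xi) ->
  (forall k : nat, (Cphi b etahat g (j0 + k%:Z) N < +oo)%E) ->
  (Dphi b phi etahat Theta A N < +oo)%E ->
  ((normc (scaled_conv f g x t))%:E <=
   \sum_(k <oo) Cphi b etahat g (j0 + k%:Z)%R N *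
      peetre (scaled_conv f phi) N x (b ^ (j0 + k%:Z) * t)%R +
   Dphi b phi etahat Theta A N * peetre (scaled_conv f phi) N x t)%E.
Proof.
move=> ig cTheta A0 N0 t0 hj0 gphi Coo Doo.
have r20 : 0 < r2 by case/andP: r12 => r10' /(lt_trans r10').
have [B B0 hB] := term_sum_bounded b01 r12 iphi ceta seta.
have [cz cz0 hcz] := zetahat_bounded b01 r12 iphi ceta seta A0.
have [cg cg0 hcg] := fourier_bounded ig.
have [ce ce0 hce] := eta_bounded ceta seta.
have [cT cT0 hcT] := ccontinuous_bounded (r2 / A) cTheta.
have mf := cintegrable_cmeas (schwartz_fourier_integrable sf).
pose term (j : int) xi := fourier phi (b ^ j *: xi) * etahat (b ^ j *: xi).
pose zeta := zetahat b phi etahat A.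
have mzeta : cmeas zeta := zetahat_cmeas b01 r12 iphi ceta seta sum1 A0.
have szeta xi : zeta xi != 0 -> enorm xi < r2 / A := zetahat_support b01 r12 seta sum1 A0.
pose S (m : nat) xi := fourier f xi * fourier g (t *: xi) *
   (\sum_(k < m) term (j0 + k%:Z) (t *: xi) + zeta (t *: xi)) * chi x xi.
pose I (k : nat) xi := fourier f xi * fourier g (t *: xi) * term (j0 + k%:Z) (t *: xi) * chi x xi.
pose J xi := fourier f xi * fourier g (t *: xi) * zeta (t *: xi) * chi x xi.
have ms := measurable_scale t : measurable_fun setT (fun x : Rn => _).
have ichi h : cintegrable mu h -> cintegrable mu (fun xi => h xi * chi x xi).
  move=> ih; apply: cintegrable_eq (cintegrable_ft 1 x ih) => xi.
  by rewrite scale1r chiC.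
have ibd h (c : R) : cmeas h -> (forall xi, normc (h xi) <= c) ->
    cintegrable mu (fun xi => fourier f xi * fourier g (t *: xi) * h (t *: xi) * chi x xi).
  move=> mh hc; apply: ichi.
  apply: cintegrable_eq (cintegrableM_bounded (cmeas_comp mh ms) (fun xi => hc (t *: xi)) (cintegrable_scaled t ig)) => xi.
  by rewrite mulrC.
have iI k : cintegrable mu (I k).
  apply: (ibd (term (j0 + k%:Z)) B); first exact: term_cmeas.
  by move=> xi; have := hB (j0 + k%:Z) 1%N xi; rewrite big_ord1 addr0.
have iJ : cintegrable mu J by exact: (ibd zeta cz).
have SE (m : nat) : cint mu (S m) = \sum_(k < m) cint mu (I k) + cint mu J.
  rewrite -(@cint_sum _ _ _ mu _ (index_enum 'I_m) (fun k : 'I_m => I k))//.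
  rewrite -cintD//; last first.
    apply: cintegrable_eq (ibd (fun xi => \sum_(k < m) term (j0 + k%:Z) xi) B _ (hB j0 m)).
      by move=> xi; rewrite mulr_sumr mulr_suml.
    by apply: cmeas_sum => k; exact: term_cmeas.
  apply: eq_cint => xi; rewrite /S mulrDr mulrDl; congr (_ + _).
  by rewrite mulr_sumr mulr_suml.
have cvS : ccvg (fun m : nat => cint mu (S m)) (scaled_conv f g x t).
  suff [] : cintegrable mu (fun xi => fourier f xi * fourier g (t *: xi) * chi x xi) /\
      ccvg (fun m : nat => cint mu (S m)) (scaled_conv f g x t) by [].
  apply: (@cint_dominated _ _ _ mu S _ (fun xi => ((cg * (B + cz))%:E * (normc (fourier f xi))%:E)%E)).
  - move=> m; apply: cintegrable_cmeas (ibd (fun xi => \sum_(k < m) term (j0 + k%:Z) xi + zeta xi) (B + cz) _ _).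
      by apply: cmeasD => //; apply: cmeas_sum => k; exact: term_cmeas.
    by move=> xi; rewrite (le_trans (le_normcD _ _))// lerD//; exact: hB.
  - apply: cintegrable_cmeas; apply: ichi; exact: cintegrable_scaled.
  - move=> xi; have [K hK] := zetahat_partial (etahat := etahat) phi b01 r12 seta (enorm (t *: xi)) hj0.
    apply: (eq_ccvg (u := fun=> fourier f xi * fourier g (t *: xi) * chi x xi)); last exact: ccvg_cst.
    exists K => // m /= Km; rewrite /S /zeta (hK m Km)// addrC subrK mulr1//.
  - move=> m xi; rewrite !ComplexField.Normc.normcM normc_chi mulr1 -EFinM lee_fin.
    rewrite -mulrA mulrC ler_wpM2r ?normc_ge0//; apply: ler_pM; rewrite ?normc_ge0//.
    by rewrite (le_trans (le_normcD _ _))// lerD//; exact: hB.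
  - by apply: emeasurable_funM => //; exact: (nnmeas_normc mf).1.
  - rewrite nnmeas_integralZl//; last 2 first.
      exact: nnmeas_normc.
      by rewrite lee_fin mulr_ge0 ?addr_ge0.
    rewrite lte_mul_pinfty ?lee_fin ?mulr_ge0 ?addr_ge0//.
    exact: cintegrable_lty (schwartz_fourier_integrable sf).
apply: (ccvg_normc_le cvS) => m; rewrite SE.
have P0 tau : 0 < tau -> (0 <= peetre (scaled_conv f phi) N x tau)%E.
  by move=> tau0; exact: peetre_ge0.
have W0 (h : Rn -> R[i]) : (0 <= weighted_L1 N h)%E.
  by apply: integral_ge0 => y _; rewrite lee_fin mulr_ge0 ?powR_ge0 ?normc_ge0.
have bt k : 0 < b ^ (j0 + k%:Z) * t by rewrite mulr_gt0// scale_gt0.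
apply: (@le_trans _ _ ((\sum_(k < m) normc (cint mu (I k)))%:E + (normc (cint mu J))%:E)%E).
  rewrite -EFinD lee_fin (le_trans (le_normcD _ _))// lerD2r; exact: normc_sum.
apply: leeD.
  apply: (@le_trans _ _ (\big[+%E/0%E]_(0 <= k < m) (Cphi b etahat g (j0 + k%:Z)%R N *
      peetre (scaled_conv f phi) N x (b ^ (j0 + k%:Z) * t)%R))%E); last first.
    by apply: nneseries_lim_ge => k _ _; apply: mule_ge0; [exact: W0|exact: P0].
  rewrite -sumEFin big_mkord; apply: lee_sum => k _.
  pose j := j0 + (k : nat)%:Z.
  pose mk xi := fourier g (b ^ (- j) *: xi) * etahat xi.
  have bj : b ^ j != 0 by rewrite gt_eqF// scale_gt0.
  have mkmeas : cmeas mk.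
    by apply: cmeasM; [exact: cmeas_fourier_scale|exact: ccontinuous_cmeas].
  have mkb xi : normc (mk xi) <= cg * ce.
    by rewrite ComplexField.Normc.normcM ler_pM ?normc_ge0.
  have imk : cintegrable mu mk.
    apply: (cintegrable_bounded_support (rho := r2) mkmeas mkb) => xi.
    by rewrite mulf_eq0 negb_or => /andP[_ /seta/andP[]].
  have cmk : seq_continuous mk.
    apply: seq_continuousM; last exact: ccontinuous_seq.
    by rewrite fourierE; apply: seq_continuousZ; exact: ft_seq_continuous.
  have IE : I k =1 fun xi => fourier f xi * fourier phi ((b ^ j * t) *: xi) * mk ((b ^ j * t) *: xi) * chi x xi.
    have mAC (u v w z e : R[i]) : u * v * (w * z) * e = u * w * (v * z) * e.
      by rewrite mulrACA.
    have tj : b ^ (- j) * (b ^ j * t) = t by rewrite -invr_expz mulKf.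
    move=> xi; rewrite /I /mk /term -/j !scalerA tj.
    exact: mAC.
  rewrite (eq_cint mu IE).
  exact: (peetre_kernel_bound x iphi N0 (bt k) imk mkb cmk (Coo k)).
pose mz xi := zeta xi * Theta xi.
have mzb xi : normc (mz xi) <= cz * cT.
  rewrite /mz; have [->|/szeta xiA] := eqVneq (zeta xi) 0; rewrite ComplexField.Normc.normcM.
    by rewrite ComplexField.Normc.normc0 mul0r mulr_ge0.
  by rewrite ler_pM ?normc_ge0// hcT// ltW.
have mmz : cmeas mz by apply: cmeasM => //; exact: ccontinuous_cmeas.
have imz : cintegrable mu mz.
  apply: (cintegrable_bounded_support (rho := r2 / A) mmz mzb) => xi.
  by rewrite mulf_eq0 negb_or => /andP[/szeta].
have cmz : seq_continuous mz.
  apply: seq_continuousM; last exact: ccontinuous_seq.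
  exact: (zetahat_seq_continuous b01 r12 iphi ceta seta A0).
have JE : J =1 fun xi => fourier f xi * fourier phi (t *: xi) * mz (t *: xi) * chi x xi.
  move=> xi; rewrite /J /mz; congr (_ * _).
  have [z0|/szeta xiA] := eqVneq (zeta (t *: xi)) 0; first by rewrite z0 mul0r !mulr0.
  by rewrite (gphi _ xiA) [zeta _ * Theta _]mulrC !mulrA.
rewrite (eq_cint mu JE).
exact: (peetre_kernel_bound x iphi N0 t0 imz mzb cmz Doo).
Qed.

End decomposition.

(** * Peetre's pointwise estimate *)

Section increments.
Context {R : realType} {n : nat}.
Local Notation Rn := 'rV[R]_n.
Local Notation mu := (@leb R n).
Local Notation leb1 := (@lebesgue_measure R).
Implicit Types (x y z xi h : Rn).
Variables (f phi : Rn -> R[i]).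
Hypothesis sf : schwartz f.
Hypothesis iphi : cintegrable mu phi.
Hypothesis phi1 : Ck 1 setT phi.
Hypothesis idphi : forall k : 'I_n, cintegrable mu (cpartial k phi).

(** The mean value inequality, obtained on the frequency side: e^(2 pi i <h,
xi>) - 1 is 2 pi i <h, xi> times the integral of e^(2 pi i u <h, xi>) for u in
[0, 1], and the factors 2 pi i xi_k turn phi into its partial derivatives. *)
Lemma scaled_conv_increment z h (t M : R) : 0 < t ->
  (forall (k : 'I_n) (s : R), 0 <= s <= 1 ->
     normc (scaled_conv f (cpartial k phi) (z + s *: h) t) <= M) ->
  normc (scaled_conv f phi (z + h) t - scaled_conv f phi z t) <=
    (\sum_(k < n) `|h ord0 k|) / t * M.
Proof.
move=> t0 GM; have t_neq0 : t != 0 by rewrite gt_eqF.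
pose a xi := 2 * pi * dot h xi.
have E xi := cint_cis (a xi) (@ltr01 R).
pose e xi := cint leb1 (on_segment 1 (fun u => cis (a xi * u))).
have chE xi : chi h xi - 1 = (0 +i* a xi)%C * e xi.
  by rewrite /e (E xi).2 mulr1.
pose A k xi := fourier f xi * fourier (cpartial k phi) (t *: xi).
have iA k : cintegrable mu (A k) by exact: cintegrable_scaled.
have aE xi : (0 +i* a xi)%C = \sum_(k < n) (h ord0 k)%:C%C * Xi k xi.
  apply: complex_ext.
    by rewrite Re_sum big1// => k _; rewrite Re_mul /= mulr0 mul0r subrr.
  rewrite Im_sum /= /a /dot mulr_sumr; apply: eq_bigr => k _.
  by rewrite mul0r addr0 mulrCA.
have key k : cintegrable mu (fun xi => A k xi * chi z xi * e xi) /\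
    normc (cint mu (fun xi => A k xi * chi z xi * e xi)) <= M.
  pose G (v : Rn * measurableTypeR R) := A k v.1 * chi z v.1 * on_segment 1 (fun u => cis (a v.1 * u)) v.2.
  have mG : cmeas G.
    apply: cmeasM.
      apply: cmeasM; first exact: cmeas_comp (cintegrable_cmeas (iA k)) measurable_fst.
      by apply: cmeas_chi; [exact: measurable_cst|exact: measurable_fst].
    apply: cmeasM.
      apply: cmeas_real.
      have mI : measurable_fun [set: measurableTypeR R] (fun u => \1_(`[0, 1] : set R) u : R).
        by apply: measurable_indic; exact: measurable_itv.
      exact: (measurableT_comp mI measurable_snd).
    apply: cmeas_cis; apply: measurable_funM; last exact: measurable_snd.
    apply: measurable_funM => //; exact: measurableT_comp (measurable_dot h) measurable_fst.
  pose one_ (u : measurableTypeR R) : R[i] := (\1_(`[0, 1] : set R) u)%:C%C.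
  have i1 : cintegrable leb1 one_.
    apply: cintegrable_eq (cint_cis 0 (@ltr01 R)).1 => u.
    by rewrite /on_segment mul0r cis0 mulr1.
  have [|iG FG] := cint_fubini_prod mG _ (iA k) i1.
    move=> xi u; rewrite /G /on_segment !ComplexField.Normc.normcM normc_chi mulr1 normc_cis mulr1.
    exact: lexx.
  have e1 xi : cint leb1 (fun u => G (xi, u)) = A k xi * chi z xi * e xi.
    by rewrite /G /= cintZ//; exact: (E xi).1.
  have e2 u : cint mu (fun xi => G (xi, u)) =
      one_ u * scaled_conv f (cpartial k phi) (z + u *: h) t.
    rewrite /scaled_conv -cintZ; last first.
      by apply: cintegrable_eq (cintegrable_ft 1 (z + u *: h) (iA k)) => xi; rewrite scale1r chiC.
    apply: eq_cint => xi; rewrite /G /on_segment /= chiD.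
    have -> : chi (u *: h) xi = cis (a xi * u) by rewrite /chi dotZl /a; congr cis; ring.
    have R0 (Fv Z O C : R[i]) : Fv * Z * (O * C) = O * (Fv * (Z * C)) by ring.
    exact: R0.
  have iG' : cintegrable mu (fun xi => A k xi * chi z xi * e xi).
    by apply: cintegrable_eq iG => xi; exact: e1.
  split=> //.
  have M0 : 0 <= M.
    by apply: le_trans (GM k 0 _); rewrite ?normc_ge0// lexx ler01.
  have pI : nnmeas (fun u : measurableTypeR R => (\1_(`[0, 1] : set R) u : R)%:E).
    by apply: nnmeas_indic; exact: measurable_itv.
  have M0' : (0 <= M%:E)%E by rewrite lee_fin.
  have iM : (\int[leb1]_u (M%:E * (\1_(`[0, 1] : set R) u)%:E) = M%:E)%E.
    by rewrite (nnmeas_integralZl _ measurableT pI M0') integral_indic_segment// -EFinM mulr1.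
  rewrite -(eq_cint mu e1) FG (eq_cint leb1 e2) -lee_fin.
  have io : cintegrable leb1 (fun u => one_ u * scaled_conv f (cpartial k phi) (z + u *: h) t).
    apply/cintegrableP; split.
      apply: cmeasM; first exact: cintegrable_cmeas i1.
      have := cmeas_scaled_conv sf (idphi k) => mF.
      apply: (cmeas_comp mF (g := fun u : measurableTypeR R => (z + u *: h, t))).
      apply: measurable_fun_pair; last exact: measurable_cst.
      apply: measurable_fun_rV => i.
      rewrite (_ : (fun _ => _) = fun u : R => z ord0 i + u * h ord0 i); last first.
        by apply/funext => u; rewrite !mxE.
      by apply: measurable_funD => //; exact: measurable_funM.
    apply: (@le_lt_trans _ _ (\int[leb1]_u (M%:E * (\1_(`[0, 1] : set R) u)%:E))%E).
      apply: ge0_le_integralT => u; first by rewrite lee_fin normc_ge0.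
      rewrite -EFinM lee_fin ComplexField.Normc.normcM normc_real indicE.
      have [u01|u01] := boolP (u \in _); last by rewrite normr0 mul0r mulr0.
      by rewrite normr1 mul1r mulr1; apply: GM; move: u01; rewrite inE /= in_itv.
    by rewrite iM ltry.
  apply: normc_cint_le => //.
  apply: (@le_trans _ _ (\int[leb1]_u (M%:E * (\1_(`[0, 1] : set R) u)%:E))%E).
    apply: ge0_le_integralT => u; first by rewrite lee_fin normc_ge0.
    rewrite -EFinM lee_fin ComplexField.Normc.normcM normc_real indicE.
    have [u01|u01] := boolP (u \in _); last by rewrite normr0 mul0r mulr0.
    by rewrite normr1 mul1r mulr1; apply: GM; move: u01; rewrite inE /= in_itv.
  by rewrite iM.
have fP k xi : fourier phi (t *: xi) * Xi k xi = (t^-1)%:C%C * fourier (cpartial k phi) (t *: xi).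
  rewrite fourier_partial// mulrA mulrC; congr (_ * _).
  apply: complex_ext; rewrite ?Re_mul ?Im_mul /= !mxE; first by rewrite mulr0 mul0r subrr.
  by rewrite mul0r addr0 mulrCA mulKf// mulrA.
have DE : scaled_conv f phi (z + h) t - scaled_conv f phi z t =
    \sum_(k < n) (h ord0 k / t)%:C%C * cint mu (fun xi => A k xi * chi z xi * e xi).
  have i0 y : cintegrable mu (fun xi => fourier f xi * fourier phi (t *: xi) * chi y xi).
    by apply: cintegrable_eq (cintegrable_ft 1 y (cintegrable_scaled sf t iphi)) => xi; rewrite scale1r chiC.
  rewrite /scaled_conv -cintB//.
  transitivity (cint mu (fun xi => \sum_(k < n) (h ord0 k / t)%:C%C * (A k xi * chi z xi * e xi))).
    apply: eq_cint => xi; rewrite chiD mulrA -[X in _ - X]mulr1 -mulrBr chE aE.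
    rewrite mulr_suml mulr_sumr; apply: eq_bigr => k _.
    rewrite /A rmorphM /=.
    have R1 (F P C H X e0 : R[i]) : F * P * C * (H * X * e0) = H * (F * (P * X) * C * e0) by ring.
    have R2 (F T D C H e0 : R[i]) : H * (F * (T * D) * C * e0) = H * T * (F * D * C * e0) by ring.
    by rewrite R1 fP R2.
  rewrite cint_sum => [|k _]; last by apply: cintegrableZ; exact: (key k).1.
  by apply: eq_bigr => k _; rewrite cintZ//; exact: (key k).1.
rewrite DE (le_trans (normc_sum _ _))// mulr_suml mulr_suml; apply: ler_sum => k _.
rewrite ComplexField.Normc.normcM normc_real normrM [`|t^-1|]gtr0_norm ?invr_gt0//.
by rewrite ler_wpM2l ?mulr_ge0 ?invr_ge0 ?(ltW t0)//; exact: (key k).2.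
Qed.

End increments.

Lemma poweR_add_le (R : realType) (x y : \bar R) (s : R) : 0 < s -> (0 <= x)%E -> (0 <= y)%E ->
  ((x + y) `^ s <= (2 `^ s)%:E * (x `^ s + y `^ s))%E.
Proof.
move=> s0; wlog xy : x y / (x <= y)%E.
  move=> H x0 y0; have [xy|/ltW yx] := leP x y; first exact: H.
  by rewrite addeC [X in (_ <= _ * X)%E]addeC; exact: H.
move=> x0 y0; have s0' := ltW s0.
apply: (@le_trans _ _ ((2%:E * y) `^ s)%E).
  by apply: lee_poweR => //; [exact: adde_ge0|rewrite mule_natl mule2n leeD].
rewrite poweRM// poweR_EFin; apply: lee_wpmul2l; first by rewrite lee_fin powR_ge0.
by rewrite leeDr// poweR_ge0.
Qed.

Lemma powR_add_le (R : realType) (x y s : R) : 0 < s -> 0 <= x -> 0 <= y ->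
  (x + y) `^ s <= 2 `^ s * (x `^ s + y `^ s).
Proof.
by move=> s0 x0 y0; have := @poweR_add_le R x%:E y%:E s s0 x0 y0; rewrite -EFinD !poweR_EFin -EFinD -EFinM lee_fin.
Qed.

Section peetre_estimate.
Context {R : realType} {n : nat}.
Local Notation Rn := 'rV[R]_n.
Local Notation mu := (@leb R n).
Local Notation leb1 := (@lebesgue_measure R).
Local Notation one := ((fun=> 1) : Rn -> R).
Implicit Types (x y z h : Rn) (F : Rn -> R -> R[i]) (G : 'I_n -> Rn -> R -> R[i]).
Hypothesis n0 : (0 < n)%N.
Variables (N b eps C2 : R).
Hypothesis N0 : 0 < N.
Hypothesis b01 : 0 < b < 1.
Hypothesis eps0 : 0 < eps.
Hypothesis C20 : 0 <= C2.

Let th := b `^ eps.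
Let r := n%:R / N.

Lemma th01 : 0 < th < 1.
Proof.
case/andP: b01 => b0 b1; rewrite powR_gt0//= /th /powR gt_eqF// -expR0 ltr_expR.
by rewrite pmulr_rlt0// ln_lt0// b0.
Qed.

(** The properties of F = f * phi_t and of G k = f * (d_k phi)_t from which
Peetre's estimate follows: the gradient of F is controlled by Peetre's functions
of F itself at the finer scales b^j t, with a gain th^j. *)
Record self_improving F G : Prop := SelfImproving {
  si_continuous : forall t, 0 < t -> seq_continuous (F ^~ t) ;
  si_measurable : cmeas (fun z : Rn * measurableTypeR R => F z.1 z.2) ;
  si_increment : forall z h t M, 0 < t ->
    (forall (k : 'I_n) (s : R), 0 <= s <= 1 -> normc (G k (z + s *: h) t) <= M) ->
    normc (F (z + h) t - F z t) <= (\sum_(k < n) `|h ord0 k|) / t * M ;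
  si_gradient : forall k z t, 0 < t ->
    ((normc (G k z t))%:E <= C2%:E * \sum_(j <oo) (((b ^+ j) `^ N * th ^+ j)%R%:E * peetre F N z (b ^+ j * t)%R))%E
}.

Definition peetre_sum F x t : \bar R := (\sum_(j <oo) ((th ^+ j)%:E * peetre F N x (b ^+ j * t)%R))%E.

Definition local_power F (y : Rn) (t : R) : \bar R := ((normc (F y t)) `^ r)%:E.

Let b0 : 0 < b. Proof. by case/andP: b01. Qed.
Let th0 : 0 < th. Proof. exact: powR_gt0. Qed.
Let r0 : 0 < r. Proof. by rewrite divr_gt0// ltr0n. Qed.
Let NN : 0 <= N. Proof. exact: ltW. Qed.
Let bj0 j : 0 < b ^+ j. Proof. exact: exprn_gt0. Qed.

Lemma peetre_sum_ge0 F x t : 0 < t -> (0 <= peetre_sum F x t)%E.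
Proof.
move=> t0; apply: nneseries_ge0 => j _ _; apply: mule_ge0.
  by rewrite lee_fin exprn_ge0// ltW.
by apply: peetre_ge0 => //; rewrite mulr_gt0.
Qed.

(** Moving the centre from x - y to x costs Peetre's weight at the scale b^j t;
the factor (b^j)^N brings it down to the weight at the scale t. *)
Lemma gradient_bound F G k x y t : self_improving F G -> 0 < t ->
  ((normc (G k (x - y) t))%:E <= (C2 * peetre_weight N y t)%:E * peetre_sum F x t)%E.
Proof.
move=> si t0; apply: (le_trans (si_gradient si k (x - y) t0)).
rewrite EFinM -muleA; apply: lee_wpmul2l; first by rewrite lee_fin.
have W0 := ltW (peetre_weight_gt0 y NN t0).
have bt j : 0 < b ^+ j * t by rewrite mulr_gt0.
have P0 j z := peetre_ge0 F z NN (bt j).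
rewrite /peetre_sum -nneseriesZl => [|j _]; last by rewrite mule_ge0// lee_fin exprn_ge0// ltW.
apply: lee_nneseries => [j _ _|j _]; first by rewrite mule_ge0// lee_fin mulr_ge0 ?powR_ge0 ?exprn_ge0// ltW.
apply: (@le_trans _ _ (((b ^+ j) `^ N * th ^+ j)%:E * (peetre F N x (b ^+ j * t)%R * (peetre_weight N y (b ^+ j * t))%:E))%E).
  apply: lee_wpmul2l; first by rewrite lee_fin mulr_ge0 ?powR_ge0 ?exprn_ge0// ltW.
  by apply: peetre_shift => //; exact: si_continuous si _ (bt j).
rewrite (muleC (peetre _ _ _ _)) !muleA -!EFinM; apply: lee_wpmul2r => //.
rewrite lee_fin mulrAC ler_wpM2r ?exprn_ge0 ?(ltW th0)//.
have e0 : 0 <= enorm y by exact: enorm_ge0.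
rewrite /peetre_weight -powRM ?(ltW (bj0 j)) ?addr_ge0 ?divr_ge0 ?(ltW (bt j))//.
have E : b ^+ j * (1 + enorm y / (b ^+ j * t)) = b ^+ j + enorm y / t.
  by field; rewrite !gt_eqF.
rewrite E; apply: ge0_ler_powR; rewrite ?nnegrE ?addr_ge0 ?divr_ge0 ?(ltW t0) ?(ltW (bj0 j))//.
by rewrite lerD2r exprn_ile1 ?(ltW b0)//; case/andP: b01 => _ /ltW.
Qed.

Lemma nnmeas_local_power F t : cmeas (fun z : Rn * measurableTypeR R => F z.1 z.2) ->
  nnmeas (local_power F ^~ t).
Proof.
move=> mF; apply: nnmeas_EFin => [|y]; last exact: powR_ge0.
apply: (measurableT_comp (measurable_powR _)); apply: (measurable_normc (f := fun y => F y t)).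
apply: (cmeas_comp mF (g := fun y : Rn => (y, t : measurableTypeR R))).
exact: pair2_measurable.
Qed.

Lemma integral_cube_le_maxf (g : Rn -> \bar R) i x : nnmeas g -> rat_cube i x ->
  (\int[mu]_(y in rat_cube i) g y <= ((2 * ratr (rat_cube_code n i).2) ^+ n : R)%R%:E * maxf mu (@rat_cube R n) one g x)%E.
Proof.
move=> pg ix.
have c0 : 0 < (2 * ratr (rat_cube_code n i).2 : R) ^+ n.
  by rewrite exprn_gt0// mulr_gt0// rat_radius_gt0.
apply: (@le_trans _ _ (((2 * ratr (rat_cube_code n i).2) ^+ n)%:E * wavg mu (@rat_cube R n) one g i)%E).
  have cE : wmass mu (@rat_cube R n) one i = ((2 * ratr (rat_cube_code n i).2 : R) ^+ n)%:E.
    by rewrite (wmass1 (@rat_cube_vitali_family R n)); exact: leb_rat_cube.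
  rewrite /wavg cE /= muleA -EFinM divff ?gt_eqF// mul1e.
  by under [leRHS]eq_integral do rewrite mule1.
apply: lee_wpmul2l; first by rewrite lee_fin ltW.
apply: le_ereal_sup_tmp; exists ((\1_(rat_cube i) x : R)%:E * wavg mu (@rat_cube R n) one g i)%E.
  by exists i.
by rewrite indicE mem_set// mul1e.
Qed.

(** The mean value inequality on a ball of radius d t, with gradient_bound for
the gradient; the factor d will be chosen small. *)
Lemma oscillation F G x y z t d s : self_improving F G -> 0 < t -> 0 < d <= 1 -> 0 <= s ->
  peetre_sum F x t = s%:E -> ball (x - y) (d * t) z ->
  normc (F (x - y) t) <= normc (F z t) +
    n%:R * (C2 * (1 + n%:R) `^ N) * d * s * peetre_weight N y t.
Proof.
move=> si t0 /andP[d0 d1] s0 Ss zB.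
pose h := z - (x - y); have zE : z = (x - y) + h by rewrite /h addrC subrK.
have hk k : `|h ord0 k| <= d * t.
  have := zB; rewrite rV_ballE ?mulr_gt0// => /(_ k) /=; rewrite in_itv/= => /andP[z1 z2].
  rewrite /h mxE [X in _ + X]mxE ler_norml; apply/andP; split; lra.
have W0 := ltW (peetre_weight_gt0 y NN t0).
pose M := C2 * (1 + n%:R) `^ N * s * peetre_weight N y t.
have M0 : 0 <= M by rewrite !mulr_ge0 ?powR_ge0.
have GM (k : 'I_n) (u : R) : 0 <= u <= 1 -> normc (G k ((x - y) + u *: h) t) <= M.
  move=> /andP[u0 u1]; have -> : x - y + u *: h = x - (y + u *: (- h)).
    by rewrite scalerN opprD opprK addrA.
  rewrite -lee_fin; apply: (le_trans (gradient_bound k x _ si t0)).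
  rewrite Ss -EFinM lee_fin /M mulrAC -!mulrA ler_wpM2l// mulrCA ler_wpM2l//.
  rewrite mulrC; apply: (le_trans (peetre_weightD y _ NN t0)); rewrite ler_wpM2l//.
  have e0 := enorm_ge0 (u *: - h).
  apply: ge0_ler_powR; rewrite ?nnegrE ?addr_ge0 ?divr_ge0 ?(ltW t0)//.
  rewrite lerD2l ler_pdivrMr//; apply: enorm_le_coord; first exact: ltW.
  move=> k'; rewrite mxE [X in _ * X]mxE normrM normrN ger0_norm//.
  apply: (le_trans (ler_piMl (normr_ge0 _) u1)); apply: (le_trans (hk k')).
  by rewrite ler_piMl// ltW.
have := si_increment si t0 GM; rewrite -zE => inc.
have T (u v : R[i]) : normc u <= normc v + normc (v - u).
  by rewrite -{1}(subKr v u) (le_trans (le_normcD _ _))// normcN.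
apply: (le_trans (T _ (F z t))); rewrite lerD2l (le_trans inc)//.
apply: (@le_trans _ _ (n%:R * d * M)); last by rewrite /M; lra.
rewrite ler_wpM2r// ler_pdivrMr// -mulrA.
apply: (@le_trans _ _ (\sum_(k < n) d * t)); first by apply: ler_sum => k _.
by rewrite sumr_const card_ord -[in leLHS]mulr_natl.
Qed.

(** Average the r-th power of oscillation over the ball of radius d t around x -
y. This ball is contained in the cube of radius |y| + d t around x, so that the
average of |F|^r over it is at most the maximal function at x times the ratio of
the volumes, of order d^(-n) (1 + |y| / t)^n. As r = n / N, the factor (1 + |y|
/ t)^n is the r-th power of Peetre's weight, by which the inequality is divided.
*)
Lemma peetre_pointwise : exists2 C : R, 0 < C & forall F G d x t, self_improving F G ->
  0 < d <= 1 -> 0 < t ->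
  (peetre F N x t `^ r <= C%:E * ((d ^- n)%:E * maxf mu (@rat_cube R n) one (local_power F ^~ t) x +
    (d `^ r)%:E * peetre_sum F x t `^ r))%E.
Proof.
pose c1 := n%:R * (C2 * (1 + n%:R) `^ N).
have c10 : 0 <= c1 by rewrite !mulr_ge0 ?powR_ge0.
exists (2 `^ r * (2 ^+ n + c1 `^ r)).
  by rewrite mulr_gt0 ?powR_gt0// ltr_wpDr ?powR_ge0// exprn_gt0.
move=> F G d x t si d01 t0; have /andP[d0 d1] := d01.
have dn0 : 0 < d ^- n by rewrite invr_gt0 exprn_gt0.
have dr0 : 0 < d `^ r by rewrite powR_gt0.
set C := 2 `^ r * _; have C0 : 0 < C.
  by rewrite mulr_gt0 ?powR_gt0// ltr_wpDr ?powR_ge0// exprn_gt0.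
set M := maxf _ _ _ _ _.
have pg := nnmeas_local_power t (si_measurable si).
have M0 : (0 <= M)%E.
  apply: le_ereal_sup_tmp; exists ((\1_(rat_cube 0) x : R)%:E * wavg mu (@rat_cube R n) one (local_power F ^~ t) 0)%E.
    by exists 0%N.
  apply: mule_ge0; first by rewrite lee_fin indicE.
  apply: mule_ge0; first by rewrite lee_fin invr_ge0 fine_ge0// (wmass1 (@rat_cube_vitali_family R n)) measure_ge0.
  by apply: integral_ge0 => y _; rewrite mule1; exact: pg.2.
have S0 := peetre_sum_ge0 F x t0.
have [Soo|] := eqVneq (peetre_sum F x t) +oo%E.
  rewrite Soo poweRyr ?gt_eqF// [X in (_ + X)%E]gt0_muley ?lte_fin//.
  rewrite addey ?gt0_muley ?leey ?lte_fin//.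
  by rewrite gt_eqF// (lt_le_trans _ (mule_ge0 _ M0))// lee_fin ltW.
move=> Sfin; have [Moo|] := eqVneq M +oo%E.
  rewrite Moo gt0_muley ?lte_fin// addye ?gt0_muley ?leey ?lte_fin//.
  by rewrite gt_eqF// (lt_le_trans _ (mule_ge0 _ (poweR_ge0 _ _)))// lee_fin ltW.
move=> Mfin; have Mf : M \is a fin_num by rewrite ge0_fin_numE// ltey.
have Sf : peetre_sum F x t \is a fin_num by rewrite ge0_fin_numE// ltey.
pose m := fine M; pose s := fine (peetre_sum F x t).
have mE : M = m%:E by rewrite fineK.
have sE : peetre_sum F x t = s%:E by rewrite fineK.
have m0 : 0 <= m by exact: fine_ge0.
have s0 : 0 <= s by exact: fine_ge0.
rewrite mE sE poweR_EFin.
pose X := d ^- n * m + d `^ r * s `^ r.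
have XE : ((d ^- n)%:E * m%:E + (d `^ r)%:E * (s `^ r)%:E = X%:E)%E by [].
rewrite XE.
have X0 : 0 <= X by rewrite addr_ge0// mulr_ge0 ?powR_ge0// ltW.
have key y : normc (F (x - y) t) / peetre_weight N y t <= (C * X) `^ r^-1.
  have W0 := peetre_weight_gt0 y NN t0; set W := peetre_weight N y t in W0 *.
  set f0 := normc (F (x - y) t); have f00 : 0 <= f0 by exact: normc_ge0.
  pose D := c1 * d * s * W; have D0 : 0 <= D by rewrite !mulr_ge0// ltW.
  have dt0 : 0 < d * t by rewrite mulr_gt0.
  have e0 := enorm_ge0 y.
  have rho0 : 0 < enorm y + d * t by rewrite ltr_wpDl.
  have [i [Bi ri _]] := ball_in_rat_cube x rho0.
  have WE : W `^ r = (1 + enorm y / t) ^+ n.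
    by rewrite /W /peetre_weight -powRrM /r mulrCA divff ?gt_eqF// mulr1 powR_mulrn// addr_ge0 ?divr_ge0// ltW.
  have mB : measurable (ball (x - y) (d * t)) := measurable_rV_ball _ _.
  have osc z : ball (x - y) (d * t) z -> ((f0 `^ r)%:E <= (2 `^ r)%:E * (local_power F z t + (D `^ r)%:E))%E.
    move=> zB; rewrite /local_power -EFinD -EFinM lee_fin.
    apply: le_trans (powR_add_le r0 (normc_ge0 _) D0).
    apply: ge0_ler_powR; rewrite ?nnegrE ?addr_ge0 ?normc_ge0// ?(ltW r0)//.
    have := oscillation si t0 d01 s0 sE zB; rewrite -/W -/f0 /D /c1.
    by move=> h; rewrite (le_trans h)// lerD2l -!mulrA.
  have BE : mu (ball (x - y) (d * t)) = ((2 * (d * t)) ^+ n)%:E by exact: leb_rV_ball.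
  have i1 : ((f0 `^ r)%:E * ((2 * (d * t)) ^+ n)%:E <=
     (2 `^ r)%:E * (((2 * ratr (rat_cube_code n i).2) ^+ n)%:E * m%:E + (D `^ r)%:E * ((2 * (d * t)) ^+ n)%:E))%E.
    apply: (@le_trans _ _ (\int[mu]_(z in ball (x - y)%R (d * t)%R) ((2 `^ r)%:E * (local_power F z t + (D `^ r)%:E)))%E).
      rewrite -BE -integral_cst//; apply: nnmeas_le_integral => //.
        by apply: nnmeas_cst; rewrite lee_fin powR_ge0.
      apply: nnmeasM; first by apply: nnmeas_cst; rewrite lee_fin powR_ge0.
      by apply: nnmeasD => //; apply: nnmeas_cst; rewrite lee_fin powR_ge0.
    have pD : nnmeas (fun=> (D `^ r)%:E : \bar R) by move=> d' T'; apply: nnmeas_cst; rewrite lee_fin powR_ge0.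
    rewrite nnmeas_integralZl ?lee_fin ?powR_ge0//; last by apply: nnmeasD => //; exact: pD.
    apply: lee_wpmul2l; first by rewrite lee_fin powR_ge0.
    rewrite (nnmeas_integralD (leb n) mB pg (pD _ _)).
    apply: leeD; last by rewrite integral_cst// -BE.
    have xi : rat_cube i x by apply: Bi; exact: ballxx.
    rewrite -mE; apply: le_trans (integral_cube_le_maxf pg xi).
    apply: ge0_subset_integral => //; first exact: measurable_rV_ball.
    + by apply: measurable_funTS; exact: pg.1.
    + by move=> z _; exact: pg.2.
    move=> z zB; apply: Bi; have := zB; rewrite !rV_ballE// => h k; have := h k.
    rewrite /= !in_itv/= !mxE => /andP[h1 h2].
    have := coord_le_enorm y k; rewrite ler_norml => /andP[y1 y2].
    by apply/andP; split; lra.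
  have i2 : f0 `^ r <= 2 `^ r * (2 ^+ n * d ^- n * W `^ r * m + D `^ r).
    have {}i1 : f0 `^ r * (2 * (d * t)) ^+ n <=
        2 `^ r * ((2 * ratr (rat_cube_code n i).2) ^+ n * m + D `^ r * (2 * (d * t)) ^+ n).
      by rewrite -lee_fin; exact: i1.
    have dtn : 0 < (2 * (d * t)) ^+ n by rewrite exprn_gt0// mulr_gt0.
    rewrite -(ler_pM2r dtn) (le_trans i1)// -[leRHS]mulrA; apply: ler_wpM2l; first exact: powR_ge0.
    rewrite [leRHS]mulrDl lerD2r.
    have -> : 2 ^+ n * d ^- n * W `^ r * m * (2 * (d * t)) ^+ n = (4 * (d * t) / d * (1 + enorm y / t)) ^+ n * m.
      rewrite WE -exprVn mulrAC -!exprMn; congr (_ ^+ n * m); field.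
      by rewrite !gt_eqF.
    apply: ler_wpM2r => //; apply: lerXn2r; rewrite ?nnegrE.
    - by rewrite mulr_ge0// ltW// rat_radius_gt0.
    - by rewrite !mulr_ge0 ?invr_ge0 ?addr_ge0 ?divr_ge0// ltW.
    have -> : 4 * (d * t) / d * (1 + enorm y / t) = 2 * (2 * (t + enorm y)).
      by field; rewrite !gt_eqF.
    rewrite ler_wpM2l// (le_trans (ltW ri))// ler_wpM2l// addrC lerD2r.
    by rewrite ler_piMl// ltW.
  have DE : D `^ r = c1 `^ r * d `^ r * s `^ r * W `^ r.
    by rewrite /D !powRM ?mulr_ge0// ltW.
  have i3 : (f0 / W) `^ r <= C * X.
    rewrite powRM ?invr_ge0 ?(ltW W0)//.
    have -> : (W^-1) `^ r = (W `^ r)^-1 by rewrite -powR_inv1 ?(ltW W0)// -powRrM mulN1r powRN.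
    have W2 : 0 < W `^ r by exact: powR_gt0.
    rewrite (ler_pdivrMr _ _ W2); apply: (le_trans i2).
    rewrite DE /C /X -!mulrA ler_wpM2l ?powR_ge0//.
    set u := W `^ r; set v := s `^ r; set c := c1 `^ r; set e := d `^ r; set a := d ^- n; set p := 2 ^+ n.
    have pos1 : 0 <= p * e * v * u by rewrite !mulr_ge0 ?powR_ge0 ?exprn_ge0.
    have pos2 : 0 <= c * a * m * u by rewrite !mulr_ge0 ?powR_ge0// ltW.
    by lra.
  have fW0 : 0 <= f0 / W by rewrite divr_ge0// ltW.
  rewrite -[leLHS](powRr1 fW0) -(mulfV (lt0r_neq0 r0)) powRrM.
  apply: ge0_ler_powR => //; rewrite ?nnegrE ?powR_ge0//; first by rewrite invr_ge0 ltW.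
  by rewrite mulr_ge0// ltW.
have Ple : (peetre F N x t <= ((C * X) `^ r^-1)%:E)%E.
  by apply: ge_ereal_sup => _ [i _ <-]; rewrite lee_fin; exact: key.
apply: (le_trans (lee_poweR (ltW r0) (peetre_ge0 F x NN t0) Ple)).
by rewrite poweR_EFin -powRrM mulVf ?gt_eqF// powRr1// mulr_ge0// ltW.
Qed.

End peetre_estimate.

(** * Integration over the scales *)

Section logarithmic_measure.
Context {R : realType}.
Local Notation leb1 := (@lebesgue_measure R).

(** The density of dt/t on the positive half-line, extended by zero. *)
Definition kern (t : R) : \bar R := ((0 < t)%R%:R * t `^ (-1))%:E.

Lemma nnmeas_kern : nnmeas (kern : measurableTypeR R -> \bar R).
Proof.
apply: nnmeas_EFin => [|t]; last by rewrite mulr_ge0// powR_ge0.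
apply: measurable_funM; last exact: measurable_powR.
apply: measurable_natr_bool; apply: measurable_fun_ltr; first exact: measurable_cst.
exact: measurable_id.
Qed.

Lemma kern_ge0 t : (0 <= kern t)%E. Proof. exact: nnmeas_kern.2. Qed.

Lemma kern_gt0 t : 0 < t -> kern t = (t^-1)%:E.
Proof. by move=> t0; rewrite /kern t0 mul1r powR_inv1// ltW. Qed.

Lemma kern_le0 t : t <= 0 -> kern t = 0%E.
Proof. by move=> t0; rewrite /kern ltNge t0 mul0r. Qed.

Lemma kern_scale c t : 0 < c -> kern t = (c%:E * kern (c * t))%E.
Proof.
move=> c0; have [t0|t0] := ltP 0 t; last by rewrite !kern_le0 ?mule0// pmulr_rle0.
rewrite !kern_gt0 ?mulr_gt0// -EFinM; congr EFin; field; rewrite !gt_eqF//.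
Qed.

Lemma integral_kern_scale (h : R -> \bar R) c : 0 < c ->
  nnmeas ((fun t => h t * kern t)%E : measurableTypeR R -> \bar R) ->
  (\int[leb1]_t (h (c * t)%R * kern t) = \int[leb1]_t (h t * kern t))%E.
Proof.
move=> c0 ph.
have ph' : nnmeas ((fun t => h (c * t)%R * kern (c * t)%R)%E : measurableTypeR R -> \bar R).
  apply: (nnmeas_comp ph (h := fun t : measurableTypeR R => (c * t : measurableTypeR R))).
  by have := measurable_affine1 c 0; under eq_fun do rewrite addr0.
transitivity (\int[leb1]_t (c%:E * (h (c * t)%R * kern (c * t)%R)))%E.
  by apply: eq_integral => t _; rewrite (kern_scale t c0) muleCA.
have cn0 : c != 0 by rewrite gt_eqF.
have := @integral_affine1 R c 0 (fun t => h t * kern t)%E cn0 ph.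
under eq_integral do rewrite addr0.
have c0' : (0 <= c%:E)%E by rewrite lee_fin ltW.
rewrite (nnmeas_integralZl _ measurableT ph' c0') => ->.
by rewrite muleA -EFinM (ger0_norm (ltW c0)) divff// mul1e.
Qed.

Lemma eq_integral_kern (h1 h2 : R -> \bar R) : (forall t, 0 < t -> h1 t = h2 t) ->
  (\int[leb1]_t (h1 t * kern t) = \int[leb1]_t (h2 t * kern t))%E.
Proof.
move=> h12; apply: eq_integral => t _; have [t0|t0] := ltP 0 t; first by rewrite h12.
by rewrite kern_le0// !mule0.
Qed.

Lemma integral_kernE (h : R -> R) : (forall t, 0 <= h t) ->
  (\int[leb1]_(t in `]0%R, +oo[) ((h t / t)%R)%:E = \int[leb1]_t ((h t)%:E * kern t))%E.
Proof.
move=> h0; rewrite integral_mkcond; apply: eq_integral => t _ /=; rewrite patchE.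
have [t0|t0] := ltP 0 t.
  by rewrite mem_set/= ?in_itv/= ?t0// kern_gt0.
by rewrite memNset/= ?in_itv/= ?ltNge ?t0// kern_le0// mule0.
Qed.

End logarithmic_measure.

Lemma small_powR (R : realType) (a q : R) : 0 < a -> 0 < q ->
  exists2 d : R, 0 < d <= 1 & a * d `^ q <= 2^-1.
Proof.
move=> a0 q0; have a2 : 0 < 2 * a by rewrite mulr_gt0.
have p0 : 0 < (2 * a) `^ (- q^-1) by exact: powR_gt0.
exists (Num.min 1 ((2 * a) `^ (- q^-1))); first by rewrite lt_min ltr01 p0 /= ge_min lexx.
have : Num.min 1 ((2 * a) `^ (- q^-1)) `^ q <= (2 * a)^-1.
  apply: (@le_trans _ _ (((2 * a) `^ (- q^-1)) `^ q)).
    apply: ge0_ler_powR; rewrite ?nnegrE ?(ltW q0) ?(ltW p0)//.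
      by rewrite le_min ler01 ltW.
    by rewrite ge_min lexx orbT.
  by rewrite -powRrM mulNr mulVf ?gt_eqF// powR_inv1// ltW.
move=> H; apply: (@le_trans _ _ (a * (2 * a)^-1)); first by rewrite ler_wpM2l// ltW.
by rewrite le_eqVlt; apply/orP; left; apply/eqP; field; rewrite gt_eqF.
Qed.

Section absorption.
Context {R : realType} {n : nat}.
Local Notation Rn := 'rV[R]_n.
Local Notation mu := (@leb R n).
Local Notation leb1 := (@lebesgue_measure R).
Local Notation one := ((fun=> 1) : Rn -> R).
Implicit Types (x y z h : Rn) (F : Rn -> R -> R[i]) (G : 'I_n -> Rn -> R -> R[i]).
Hypothesis n0 : (0 < n)%N.
Variables (N b q : R).
Hypothesis N0 : 0 < N.
Hypothesis b01 : 0 < b < 1.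
Hypothesis rq : n%:R / N < q.

Let r := n%:R / N.
Let b0 : 0 < b. Proof. by case/andP: b01. Qed.
Let r0 : 0 < r. Proof. by rewrite divr_gt0// ltr0n. Qed.
Let q0 : 0 < q. Proof. exact: lt_trans r0 rq. Qed.
Let NN : 0 <= N. Proof. exact: ltW. Qed.
Let bj0 j : 0 < b ^+ j. Proof. exact: exprn_gt0. Qed.

Lemma nnmeas_peetre_slice F x : cmeas (fun z : Rn * measurableTypeR R => F z.1 z.2) ->
  nnmeas ((fun t => peetre F N x t `^ q * kern t)%E : measurableTypeR R -> \bar R).
Proof.
move=> mF.
rewrite (_ : (fun t => _) = fun t : measurableTypeR R => ((((0 < t)%R%:R)%:E * peetre F N x t) `^ q * kern t)%E).
  apply: nnmeasM; last exact: nnmeas_kern.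
  apply: nnmeas_poweR; apply: (nnmeas_comp (nnmeas_peetre NN mF) (h := fun t : measurableTypeR R => (x, t))).
  exact: pair1_measurable.
apply/funext => t; have [t0|t0] := ltP 0 t; first by rewrite mul1e.
by rewrite kern_le0// !mule0.
Qed.

Lemma nnmeas_peetre_scaled F x c : 0 < c -> cmeas (fun z : Rn * measurableTypeR R => F z.1 z.2) ->
  nnmeas ((fun t => peetre F N x (c * t) `^ q * kern t)%E : measurableTypeR R -> \bar R).
Proof.
move=> c0 mF.
rewrite (_ : (fun t => _) = fun t : measurableTypeR R => (c%:E * (peetre F N x (c * t)%R `^ q * kern (c * t)%R))%E).
  apply: nnmeasM; first by apply: nnmeas_cst; rewrite lee_fin ltW.
  apply: (nnmeas_comp (nnmeas_peetre_slice x mF) (h := fun t : measurableTypeR R => (c * t : measurableTypeR R))).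
  by have := measurable_affine1 c 0; under eq_fun do rewrite addr0.
by apply/funext => t; rewrite (kern_scale t c0) muleCA.
Qed.

(** Peetre's quantities at the scales b^j t are summed with geometric weights: the
logarithmic measure is invariant under dilation, so that each of them contributes
the same integral. *)
Lemma integral_peetre_series F x c s : 0 <= s < 1 -> 0 < c ->
  cmeas (fun z : Rn * measurableTypeR R => F z.1 z.2) ->
  (\int[leb1]_t (peetre F N x t `^ q * kern t) < +oo)%E ->
  (\int[leb1]_t ((\sum_(j <oo) ((s ^+ j)%:E * peetre F N x (c * b ^+ j * t)%R `^ q)) * kern t) =
   (1 - s)^-1%:E * \int[leb1]_t (peetre F N x t `^ q * kern t))%E.
Proof.
move=> /andP[s0 s1] c0 mF Ioo.
have If : (\int[leb1]_t (peetre F N x t `^ q * kern t) \is a fin_num)%E.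
  by rewrite ge0_fin_numE//; exact: nnmeas_integral_ge0 (nnmeas_peetre_slice x mF).
have cb j : 0 < c * b ^+ j by rewrite mulr_gt0.
have ps j := nnmeas_peetre_scaled x (cb j) mF.
have sj j : 0 <= s ^+ j by rewrite exprn_ge0.
transitivity (\int[leb1]_t (\sum_(j <oo) ((s ^+ j)%:E * (peetre F N x (c * b ^+ j * t)%R `^ q * kern t))))%E.
  apply: eq_integral => t _; rewrite muleC -nneseriesZl => [|j _].
    by apply: eq_eseriesr => j _; rewrite muleCA (muleC (kern t)).
  by rewrite mule_ge0 ?lee_fin ?poweR_ge0.
rewrite integral_nneseries//; last 2 first.
- move=> j; apply: (nnmeasM (f := fun=> (s ^+ j)%:E) _ (ps j)).1.
  by apply: nnmeas_cst; rewrite lee_fin.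
- by move=> j t _; rewrite mule_ge0 ?lee_fin//; exact: (ps j).2.
rewrite -geometric_eseries ?s0// muleC -(fineK If) -nneseriesZl => [|j _]; last by rewrite lee_fin.
apply: eq_eseriesr => j _.
have sj' : (0 <= (s ^+ j)%:E)%E by rewrite lee_fin.
rewrite (nnmeas_integralZl _ measurableT (ps j) sj') (fineK If).
rewrite (integral_kern_scale (h := fun t => (peetre F N x t `^ q)%E) (cb j) (nnmeas_peetre_slice x mF)).
exact: muleC.
Qed.

Variables (eps C2 : R).
Hypothesis eps0 : 0 < eps.
Hypothesis C20 : 0 <= C2.

(** Raise peetre_pointwise to the power q / r and integrate over the scales. The
term with the series is a multiple of the left-hand side by
integral_peetre_series; for small d the multiple is at most 1/2 and is absorbed,
which is legitimate because the left-hand side is finite. *)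
Lemma peetre_integral_bound : exists2 C : R, 0 < C & forall F G x,
  self_improving N b eps C2 F G ->
  (\int[leb1]_t (peetre F N x t `^ q * kern t) < +oo)%E ->
  (\int[leb1]_t (peetre F N x t `^ q * kern t) <=
   C%:E * \int[leb1]_t (maxf mu (@rat_cube R n) one (local_power N F ^~ t) x `^ (q / r) * kern t))%E.
Proof.
have [C C0 pw] := peetre_pointwise n0 eps N0 b01 C20.
have th01 := th01 b01 eps0; set th := b `^ eps in th01.
have [B B0 gs] := poweR_geometric_sum th01 q0.
pose s := th `^ (q / 2).
have s01 : 0 <= s < 1.
  rewrite powR_ge0 /s /=; case/andP: th01 => t0 t1.
  have q2 : 0 < q / 2 by rewrite divr_gt0.
  have := @gt0_ltr_powR R (q / 2) q2 th 1; rewrite !nnegrE powR1; apply=> //; exact: ltW.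
have u0 : 0 < q / r by rewrite divr_gt0.
pose A1 := C `^ (q / r) * 2 `^ (q / r).
have A10 : 0 < A1 by rewrite mulr_gt0// powR_gt0.
pose A2 := B * (1 - s)^-1.
have s1 : 0 < 1 - s by rewrite subr_gt0; case/andP: s01.
have A20 : 0 < A2 by rewrite mulr_gt0// invr_gt0.
have [d d01 dq] := small_powR (mulr_gt0 A10 A20) q0.
have d0 : 0 < d by case/andP: d01.
pose D1 := A1 * (d ^- n) `^ (q / r).
have D10 : 0 < D1 by rewrite mulr_gt0// powR_gt0// invr_gt0 exprn_gt0.
exists (2 * D1); first by rewrite mulr_gt0.
move=> F G x si Ifin.
have mF := si_measurable si.
set I := integral _ _ _ in Ifin *; set M := integral _ _ _.
pose Mx t := maxf mu (@rat_cube R n) one (local_power N F ^~ t) x.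
have pMx : nnmeas (Mx : measurableTypeR R -> \bar R).
  have pg : nnmeas (fun z : Rn * measurableTypeR R => local_power N F z.1 z.2).
    apply: nnmeas_EFin => [|z]; last exact: powR_ge0.
    apply: (measurableT_comp (measurable_powR _)).
    exact: (measurable_normc (f := fun z : Rn * measurableTypeR R => F z.1 z.2)).
  apply: (nnmeas_comp (nnmeas_maxf_pair (@rat_cube_vitali_family R n) pg) (h := fun t : measurableTypeR R => (x, t))).
  exact: pair1_measurable.
have P0 t : 0 < t -> (0 <= peetre F N x t)%E by move=> t0; exact: peetre_ge0.
pose Sq t : \bar R := (\sum_(j <oo) ((s ^+ j)%:E * peetre F N x (1 * b ^+ j * t)%R `^ q))%E.
have step t : 0 < t -> (peetre F N x t `^ q <= D1%:E * Mx t `^ (q / r) + (A1 * d `^ q * B)%:E * Sq t)%E.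
  move=> t0; have S0 := peetre_sum_ge0 eps N0 b01 F x t0.
  have -> : (peetre F N x t `^ q = (peetre F N x t `^ r) `^ (q / r))%E.
    by rewrite -poweRrM mulrCA divff ?gt_eqF// mulr1.
  have dn0 : 0 < d ^- n by rewrite invr_gt0 exprn_gt0.
  have h1 : (0 <= (d ^- n)%:E * Mx t)%E by rewrite mule_ge0 ?lee_fin ?(ltW dn0)//; exact: pMx.2.
  have h2 : (0 <= (d `^ r)%:E * peetre_sum N b eps F x t `^ r)%E by rewrite mule_ge0 ?lee_fin ?powR_ge0 ?poweR_ge0.
  apply: (le_trans (lee_poweR (ltW u0) (poweR_ge0 _ _) (pw _ _ _ _ _ si d01 t0))).
  rewrite poweRM ?lee_fin ?(ltW C0) ?adde_ge0//.
  apply: (@le_trans _ _ ((C `^ (q / r))%:E * ((2 `^ (q / r))%:E * (((d ^- n)%:E * Mx t) `^ (q / r) + ((d `^ r)%:E * peetre_sum N b eps F x t `^ r) `^ (q / r))))%E).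
    by rewrite poweR_EFin; apply: lee_wpmul2l; [rewrite lee_fin powR_ge0|exact: poweR_add_le].
  rewrite muleA -EFinM -/A1 ge0_muleDr ?poweR_ge0//.
  rewrite poweRM ?lee_fin ?(ltW dn0)//; last exact: pMx.2.
  rewrite poweRM ?lee_fin ?powR_ge0 ?poweR_ge0//.
  rewrite !poweR_EFin muleA -EFinM -/D1 leeD2l//.
  have -> : (d `^ r) `^ (q / r) = d `^ q by rewrite -powRrM mulrCA divff ?gt_eqF// mulr1.
  have -> : ((peetre_sum N b eps F x t `^ r) `^ (q / r) = peetre_sum N b eps F x t `^ q)%E.
    by rewrite -poweRrM mulrCA divff ?gt_eqF// mulr1.
  rewrite muleA -EFinM (EFinM (A1 * d `^ q)) -[leRHS]muleA; apply: lee_wpmul2l.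
    by rewrite lee_fin mulr_ge0 ?powR_ge0// ltW.
  apply: (le_trans (gs _ _)) => [k|].
    by apply: P0; rewrite mulr_gt0.
  by rewrite /Sq; under [X in (_ <= _ * X)%E]eq_eseriesr do rewrite mul1r.
have pMk : nnmeas ((fun t => Mx t `^ (q / r) * kern t)%E : measurableTypeR R -> \bar R).
  by apply: nnmeasM; [exact: nnmeas_poweR|exact: nnmeas_kern].
have pSk : nnmeas ((fun t => Sq t * kern t)%E : measurableTypeR R -> \bar R).
  rewrite (_ : (fun t => _) = fun t : measurableTypeR R => (\sum_(j <oo) ((s ^+ j)%:E * (peetre F N x (1 * b ^+ j * t)%R `^ q * kern t)))%E).
    apply: nnmeas_series => j; apply: nnmeasM.
      by apply: nnmeas_cst; rewrite lee_fin exprn_ge0//; case/andP: s01.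
    by apply: nnmeas_peetre_scaled => //; rewrite mul1r.
  apply/funext => t; rewrite /Sq muleC -nneseriesZl => [|j _].
    by apply: eq_eseriesr => j _; rewrite muleCA (muleC (kern t)).
  by rewrite mule_ge0 ?lee_fin ?poweR_ge0// exprn_ge0//; case/andP: s01.
have c1 : (0 <= D1%:E)%E by rewrite lee_fin ltW.
have c2 : (0 <= (A1 * d `^ q * B)%:E)%E by rewrite lee_fin !mulr_ge0 ?powR_ge0// ltW.
have nnZ (c : \bar R) (h : measurableTypeR R -> \bar R) : (0 <= c)%E -> nnmeas h -> nnmeas (fun t => c * h t)%E.
  by move=> c0 ph; apply: nnmeasM => //; exact: nnmeas_cst.
have main : (I <= D1%:E * M + (2^-1)%:E * I)%E.
  apply: (@le_trans _ _ (\int[leb1]_t (D1%:E * (Mx t `^ (q / r) * kern t) + (A1 * d `^ q * B)%:E * (Sq t * kern t)))%E).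
    apply: nnmeas_le_integral => //; first exact: nnmeas_peetre_slice.
      by apply: nnmeasD; exact: nnZ.
    move=> t _; have [t0|t0] := ltP 0 t; last by rewrite kern_le0// !mule0 adde0.
    rewrite !muleA -ge0_muleDl ?mule_ge0 ?poweR_ge0//.
      by apply: lee_wpmul2r; [exact: kern_ge0|exact: step].
    by apply: nneseries_ge0 => j _ _; rewrite mule_ge0 ?lee_fin ?poweR_ge0// exprn_ge0//; case/andP: s01.
  rewrite (nnmeas_integralD _ measurableT (nnZ _ _ c1 pMk) (nnZ _ _ c2 pSk)).
  rewrite (nnmeas_integralZl _ measurableT pMk c1) (nnmeas_integralZl _ measurableT pSk c2).
  apply: leeD => //; rewrite (integral_peetre_series s01 ltr01 mF Ifin) muleA -EFinM -/I.
  apply: lee_wpmul2r; first exact: nnmeas_integral_ge0 (nnmeas_peetre_slice x mF).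
  by rewrite lee_fin (le_trans _ dq)// /A2 le_eqVlt; apply/orP; left; apply/eqP; ring.
have I0 : (0 <= I)%E by exact: nnmeas_integral_ge0 (nnmeas_peetre_slice x mF).
have M0 : (0 <= M)%E by exact: nnmeas_integral_ge0 pMk.
have If : I \is a fin_num by rewrite ge0_fin_numE.
have [Moo|Mf] := eqVneq M +oo%E; first by rewrite Moo gt0_muley ?leey// lte_fin mulr_gt0.
have {}Mf : M \is a fin_num by rewrite ge0_fin_numE// ltey.
move: main; rewrite -(fineK If) -(fineK Mf) -!EFinM -EFinD !lee_fin; lra.
Qed.

End absorption.

(** * Finiteness for Schwartz functions *)

Section power_tails.
Context {R : realType}.
Local Notation leb1 := (@lebesgue_measure R).

Lemma powRN_cvg0 (a : R) : 0 < a -> x `^ (- a) @[x --> +oo] --> 0.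
Proof.
move=> a0; apply/cvgrPdist_le => e e0.
near=> x; rewrite sub0r normrN ger0_norm ?powR_ge0//.
have x0 : 0 < x by near: x; exact: nbhs_pinfty_gt.
have ex : e `^ (- a^-1) <= x by near: x; exact: nbhs_pinfty_ge.
rewrite powRN -[leRHS]invrK lef_pV2 ?posrE ?powR_gt0 ?invr_gt0//.
have -> : e^-1 = (e `^ (- a^-1)) `^ a.
  by rewrite -powRrM mulNr mulVf ?gt_eqF// powR_inv1// ltW.
by apply: ge0_ler_powR; rewrite ?nnegrE ?powR_ge0// ltW.
Unshelve. all: by end_near. Qed.

Lemma integral_powRN_tail (a : R) : 0 < a ->
  (\int[leb1]_(t in `[1%R, +oo[) (a * t `^ (- a - 1))%:E = 1)%E.
Proof.
move=> a0.
have cx (p x : R) : 0 < x -> {for x, continuous (fun t : R => t `^ p)}.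
  move=> x0; apply/differentiable_continuous/derivable1_diffP.
  by apply: derivable_powR; rewrite in_itv/= x0.
have dx x : 0 < x -> derivable (fun t => t `^ (- a)) x 1.
  by move=> x0; apply: derivable_powR; rewrite in_itv/= x0.
rewrite (@ge0_continuous_FTC2y _ _ (fun t => - t `^ (- a)) 1 0).
- by rewrite powR1 EFinN oppeK add0e.
- by move=> x x1; rewrite mulr_ge0 ?powR_ge0// ltW.
- apply: continuous_in_subspaceT => x; rewrite inE/= in_itv/= andbT => x1.
  have c : {for x, continuous (fun t : R => a * t `^ (- a - 1))}.
    by apply: continuousM; [exact: cvg_cst|exact/cx/(lt_le_trans ltr01)].
  exact: c.
- by rewrite -oppr0; apply: cvgN; exact: powRN_cvg0.
- by move=> x x1; apply: derivableN; exact/dx/(lt_trans ltr01).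
- by apply: cvgN; exact/cvg_at_right_filter/cx.
- move=> x; rewrite in_itv/= andbT => x1; have x0 := lt_trans ltr01 x1.
  rewrite derive1E deriveN; last exact: dx.
  by rewrite -derive1E powR_derive1 ?in_itv/= ?andbT// mulNr opprK.
Qed.

End power_tails.

Section apriori.
Context {R : realType} {n : nat}.
Local Notation Rn := 'rV[R]_n.
Local Notation mu := (@leb R n).
Local Notation leb1 := (@lebesgue_measure R).
Implicit Types (x y z xi : Rn) (f phi : Rn -> R[i]).

Definition slab (k : 'I_n) (u : R) : set Rn := [set xi | `|xi ord0 k| <= u].

Lemma measurable_slab k u : measurable (slab k u).
Proof.
have -> : slab k u = [set xi : Rn | forall i, (if i == k then `[- u, u]%classic else setT) (xi ord0 i)].
  apply/seteqP; split => xi /=.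
    move=> h i; case: eqVneq => // ->; rewrite /= in_itv/=.
    by rewrite /slab /= ler_norml in h.
  by move=> /(_ k); rewrite eqxx /= in_itv/= /slab /= ler_norml.
apply: (@measurable_box R n (fun i => if i == k then `[- u, u]%classic else setT)) => i.
by case: ifP.
Qed.

(** In the direction k the factor of decay is at most one, and the slab has
width 2 u; the other directions contribute constants. *)
Lemma decay_slab (k : 'I_n) : exists2 K : R, 0 <= K & forall u, 0 <= u ->
  (\int[mu]_xi ((\1_(slab k u) xi : R)%:E * (decay xi)%:E) <= (K * u)%:E)%E.
Proof.
pose J : \bar R := (\int[leb1]_t ((1 + t ^+ 2)^-1)%:E)%E.
have J0 : (0 <= J)%E by exact: nnmeas_integral_ge0 nnmeas_inv1sqr.
have /andP[P0 Poo] : (0 <= \prod_(i < n | i != k) J < +oo)%E.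
  by apply: prode_ge0_lty => i _; rewrite J0 integral_inv1sqr_lty.
exists (2 * fine (\prod_(i < n | i != k) J)); first by rewrite mulr_ge0// fine_ge0.
move=> u u0.
pose U (i : 'I_n) (t : R) : \bar R := if i == k then (\1_(`[(- u)%R, u]%classic : set R) t : R)%:E else ((1 + t ^+ 2)^-1)%:E.
have pU i : nnmeas (U i : measurableTypeR R -> \bar R).
  by rewrite /U; case: eqP => _; [exact: nnmeas_indic|exact: nnmeas_inv1sqr].
apply: (@le_trans _ _ (\int[mu]_xi \prod_(i < n) U i (xi ord0 i))%E).
  apply: ge0_le_integralT => xi; first by rewrite mule_ge0 ?lee_fin ?indicE// ltW// decay_gt0.
  rewrite (bigD1 k)//= /U eqxx.
  have -> : (\1_(slab k u) xi : R) = \1_(`[(- u)%R, u]%classic : set R) (xi ord0 k).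
    rewrite !indicE; congr (nat_of_bool _)%:R.
    by apply/idP/idP => /set_mem h; apply/mem_set; move: h; rewrite /slab/= in_itv/= ler_norml.
  apply: lee_wpmul2l; first by rewrite lee_fin indicE.
  rewrite /decay (bigD1 k)//= [X in (_ <= X)%E](_ : _ = (\prod_(i < n | i != k) (1 + xi ord0 i ^+ 2)^-1)%:E); last first.
    by rewrite -prodEFin; apply: eq_bigr => i /negbTE ->.
  rewrite lee_fin ler_piMl//.
    by apply: prodr_ge0 => i _; rewrite invr_ge0 addr_ge0// sqr_ge0.
  by rewrite invf_le1 ?lerDl ?sqr_ge0// ltr_pwDl// sqr_ge0.
rewrite (integral_prod pU) (bigD1 k)//= {1}/U eqxx.
rewrite [X in (X * _)%E](_ : _ = (2 * u)%:E); last first.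
  transitivity (leb1 (`[(- u)%R, u]%classic : set (measurableTypeR R))); first by rewrite integral_indic// setIT.
  rewrite lebesgue_measure_itv/= lte_fin.
  case: ifPn => [_|]; first by rewrite -EFinD; congr EFin; ring.
  by rewrite -leNgt => uu; congr EFin; lra.
rewrite [X in (_ * X)%E](_ : _ = (\prod_(i < n | i != k) J)%E); last first.
  by apply: eq_bigr => i /negbTE ik; rewrite /U ik.
by rewrite -(@fineK _ (\prod_(i < n | i != k) J)%E) ?ge0_fin_numE// -EFinM lee_fin mulrAC.
Qed.

Lemma schwartz_fourier_weighted_decay f : schwartz f ->
  exists2 C : R, 0 <= C & forall xi, (1 + enorm xi) * normc (fourier f xi) <= C * decay xi.
Proof.
move=> sf; have [C0 C00 hC0] := schwartz_fourier_decay (fun=> 0%N) sf.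
have /choice[C hC] (k : 'I_n) : exists c : R, 0 <= c /\
    forall xi : Rn, `|xi ord0 k| * normc (fourier f xi) <= c * decay xi.
  have [c c0 hc] := schwartz_fourier_decay (fun i => nat_of_bool (i == k)) sf; exists c; split=> // xi.
  have := hc xi; rewrite (bigD1 k)//= eqxx expr1 big1 ?mulr1// => i /negbTE ->.
  by rewrite expr0.
have CC0 k := (hC k).1.
exists (C0 + n%:R * \sum_k C k).
  by rewrite addr_ge0// mulr_ge0// sumr_ge0// => k _.
move=> xi; have f0 := normc_ge0 (fourier f xi).
rewrite mulrDl mul1r mulrDl lerD//.
  by have := hC0 xi; rewrite big1 ?normr1 ?mul1r.
apply: (@le_trans _ _ (n%:R * (\sum_k `|xi ord0 k|) * normc (fourier f xi))).
  rewrite ler_wpM2r//; apply: enorm_le_coord; first by apply: sumr_ge0.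
  by move=> i; rewrite (bigD1 i)//= lerDl sumr_ge0.
rewrite -!mulrA ler_wpM2l// !mulr_suml ler_sum// => k _.
exact: (hC k).2.
Qed.

Section bounds.
Variables (f phi : Rn -> R[i]).
Hypothesis sf : schwartz f.
Hypothesis iphi : cintegrable mu phi.
Hypothesis phi1 : Ck 1 setT phi.
Hypothesis idphi : forall k : 'I_n, cintegrable mu (cpartial k phi).

Lemma scaled_conv_le z t (v : Rn -> \bar R) (B : \bar R) :
  (forall xi, ((normc (fourier f xi) * normc (fourier phi (t *: xi)))%:E <= v xi)%E) ->
  (\int[mu]_xi v xi <= B)%E -> ((normc (scaled_conv f phi z t))%:E <= B)%E.
Proof.
move=> hv hB; apply: normc_cint_le.
  by apply: cintegrable_eq (cintegrable_ft 1 z (cintegrable_scaled sf t iphi)) => xi; rewrite scale1r chiC.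
apply: le_trans hB; apply: ge0_le_integralT => xi; first by rewrite lee_fin normc_ge0.
by rewrite !ComplexField.Normc.normcM normc_chi mulr1.
Qed.

(** The bound on the transform of phi near the origin persists for a smaller
exponent e <= 1, since that transform is bounded; the factor |xi|^e is then
absorbed by the decay of the transform of f. *)
Lemma scaled_conv_small : (exists eps C : R, 0 < eps /\
    forall xi, normc (fourier phi xi) <= C * enorm xi `^ eps) ->
  exists2 e : R, 0 < e & exists2 C : R, 0 <= C &
    forall z t, 0 < t -> normc (scaled_conv f phi z t) <= C * t `^ e.
Proof.
move=> [eps [C1 [eps0 hC1]]].
have [c [c0 hc]] := ft_bounded iphi.
have [Cf Cf0 hCf] := schwartz_fourier_weighted_decay sf.
pose e := Num.min eps 1; have e0 : 0 < e by rewrite lt_min eps0 ltr01.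
have e1 : e <= 1 by rewrite ge_min lexx orbT.
have ee : e <= eps by rewrite ge_min lexx.
pose C2 := `|C1| + c; have C20 : 0 <= C2 by rewrite addr_ge0.
have phiE xi : normc (fourier phi xi) <= C2 * enorm xi `^ e.
  have n0 := enorm_ge0 xi; have [x1|/ltW x1] := leP (enorm xi) 1.
    apply: (le_trans (hC1 xi)); apply: (@le_trans _ _ (`|C1| * enorm xi `^ eps)).
      by rewrite ler_wpM2r ?powR_ge0// ler_norm.
    apply: ler_pM; rewrite ?powR_ge0 ?lerDl//.
    have [->|x0] := eqVneq (enorm xi) 0; first by rewrite !powR0 ?gt_eqF.
    by apply: ger_powR => //; rewrite lt_def x0 n0.
  rewrite fourierE; apply: (le_trans (hc _ _)).
  rewrite -[leLHS]mulr1; apply: ler_pM => //; first by rewrite lerDr.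
  by have := @ge0_ler_powR R e (ltW e0) 1 (enorm xi); rewrite !nnegrE powR1; apply.
exists e => //.
have Dlty := @integral_decay_lty R n; have D0 := nnmeas_integral_ge0 mu setT (@nnmeas_decay R n).
set D := (\int[mu]_x (decay x)%:E)%E in Dlty D0.
exists (C2 * Cf * fine D); first by rewrite !mulr_ge0// fine_ge0.
move=> z t t0; rewrite -lee_fin.
have K0 : 0 <= C2 * t `^ e * Cf by rewrite !mulr_ge0 ?powR_ge0.
apply: (@scaled_conv_le z t (fun xi => (C2 * t `^ e * Cf)%:E * (decay xi)%:E)%E) => [xi|].
  rewrite -EFinM lee_fin mulrC.
  have n0 := enorm_ge0 xi; have f0 := normc_ge0 (fourier f xi).
  apply: (@le_trans _ _ (C2 * t `^ e * ((1 + enorm xi) * normc (fourier f xi)))); last first.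
    by rewrite -!mulrA; do 2 (rewrite ler_wpM2l ?powR_ge0//).
  rewrite mulrA ler_wpM2r//; apply: (le_trans (phiE _)); rewrite enormZ ?(ltW t0)//.
  rewrite powRM ?(ltW t0)// -mulrA; do 2 (rewrite ler_wpM2l ?powR_ge0//).
  apply: (@le_trans _ _ ((1 + enorm xi) `^ e)).
    by apply: ge0_ler_powR; rewrite ?nnegrE ?addr_ge0 ?lerDr// ltW.
  rewrite -[leRHS]powRr1 ?addr_ge0//; apply: ler_powR => //; rewrite lerDl//.
rewrite (nnmeas_integralZl _ measurableT (@nnmeas_decay R n)) ?lee_fin// -/D.
rewrite -(@fineK _ D) ?ge0_fin_numE// -EFinM lee_fin.
by rewrite le_eqVlt; apply/orP; left; apply/eqP; rewrite /= ; ring.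
Qed.

(** The transform of phi is bounded and, phi having an integrable derivative in
the direction k, it is also O(1 / |xi_k|). On the slab |xi_k| <= u the first
bound gives O(u), off the slab the second one gives O(1 / (t u)), and u =
t^(-1/2) balances both. *)
Lemma scaled_conv_large : (0 < n)%N -> exists2 C : R, 0 <= C &
    forall z t, 0 < t -> normc (scaled_conv f phi z t) <= C * t `^ (- 2^-1).
Proof.
move=> n0; pose k := Ordinal n0.
have [c [c0 hc]] := ft_bounded iphi.
have [c1 [c10 hc1]] := ft_bounded (idphi k).
have [Cf Cf0 hCf] := schwartz_fourier_weighted_decay sf.
have {}hCf xi : normc (fourier f xi) <= Cf * decay xi.
  by apply: le_trans (hCf xi); rewrite ler_peMl ?normc_ge0// lerDl enorm_ge0.
have [K K0 hK] := decay_slab k.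
have Dlty := @integral_decay_lty R n; have D0 := nnmeas_integral_ge0 mu setT (@nnmeas_decay R n).
set D := (\int[mu]_x (decay x)%:E)%E in Dlty D0.
have dD0 := fine_ge0 D0.
exists (c * Cf * K + c1 * Cf * fine D); first by rewrite addr_ge0// !mulr_ge0.
move=> z t t0; rewrite -lee_fin.
pose u := t `^ (- 2^-1); have u0 : 0 < u by exact: powR_gt0.
have tuE : t * u = u^-1.
  have -> : t * u = t `^ (1 + - 2^-1) by rewrite (powRDp _ _ t0) (powRr1 (ltW t0)).
  by rewrite /u -powRN opprK; congr (powR t _); lra.
have A0 : 0 <= c * Cf by rewrite mulr_ge0.
have B0 : 0 <= c1 * Cf * u by rewrite !mulr_ge0// ltW.
have pS : nnmeas (fun xi => (\1_(slab k u) xi : R)%:E * (decay xi)%:E)%E.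
  by apply: nnmeasM (@nnmeas_decay R n); apply: nnmeas_indic; exact: measurable_slab.
have nnZ (a : R) (h : Rn -> \bar R) : 0 <= a -> nnmeas h -> nnmeas (fun xi => a%:E * h xi)%E.
  by move=> a0 ph; apply: nnmeasM => //; apply: nnmeas_cst; rewrite lee_fin.
apply: (@scaled_conv_le z t (fun xi => (c * Cf)%:E * ((\1_(slab k u) xi : R)%:E * (decay xi)%:E) + (c1 * Cf * u)%:E * (decay xi)%:E)%E) => [xi|].
  have d0 := ltW (decay_gt0 xi); have f0 := normc_ge0 (fourier f xi).
  rewrite -!EFinM -EFinD lee_fin indicE; have [h|h] := boolP (xi \in slab k u).
    rewrite mul1r; apply: (@le_trans _ _ (c * Cf * decay xi)); last by rewrite lerDl mulr_ge0.
    by rewrite mulrC -mulrA; apply: ler_pM => //; [exact: normc_ge0|rewrite fourierE; exact: hc].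
  rewrite mul0r mulr0 add0r mulrC.
  have xu : u <= `|xi ord0 k| by apply: ltW; rewrite ltNge; apply: contra h => h; rewrite inE.
  have -> : c1 * Cf * u * decay xi = (c1 * u) * (Cf * decay xi) by ring.
  apply: ler_pM => //; first exact: normc_ge0.
  have pi1 : 1 <= 2 * pi :> R by have := pi_ge2 R; lra.
  have g0 := normc_ge0 (fourier phi (t *: xi)).
  have := hc1 (-1) (t *: xi); rewrite -fourierE fourier_partial//.
  rewrite ComplexField.Normc.normcM normc_Xi mxE normrM (ger0_norm (ltW t0)) => h1.
  have h2 : t * u * normc (fourier phi (t *: xi)) <= c1.
    apply: le_trans h1; rewrite ler_wpM2r// -[leLHS]mul1r; apply: ler_pM => //.
      by rewrite mulr_ge0// ltW.
    by rewrite ler_wpM2l// ltW.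
  by rewrite tuE mulrC ler_pdivrMr in h2.
rewrite (nnmeas_integralD _ measurableT (nnZ _ _ A0 pS) (nnZ _ _ B0 (@nnmeas_decay R n))).
rewrite (nnmeas_integralZl _ measurableT pS) ?lee_fin// (nnmeas_integralZl _ measurableT (@nnmeas_decay R n)) ?lee_fin//.
apply: (@le_trans _ _ ((c * Cf)%:E * (K * u)%:E + (c1 * Cf * u)%:E * D)%E).
  by rewrite leeD2r//; apply: lee_wpmul2l; [rewrite lee_fin|exact/hK/ltW].
rewrite -(@fineK _ D) ?ge0_fin_numE// -!EFinM -EFinD lee_fin -/u.
by rewrite le_eqVlt; apply/orP; left; apply/eqP; rewrite /=; ring.
Qed.

(** Bounds on F (., t) that are uniform in space are bounds on Peetre's
function: scaled_conv_small makes the integral converge at zero, and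
scaled_conv_large at infinity. *)
Lemma peetre_integral_finite (N q : R) x : (0 < n)%N -> 0 <= N -> 0 < q ->
  (exists eps C : R, 0 < eps /\ forall xi, normc (fourier phi xi) <= C * enorm xi `^ eps) ->
  (\int[leb1]_t (peetre (scaled_conv f phi) N x t `^ q * kern t) < +oo)%E.
Proof.
move=> n0 N0 q0 /scaled_conv_small[e e0 [C1 C10 hC1]].
have [C2 C20 hC2] := scaled_conv_large n0.
have eq0 : 0 < e * q by rewrite mulr_gt0.
have q20 : 0 < q / 2 by rewrite divr_gt0.
have pk t B : 0 < t -> (forall z, normc (scaled_conv f phi z t) <= B) ->
    (peetre (scaled_conv f phi) N x t `^ q * kern t <= (B `^ q / t)%:E)%E.
  move=> t0 hB; rewrite kern_gt0// EFinM; apply: lee_wpmul2r; first by rewrite lee_fin invr_ge0 ltW.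
  rewrite -poweR_EFin; apply: lee_poweR; [exact: ltW|exact: peetre_ge0|].
  apply: ge_ereal_sup => _ [i _ <-]; rewrite lee_fin.
  rewrite ler_pdivrMr ?peetre_weight_gt0// (le_trans (hB _))// ler_peMr ?peetre_weight_ge1//.
  exact: le_trans (normc_ge0 _) (hB x).
pose K1 := C1 `^ q / (e * q); pose K2 := C2 `^ q / (q / 2).
have K10 : 0 <= K1 by rewrite divr_ge0 ?powR_ge0// ltW.
have K20 : 0 <= K2 by rewrite divr_ge0 ?powR_ge0// ltW.
pose h1 (t : R) : \bar R := ((e * q) * t `^ (e * q - 1))%:E.
pose h2 (t : R) : \bar R := ((q / 2) * t `^ (- (q / 2) - 1))%:E.
have ph1 : nnmeas (h1 : measurableTypeR R -> \bar R).
  apply: nnmeas_EFin => [|t]; last by rewrite mulr_ge0 ?powR_ge0// ltW.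
  by apply: measurable_funM => //; exact: measurable_powR.
have ph2 : nnmeas (h2 : measurableTypeR R -> \bar R).
  apply: nnmeas_EFin => [|t]; last by rewrite mulr_ge0 ?powR_ge0// ltW.
  by apply: measurable_funM => //; exact: measurable_powR.
have m1 : measurable (`]0%R, 1%R[%classic : set (measurableTypeR R)) by exact: measurable_itv.
have m2 : measurable (`[1%R, +oo[%classic : set (measurableTypeR R)) by exact: measurable_itv.
have nnZ (a : R) (D : set (measurableTypeR R)) (h : measurableTypeR R -> \bar R) : 0 <= a ->
    measurable D -> nnmeas h -> nnmeas (fun t => a%:E * ((\1_D t : R)%:E * h t))%E.
  move=> a0 mD ph; apply: nnmeasM; first by apply: nnmeas_cst; rewrite lee_fin.
  by apply: nnmeasM => //; exact: nnmeas_indic.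
have p1 := nnZ K1 _ _ K10 m1 ph1; have p2 := nnZ K2 _ _ K20 m2 ph2.
apply: (@le_lt_trans _ _ (\int[leb1]_t (K1%:E * ((\1_(`]0%R, 1%R[%classic : set R) t : R)%:E * h1 t)
    + K2%:E * ((\1_(`[1%R, +oo[%classic : set R) t : R)%:E * h2 t)))%E).
  apply: ge0_le_integralT => t; first by rewrite mule_ge0 ?poweR_ge0 ?kern_ge0.
  have [t0|t0] := leP t 0.
    by rewrite kern_le0// mule0 adde_ge0//; [exact: p1.2|exact: p2.2].
  have tV : t^-1 = t `^ (-1) by rewrite powR_inv1// ltW.
  have [t1|t1] := ltP t 1.
    apply: (@le_trans _ _ (K1%:E * h1 t)%E); last first.
      rewrite [X in (_ <= K1%:E * (X * _) + _)%E](_ : _ = 1%E); last first.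
        by rewrite indicE mem_set//= in_itv/= t0.
      by rewrite mul1e leeDl//; exact: p2.2.
    apply: (le_trans (pk _ _ t0 (fun z => hC1 z t t0))).
    rewrite /h1 -EFinM lee_fin powRM ?powR_ge0// -powRrM tV -mulrA -powRDp//.
    by rewrite (mulrA K1) /K1 divfK// gt_eqF.
  apply: (@le_trans _ _ (K2%:E * h2 t)%E); last first.
    rewrite [X in (_ <= _ + K2%:E * (X * _))%E](_ : _ = 1%E); last first.
      by rewrite indicE mem_set//= in_itv/= t1.
    by rewrite mul1e leeDr//; exact: p1.2.
  apply: (le_trans (pk _ _ t0 (fun z => hC2 z t t0))).
  rewrite /h2 -EFinM lee_fin powRM ?powR_ge0// -powRrM tV -mulrA -powRDp//.
  by rewrite (mulrA K2) /K2 divfK ?gt_eqF// mulNr (mulrC _ q).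
rewrite (nnmeas_integralD _ measurableT p1 p2).
rewrite (nnmeas_integralZl _ measurableT); [|exact: nnmeasM (nnmeas_indic R m1) ph1|by rewrite lee_fin].
rewrite (nnmeas_integralZl _ measurableT); [|exact: nnmeasM (nnmeas_indic R m2) ph2|by rewrite lee_fin].
rewrite -(nnmeas_integral_indic leb1 m1 ph1) -(nnmeas_integral_indic leb1 m2 ph2).
by rewrite integral_powR_oo// integral_powRN_tail// -!EFinM -EFinD ltry.
Qed.

End bounds.

End apriori.

(** * The weighted square function estimate *)

Section synthesis.
Context {R : realType} {n : nat}.
Local Notation Rn := 'rV[R]_n.
Local Notation mu := (@leb R n).
Local Notation leb1 := (@lebesgue_measure R).
Implicit Types (x y z : Rn) (F : Rn -> R -> R[i]).
Variables (N b q : R).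
Hypothesis N0 : 0 < N.
Hypothesis b01 : 0 < b < 1.
Hypothesis q0 : 0 < q.

(** By poweR_geometric_sum the q-th power goes inside the series, and by
integral_peetre_series every term contributes the same integral up to a
geometric factor. *)
Lemma integral_peetre_synthesis (S D th c : R) : 0 <= S -> 0 <= D -> 0 < th < 1 -> 0 < c ->
  exists2 C : R, 0 < C & forall F x (H : R -> R[i]),
  cmeas (fun z : Rn * measurableTypeR R => F z.1 z.2) ->
  (\int[leb1]_t (peetre F N x t `^ q * kern t) < +oo)%E ->
  (forall t, 0 < t -> ((normc (H t))%:E <=
    S%:E * \sum_(j <oo) ((th ^+ j)%:E * peetre F N x (c * b ^+ j * t)%R) + D%:E * peetre F N x t)%E) ->
  (\int[leb1]_t ((normc (H t) `^ q)%:E * kern t) <= C%:E * \int[leb1]_t (peetre F N x t `^ q * kern t))%E.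
Proof.
move=> S0 D0 th01 c0.
have b0 : 0 < b by case/andP: b01.
have [B B0 gs] := poweR_geometric_sum th01 q0.
have q2 : 0 < q / 2 by rewrite divr_gt0.
pose s := th `^ (q / 2).
have s01 : 0 <= s < 1.
  rewrite powR_ge0 /s /=; case/andP: th01 => t0 t1.
  have := @gt0_ltr_powR R (q / 2) q2 th 1; rewrite !nnegrE powR1; apply=> //; exact: ltW.
have s1 : 0 < 1 - s by rewrite subr_gt0; case/andP: s01.
pose A1 := 2 `^ q * (S `^ q * B); pose A2 := 2 `^ q * D `^ q.
have A10 : 0 <= A1 by rewrite !mulr_ge0 ?powR_ge0// ltW.
have A20 : 0 <= A2 by rewrite !mulr_ge0 ?powR_ge0.
exists (A1 * (1 - s)^-1 + A2 + 1).
  by rewrite ltr_wpDl// addr_ge0// mulr_ge0// invr_ge0 ltW.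
move=> F x H mF Ioo HF.
have pI := nnmeas_peetre_slice q N0 x mF.
have I0 : (0 <= \int[leb1]_t (peetre F N x t `^ q * kern t))%E by exact: nnmeas_integral_ge0 pI.
have cb j : 0 < c * b ^+ j by rewrite mulr_gt0// exprn_gt0.
pose Sq t : \bar R := (\sum_(j <oo) ((s ^+ j)%:E * peetre F N x (c * b ^+ j * t)%R `^ q))%E.
have sj j : 0 <= s ^+ j by rewrite exprn_ge0//; case/andP: s01.
have Sq0 t : (0 <= Sq t)%E by apply: nneseries_ge0 => j _ _; rewrite mule_ge0 ?lee_fin ?poweR_ge0.
have pSk : nnmeas ((fun t => Sq t * kern t)%E : measurableTypeR R -> \bar R).
  rewrite (_ : (fun t => _) = fun t : measurableTypeR R => (\sum_(j <oo) ((s ^+ j)%:E * (peetre F N x (c * b ^+ j * t)%R `^ q * kern t)))%E).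
    apply: nnmeas_series => j; apply: nnmeasM; first by apply: nnmeas_cst; rewrite lee_fin.
    exact: nnmeas_peetre_scaled.
  apply/funext => t; rewrite /Sq muleC -nneseriesZl => [|j _].
    by apply: eq_eseriesr => j _; rewrite muleCA (muleC (kern t)).
  by rewrite mule_ge0 ?lee_fin ?poweR_ge0.
have nnZ (a : R) (h : measurableTypeR R -> \bar R) : 0 <= a -> nnmeas h -> nnmeas (fun t => a%:E * h t)%E.
  by move=> a0 ph; apply: nnmeasM => //; apply: nnmeas_cst; rewrite lee_fin.
have step t : 0 < t -> ((normc (H t) `^ q)%:E <= A1%:E * Sq t + A2%:E * peetre F N x t `^ q)%E.
  move=> t0; set T := (\sum_(j <oo) ((th ^+ j)%:E * peetre F N x (c * b ^+ j * t)%R))%E.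
  have p0 j : (0 <= peetre F N x (c * b ^+ j * t))%E by apply: peetre_ge0; [exact: ltW|rewrite mulr_gt0].
  have P0 : (0 <= peetre F N x t)%E by apply: peetre_ge0; [exact: ltW|].
  have T0 : (0 <= T)%E.
    by apply: nneseries_ge0 => j _ _; rewrite mule_ge0 ?lee_fin ?exprn_ge0//; case/andP: th01 => /ltW.
  rewrite -poweR_EFin.
  apply: (le_trans (lee_poweR (ltW q0) _ (HF t t0))); first by rewrite lee_fin normc_ge0.
  apply: (le_trans (poweR_add_le q0 _ _)); [by rewrite mule_ge0 ?lee_fin|by rewrite mule_ge0 ?lee_fin|].
  rewrite ge0_muleDr ?poweR_ge0// !poweRM ?lee_fin// !poweR_EFin; apply: leeD; last by rewrite muleA -EFinM.
  rewrite /A1 EFinM -muleA; apply: lee_wpmul2l; first by rewrite lee_fin powR_ge0.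
  rewrite EFinM -muleA; apply: lee_wpmul2l; first by rewrite lee_fin powR_ge0.
  exact: gs.
apply: (@le_trans _ _ (\int[leb1]_t (A1%:E * (Sq t * kern t) + A2%:E * (peetre F N x t `^ q * kern t)))%E).
  apply: ge0_le_integralT => t; first by apply: mule_ge0; [rewrite lee_fin powR_ge0|exact: kern_ge0].
  have [t0|t0] := ltP 0 t; last by rewrite kern_le0// !mule0 adde0.
  rewrite !muleA -ge0_muleDl ?mule_ge0 ?lee_fin ?poweR_ge0//.
  by apply: lee_wpmul2r; [exact: kern_ge0|exact: step].
rewrite (nnmeas_integralD _ measurableT (nnZ _ _ A10 pSk) (nnZ _ _ A20 pI)).
have A10' : (0 <= A1%:E)%E by rewrite lee_fin.
have A20' : (0 <= A2%:E)%E by rewrite lee_fin.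
rewrite (nnmeas_integralZl _ measurableT pSk A10') (nnmeas_integralZl _ measurableT pI A20').
rewrite (integral_peetre_series N0 b01 s01 c0 mF Ioo) muleA -EFinM.
have h5 : (0 <= (A1 * (1 - s)^-1)%:E)%E by rewrite lee_fin; apply: mulr_ge0 => //; rewrite invr_ge0 ltW.
rewrite -(ge0_muleDl _ h5 A20').
by apply: lee_wpmul2r => //; rewrite -EFinD lee_fin lerDl.
Qed.

End synthesis.

Section main_estimate.
Context {R : realType} {n : nat}.
Local Notation Rn := 'rV[R]_n.
Local Notation mu := (@leb R n).
Local Notation leb1 := (@lebesgue_measure R).
Implicit Types (x y z xi : Rn).

Lemma weighted_L1_ge0 L (f : Rn -> R[i]) : (0 <= weighted_L1 L f)%E.
Proof. by apply: integral_ge0 => x _; rewrite lee_fin mulr_ge0 ?powR_ge0 ?normc_ge0. Qed.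

Lemma ereal_sup_lty_bound (I : Type) (J : set I) (u : I -> \bar R) (c : I -> R) :
  (forall j, 0 <= u j)%E -> (forall j, 0 < c j) ->
  (ereal_sup [set u j * (c j)%:E | j in J] < +oo)%E ->
  exists2 S : R, 0 <= S & forall j, J j -> (u j <= (S * (c j)^-1)%:E)%E.
Proof.
move=> u0 c0 soo; set s := ereal_sup _ in soo.
exists `|fine s| => // j Jj.
have le_s : (u j * (c j)%:E <= s)%E by apply: ereal_sup_ubound; exists j.
have s0 : (0 <= s)%E by apply: le_trans le_s; rewrite mule_ge0// lee_fin ltW.
have sf : s \is a fin_num by rewrite ge0_fin_numE.
rewrite EFinM -[leLHS]mule1 -(divff (lt0r_neq0 (c0 j))) EFinM muleA; apply: lee_wpmul2r.
  by rewrite lee_fin invr_ge0 ltW.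
by rewrite (le_trans le_s)// -(fineK sf) lee_fin ler_norm.
Qed.

Lemma wnorm_square_function (p q : R) w (f g : Rn -> R[i]) : 0 < q -> schwartz f -> cintegrable mu g ->
  wnorm p w (square_function q f g) =
  ((\int[mu]_x ((\int[leb1]_t ((normc (scaled_conv f g x t) `^ q)%:E * kern t)) `^ (p / q) * (w x)%:E)) `^ p^-1)%E.
Proof.
move=> q0 sf ig.
have E x : square_function q f g x =
    ((\int[leb1]_t ((normc (scaled_conv f g x t) `^ q)%:E * kern t)) `^ q^-1)%E.
  have h1 := @integral_kernE R (fun t => normc (convolution f (dilate g t) x) `^ q) (fun t => powR_ge0 _ _).
  have h2 := @eq_integral_kern R (fun t => (normc (convolution f (dilate g t) x) `^ q)%:E)
    (fun t => (normc (scaled_conv f g x t) `^ q)%:E).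
  have h3 t : 0 < t -> (normc (convolution f (dilate g t) x) `^ q)%:E = (normc (scaled_conv f g x t) `^ q)%:E.
    by move=> t0; rewrite (scaled_convE sf x ig t0).
  have h4 := etrans h1 (h2 h3).
  exact: (congr1 (fun z : \bar R => (z `^ q^-1)%E) h4).
have K : (\int[mu]_x (`|square_function q f g x| `^ p * (w x)%:E) =
    \int[mu]_x ((\int[leb1]_t ((normc (scaled_conv f g x t) `^ q)%:E * kern t)) `^ (p / q) * (w x)%:E))%E.
  apply: eq_integral => x _; rewrite E.
  set X := (\int[_]_t _)%E; rewrite (gee0_abs (poweR_ge0 X _)).
  by rewrite -(poweRrM X) mulrC.
exact: (congr1 (fun z : \bar R => (z `^ p^-1)%E) K).
Qed.

Lemma square_function_le (p q C : R) (w : Rn -> R) (f g phi : Rn -> R[i]) : 0 < C -> 0 < p -> 0 < q ->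
  schwartz f -> cintegrable mu phi -> cintegrable mu g -> (forall x, 0 <= w x) ->
  (\int[mu]_x ((\int[leb1]_t ((normc (scaled_conv f g x t) `^ q)%:E * kern t)) `^ (p / q) * (w x)%:E) <=
   C%:E * \int[mu]_x ((\int[leb1]_t ((normc (scaled_conv f phi x t) `^ q)%:E * kern t)) `^ (p / q) * (w x)%:E))%E ->
  (wnorm p w (square_function q f g) <= (C `^ p^-1)%:E * wnorm p w (square_function q f phi))%E.
Proof.
move=> C0 p0 q0 sf ip ig w0 H.
have aux (X Y A B : \bar R) : A = (X `^ p^-1)%E -> B = (Y `^ p^-1)%E -> (0 <= X)%E -> (0 <= Y)%E ->
    (X <= C%:E * Y)%E -> (A <= (C `^ p^-1)%:E * B)%E.
  move=> -> -> X0 Y0 XY; have pV : 0 <= p^-1 by rewrite invr_ge0 ltW.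
  by apply: (le_trans (lee_poweR pV X0 XY)); rewrite poweRM ?lee_fin ?(ltW C0)// poweR_EFin.
have i0 (h : Rn -> R[i]) : (0 <= \int[mu]_x ((\int[leb1]_t ((normc (scaled_conv f h x t) `^ q)%:E * kern t)) `^ (p / q) * (w x)%:E))%E.
  by apply: integral_ge0 => x _; rewrite mule_ge0 ?poweR_ge0 ?lee_fin.
exact: aux (wnorm_square_function p w q0 sf ig) (wnorm_square_function p w q0 sf ip) (i0 g) (i0 phi) H.
Qed.

Variables (b r1 r2 : R) (phi etahat : Rn -> R[i]).
Hypothesis b01 : 0 < b < 1.
Hypothesis r12 : 0 < r1 < r2.
Hypothesis iphi : cintegrable mu phi.
Hypothesis ceta : ccontinuous_on setT etahat.
Hypothesis seta : forall xi, etahat xi != 0 -> r1 < enorm xi < r2.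
Hypothesis sum1 : forall xi, xi != 0 ->
    \sum_(j \in [set: int]) (fourier phi (b ^ j *: xi) * etahat (b ^ j *: xi)) = 1.
Variable (N : R).
Hypothesis N0 : 0 < N.

Lemma calderon_bound (f g Theta : Rn -> R[i]) (A S D : R) (a : nat -> R) (j0 : int) x t :
  schwartz f -> cintegrable mu g -> ccontinuous_on setT Theta -> 0 < A -> 0 < t ->
  0 <= S -> (forall k, 0 <= a k) ->
  (forall j : int, (b ^ j <= A) = (j0 <= j)) ->
  (forall xi, enorm xi < r2 / A -> fourier g xi = fourier phi xi * Theta xi) ->
  (forall k : nat, (Cphi b etahat g (j0 + k%:Z) N <= (S * a k)%:E)%E) ->
  (Dphi b phi etahat Theta A N <= D%:E)%E ->
  ((normc (scaled_conv f g x t))%:E <=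
   S%:E * \sum_(k <oo) ((a k)%:E * peetre (scaled_conv f phi) N x (b ^ j0 * b ^+ k * t)%R) +
   D%:E * peetre (scaled_conv f phi) N x t)%E.
Proof.
move=> sf ig cT A0 t0 S0 a0 hj hg hC hD.
have b0 : 0 < b by case/andP: b01.
have NN := ltW N0.
have P0 s : 0 < s -> (0 <= peetre (scaled_conv f phi) N x s)%E by move=> s0; exact: peetre_ge0.
have cb k : 0 < b ^ j0 * b ^+ k * t by rewrite !mulr_gt0 ?exprn_gt0 ?exprz_gt0.
have Coo k : (Cphi b etahat g (j0 + k%:Z) N < +oo)%E by apply: le_lt_trans (hC k) _; exact: ltry.
have Doo : (Dphi b phi etahat Theta A N < +oo)%E by apply: le_lt_trans hD _; exact: ltry.
apply: (le_trans (calderon_decomposition sf b01 r12 iphi ceta seta sum1 x ig cT A0 NN t0 hj hg Coo Doo)).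
apply: leeD; last by apply: lee_wpmul2r; [exact: P0|exact: hD].
rewrite -nneseriesZl => [|k _]; last by rewrite mule_ge0 ?lee_fin// P0.
apply: lee_nneseries => [k _ _|k _].
  by rewrite mule_ge0 ?weighted_L1_ge0// scale_natD// P0.
by rewrite scale_natD// muleA -EFinM; apply: lee_wpmul2r; [exact: P0|exact: hC].
Qed.

Hypothesis phi1 : Ck 1 setT phi.
Hypothesis idphi : forall k : 'I_n, cintegrable mu (cpartial k phi).

Lemma ccontinuous_Xi (k : 'I_n) : ccontinuous_on setT (Xi k : Rn -> R[i]).
Proof.
move=> xi _; split; rewrite /Xi /=; first exact: cst_continuous.
apply: (@continuousM R Rn (fun=> 2 * pi) (fun y : Rn => y ord0 k) xi); first exact: cst_continuous.
exact: coord_continuous.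
Qed.

(** The decomposition of calderon_bound with A = 1 and Theta = Xi k, as the
transform of the partial derivative is Xi k times that of phi. The term with
Dphi has the form of the term of index 0 in the series, which is why the
constants add up. *)
Lemma scaled_conv_self_improving (eps : R) : 0 < eps ->
  (ereal_sup [set ((\sum_(k < n) Cphi b etahat (cpartial k phi) j N) *
        (b `^ (- (j%:~R * N) - eps * j%:~R))%R%:E)%E
      | j in [set j : int | (0 <= j)%R]] < +oo)%E ->
  (\sum_(k < n) Dphi b phi etahat (Xi k) 1 N < +oo)%E ->
  exists2 C2 : R, 0 <= C2 & forall f, schwartz f ->
    self_improving N b eps C2 (scaled_conv f phi) (fun k => scaled_conv f (cpartial k phi)).
Proof.
move=> eps0 h3 h4; have b0 : 0 < b by case/andP: b01.
have th0 : 0 < b `^ eps by exact: powR_gt0.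
have C0 k j : (0 <= Cphi b etahat (cpartial k phi) j N)%E by exact: weighted_L1_ge0.
have D0 k : (0 <= Dphi b phi etahat (Xi k) 1 N)%E by exact: weighted_L1_ge0.
have C0' j : (0 <= \sum_(k < n) Cphi b etahat (cpartial k phi) j N)%E by apply: sume_ge0 => k _; exact: C0.
have [S S0 hS] := ereal_sup_lty_bound C0' (fun j => powR_gt0 _ b0) h3.
pose a k := (b ^+ k) `^ N * (b `^ eps) ^+ k.
have a0 k : 0 <= a k by rewrite mulr_ge0 ?powR_ge0// exprn_ge0// ltW.
have aE k : (b `^ (- ((k%:Z)%:~R * N) - eps * (k%:Z)%:~R))^-1 = a k.
  rewrite -powRN opprB addrC opprK -pmulrn powRDp// /a.
  have bk : b ^+ k = b `^ k%:R by rewrite powR_mulrn// ltW.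
  have ek : (b `^ eps) ^+ k = b `^ (eps * k%:R) by rewrite powRrM powR_mulrn// powR_ge0.
  by rewrite bk ek -powRrM.
pose D := \sum_(k < n) fine (Dphi b phi etahat (Xi k) 1 N).
have Dk k : (Dphi b phi etahat (Xi k) 1 N <= D%:E)%E.
  have Df i : Dphi b phi etahat (Xi i) 1 N \is a fin_num.
    rewrite ge0_fin_numE//; apply: le_lt_trans h4; rewrite (bigD1 i)//= leeDl// sume_ge0//.
  rewrite -(fineK (Df k)) lee_fin /D (bigD1 k)//= lerDl sumr_ge0// => i _.
  exact: fine_ge0.
have DD : 0 <= D by apply: sumr_ge0 => k _; exact: fine_ge0.
exists (S + D); first exact: addr_ge0.
move=> f sf; split.
- by move=> t _; exact: scaled_conv_seq_continuous.
- exact: cmeas_scaled_conv.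
- by move=> z h t M t0 hM; exact: scaled_conv_increment.
move=> k z t t0.
have hj (j : int) : (b ^ j <= 1) = (0 <= j).
  apply/idP/idP => [|j0]; last by rewrite -(expr0z b); apply: scale_le.
  apply: contraTT; rewrite -!ltNge => j0.
  have : b ^ (-1) <= b ^ j by apply: scale_le => //; rewrite -ltzD1.
  apply: lt_le_trans; rewrite exprN1 invf_gt1//; by case/andP: b01.
have hg xi : enorm xi < r2 / 1 -> fourier (cpartial k phi) xi = fourier phi xi * Xi k xi.
  by move=> _; rewrite fourier_partial// mulrC.
have hC (j : nat) : (Cphi b etahat (cpartial k phi) (0 + j%:Z) N <= (S * a j)%:E)%E.
  rewrite add0r; apply: le_trans (_ : (\sum_(k < n) Cphi b etahat (cpartial k phi) j N <= _)%E).
    by rewrite (bigD1 k)//= leeDl// sume_ge0.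
  by rewrite -aE; exact: hS.
have P0 s : 0 < s -> (0 <= peetre (scaled_conv f phi) N z s)%E by move=> s0; apply: peetre_ge0 => //; exact: ltW.
apply: (le_trans (calderon_bound z sf (idphi k) (@ccontinuous_Xi k) ltr01 t0 S0 a0 hj hg hC (Dk k))).
have termE j : (b ^ 0 * b ^+ j * t)%R = (b ^+ j * t)%R by rewrite expr0z mul1r.
under eq_eseriesr do rewrite termE.
set T := (\sum_(_ <= _ <oo) _)%E.
rewrite EFinD ge0_muleDl ?lee_fin// leeD2l//; apply: lee_wpmul2l; first by rewrite lee_fin.
have tj0 j : (0 <= (a j)%:E * peetre (scaled_conv f phi) N z (b ^+ j * t)%R)%E.
  by rewrite mule_ge0 ?lee_fin// P0// mulr_gt0// exprn_gt0.
have := @nneseries_lim_ge R _ xpredT 0 1 (fun j _ _ => tj0 j); apply: le_trans.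
by rewrite big_nat1 /a !expr0 powR1 mul1r mul1e mul1r.
Qed.

End main_estimate.

Lemma nnmeas_integral_kern (R : realType) (n : nat) (h : 'rV[R]_n * measurableTypeR R -> \bar R) (q : R) :
  nnmeas h -> nnmeas (fun x => \int[@lebesgue_measure R]_t (h (x, t) `^ q * kern t))%E.
Proof.
move=> ph; have pk : nnmeas (fun z : 'rV[R]_n * measurableTypeR R => h z `^ q * kern z.2)%E.
  by apply: nnmeasM; [exact: nnmeas_poweR|exact: nnmeas_comp nnmeas_kern measurable_snd].
split=> [|x]; first exact: (@measurable_fun_fubini_tonelli_F _ _ _ _ _ (@lebesgue_measure R) _ pk.1 pk.2).
by apply: integral_ge0 => t _; exact: (pk.2 (x, t)).
Qed.

Theorem proposition2p3 (R : realType) (n : nat) (hn : (0 < n)%N)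
  (phi : 'rV[R]_n -> R[i]) (hphi : cL1 phi) (hnd : non_degenerate phi)
  (b0 r1 r2 : R) (hsetup : calderon_setup phi b0 r1 r2)
  (b : R) (hb : b0 <= b < 1)
  (eta etahat : 'rV[R]_n -> R[i])
  (heta : calderon_pair phi r1 r2 b eta etahat)
  (N p q : R) (hN : 0 < N) (hp : n%:R / N < p) (hq : n%:R / N < q)
  (w : 'rV[R]_n -> R) (hw : muckenhoupt (p * N / n%:R) w)
  (h1 : Ck 1 setT phi /\ forall k : 'I_n, cL1 (cpartial k phi))
  (h2 : exists eps C : R, 0 < eps /\
    forall xi, ComplexField.Normc.normc (fourier phi xi) <= C * enorm xi `^ eps)
  (h3 : exists2 eps : R, 0 < eps &
    (ereal_sup [set ((\sum_(k < n) Cphi b etahat (cpartial k phi) j N) *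
        (b `^ (- (j%:~R * N) - eps * j%:~R))%R%:E)%E
      | j in [set j : int | (0 <= j)%R]] < +oo)%E)
  (h4 : (\sum_(k < n) Dphi b phi etahat (Xi k) 1 N < +oo)%E)
  (psi : 'rV[R]_n -> R[i]) (hpsi : cL1 psi)
  (Theta : 'rV[R]_n -> R[i]) (hTheta : smooth Theta)
  (A : R) (hA : 1 <= A)
  (h5 : forall xi, enorm xi < r2 * A^-1 ->
    fourier psi xi = fourier phi xi * Theta xi)
  (h6 : exists2 eps : R, 0 < eps &
    (ereal_sup [set (Cphi b etahat psi j N *
        (b `^ (- (eps * j%:~R)))%R%:E)%E
      | j in [set j : int | (b ^ j <= A)%R]] < +oo)%E)
  (h7 : (Dphi b phi etahat Theta A N < +oo)%E) :
  exists C : R, 0 < C /\ forall f, schwartz f ->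
    (wnorm p w (square_function q f psi) <=
     C%:E * wnorm p w (square_function q f phi))%E.
Proof.
have n0R : 0 < n%:R :> R by rewrite ltr0n.
pose r := n%:R / N; have r0 : 0 < r by rewrite divr_gt0.
have p0 : 0 < p by exact: lt_trans r0 hp.
have q0 : 0 < q by exact: lt_trans r0 hq.
have [b00 r12 _] := hsetup.
have b01 : 0 < b < 1.
  by case/andP: hb => h ->; rewrite (lt_le_trans _ h)//; case/andP: b00.
have iphi : cintegrable (leb n) phi by exact: hphi.
have idphi (k : 'I_n) : cintegrable (leb n) (cpartial k phi) by exact: h1.2.
have ipsi : cintegrable (leb n) psi by exact: hpsi.
have ceta := calderon_continuous heta.
have seta xi : etahat xi != 0 -> r1 < enorm xi < r2.
  by move=> x0; apply: (calderon_supp heta); exact: subset_closure.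
have sum1 := calderon_sum heta.
have [eps eps0 {}h3] := h3.
have [C2 C20 si] := scaled_conv_self_improving b01 r12 iphi ceta seta sum1 hN h1.1 idphi eps0 h3 h4.
have [C1 C10 hI] := @peetre_integral_bound R n hn N b q hN b01 hq eps C2 eps0 C20.
have A0 : 0 < A by exact: lt_le_trans hA.
have [j0 hj] := scale_threshold b01 A0.
have [e e0 {}h6] := h6.
have bb : 0 < b by case/andP: b01.
have Cpos j : (0 <= Cphi b etahat psi j N)%E by exact: weighted_L1_ge0.
have [S S0 hS] := ereal_sup_lty_bound Cpos (fun j => powR_gt0 _ bb) h6.
have th01' : 0 < b `^ e < 1 := th01 b01 e0.
(* The scales b^j <= A are those with j >= j0; numbering them from j0 on costs
the factor b^(e j0). *)
pose S' := S * b `^ (e * j0%:~R); have S'0 : 0 <= S' by rewrite mulr_ge0 ?powR_ge0.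
have hC (k : nat) : (Cphi b etahat psi (j0 + k%:Z) N <= (S' * (b `^ e) ^+ k)%:E)%E.
  have /hS : [set j : int | b ^ j <= A] (j0 + k%:Z) by rewrite /= hj lerDl.
  move=> h; apply: (le_trans h); rewrite lee_fin -powRN opprK intrD mulrDr powRDp// mulrA.
  have ek : (b `^ e) ^+ k = b `^ (e * (k%:Z)%:~R).
    by rewrite -pmulrn powRrM powR_mulrn// powR_ge0.
  by rewrite ek.
pose D := fine (Dphi b phi etahat Theta A N).
have Dpos : (0 <= Dphi b phi etahat Theta A N)%E by exact: weighted_L1_ge0.
have D0 : 0 <= D by exact: fine_ge0.
have hD : (Dphi b phi etahat Theta A N <= D%:E)%E by rewrite fineK// ge0_fin_numE.
have cT := smooth_continuous hTheta.
have [C3 C30 syn] := @integral_peetre_synthesis R n N b q hN b01 q0 S' D (b `^ e) (b ^ j0) S'0 D0 th01' (scale_gt0 b01 j0).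
have s1 : 1 < p * N / n%:R.
  by rewrite ltr_pdivlMr// mul1r -ltr_pdivrMr.
have [K K0 [w' [Aw' ww']]] := muckenhoupt_Ap_weight s1 hw.
have q1 : 1 < q / r by rewrite ltr_pdivlMr// mul1r.
(* The weight and both exponents fit the maximal inequality for |F|^r: pN/n =
p/r is the Muckenhoupt exponent, and q/r > 1. *)
have prE : p * N / n%:R = p / r by rewrite /r invf_div mulrA.
rewrite prE in s1 Aw'.
have [C4 C40 vvm] := vector_valued_maximal (rat_cube_vitali_family n) (@lebesgue_measure R) s1 q1 K0.
have cancel (c : R) : c != 0 -> p / c / (q / c) = p / q by move=> c0; field; rewrite c0 gt_eqF.
have pqE : p / r / (q / r) = p / q by apply: cancel; rewrite gt_eqF.
have [mw w0 _ _] := hw.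
have [mw' _] : weight w' by case: Aw'.
pose u := p / q; have u0 : 0 < u by rewrite divr_gt0.
pose C5 := C3 * C1; have C50 : 0 < C5 by rewrite mulr_gt0.
pose C6 := C5 `^ u * C4; have C60 : 0 < C6 by rewrite mulr_gt0 ?powR_gt0.
exists (C6 `^ p^-1); split; first exact: powR_gt0.
move=> f sf; apply: square_function_le => //.
pose F := scaled_conv f phi.
have sif := si f sf.
have mF := si_measurable sif.
have pg : nnmeas (fun z : 'rV[R]_n * measurableTypeR R => local_power N F z.1 z.2).
  apply: nnmeas_EFin => [|z]; last exact: powR_ge0.
  apply: (measurableT_comp (measurable_powR _)).
  exact: (measurable_normc (f := fun z : 'rV[R]_n * measurableTypeR R => F z.1 z.2)).
have pM := nnmeas_maxf_pair (@rat_cube_vitali_family R n) pg.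
pose Jm x := (\int[@lebesgue_measure R]_t (maxf (leb n) (@rat_cube R n) (fun=> 1%R) (local_power N F ^~ t) x `^ (q / r) * kern t))%E.
pose Jphi x := (\int[@lebesgue_measure R]_t ((normc (F x t) `^ q)%:E * kern t))%E.
pose Jpsi x := (\int[@lebesgue_measure R]_t ((normc (scaled_conv f psi x t) `^ q)%:E * kern t))%E.
have pJm : nnmeas (Jm : 'rV[R]_n -> \bar R) := nnmeas_integral_kern (q / r) pM.
have JphiE x : Jphi x = (\int[@lebesgue_measure R]_t (local_power N F x t `^ (q / r) * kern t))%E.
  apply: eq_integral => t _; apply: (congr1 (fun z => z * kern t)%E).
  rewrite /local_power poweR_EFin; apply: (congr1 EFin).
  by rewrite -powRrM mulrC divfK// gt_eqF.
have pJphi : nnmeas (Jphi : 'rV[R]_n -> \bar R).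
  rewrite (_ : Jphi = fun x => (\int[@lebesgue_measure R]_t (local_power N F x t `^ (q / r) * kern t))%E).
    exact: nnmeas_integral_kern (q / r) pg.
  exact/funext/JphiE.
have pw : nnmeas (fun x => (w x)%:E) by apply: nnmeas_EFin.
have wE (h : 'rV[R]_n -> \bar R) : nnmeas h -> (\int[leb n]_x (h x * (w x)%:E) = \int[leb n]_x (h x * (w' x)%:E))%E.
  move=> ph; apply: ae_eq_integral => //.
  - exact: (nnmeasM ph pw).1.
  - by apply: emeasurable_funM; [exact: ph.1|exact/measurable_EFinP].
  - by apply: filterS ww' => x wx _; rewrite wx.
have JJ x : (Jpsi x <= C5%:E * Jm x)%E.
  have fin := peetre_integral_finite sf iphi h1.1 idphi x hn (ltW hN) q0 h2.
  have sy t : 0 < t -> ((normc (scaled_conv f psi x t))%:E <= S'%:E * \sum_(k <oo) (((b `^ e) ^+ k)%:E * peetre F N x (b ^ j0 * b ^+ k * t)%R) + D%:E * peetre F N x t)%E.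
    move=> t0; apply: (calderon_bound b01 r12 iphi ceta seta sum1 hN x sf ipsi cT A0 t0 S'0 _ hj h5 hC hD).
    by move=> k; rewrite exprn_ge0 ?powR_ge0.
  apply: (le_trans (syn F x (scaled_conv f psi x) mF fin sy)).
  rewrite /C5 EFinM -muleA; apply: lee_wpmul2l; first by rewrite lee_fin ltW.
  exact: hI sif fin.
have Jpsi0 x : (0 <= Jpsi x)%E.
  by apply: integral_ge0 => t _; apply: mule_ge0; [rewrite lee_fin powR_ge0|exact: kern_ge0].
apply: (@le_trans _ _ (\int[leb n]_x ((C5 `^ u)%:E * (Jm x `^ u * (w x)%:E)))%E).
  apply: ge0_le_integralT => x; first by rewrite mule_ge0 ?poweR_ge0 ?lee_fin.
  rewrite muleA; apply: lee_wpmul2r; first by rewrite lee_fin.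
  apply: (le_trans (lee_poweR (ltW u0) (Jpsi0 x) (JJ x))).
  by rewrite poweRM ?lee_fin ?(ltW C50)//; exact: pJm.2.
have pJu := nnmeas_poweR u pJm.
have C5u : (0 <= (C5 `^ u)%:E)%E by rewrite lee_fin powR_ge0.
rewrite (nnmeas_integralZl _ measurableT (nnmeasM pJu pw) C5u) (wE _ pJu).
rewrite /C6 EFinM -muleA; apply: lee_wpmul2l => //.
rewrite (wE _ (nnmeas_poweR u pJphi)).
have := vvm _ kern pg nnmeas_kern w' Aw'; rewrite pqE => h.
apply: (le_trans h); apply: lee_wpmul2l; first by rewrite lee_fin ltW.
rewrite le_eqVlt; apply/orP; left; apply/eqP; apply: eq_integral => x _.
by apply: (congr1 (fun z => z `^ u * (w' x)%:E)%E); exact/esym/JphiE.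
Qed.
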